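(* Let $X$ be a symmetrically self-similar graph with bounded geometry and suppose the Julia set $\mathcal{J}$ of its transition function $d$ is a Cantor set. Then the reciprocal spectrum $\operatorname{spec}^{-1}P$ of the simple random walk transition operator coincides with the set $\mathcal{S}$ of singularities of all Green functions $G(x,y|\cdot)$, $x,y\in VX$.
   Context: Graphs are connected, locally finite, infinite, undirected, without loops or multiple edges. For $C\subseteq VX$, $\theta C$ is the set of vertices of $VX\setminus C$ adjacent to a vertex of $C$, $\overline C=C\cup\theta C$. For $F\subseteq VX$, $\mathcal{C}_X(F)$ is the set of connected components (as vertex sets) of the subgraph induced on $VX\setminus F$. The reduced graph $X_F$ has vertex set $F$, distinct $x,y$ adjacent iff $x,y\in\theta C$ for some $C\in\mathcal{C}_X(F)$. $X$ is self-similar with respect to $F$ if (F1) no two vertices of $F$ are adjacent in $X$, (F2) distinct $C,D\in\mathcal{C}_X(F)$ satisfy $|\overline C\cap\overline D|\le1$, (F3) there is a graph isomorphism $X\to X_F$. Cells: elements of $\mathcal{C}_X(F)$; $\hat C$ the subgraph induced on $\overline C$. Symmetrically self-similar: additionally (S1) all cells finite and any two $\hat C,\hat D$ are isomorphic via an isomorphism mapping $\theta C$ onto $\theta D$, and (S3) automorphisms of $\hat C$ preserving $\theta C$ act doubly transitively on $\theta C$. $\theta_X=|\theta C|$. Bounded geometry: vertex degrees bounded, cells finite, boundary sizes bounded. $P$: $p(x,y)=1/\deg_X x$ for $x\sim y$, on $\ell^2(X)$ weighted by $\deg_X$; $G(x,y|z)=\sum_n p^{(n)}(x,y)z^n$ for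 $|z|<1$ and its analytic continuations; $\operatorname{spec}^{-1}P=\{1/\lambda:\lambda\in\operatorname{spec}P\}\subset\overline{\mathbb{C}}$. Transition function: $d(z)=(\theta_X-1)((I-zQ)^{-1})_{v,w}$ for distinct $v,w\in\theta C$, where $Q$ has entries $1/\deg_{\hat C}x$ for $x\sim y$, $x\notin\theta C\setminus\{v\}$, else 0.
   Formalization: At the point infinity, a Green function counts as non-singular only if it continues analytically there and vanishes there; with mere analyticity the claim fails when 0 is an isolated eigenvalue of P. *)

(* Defs.v *)
From HB Require Import structures.
From mathcomp Require Import all_boot all_order all_algebra.
From mathcomp Require Import finmap.
From mathcomp Require Import all_classical all_reals all_analysis.
From mathcomp Require Import complex.

Set Implicit Arguments.
Unset Strict Implicit.
Unset Printing Implicit Defensive.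

Import Order.TTheory GRing.Theory Num.Theory.
Import numFieldNormedType.Exports.

Local Open Scope classical_set_scope.
Local Open Scope ring_scope.

Section Graphs.
Context {V : choiceType} (adj : rel V).

(* [joined A x y]: x and y lie in the same component of the subgraph induced
   on A. *)
Definition joined (A : set V) (x y : V) : Prop :=
  exists p : seq V,
    [/\ path adj x p, last x p = y & forall z, z \in x :: p -> A z].

Definition infinite_connected_graph : Prop :=
  [/\ symmetric adj, irreflexive adj,
      forall x y, joined setT x y,
      forall x, finite_set [set y | adj x y]
    & infinite_set [set: V]].

Definition degree_in (A : set V) (x : V) : nat :=
  #|` fset_set [set y | A y /\ adj x y]|.

Definition degree (x : V) : nat := degree_in setT x.

Definition bdry (C : set V) : set V :=
  [set y | ~ C y /\ exists2 x, C x & adj x y].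

Definition gclosure (C : set V) : set V := C `|` bdry C.

Definition cells (F : set V) : set (set V) :=
  [set C | exists2 x, ~ F x & C = [set y | joined (~` F) x y]].

Definition reduced_adj (F : set V) (x y : V) : Prop :=
  [/\ F x, F y, x <> y & exists2 C, cells F C & bdry C x /\ bdry C y].

Definition self_similar (F : set V) : Prop :=
  [/\ forall x y, F x -> F y -> ~~ adj x y,
      forall C D, cells F C -> cells F D -> C <> D ->
        is_subset1 (gclosure C `&` gclosure D)
    & exists psi : V -> V, set_bij setT F psi /\
        forall x y, adj x y <-> reduced_adj F (psi x) (psi y)].

Definition cell_iso (C D : set V) (f : V -> V) : Prop :=
  [/\ set_bij (gclosure C) (gclosure D) f,
      forall x y, gclosure C x -> gclosure C y -> adj (f x) (f y) = adj x y
    & f @` bdry C = bdry D].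

Definition symmetrically_self_similar (F : set V) : Prop :=
  [/\ self_similar F,
      forall C, cells F C -> finite_set C,
      forall C D, cells F C -> cells F D -> exists f, cell_iso C D f
    & forall C, cells F C -> forall a b a' b',
        bdry C a -> bdry C b -> a <> b ->
        bdry C a' -> bdry C b' -> a' <> b' ->
        exists g, [/\ cell_iso C C g, g a = a' & g b = b']].

Definition bounded_geometry (F : set V) : Prop :=
  [/\ exists N, forall x, (degree x <= N)%N,
      forall C, cells F C -> finite_set C
    & exists N, forall C, cells F C ->
        finite_set (bdry C) /\ (#|` fset_set (bdry C)| <= N)%N].

End Graphs.

(* R[i] packed as a numClosedFieldType, through which it gets its topology. *)
Definition cplx (R : realType) : numClosedFieldType := R[i].

(* The Riemann sphere; [None] is the point at infinity. *)
Notation sphere R := (one_point_compactification (cplx R)).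

Notation infty := (None : sphere _).

Definition sphere_inv {R : realType} (z : cplx R) : sphere R :=
  if z == 0 then infty else Some z^-1.

Section SphereDynamics.
Context {R : realType}.
Local Notation C := (cplx R).
Local Notation normc := (@Normc.normc R).

Definition chordal (p q : sphere R) : R :=
  match p, q with
  | Some z, Some w =>
      2 * normc (z - w) /
        (Num.sqrt (1 + normc z ^+ 2) * Num.sqrt (1 + normc w ^+ 2))
  | Some z, None | None, Some z => 2 / Num.sqrt (1 + normc z ^+ 2)
  | None, None => 0
  end.

Definition converges_locally_uniformly (U : set (sphere R))
    (s : nat -> sphere R -> sphere R) (g : sphere R -> sphere R) : Prop :=
  forall p, U p -> exists2 W, nbhs p W &
    forall eps : R, 0 < eps ->
      \forall k \near \oo, forall q, W q -> chordal (s k q) (g q) < eps.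

Definition normal_iterates (f : sphere R -> sphere R) (U : set (sphere R)) :
    Prop :=
  forall m : nat -> nat, exists k : nat -> nat,
    {homo k : i j / (i < j)%N} /\
    exists g, converges_locally_uniformly U (fun j => iter (m (k j)) f) g.

Definition fatou_set (f : sphere R -> sphere R) : set (sphere R) :=
  [set p | exists U, [/\ open U, U p & normal_iterates f U]].

Definition julia_set (f : sphere R -> sphere R) : set (sphere R) :=
  ~` fatou_set f.

Definition cantor_set (J : set (sphere R)) : Prop :=
  [/\ J !=set0, compact J, perfect_set J & totally_disconnected J].

(* The self-map of the sphere given by a rational function, evaluated in
   lowest terms so that removable singularities are removed; the value at
   infinity compares the degrees of numerator and denominator. *)
Definition ratfun_map (f : {fraction {poly C}}) (p : sphere R) : sphere R :=
  let n0 := (generic_quotient.repr f : {ratio {poly C}}).1 in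
  let d0 := (generic_quotient.repr f : {ratio {poly C}}).2 in
  let n := n0 %/ gcdp n0 d0 in
  let d := d0 %/ gcdp n0 d0 in
  match p with
  | Some z => if d.[z] == 0 then infty else Some (n.[z] / d.[z])
  | None => if (size d < size n)%N then infty
            else Some (n`_(size d).-1 / lead_coef d)
  end.

End SphereDynamics.

Section Transition.
Context (R : realType) {V : choiceType} (adj : rel V) (C : set V).
Local Notation K := {fraction {poly cplx R}}.

(* Walk on the finite graph induced on the closure of the cell C, started at v
   and absorbed in the other boundary vertices. *)
Definition cellQ (v x y : V) : cplx R :=
  if adj x y && ~~ `[< (bdry adj C `\ v) x >]
  then (degree_in adj (gclosure adj C) x)%:R^-1 else 0.

Let I : finType := fset_sub_type (fset_set (gclosure adj C)).

Definition cellQmx (v : V) : 'M[K]_#|I| :=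
  \matrix_(i, j)
    FracField.tofrac (cellQ v (val (enum_val i)) (val (enum_val j)))%:P.

(* [I] is the index set of the matrix; the last branch is never taken when C is
   finite with finite boundary and v, w belong to the boundary. *)
Definition transition_function (v w : V) : K :=
  match insub v : option I, insub w : option I with
  | Some i, Some j =>
      (#|` fset_set (bdry adj C)|.-1)%:R *
      invmx (1%:M - FracField.tofrac 'X *: cellQmx v)
        (enum_rank i) (enum_rank j)
  | _, _ => 0
  end.

End Transition.

Section RandomWalk.
Context (R : realType) {V : choiceType} (adj : rel V).
Local Notation C := (cplx R).
Local Notation normc := (@Normc.normc R).

Definition step (x y : V) : C :=
  if adj x y then (degree adj x)%:R^-1 else 0.

Fixpoint stepn (n : nat) (x y : V) : C :=
  if n is m.+1 then \sum_(u \in [set u | adj x u]) step x u * stepn m u y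
  else (x == y)%:R.

Definition P_op (f : V -> C) (x : V) : C :=
  \sum_(y \in [set y | adj x y]) step x y * f y.

Definition sqnorm (f : V -> C) : \bar R :=
  (\esum_(x in [set: V]) ((degree adj x)%:R * normc (f x) ^+ 2)%:E)%E.

Definition ell2 (f : V -> C) : Prop := (sqnorm f < +oo)%E.

Definition ell2_norm (f : V -> C) : R := Num.sqrt (fine (sqnorm f)).

Definition bounded_operator (T : (V -> C) -> (V -> C)) : Prop :=
  [/\ forall f, ell2 f -> ell2 (T f),
      forall (a : C) f g, ell2 f -> ell2 g ->
        T (fun x => a * f x + g x) = (fun x => a * T f x + T g x)
    & exists M : R, forall f, ell2 f -> ell2_norm (T f) <= M * ell2_norm f].

Definition resolvent_set : set C :=
  [set l | exists2 T, bounded_operator T &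
    forall f, ell2 f ->
      (fun x => l * T f x - P_op (T f) x) = f /\
      T (fun x => l * f x - P_op f x) = f].

Definition spec : set C := ~` resolvent_set.

Definition spec_inv : set (sphere R) := sphere_inv @` spec.

Definition green (x y : V) (z : C) : C :=
  limn (series (fun n => stepn n x y * z ^+ n)).

Definition chart (p : sphere R) (h : C) : sphere R :=
  if p is Some z then Some (z + h) else sphere_inv h.

Definition analytic_at (f : sphere R -> C) (p : sphere R) : Prop :=
  exists a : nat -> C, exists2 r : R, 0 < r &
    forall h : C, normc h < r ->
      series (fun n => a n * h ^+ n) @ \oo --> f (chart p h).

(* G(x,y|.) continues analytically to p. At infinity the continuation must
   vanish, as G(x,y|z) = z^-1 ((z^-1 - P)^-1)(x,y) does off the reciprocal
   spectrum, i.e. the resolvent kernel must be analytic at 0. Analyticity alone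
   would not see an isolated eigenvalue 0 of P, whose contribution to G(x,y|z)
   is constant in z. *)
Definition green_regular_at (x y : V) (p : sphere R) : Prop :=
  exists (Om : set (sphere R)) (f : sphere R -> C),
    [/\ open Om, connected Om,
        forall z : C, normc z < 1 -> Om (Some z) /\ f (Some z) = green x y z,
        forall q, Om q -> analytic_at f q
      & Om p /\ (p = infty -> f infty = 0)].

Definition green_singularities : set (sphere R) :=
  [set p | exists x y, ~ green_regular_at x y p].

End RandomWalk.

Arguments spec_inv R {V} adj _.
Arguments green_singularities R {V} adj _.

(* Main.v *)
Require Import Defs.
From HB Require Import structures.
From mathcomp Require Import all_boot all_order all_algebra.
From mathcomp Require Import finmap.
From mathcomp Require Import all_classical all_reals all_analysis.
From mathcomp Require Import complex.
From mathcomp Require Import ring lra zify.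

Set Implicit Arguments.
Unset Strict Implicit.
Unset Printing Implicit Defensive.

Import Order.TTheory GRing.Theory Num.Theory.
Import numFieldNormedType.Exports.

Local Open Scope classical_set_scope.
Local Open Scope ring_scope.

(** Put [lam = 1 / z].  Solving [(lam - P) u = f] inside the cells and reading
    the result on [F], which is a copy of [X] through [psi], turns the equation
    into [(A(lam) - B(lam) P) (u o psi) = ...] with polynomials [A], [B] such
    that [lam |-> A(lam) / B(lam)] is the transition function [d] in the
    coordinate [1 / z].  So the resolvents at [lam] and at [A(lam) / B(lam)]
    determine each other.  Points outside the closed numerical range of [P]
    stay outside under this map and are attracted by [z = 0], hence real points
    whose orbit never leaves the numerical range lie in the Julia set.  As the
    latter is totally disconnected, the spectrum contains no real interval, and
    a continuation of a Green function agrees with the resolvent kernel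
    wherever the latter exists; at a point [lam0] where all Green functions are
    regular, this bounds every [R(lam) delta_x] near [lam0].

    If the orbit of [lam0] leaves the numerical range, the real points near
    [lam0] other than [lam0] are in the resolvent set; the bounds make the range
    of [lam0 - P] dense, so [lam0] is in the resolvent set as well.  Otherwise
    some iterate of [d] maps every neighbourhood of [lam0] onto the whole
    numerical range, and transporting the bounds along it leaves [R(lam) delta_x]
    with poles only.  Then [Pi(P) delta_x] has a bounded resolvent for a
    polynomial [Pi <> 0], and vanishes by a Liouville argument, which is
    impossible in an infinite connected graph. *)

(** * Symmetric contractions of a Hilbert space *)

(** No spectral measure is used: everything is phrased as lower bounds on [lam - P] and bounds on
    solutions of [(lam - P) u = delta_x]. The numerical range is preferred to the spectrum because
    its complement avoids the Dirichlet eigenvalues of the cells, where the elimination breaks down;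
    so it is mapped into itself without exceptions. The bound on [R(lam) delta_x] holds near [lam0]
    in a neighbourhood that depends on [x], whereas transport along iterates needs one neighbourhood
    for all [x]. Self-similarity supplies it: arbitrarily large finite sets exist whose inner
    boundaries have bounded size, so that modulo the range of [lam - P], with coefficients
    polynomial in [lam], all deltas depend on finitely many of them. The zeros of these coefficients
    and of the characteristic polynomial of a cell are the origin of the poles. The other inclusion
    needs no dynamics: off the reciprocal spectrum the resolvent kernel is itself a continuation. *)

Section ComplexNorm.
Context {R : realType}.
Local Notation Cx := (cplx R).
Local Notation normc := (@Normc.normc R).
Local Notation Re := (@complex.Re R).
Local Notation Im := (@complex.Im R).
Implicit Types a b c : Cx.

Lemma normc2 a : normc a ^+ 2 = Re a ^+ 2 + Im a ^+ 2.
Proof. by case: a => x y /=; rewrite sqr_sqrtr // addr_ge0 ?sqr_ge0. Qed.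

Lemma normc_ge0 a : 0 <= normc a.
Proof. by case: a => x y; rewrite sqrtr_ge0. Qed.

Lemma normc_normr a : `|a| = (normc a)%:C%C :> Cx.
Proof. by case: a. Qed.

Lemma normc_eq0 a : (normc a == 0) = (a == 0).
Proof.
by apply/eqP/eqP => [/Normc.eq0_normc //|->]; exact: Normc.normc0.
Qed.

Lemma normc_gt0 a : (0 < normc a) = (a != 0).
Proof. by rewrite lt_neqAle normc_ge0 andbT eq_sym normc_eq0. Qed.

Lemma normcM a b : normc (a * b) = normc a * normc b.
Proof. exact: Normc.normcM. Qed.

Lemma normcV a : normc a^-1 = (normc a)^-1.
Proof. exact: Normc.normcV. Qed.

Lemma normcX a n : normc (a ^+ n) = normc a ^+ n.
Proof.
elim: n => [|n IH]; first by rewrite !expr0; exact: Normc.normc1.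
by rewrite !exprS normcM IH.
Qed.

Lemma normcD a b : normc (a + b) <= normc a + normc b.
Proof. exact: le_normcD. Qed.

Lemma normcN a : normc (- a) = normc a.
Proof. exact: (normcN a). Qed.

Lemma normcBC a b : normc (a - b) = normc (b - a).
Proof. by rewrite -normcN opprB. Qed.

Lemma normcB_ge a b : normc a - normc b <= normc (a + b).
Proof.
by rewrite lerBlDr; have := normcD (a + b) (- b); rewrite addrK normcN.
Qed.

Lemma normc_real (x : R) : normc x%:C%C = `|x|.
Proof. by rewrite /= expr0n /= addr0 sqrtr_sqr. Qed.

Lemma normc_nat (n : nat) : normc (n%:R : Cx) = n%:R.
Proof.
have -> : (n%:R : Cx) = (n%:R : R)%:C%C by rewrite rmorph_nat.
by rewrite normc_real ger0_norm.
Qed.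

Lemma normcJ a : normc (conjc a) = normc a.
Proof. by case: a => x y /=; rewrite sqrrN. Qed.

Lemma ler_Re_normc a : `|Re a| <= normc a.
Proof.
by rewrite -ler_sqr ?nnegrE ?normc_ge0 // real_normK ?num_real // normc2 lerDl sqr_ge0.
Qed.

Lemma ler_Im_normc a : `|Im a| <= normc a.
Proof.
by rewrite -ler_sqr ?nnegrE ?normc_ge0 // real_normK ?num_real // normc2 lerDr sqr_ge0.
Qed.

Lemma normc_le_ReIm a : normc a <= `|Re a| + `|Im a|.
Proof.
rewrite -ler_sqr ?nnegrE ?normc_ge0 ?addr_ge0 // normc2 sqrrD.
rewrite !real_normK ?num_real // -addrA lerD2l lerDr mulrn_wge0 //.
Qed.

Lemma normc_sum (I : Type) (r : seq I) (P : pred I) (F : I -> Cx) :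
  normc (\sum_(i <- r | P i) F i) <= \sum_(i <- r | P i) normc (F i).
Proof.
elim/big_ind2 : _ => [|x1 x2 y1 y2 h1 h2|i _].
- by have -> : normc 0 = 0 by exact: Normc.normc0.
- exact: le_trans (normcD _ _) (lerD h1 h2).
- by [].
Qed.

Lemma cReD a b : Re (a + b) = Re a + Re b.
Proof. by case: a b => ? ? [? ?]. Qed.
Lemma cImD a b : Im (a + b) = Im a + Im b.
Proof. by case: a b => ? ? [? ?]. Qed.
Lemma cReN a : Re (- a) = - Re a.
Proof. by case: a. Qed.
Lemma cImN a : Im (- a) = - Im a.
Proof. by case: a. Qed.
Lemma cReM a b : Re (a * b) = Re a * Re b - Im a * Im b.
Proof. by case: a b => ? ? [? ?]. Qed.
Lemma cImM a b : Im (a * b) = Re a * Im b + Im a * Re b.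
Proof. by case: a b => ? ? [? ?]. Qed.
Lemma cReJ a : Re (conjc a) = Re a.
Proof. by case: a. Qed.
Lemma cImJ a : Im (conjc a) = - Im a.
Proof. by case: a. Qed.
Lemma cRe_real (r : R) : Re (r%:C%C) = r.
Proof. by []. Qed.
Lemma cIm_real (r : R) : Im (r%:C%C) = 0.
Proof. by []. Qed.
Lemma cReRM (r : R) a : Re (r%:C%C * a) = r * Re a.
Proof. by case: a => p q /=; ring. Qed.

Lemma cplx_eqP a b : Re a = Re b -> Im a = Im b -> a = b.
Proof. by case: a b => ? ? [? ?] /= -> ->. Qed.

Lemma cImV a : a != 0 -> Im a^-1 = - Im a / normc a ^+ 2.
Proof.
move=> a0; rewrite normc2; case: a a0 => x y xy0 /=.
by rewrite mulNr.
Qed.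

Lemma conjcV a : conjc a^-1 = (conjc a)^-1 :> Cx.
Proof. exact: conjc_inv. Qed.
Lemma conjcM a b : conjc (a * b) = conjc a * conjc b :> Cx.
Proof. by rewrite rmorphM. Qed.
Lemma conjcD a b : conjc (a + b) = conjc a + conjc b :> Cx.
Proof. by rewrite rmorphD. Qed.

End ComplexNorm.

(* [ip] is the real part of the Hermitian product. *)
Record inner_product (R : realType) (H : lmodType (cplx R)) (ip : H -> H -> R) :
    Prop := InnerProduct {
  ip_sym : forall u v, ip u v = ip v u;
  ip_addl : forall u v w, ip (u + v) w = ip u w + ip v w;
  ip_scale : forall (c : cplx R) u v, ip (c *: u) v = ip u ((conjc c : cplx R) *: v);
  ip_reall : forall (r : R) u v, ip ((r%:C%C : cplx R) *: u) v = r * ip u v;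
  ip_ge0 : forall u, 0 <= ip u u;
  ip_eq0 : forall u, ip u u = 0 -> u = 0
}.

(** Completeness in the form that contraction arguments use: increments that decay geometrically,
    with an explicit distance to the limit. *)
Definition ip_complete (R : realType) (H : lmodType (cplx R)) (ip : H -> H -> R) :=
  forall (u : nat -> H) (q K : R), 0 <= q -> q < 1 -> 0 <= K ->
    (forall n, Num.sqrt (ip (u n.+1 - u n) (u n.+1 - u n)) <= K * q ^+ n) ->
    exists v, forall n, Num.sqrt (ip (v - u n) (v - u n)) <= K * q ^+ n / (1 - q).

Section Hilbert.
Context {R : realType} {H : lmodType (cplx R)} {ip : H -> H -> R}.
Context (hH : inner_product ip) (hC : ip_complete ip).
Local Notation Cx := (cplx R).
Local Notation normc := (@Normc.normc R).
Local Notation Re := (@complex.Re R).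
Local Notation Im := (@complex.Im R).
Implicit Types (u v x y f g h : H) (c lam : Cx).

Definition nm u : R := Num.sqrt (ip u u).

Let symh := ip_sym hH.
Lemma ipDl u v w : ip (u + v) w = ip u w + ip v w.
Proof. exact: ip_addl hH u v w. Qed.
Lemma ipDr u v w : ip u (v + w) = ip u v + ip u w.
Proof. by rewrite symh ipDl !(symh u). Qed.
Lemma ipRl (r : R) u v : ip ((r%:C%C : Cx) *: u) v = r * ip u v.
Proof. exact: ip_reall hH r u v. Qed.
Lemma ipNl u v : ip (- u) v = - ip u v.
Proof.
by rewrite -scaleN1r (_ : (-1 : Cx) = (-1)%:C%C) ?ipRl ?mulN1r // rmorphN1.
Qed.
Lemma ipNr u v : ip u (- v) = - ip u v.
Proof. by rewrite symh ipNl symh. Qed.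
Lemma ip0l u : ip 0 u = 0.
Proof. by rewrite -(subrr u) ipDl ipNl subrr. Qed.
Lemma ip0r u : ip u 0 = 0.
Proof. by rewrite symh ip0l. Qed.
Lemma ipRr (r : R) u v : ip u ((r%:C%C : Cx) *: v) = r * ip u v.
Proof. by rewrite symh ipRl symh. Qed.
Lemma ipZ c u v : ip (c *: u) v = ip u ((conjc c : Cx) *: v).
Proof. exact: ip_scale hH c u v. Qed.

Definition ipE := (ipDl, ipDr, ipNl, ipNr, ipRl, ipRr).

Lemma ipZZ c u : ip (c *: u) (c *: u) = normc c ^+ 2 * ip u u.
Proof.
rewrite ipZ scalerA -ipRr; congr (ip u (_ *: u)).
by rewrite normc2; case: c => a b; apply: cplx_eqP => /=; ring.
Qed.

(** [ip] is only real bilinear, and multiplication by [i] is skew for it. *)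
Lemma ipi u : ip (('i%C : Cx) *: u) u = 0.
Proof.
have /eqP := ipZ ('i%C) u u.
rewrite (_ : (conjc 'i%C : Cx) = - 'i%C); last by apply: cplx_eqP => /=; lra.
by rewrite scaleNr ipNr symh -addr_eq0 -mulr2n mulrn_eq0 /= => /eqP.
Qed.

Lemma ip_scaleE c u v :
  ip (c *: u) v = Re c * ip u v + Im c * ip (('i%C : Cx) *: u) v.
Proof.
rewrite -!ipRl -ipDl scalerA -scalerDl; congr (ip (_ *: u) v).
by apply: cplx_eqP; rewrite ?cReD ?cImD ?cReM ?cImM /=; ring.
Qed.

Lemma ip_scale_self c u : ip (c *: u) u = Re c * ip u u.
Proof. by rewrite ip_scaleE ipi mulr0 addr0. Qed.

Lemma hn_ge0 u : 0 <= nm u.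
Proof. exact: sqrtr_ge0. Qed.

Lemma hn2 u : nm u ^+ 2 = ip u u.
Proof. by rewrite sqr_sqrtr // (ip_ge0 hH). Qed.

Lemma hn_eq0 u : nm u = 0 -> u = 0.
Proof. by move=> u0; apply: (ip_eq0 hH); rewrite -hn2 u0 expr0n. Qed.

Lemma hn0 : nm 0 = 0.
Proof. by rewrite /nm ip0l sqrtr0. Qed.

Lemma hn_le u (M : R) : 0 <= M -> ip u u <= M ^+ 2 -> nm u <= M.
Proof. by move=> M0; rewrite -hn2 ler_sqr ?nnegrE ?hn_ge0. Qed.

Lemma hnZ c u : nm (c *: u) = normc c * nm u.
Proof.
by rewrite /nm ipZZ sqrtrM ?sqr_ge0 // sqrtr_sqr ger0_norm ?normc_ge0.
Qed.

Lemma hnN u : nm (- u) = nm u.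
Proof. by rewrite /nm !ipE opprK. Qed.

Lemma hnB u v : nm (u - v) = nm (v - u).
Proof. by rewrite -hnN opprB. Qed.

Lemma Cauchy_Schwarz u v : `|ip u v| <= nm u * nm v.
Proof.
rewrite -ler_sqr ?nnegrE ?mulr_ge0 ?hn_ge0 // real_normK ?num_real //.
rewrite exprMn !hn2.
have h : forall t : R, 0 <= ip u u - (t * ip u v) *+ 2 + t ^+ 2 * ip v v.
  move=> t; have := ip_ge0 hH (u - (t%:C%C : Cx) *: v).
  by rewrite !ipE (symh v u) => /le_trans; apply; rewrite le_eqVlt; apply/orP; left; apply/eqP; ring.
have [v0|v0] := eqVneq (ip v v) 0.
  by rewrite (ip_eq0 hH v0) ip0r expr0n ip0l mulr0.
have vp : 0 < ip v v by rewrite lt_neqAle eq_sym v0 (ip_ge0 hH).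
have := h (ip u v / ip v v).
have -> : ip u u - (ip u v / ip v v * ip u v) *+ 2 + (ip u v / ip v v) ^+ 2 * ip v v
   = (ip u u * ip v v - ip u v ^+ 2) / ip v v by field.
by rewrite pmulr_lge0 ?invr_gt0 // subr_ge0.
Qed.

Lemma ip_le u v : ip u v <= nm u * nm v.
Proof. exact: le_trans (ler_norm _) (Cauchy_Schwarz u v). Qed.

Lemma hnD u v : nm (u + v) <= nm u + nm v.
Proof.
apply: hn_le; first by rewrite addr_ge0 ?hn_ge0.
rewrite sqrrD !hn2 !ipE (symh v u).
by have := ip_le u v; lra.
Qed.

Lemma hnD3 u v w : nm (u - w) <= nm (u - v) + nm (v - w).
Proof. by rewrite -[u - w](_ : (u - v) + (v - w) = _) ?hnD // addrA subrK. Qed.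

Lemma hnB_ge u v : nm u - nm v <= nm (u + v).
Proof. by rewrite lerBlDr; have := hnD (u + v) (- v); rewrite addrK hnN. Qed.

Lemma hilbert_fixpoint (G : H -> H) (q : R) : 0 <= q -> q < 1 ->
  (forall u v, nm (G u - G v) <= q * nm (u - v)) -> exists u, G u = u.
Proof.
move=> q0 q1 Gq; pose s n := iter n G 0.
have st n : nm (s n.+1 - s n) <= nm (G 0) * q ^+ n.
  elim: n => [|n IH]; first by rewrite /s /= subr0 expr0 mulr1.
  by apply: le_trans (Gq _ _) _; rewrite exprS mulrCA ler_wpM2l.
have [v hv] := hC q0 q1 (hn_ge0 (G 0)) st.
exists v; apply/eqP; rewrite -subr_eq0; apply/eqP/hn_eq0.
apply/eqP; rewrite eq_le hn_ge0 andbT; apply/ler_addgt0Pr => e e0; rewrite add0r.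
(* The two parts [q |v - s n|] and [|s n.+1 - v|] are each at most [q ^+ n * (nm (G 0) / (1 - q))],
   hence the factor 2; the 1 keeps [K] positive. *)
pose K := nm (G 0) / (1 - q) * 2 + 1.
have K0 : 0 < K.
  by rewrite ltr_wpDl // ?mulr_ge0 ?hn_ge0 // invr_ge0 subr_ge0 ltW.
have [n hn] : exists n, q ^+ n < e / K.
  have q1' : `|q| < 1 by rewrite ger0_norm.
  have /cvgrPdist_lt h := cvg_expr q1'.
  have [n _ /(_ n (leqnn n)) /= p] := h (e / K) (divr_gt0 e0 K0).
  by exists n; rewrite sub0r normrN ger0_norm ?exprn_ge0 in p.
apply: le_trans (hnD3 _ (s n.+1) _) _.
have h1 := Gq v (s n); have h2 := hv n; have h3 := hv n.+1.
rewrite -/(nm _) in h2; rewrite -/(nm _) hnB in h3.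
have qn0 : 0 <= q ^+ n by rewrite exprn_ge0.
have A0 : 0 <= nm (G 0) / (1 - q) by rewrite mulr_ge0 ?hn_ge0 // invr_ge0 subr_ge0 ltW.
have -> : G v - s n.+1 = G v - G (s n) by [].
apply: (@le_trans _ _ (q ^+ n * K)); last by rewrite -ler_pdivlMr // ltW.
have h4 : q * nm (v - s n) <= q ^+ n * (nm (G 0) / (1 - q)).
  apply: (@le_trans _ _ (nm (v - s n))); first by rewrite ler_piMl ?hn_ge0 // ltW.
  by apply: le_trans h2 _; rewrite mulrAC mulrC.
have h5 : nm (s n.+1 - v) <= q ^+ n * (nm (G 0) / (1 - q)).
  apply: le_trans h3 _; rewrite mulrAC mulrC ler_wpM2r // exprS.
  by rewrite ler_piMl // ltW.
by rewrite /K; lra.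
Qed.

Section Operator.
Context (P : H -> H).
Context (Plin : forall c u v, P (c *: u + v) = c *: P u + P v).
Context (Psym : forall u v, ip (P u) v = ip u (P v)).
Context (Pcontr : forall u, ip (P u) (P u) <= ip u u).

Lemma opD u v : P (u + v) = P u + P v.
Proof. by rewrite -[u]scale1r Plin !scale1r. Qed.
Lemma op0 : P 0 = 0.
Proof. by apply: (addrI (P 0)); rewrite -opD !addr0. Qed.
Lemma opZ c u : P (c *: u) = c *: P u.
Proof. by rewrite -[c *: u]addr0 Plin op0 addr0. Qed.
Lemma opN u : P (- u) = - P u.
Proof. by rewrite -scaleN1r opZ scaleN1r. Qed.
Lemma opB u v : P (u - v) = P u - P v.
Proof. by rewrite opD opN. Qed.

Lemma op_contr u : nm (P u) <= nm u.
Proof. by rewrite ler_sqrt // (ip_ge0 hH). Qed.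

(** Locked, so that [L lam u] is opaque to rewriting; [res_opE] opens it. *)
Definition res_op : Cx -> H -> H := locked (fun lam u => lam *: u - P u).
Local Notation L := res_op.

Lemma res_opE lam u : L lam u = lam *: u - P u.
Proof. by rewrite /res_op -lock. Qed.

Lemma res_opD lam u v : L lam (u + v) = L lam u + L lam v.
Proof. by rewrite !res_opE scalerDr opD opprD addrACA. Qed.
Lemma res_opZ lam c u : L lam (c *: u) = c *: L lam u.
Proof. by rewrite !res_opE opZ scalerBr !scalerA mulrC. Qed.
Lemma res_opN lam u : L lam (- u) = - L lam u.
Proof. by rewrite -scaleN1r res_opZ scaleN1r. Qed.
Lemma res_opB lam u v : L lam (u - v) = L lam u - L lam v.
Proof. by rewrite res_opD res_opN. Qed.
Lemma res_op0 lam : L lam 0 = 0.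
Proof. by rewrite !res_opE scaler0 op0 subr0. Qed.
Lemma res_op_shift lam lam' u : L lam' u = L lam u + (lam' - lam) *: u.
Proof. by rewrite !res_opE scalerBl [RHS]addrC -addrA addKr. Qed.
Lemma res_op_sym (r : R) u v : ip (L r%:C%C u) v = ip u (L r%:C%C v).
Proof. by rewrite !res_opE !ipE Psym. Qed.
Lemma res_op_bound lam u : nm (L lam u) <= (normc lam + 1) * nm u.
Proof.
rewrite res_opE; apply: le_trans (hnD _ _) _; rewrite hnN hnZ mulrDl mul1r lerD2l.
exact: op_contr.
Qed.

Definition bounded_below lam : Prop :=
  exists2 c : R, 0 < c & forall u, c * nm u <= nm (L lam u).

Definition regular lam : Prop :=
  (exists2 c : R, 0 < c & forall u, c * nm u <= nm (L lam u)) /\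
  (forall f, exists u, L lam u = f).

(* For symmetric [P]: [lam] lies outside the closure of the numerical range. *)
Definition coercive lam : Prop :=
  exists c : Cx, exists2 del : R, 0 < del &
    forall u, del * ip u u <= ip (c *: L lam u) u.

Lemma ip_iP u : ip (('i%C : Cx) *: P u) u = 0.
Proof.
have /eqP : ip (('i%C : Cx) *: P u) u = - ip (('i%C : Cx) *: P u) u.
  rewrite {1}ipZ (_ : (conjc 'i%C : Cx) = - 'i%C); last by apply: cplx_eqP => /=; lra.
  by rewrite scaleNr ipNr Psym opZ symh.
by rewrite -addr_eq0 -mulr2n mulrn_eq0 /= => /eqP.
Qed.

(** [i u] and [i P u] are orthogonal to [u] for the real form, so only [Re (c lam)] and [Re c]
    matter: coercivity becomes a scalar inequality on the quadratic form of [P]. *)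
Lemma ip_res_self c lam u :
  ip (c *: L lam u) u = Re (c * lam) * ip u u - Re c * ip (P u) u.
Proof.
rewrite !res_opE scalerBr scalerA !ipE ip_scale_self.
by rewrite [ip (c *: P u) u]ip_scaleE ip_iP mulr0 addr0.
Qed.

Lemma coercive_below lam : coercive lam -> bounded_below lam.
Proof.
move=> [c [del d0 hc]]; exists (del / (normc c + 1)).
  by rewrite divr_gt0 // ltr_wpDl ?normc_ge0.
move=> u; have c0 : 0 < normc c + 1 by rewrite ltr_wpDl ?normc_ge0.
rewrite mulrAC ler_pdivrMr //.
have [->|u0] := eqVneq u 0; first by rewrite hn0 mulr0 mulr_ge0 ?hn_ge0 // ltW.
have up : 0 < nm u.
  by rewrite lt_neqAle hn_ge0 andbT eq_sym; apply: contra u0 => /eqP/hn_eq0 ->.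
rewrite -(ler_pM2r up) -mulrA -expr2 hn2; apply: le_trans (hc u) _.
apply: le_trans (ip_le _ _) _; rewrite ler_wpM2r ?hn_ge0 // hnZ mulrC.
by rewrite ler_wpM2l ?hn_ge0 // lerDl.
Qed.

(** The Lax-Milgram iteration: in [|u - k c L u|^2 = |u|^2 - 2 k ip (c L u) u + k^2 |c L u|^2] the
    linear term wins for small [k]. *)
Lemma coercive_contraction lam : coercive lam -> exists (t : Cx) (q : R),
  [/\ 0 <= q, q < 1 & forall u, nm (u - t *: L lam u) <= q * nm u].
Proof.
move=> [c [del d0 hc]].
(* [K] dominates both the squared norm of [c (lam - P)] and [del ^+ 2]; with [k = del / K] the
   contraction factor satisfies [q ^+ 2 = 1 - del ^+ 2 / K]. *)
pose K := (normc c * (normc lam + 1)) ^+ 2 + del ^+ 2 + 1.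
have K0 : 0 < K by rewrite /K; have := sqr_ge0 (normc c * (normc lam + 1)); nra.
pose q := Num.sqrt (1 - del ^+ 2 / K).
have r1 : del ^+ 2 / K < 1.
  by rewrite ltr_pdivrMr // mul1r /K; have := sqr_ge0 (normc c * (normc lam + 1)); lra.
have r0 : 0 < del ^+ 2 / K by rewrite divr_gt0 // exprn_gt0.
exists ((del / K)%:C%C * c), q; split; first exact: sqrtr_ge0.
  by rewrite -sqrtr1 ltr_sqrt //; lra.
move=> u; apply: hn_le; first by rewrite mulr_ge0 ?sqrtr_ge0 ?hn_ge0.
rewrite exprMn hn2 sqr_sqrtr; last by lra.
rewrite -scalerA !ipE (symh u) -/(L lam u).
have h1 := hc u.
have h2 : ip (c *: L lam u) (c *: L lam u) <= K * ip u u.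
  rewrite -!hn2 hnZ.
  have h : normc c * nm (L lam u) <= normc c * (normc lam + 1) * nm u.
    by rewrite -mulrA ler_wpM2l ?normc_ge0 // res_op_bound.
  have h' := lerXn2r 2 _ _ h.
  apply: le_trans (h' _ _) _; rewrite ?nnegrE ?mulr_ge0 ?normc_ge0 ?hn_ge0 //.
    by rewrite addr_ge0 ?normc_ge0.
  by rewrite exprMn ler_wpM2r ?sqr_ge0 // /K; have := sqr_ge0 del; lra.
set a := ip (c *: L lam u) u in h1 *; set b := ip (c *: _) (c *: _) in h2 *.
set k := del / K.
have k0 : 0 < k by rewrite divr_gt0.
have e1 : del ^+ 2 / K = del * k by rewrite /k; field; rewrite gt_eqF.
have e2 : K * k = del by rewrite /k; field; rewrite gt_eqF.
have h3 : k * b <= del * ip u u.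
  have -> : del * ip u u = k * (K * ip u u) by rewrite -[in LHS]e2; ring.
  by rewrite ler_wpM2l // ltW.
have h4 : k * (k * b) <= k * (del * ip u u) by rewrite ler_wpM2l // ltW.
have h5 : k * (del * ip u u) <= k * a by rewrite ler_wpM2l // ltW.
have -> : (1 - del ^+ 2 / K) * ip u u = ip u u - k * (del * ip u u) by rewrite e1; ring.
lra.
Qed.

Lemma coercive_regular lam : coercive lam -> regular lam.
Proof.
move=> hc; split; first exact: coercive_below.
move=> f; have [t [q [q0 q1 hq]]] := coercive_contraction hc.
(* [t = 0] would make the identity a strict contraction; then the space is trivial and [f = 0]. *)
have [t0|t0] := eqVneq t 0.
  exists 0; have fz : f = 0.
    apply: hn_eq0; apply/eqP; rewrite eq_le hn_ge0 andbT.
    have := hq f; rewrite t0 scale0r subr0 => h.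
    have := hn_ge0 f; nra.
  by rewrite !res_opE fz scaler0 op0 subr0.
have [u hu] : exists u, (u - t *: L lam u) + t *: f = u.
  apply: (hilbert_fixpoint q0 q1) => u v.
  rewrite opprD addrACA subrr addr0.
  apply: le_trans (hq (u - v)); rewrite res_opB (scalerBr t (L lam u)) !opprB.
  have -> : u - t *: L lam u + (t *: L lam v - v) = u - v + (t *: L lam v - t *: L lam u).
    by rewrite addrACA [RHS]addrACA; congr (_ + _); exact: addrC.
  exact: lexx.
exists u; apply: (scalerI t0); apply/esym/eqP; rewrite -subr_eq0.
by rewrite -(inj_eq (addrI u)) addr0 addrCA addrC hu.
Qed.

Lemma nonreal_coercive lam : Im lam != 0 -> coercive lam.
Proof.
(* With [c = - i Im lam], [Re c = 0] and [Re (c lam) = (Im lam) ^ 2]. *)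
move=> l0; exists (0 +i* (- Im lam))%C; exists (Im lam ^+ 2).
  by rewrite lt_neqAle eq_sym sqrf_eq0 l0 sqr_ge0.
by move=> u; rewrite ip_res_self cReM /=; rewrite le_eqVlt; apply/orP; left; apply/eqP; ring.
Qed.

Lemma large_coercive lam : 1 < normc lam -> coercive lam.
Proof.
(* With [c = conj lam] the form is [|lam|^2 ip u u - Re lam ip (P u) u], and [P] is a
   contraction. *)
move=> l1; exists (conjc lam); exists (normc lam ^+ 2 - normc lam); first by nra.
move=> u; rewrite ip_res_self cReM cReJ cImJ.
have -> : Re lam * Re lam - - Im lam * Im lam = normc lam ^+ 2.
  by rewrite normc2; ring.
rewrite mulrBl lerD2l lerN2; apply: le_trans (ler_norm _) _; rewrite normrM.
apply: (@le_trans _ _ (normc lam * (nm u * nm u))).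
  apply: ler_pM; rewrite ?normr_ge0 ?ler_Re_normc //.
  by apply: le_trans (Cauchy_Schwarz _ _) _; rewrite ler_wpM2r ?hn_ge0 ?op_contr.
by rewrite -expr2 hn2.
Qed.

(** Perturbation: solutions at [lam'] are the fixed points of
    [u |-> (lam - P)^-1 (f - (lam' - lam) u)], a contraction of ratio [|lam' - lam| / c]. *)
Lemma regular_near lam lam' (c : R) :
  (forall u, c * nm u <= nm (L lam u)) -> (forall f, exists u, L lam u = f) ->
  normc (lam' - lam) < c -> regular lam'.
Proof.
move=> hc hs hl; have c0 : 0 < c by apply: le_lt_trans hl; exact: normc_ge0.
split.
  exists (c - normc (lam' - lam)); first by rewrite subr_gt0.
  move=> u; rewrite (res_op_shift lam).
  apply: le_trans (hnB_ge _ _); rewrite hnZ mulrBl lerD2r.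
  exact: hc.
move=> f; have /choice [S hS] := hs.
have [u hu] : exists u, S (f - (lam' - lam) *: u) = u.
  apply: (@hilbert_fixpoint (fun u => S (f - (lam' - lam) *: u)) (normc (lam' - lam) / c)).
  - by rewrite mulr_ge0 ?normc_ge0 // invr_ge0 ltW.
  - by rewrite ltr_pdivrMr // mul1r.
  move=> u v; rewrite mulrAC ler_pdivlMr // mulrC; apply: le_trans (hc _) _.
  rewrite res_opB !hS opprB addrC addrA addrNK -scalerBr hnZ //.
  by rewrite hnB.
by exists u; rewrite (res_op_shift lam) -{1}hu hS addrNK.
Qed.

(** [r - P] is symmetric, so [i u] and [(r - P) u] are orthogonal for the real form and the cross
    term disappears. *)
Lemma ip_shift_imag (r e : R) u :
  ip (L (r +i* e)%C u) (L (r +i* e)%C u) = ip (L r%:C%C u) (L r%:C%C u) + e ^+ 2 * ip u u.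
Proof.
have z : ip (('i%C : Cx) *: u) (L r%:C%C u) = 0.
  rewrite !res_opE ipDr ipRr ipNr ipi mulr0 add0r -Psym opZ ip_iP oppr0 //.
have -> : L (r +i* e)%C u = L r%:C%C u + (e%:C%C : Cx) *: (('i%C : Cx) *: u).
  rewrite (res_op_shift r%:C%C) scalerA; congr (_ + _ *: u).
  by apply: cplx_eqP; rewrite /= ; ring.
rewrite !ipE (symh (L _ u)) z ipZZ normc2 /=; ring.
Qed.

(** The lower bound [c] survives the move to [r + i c / 2], where the operator is onto, and [r] lies
    within [c] of that point. *)
Lemma real_below_regular (r : R) : bounded_below r%:C%C -> regular r%:C%C.
Proof.
move=> [c c0 hc]; have cI : Im (r +i* (c / 2))%C != 0 by rewrite /= gt_eqF // divr_gt0.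
have [_ hs] := coercive_regular (nonreal_coercive cI).
apply: (regular_near (c := c) _ hs).
  move=> u; apply: le_trans (hc u) _; rewrite ler_sqrt ?(ip_ge0 hH) //.
  by rewrite ip_shift_imag lerDl mulr_ge0 ?sqr_ge0 ?(ip_ge0 hH).
have -> : (r%:C%C - (r +i* (c / 2))%C : Cx) = (0 +i* (- (c / 2)))%C.
  by apply: cplx_eqP => /=; ring.
by rewrite /= expr0n /= add0r sqrrN sqrtr_sqr gtr0_norm ?divr_gt0 //; lra.
Qed.

Lemma regular_unique lam u v : regular lam -> L lam u = L lam v -> u = v.
Proof.
move=> [[c c0 hc] _] e; apply/eqP; rewrite -subr_eq0; apply/eqP/hn_eq0.
have := hc (u - v); rewrite res_opB e subrr hn0 pmulr_rle0 // => h.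
by apply/eqP; rewrite eq_le h hn_ge0.
Qed.

(* If the inverse of A - s, with A = P - r and s = del / 2, had norm n > 2 / del,
   then vectors almost attaining n would be almost killed by
   (A - s) ^ 2 - n ^ -2 = (A - s - 1 / n) (A - s + 1 / n). *)
Lemma gap_below (r s del : R) : 0 < del -> `|s| = del / 2 ->
  (forall t : R, 0 < `|t| -> `|t| < del -> bounded_below (r + t)%:C%C) ->
  forall u, del / 2 * nm u <= nm (L (r + s)%:C%C u).
Proof.
move=> d0 sd hb u0; rewrite leNgt; apply/negP => hu0.
have sr : regular (r + s)%:C%C by apply: real_below_regular; apply: hb; rewrite sd; lra.
have [[c c0 hc] hs] := sr.
set Ls := L (r + s)%:C%C in hu0 hc hs *.
have u0n : 0 < nm u0.
  rewrite lt_neqAle hn_ge0 andbT eq_sym; apply/eqP => e.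
  by move: hu0; rewrite e mulr0 ltNge hn_ge0.
(* The supremum [N] of [E] is the squared norm [n ^ 2] of the inverse. *)
pose E := [set e | exists2 x, x != 0 & e = ip x x / ip (Ls x) (Ls x)].
have Lp x : x != 0 -> 0 < ip (Ls x) (Ls x).
  move=> x0; rewrite -hn2 exprn_gt0 //; apply: lt_le_trans (hc x).
  rewrite mulr_gt0 // lt_neqAle hn_ge0 andbT eq_sym.
  by apply: contra x0 => /eqP/hn_eq0 ->.
have u0z : u0 != 0 by apply: contraTneq u0n => ->; rewrite hn0 ltxx.
have Eub : has_sup E.
  split; first by exists (ip u0 u0 / ip (Ls u0) (Ls u0)), u0.
  exists (c ^- 2) => _ [x x0 ->]; rewrite ler_pdivrMr ?Lp // mulrC ler_pdivlMr ?exprn_gt0 //.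
  by rewrite -!hn2 mulrC -exprMn; apply: lerXn2r; rewrite ?nnegrE ?mulr_ge0 ?hn_ge0 ?(ltW c0).
pose N := sup E.
have hN x : ip x x <= N * ip (Ls x) (Ls x).
  have [->|x0] := eqVneq x 0; first by rewrite /Ls res_op0 !ip0l mulr0.
  by rewrite -ler_pdivrMr ?Lp //; apply: (ub_le_sup Eub.2); exists x.
have Nlb : (2 / del) ^+ 2 < N.
  apply: lt_le_trans (_ : ip u0 u0 / ip (Ls u0) (Ls u0) <= _); last by apply: (ub_le_sup Eub.2); exists u0.
  have d2 : 0 < 2 / del by rewrite divr_gt0.
  rewrite ltr_pdivlMr ?Lp // -!hn2 -exprMn ltrXn2r ?nnegrE ?mulr_ge0 ?hn_ge0 ?invr_ge0 ?(ltW d0) //.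
  rewrite -(ltr_pM2l d2) in hu0; apply: lt_le_trans hu0 _.
  by rewrite le_eqVlt; apply/orP; left; apply/eqP; field; rewrite gt_eqF.
have N0 : 0 < N by apply: le_lt_trans Nlb; exact: sqr_ge0.
(* [m = 1 / n < del / 2], so [s - m] and [s + m] are nonzero and smaller than [del] in absolute
   value: both factors are bounded below. *)
pose m := Num.sqrt N^-1.
have m2 : m ^+ 2 = N^-1 by rewrite sqr_sqrtr // invr_ge0 ltW.
have m0 : 0 < m by rewrite sqrtr_gt0 invr_gt0.
have md : m < del / 2.
  rewrite -ltr_sqr ?nnegrE ?(ltW m0) ?divr_ge0 ?(ltW d0) // m2.
  by rewrite -[X in _ < X]invrK ltf_pV2 ?posrE // ?invr_gt0 ?exprn_gt0 ?divr_gt0 // -exprVn invf_div.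
have [c1 c10 h1] : bounded_below (r + (s - m))%:C%C.
  by apply: hb; case: (ger0P s) sd => ? sd; case: (ger0P (s - m)) => ?; lra.
have [c2 c20 h2] : bounded_below (r + (s + m))%:C%C.
  by apply: hb; case: (ger0P s) sd => ? sd; case: (ger0P (s + m)) => ?; lra.
pose M := (normc (r + s)%:C%C + 1) ^+ 2.
have M0 : 0 < M by rewrite exprn_gt0 // ltr_wpDl ?normc_ge0.
pose k := N * (c1 * c2 / M).
have k0 : 0 < k by rewrite /k mulr_gt0 // divr_gt0 // mulr_gt0.
(* Since [N m ^ 2 = 1], [w - N Ls (Ls w) = - N (Ls - m) (Ls + m) w]. *)
have key w : k * nm (Ls (Ls w)) <= nm (w - (N%:C%C : Cx) *: Ls (Ls w)).
  have -> : w - (N%:C%C : Cx) *: Ls (Ls w) =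
      (- (N%:C%C) : Cx) *: L (r + (s - m))%:C%C (L (r + (s + m))%:C%C w).
    have -> : L (r + (s + m))%:C%C w = Ls w + (m%:C%C : Cx) *: w.
      rewrite (res_op_shift (r + s)%:C%C); congr (_ + _ *: w).
      by apply: cplx_eqP => /=; ring.
    rewrite (res_op_shift (r + s)%:C%C) -/Ls.
    have -> : ((r + (s - m))%:C%C - (r + s)%:C%C : Cx) = - (m%:C%C).
      by apply: cplx_eqP => /=; ring.
    have -> : Ls (Ls w + (m%:C%C : Cx) *: w) + (- m%:C%C : Cx) *: (Ls w + (m%:C%C : Cx) *: w)
        = Ls (Ls w) - ((m * m)%:C%C : Cx) *: w.
      have -> : Ls (Ls w + (m%:C%C : Cx) *: w) = Ls (Ls w) + (m%:C%C : Cx) *: Ls w.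
        by rewrite /Ls res_opD res_opZ.
      by rewrite scaleNr scalerDr scalerA opprD addrA addrK rmorphM.
    rewrite scaleNr scalerBr opprB scalerA -rmorphM.
    by rewrite -expr2 m2 mulfV ?gt_eqF // rmorph1 scale1r.
  rewrite hnZ normcN normc_real gtr0_norm // /k -mulrA ler_wpM2l ?(ltW N0) //.
  apply: le_trans (h1 _); rewrite -!mulrA ler_wpM2l ?(ltW c10) //.
  apply: le_trans (h2 _); rewrite ler_wpM2l ?(ltW c20) //.
  rewrite mulrC ler_pdivrMr // mulrC /M expr2 -mulrA.
  apply: le_trans (res_op_bound _ _) _; rewrite ler_wpM2l ?addr_ge0 ?normc_ge0 //.
  exact: res_op_bound.
have e0 : 0 < k ^+ 2 / (2 * N) by apply: divr_gt0; [exact: exprn_gt0 | exact: mulr_gt0].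
have [_ [x x0 ->] hx] := sup_adherent e0 Eub.
rewrite -/N ltr_pdivlMr ?Lp // in hx.
(* Let [a = |x|^2] and [b = |Ls x|^2]. Squaring [key] at [Ls w = x] gives [k^2 b <= |w|^2 - 2 N a +
   N^2 b <= N (N b - a)], and near-maximality of [x] makes the right side smaller than
   [k^2 b / 2]. *)
have [w hw] := hs x.
have := key w; rewrite hw => /(lerXn2r 2).
rewrite !nnegrE !(mulr_ge0, hn_ge0, ltW k0) // => /(_ isT isT).
rewrite exprMn !hn2 !ipE (symh _ w).
have -> : ip w (Ls x) = ip x x by rewrite /Ls -res_op_sym -/Ls hw.
have hw2 : ip w w <= N * ip x x by rewrite -hw.
set a := ip x x in hw2 hx *; set b := ip (Ls x) (Ls x) in hx *.
have b0 : 0 < b by exact: Lp.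
have hx2 : N * ((N - k ^+ 2 / (2 * N)) * b) < N * a by rewrite ltr_pM2l.
have e1 : N * ((N - k ^+ 2 / (2 * N)) * b) = N ^+ 2 * b - k ^+ 2 * b / 2.
  by field; rewrite gt_eqF.
have kb : 0 < k ^+ 2 * b by rewrite mulr_gt0 ?exprn_gt0.
by rewrite e1 in hx2; rewrite expr2 in hx2 *; nra.
Qed.

(** Write [A = r - P]. The gap gives [del |ip (A u) u| <= |A u|^2]; polarizing at [u] and
    [A u / del] turns this into [del |A u| <= |A (A u)|], a lower bound on the range of [A], which
    is dense. *)
Lemma isolated_dense_below (r del : R) : 0 < del ->
  (forall t : R, 0 < `|t| -> `|t| < del -> bounded_below (r + t)%:C%C) ->
  (forall f (e : R), 0 < e -> exists u, nm (f - L r%:C%C u) < e) ->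
  bounded_below r%:C%C.
Proof.
move=> d0 hb hd; pose A := L r%:C%C.
have Asym u v : ip (A u) v = ip u (A v) by exact: res_op_sym.
(* From [gap_below] at [s = del / 2] and [s = - del / 2]; the terms [s ^ 2 ip u u] cancel. *)
have form u : del * `|ip (A u) u| <= ip (A u) (A u).
  have aux s : `|s| = del / 2 -> 0 <= ip (A u) (A u) + 2 * s * ip (A u) u.
    move=> hs; have := gap_below d0 hs hb u.
    move=> /(lerXn2r 2); rewrite !nnegrE !(mulr_ge0, hn_ge0) ?divr_ge0 ?(ltW d0) //.
    move=> /(_ isT isT); rewrite exprMn !hn2.
    have -> : L (r + s)%:C%C u = A u + (s%:C%C : Cx) *: u.
      rewrite (res_op_shift r%:C%C); congr (_ + _ *: u).
      by apply: cplx_eqP => /=; ring.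
    have s2 : s ^+ 2 = (del / 2) ^+ 2 by rewrite -hs real_normK ?num_real.
    rewrite !ipE (symh u) -s2 /A; lra.
  have h1 : `|del / 2| = del / 2 by rewrite ger0_norm // divr_ge0 // ltW.
  have h2 : `|- (del / 2)| = del / 2 by rewrite normrN.
  have := aux _ h1; have := aux _ h2.
  by case: (ger0P (ip (A u) u)) => _; lra.
have step u : del * nm (A u) <= nm (A (A u)).
  rewrite -ler_sqr ?nnegrE ?mulr_ge0 ?hn_ge0 ?(ltW d0) // exprMn !hn2.
  pose v := (del^-1%:C%C : Cx) *: A u.
  have e1 := form (u + v); have e2 := form (u - v).
  have n1 := ler_norm (ip (A (u + v)) (u + v)).
  have n2 := ler_norm (- ip (A (u - v)) (u - v)); rewrite normrN in n2.
  have Av : A v = (del^-1%:C%C : Cx) *: A (A u) by rewrite /A res_opZ.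
  have pol : ip (A (u + v)) (u + v) - ip (A (u - v)) (u - v) = 4 * (del^-1 * ip (A u) (A u)).
    have AD : A (u + v) = A u + A v by exact: res_opD.
    have AB : A (u - v) = A u - A v by exact: res_opB.
    rewrite AD AB Av /v !ipE ![ip (A (A u)) u]Asym.
    by ring.
  have par : ip (A (u + v)) (A (u + v)) + ip (A (u - v)) (A (u - v)) =
      2 * ip (A u) (A u) + 2 * (del^-1 ^+ 2 * ip (A (A u)) (A (A u))).
    rewrite /A !res_opD !res_opN -/A Av !ipE; ring.
  have k1 : del * (4 * (del^-1 * ip (A u) (A u))) = 4 * ip (A u) (A u).
    by field; rewrite gt_eqF.
  have k2 : del * (ip (A (u + v)) (u + v) - ip (A (u - v)) (u - v)) <=
     del * `|ip (A (u + v)) (u + v)| + del * `|ip (A (u - v)) (u - v)|.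
    by rewrite -mulrDr ler_wpM2l ?(ltW d0) // lerD.
  rewrite pol k1 in k2.
  have k3 : ip (A u) (A u) <= del^-1 ^+ 2 * ip (A (A u)) (A (A u)) by lra.
  rewrite exprVn mulrC ler_pdivlMr ?exprn_gt0 // in k3.
  by rewrite mulrC.
exists (del / 2); first by rewrite divr_gt0.
move=> f; rewrite -/(A f).
have K0 : 0 < del + (normc (r%:C%C : Cx) + 1) by have := normc_ge0 (r%:C%C : Cx); lra.
apply: (@le_trans _ _ (del * nm f)).
  by rewrite ler_wpM2r ?hn_ge0 //; lra.
apply/ler_addgt0Pr => e e0.
have [u hu] := hd f (e / (del + (normc (r%:C%C : Cx) + 1))) (divr_gt0 e0 K0).
have h1 := step u.
have h2 := hnD3 f (A u) 0; rewrite !subr0 in h2.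
have h3 := hnD3 (A (A u)) (A f) 0; rewrite !subr0 in h3.
have h4 : nm (A (A u) - A f) <= (normc (r%:C%C : Cx) + 1) * nm (f - A u).
  by rewrite hnB {1 3}/A -res_opB; exact: res_op_bound.
rewrite -/(A u) ltr_pdivlMr // in hu.
have h5 : del * nm f <= del * nm (f - A u) + del * nm (A u).
  by rewrite -mulrDr ler_wpM2l // ltW.
have := hn_ge0 (f - A u); lra.
Qed.

(* The sum is [X + z V X] with [X] the sum for [V \o V] and [z ^ 2] its constant;
   by the parallelogram law one of the two square roots gains a factor [1 + s]. *)
Lemma dyadic_orbit_large k : forall (V : H -> H) (s : R) (phi : H),
  (forall c u v, V (c *: u + v) = c *: V u + V v) -> 0 <= s -> s <= 1 ->
  (forall u, ip (V u) (V u) = s * ip u u) ->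
  exists c, normc c = 1 /\
    (1 + s ^+ (2 ^ k)) ^+ k * ip phi phi <=
    ip (\sum_(n < 2 ^ k) c ^+ n *: iter n V phi) (\sum_(n < 2 ^ k) c ^+ n *: iter n V phi).
Proof.
elim: k => [|k IH] V s phi Vlin s0 s1 Vs.
  exists 1; split; first exact: Normc.normc1.
  by rewrite expr0 mul1r /= big_ord_recl big_ord0 addr0 expr0 scale1r.
have VD u v : V (u + v) = V u + V v by rewrite -[u]scale1r Vlin !scale1r.
have V0 : V 0 = 0 by apply: (addrI (V 0)); rewrite -VD !addr0.
have VZ c u : V (c *: u) = c *: V u by rewrite -[c *: u]addr0 Vlin V0 addr0.
have [] := IH (V \o V) (s ^+ 2) phi.
- by move=> c u v /=; rewrite !Vlin.
- by rewrite sqr_ge0.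
- by rewrite expr_le1.
- by move=> u /=; rewrite !Vs mulrA expr2.
move=> c [c1 /=]; rewrite -exprM -expnS => hc.
pose z : Cx := sqrtc c.
have z2 : z ^+ 2 = c by rewrite sqr_sqrtc.
have nz : normc z = 1.
  apply/eqP; rewrite -(@eqrXn2 _ 2) ?normc_ge0 //.
  by rewrite -normcX z2 c1 expr1n.
set X := \sum_(n < _) _ in hc.
have split_sum w : w ^+ 2 = c ->
    \sum_(n < 2 ^ k.+1) w ^+ n *: iter n V phi = X + w *: V X.
  move=> w2; have : forall m, \sum_(n < 2 * m) w ^+ n *: iter n V phi =
      \sum_(n < m) c ^+ n *: iter n (V \o V) phi +
      w *: V (\sum_(n < m) c ^+ n *: iter n (V \o V) phi).
    have it n : iter (2 * n) V phi = iter n (V \o V) phi.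
      by elim: n => [//|n IHn]; rewrite mulnS !iterS IHn.
    elim=> [|m IHm]; first by rewrite muln0 !big_ord0 V0 scaler0 addr0.
    rewrite mulnS !big_ord_recr /= IHm VD scalerDr -!addrA; congr (_ + _).
    rewrite addrCA it exprS exprM w2; congr (_ + (_ + _)).
    by rewrite -scalerA VZ.
  by rewrite expnS; exact.
have par : ip (X + z *: V X) (X + z *: V X) + ip (X + (- z) *: V X) (X + (- z) *: V X)
    = 2 * (1 + s) * ip X X.
  have e : ip (z *: V X) (z *: V X) = s * ip X X by rewrite ipZZ nz expr1n mul1r Vs.
  rewrite scaleNr !ipDl !ipDr !ipNl !ipNr e; ring.
have big : (1 + s ^+ (2 ^ k.+1)) ^+ k.+1 * ip phi phi <= (1 + s) * ip X X.
  rewrite exprS -mulrA; apply: ler_pM.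
  - by rewrite addr_ge0 ?exprn_ge0.
  - by rewrite mulr_ge0 ?(ip_ge0 hH) // exprn_ge0 // addr_ge0 ?exprn_ge0.
  - by rewrite lerD2l; rewrite -[X in _ <= X]expr1 ler_wiXn2l ?expn_gt0.
  - exact: hc.
have [h|h] := lerP (ip (X + (- z) *: V X) (X + (- z) *: V X)) (ip (X + z *: V X) (X + z *: V X)).
  exists z; split => //; rewrite split_sum //; lra.
exists (- z); split; first by rewrite normcN.
by rewrite split_sum ?sqrrN //; lra.
Qed.

Lemma Bernoulli_le (x : R) n : 0 <= x -> x <= 1 -> 1 - n%:R * x <= (1 - x) ^+ n.
Proof.
move=> x0 x1; elim: n => [|n IH]; first by rewrite mul0r subr0 expr0.
rewrite exprS; have h : 0 <= 1 - x by lra.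
have := ler_wpM2l h IH; apply: le_trans.
have := sqr_ge0 x; have : 0 <= n%:R :> R by []; rewrite -natr1; nra.
Qed.

(** [U = (i - P) (- i - P)^-1] is the Cayley transform, and [(1 - w U)^-1 phi = (1 - w)^-1 (- i - P)
    u] where [(lam - P) u = phi] and [lam = - i (1 + w) / (1 - w)], which maps the disc to the lower
    half plane. *)
Lemma cayley_bound (phi : H) (K : R) :
  (forall lam u, Im lam != 0 -> L lam u = phi -> nm u <= K) ->
  exists (U : H -> H) (K' : R),
  [/\ forall c u v, U (c *: u + v) = c *: U u + U v,
      forall u, ip (U u) (U u) = ip u u
    & forall w, normc w < 1 -> exists2 h, h = phi + w *: U h & nm h <= K'].
Proof.
move=> hK.
have rm : regular (0 +i* (-1))%C.
  by apply/coercive_regular/nonreal_coercive; rewrite /= oppr_eq0 oner_eq0.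
have [S hS] := choice rm.2.
have SL u : S (L (0 +i* (-1))%C u) = u by apply: (regular_unique rm); rewrite hS.
have Slin c u v : S (c *: u + v) = c *: S u + S v.
  by apply: (regular_unique rm); rewrite hS res_opD res_opZ !hS.
have isom u : ip (L (0 +i* 1)%C u) (L (0 +i* 1)%C u) =
    ip (L (0 +i* (-1))%C u) (L (0 +i* (-1))%C u) by rewrite (ip_shift_imag 0 1) (ip_shift_imag 0 (-1)); ring.
exists (fun f => L (0 +i* 1)%C (S f)), (3 * `|K| + 3 * nm phi); split.
- by move=> c u v; rewrite Slin res_opD res_opZ.
- by move=> u; rewrite isom hS.
move=> w w1.
have w10 : 1 - w != 0.
  rewrite subr_eq0 eq_sym; apply: contraTneq w1 => ->.
  by rewrite [normc 1]Normc.normc1 ltxx.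
pose lam : Cx := - 'i%C * ((1 + w) / (1 - w)).
have Ilam : Im lam != 0.
  have -> : Im lam = - ((1 - normc w ^+ 2) / normc (1 - w) ^+ 2).
    have nz : normc (1 - w) ^+ 2 != 0 by rewrite expf_neq0 // normc_eq0.
    have -> : lam = - 'i%C * ((1 + w) * conjc (1 - w)) * ((normc (1 - w) ^+ 2)^-1)%:C%C.
      rewrite /lam -!mulrA; congr (_ * (_ * _)).
      apply: (mulfI w10); rewrite mulfV // mulrA.
      have -> : (1 - w) * conjc (1 - w) = (normc (1 - w) ^+ 2)%:C%C.
        by rewrite normc2; case: (1 - w) => a b; apply: cplx_eqP => /=; ring.
      by rewrite -rmorphM mulfV // rmorph1.
    by move: (normc (1 - w) ^- 2) => N; rewrite normc2; case: (w) => a b /=; ring.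
  rewrite oppr_eq0 mulf_neq0 ?invr_eq0 ?expf_neq0 ?normc_eq0 //.
  by rewrite subr_eq0 eq_sym lt_eqF // expr_lt1 ?normc_ge0.
have [_ /(_ phi) [u hu]] := coercive_regular (nonreal_coercive Ilam).
have uK := hK _ _ Ilam hu.
exists ((1 - w)^-1 *: L (0 +i* (-1))%C u).
  rewrite -res_opZ SL !res_opZ scalerA mulrC -scalerA -[LHS]addr0.
  apply/eqP; rewrite addr0 -subr_eq -scalerBr; apply/eqP; rewrite -hu.
  have -> : L (0 +i* (-1))%C u - w *: L (0 +i* 1)%C u =
      ((0 +i* (-1))%C - w * (0 +i* 1)%C) *: u - (1 - w) *: P u.
    by rewrite !res_opE !scalerBr !scalerBl scale1r scalerA opprD opprK addrACA opprB
       [- P u + _]addrC.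
  rewrite scalerBr !scalerA mulVf // scale1r res_opE; congr (_ *: _ - _).
  have -> : (0 +i* (-1))%C = - 'i%C :> Cx by apply: cplx_eqP => /=; ring.
  by rewrite /lam; field.
rewrite hnZ; have n1 : normc (0 +i* (-1) : Cx)%C = 1.
  by rewrite /= expr0n /= add0r sqrrN expr1n sqrtr1.
have b1 := res_op_bound (0 +i* (-1))%C u; rewrite n1 in b1.
have b2 : normc (1 - w)^-1 <= (1 + normc lam) / 2.
  have -> : (1 - w)^-1 = (1 + 'i%C * lam) / 2.
    by rewrite /lam mulrA mulrN -expr2 sqr_i; field.
  rewrite normcM normcV (normc_nat 2) ler_wpM2r //; apply: le_trans (normcD _ _) _.
  rewrite [normc 1]Normc.normc1 lerD2l normcM.
  by rewrite /= expr0n /= add0r expr1n sqrtr1 mul1r.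
have b3 : normc (1 - w)^-1 * nm (L (0 +i* (-1))%C u) <= (1 + normc lam) * nm u.
  apply: (@le_trans _ _ ((1 + normc lam) / 2 * ((1 + 1) * nm u))); last first.
    by rewrite le_eqVlt; apply/orP; left; apply/eqP; field.
  by apply: ler_pM; rewrite ?normc_ge0 ?hn_ge0.
apply: le_trans b3 _.
have K0 := ler_norm K; have u0 := hn_ge0 u; have p0 := hn_ge0 phi.
(* It remains to bound [(1 + |lam|) |u|]: for [|lam| <= 2] by [3 |K|], beyond that by
   [(|lam| - 1) |u| <= |phi|] and [1 + |lam| <= 3 (|lam| - 1)]. *)
have [l2|l2] := lerP (normc lam) 2; first by have := normc_ge0 lam; nra.
have : normc lam * nm u - nm u <= nm phi.
  rewrite -hu res_opE -hnZ; apply: le_trans (hnB_ge _ _); rewrite hnN lerD2l lerN2.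
  exact: op_contr.
have := normr_ge0 K; nra.
Qed.

(* The Cayley transform [U] of [P] is isometric and [(1 - w U)^-1 phi] stays bounded
   for [|w| < 1], so that the sums of [w ^ n U ^ n phi] over [n < 2 ^ k] are bounded
   uniformly in [k]. *)
Lemma resolvent_Liouville (phi : H) (K : R) :
  (forall lam u, Im lam != 0 -> L lam u = phi -> nm u <= K) -> phi = 0.
Proof.
move=> /cayley_bound [U [K' [Ulin Uis hU]]].
have UD u v : U (u + v) = U u + U v by rewrite -[u]scale1r Ulin !scale1r.
have U0 : U 0 = 0 by apply: (addrI (U 0)); rewrite -UD !addr0.
have UZ c u : U (c *: u) = c *: U u by rewrite -[c *: u]addr0 Ulin U0 addr0.
have itD n u v : iter n U (u + v) = iter n U u + iter n U v.
  by elim: n => [//|n IH]; rewrite !iterS IH UD.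
have itZ n c u : iter n U (c *: u) = c *: iter n U u.
  by elim: n => [//|n IH]; rewrite !iterS IH UZ.
have itn n u : nm (iter n U u) = nm u.
  by elim: n => [//|n IH]; rewrite iterS -IH /nm Uis.
have tele w h M : h = phi + w *: U h ->
    \sum_(n < M) w ^+ n *: iter n U phi = h - w ^+ M *: iter M U h.
  move=> hh; elim: M => [|M IH]; first by rewrite big_ord0 expr0 scale1r subrr.
  have e : iter M U h = iter M U phi + w *: iter M.+1 U h.
    by rewrite {1}hh itD itZ -iterSr.
  rewrite big_ord_recr IH e scalerDr scalerA -exprSr opprD addrA.
  by rewrite [LHS]addrAC addrNK.
have key k : (3 / 2) ^+ k * ip phi phi <= (2 * K') ^+ 2.
  (* By Bernoulli [s ^+ (2 ^ k) >= 1 / 2], so each of the [k] doublings still gains a factor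
     [3 / 2], while [w = c sqrt s] stays in the open disc. *)
  pose s : R := 1 - (2 ^+ k.+1)^-1.
  have i0 : 0 < (2 ^+ k.+1)^-1 :> R by rewrite invr_gt0 exprn_gt0.
  have i1 : (2 ^+ k.+1)^-1 <= 1 :> R.
    by rewrite invf_le1 ?exprn_gt0 // exprn_ege1 // ler1n.
  have s0 : 0 <= s by rewrite /s; lra.
  have s1 : s < 1 by rewrite /s; lra.
  have hs : 1 / 2 <= s ^+ (2 ^ k).
    have := Bernoulli_le (2 ^ k) (ltW i0) i1; apply: le_trans.
    have e : (2 ^ k)%:R * (2 ^+ k.+1)^-1 = 1 / 2 :> R.
      by rewrite natrX exprS invfM mulrCA mulfV ?expf_neq0 // mulr1 mul1r.
    by rewrite e; lra.
  pose V u := ((Num.sqrt s)%:C%C : Cx) *: U u.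
  have [] := @dyadic_orbit_large k V s phi.
  - by move=> c u v; rewrite /V Ulin scalerDr !scalerA mulrC.
  - by [].
  - exact: ltW.
  - by move=> u; rewrite /V ipZZ Uis normc_real real_normK ?num_real // sqr_sqrtr.
  move=> c [c1 hc].
  pose w := c * (Num.sqrt s)%:C%C.
  have w1 : normc w < 1.
    rewrite normcM c1 mul1r normc_real ger0_norm ?sqrtr_ge0 //.
    by rewrite -sqrtr1 ltr_sqrt.
  have [h hh hK] := hU w w1.
  have itV n : c ^+ n *: iter n V phi = w ^+ n *: iter n U phi.
    rewrite /w exprMn -scalerA; congr (_ *: _); elim: n => [|n IH].
      by rewrite expr0 scale1r.
    by rewrite !iterS IH /V UZ scalerA exprS.
  rewrite (eq_bigr _ (fun (n : 'I__) _ => itV n)) (tele _ _ _ hh) in hc.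
  apply: (@le_trans _ _ ((1 + s ^+ (2 ^ k)) ^+ k * ip phi phi)).
    rewrite ler_wpM2r ?(ip_ge0 hH) // lerXn2r ?nnegrE ?divr_ge0 ?addr_ge0 ?exprn_ge0 //.
    by lra.
  apply: le_trans hc _; rewrite -hn2 lerXn2r ?nnegrE ?hn_ge0 //.
    by have := hn_ge0 h; lra.
  apply: le_trans (hnD _ _) _; rewrite hnN hnZ itn normcX.
  have : normc w ^+ (2 ^ k) * nm h <= nm h.
    by rewrite ler_piMl ?hn_ge0 // exprn_ile1 ?normc_ge0 // ltW.
  by lra.
apply: (ip_eq0 hH); apply/eqP; rewrite eq_le (ip_ge0 hH) andbT leNgt; apply/negP => p0.
have key2 k : k%:R / 2 * ip phi phi <= (2 * K') ^+ 2.
  apply: le_trans (key k); rewrite ler_wpM2r ?ltW //.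
  elim: k => [|k IH]; first by rewrite mul0r.
  have h1 : 1 <= (3 / 2 : R) ^+ k by rewrite exprn_ege1 //; lra.
  by rewrite exprS -natr1; lra.
have [n hn] : exists n : nat, 2 * (2 * K') ^+ 2 / ip phi phi < n%:R.
  exists (Num.bound (2 * (2 * K') ^+ 2 / ip phi phi)); apply: archi_boundP.
  by rewrite divr_ge0 ?(ltW p0) // mulr_ge0 // sqr_ge0.
have := key2 n; rewrite ltr_pdivrMr // in hn; lra.
Qed.

End Operator.
End Hilbert.

(** * The Hilbert space of the graph *)

Section NonnegativeSums.
Context {R : realType} {V : choiceType}.
Implicit Types (a b : V -> R) (s : seq V).

Definition asum a : R := fine (\esum_(x in [set: V]) (a x)%:E)%E.
Definition summ a : Prop := (\esum_(x in [set: V]) (a x)%:E < +oo)%E.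

Lemma asum_ub a (M : R) : (forall x, 0 <= a x) ->
  (forall s, uniq s -> \sum_(x <- s) a x <= M) -> summ a /\ asum a <= M.
Proof.
move=> a0 hM; have le : (\esum_(x in [set: V]) (a x)%:E <= M%:E)%E.
  apply: ge_ereal_sup => _ [A [fA _] <-].
  by rewrite fsbig_finite //= sumEFin lee_fin hM.
split; first by apply: le_lt_trans le _; rewrite ltry.
have : (0%:E <= \esum_(x in [set: V]) (a x)%:E)%E by apply: esum_ge0 => x _; rewrite lee_fin.
by rewrite /asum; move: le; case: (\esum_(x in _) _)%E.
Qed.

Lemma asum_lb a s : (forall x, 0 <= a x) -> summ a -> uniq s ->
  \sum_(x <- s) a x <= asum a.
Proof.
move=> a0 sa us.
have le : ((\sum_(x <- s) a x)%:E <= \esum_(x in [set: V]) (a x)%:E)%E.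
  apply: esum_ge; exists [set` s]; first by split => //; exact: finite_seq.
  by rewrite -fsbig_seq // sumEFin.
have : (0%:E <= \esum_(x in [set: V]) (a x)%:E)%E by apply: esum_ge0 => x _; rewrite lee_fin.
by move: sa le; rewrite /summ /asum; case: (\esum_(x in _) _)%E => // r _; rewrite lee_fin.
Qed.

Lemma asum_ge0 a : (forall x, 0 <= a x) -> 0 <= asum a.
Proof. by move=> a0; apply/fine_ge0/esum_ge0 => x _; rewrite lee_fin. Qed.

Lemma summ_le a b : (forall x, 0 <= a x) -> (forall x, a x <= b x) -> summ b ->
  summ a /\ asum a <= asum b.
Proof.
move=> a0 ab sb; apply: asum_ub => // s us.
apply: (@le_trans _ _ (\sum_(x <- s) b x)); first exact: ler_sum.
by apply: asum_lb => // x; apply: le_trans (ab x).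
Qed.

Lemma asumD a b : (forall x, 0 <= a x) -> (forall x, 0 <= b x) -> summ a -> summ b ->
  summ (fun x => a x + b x) /\ asum (fun x => a x + b x) = asum a + asum b.
Proof.
move=> a0 b0 sa sb.
have e : (\esum_(x in [set: V]) (a x + b x)%:E =
  \esum_(x in [set: V]) (a x)%:E + \esum_(x in [set: V]) (b x)%:E)%E.
  rewrite -esumD; [|by move=> x _; rewrite lee_fin..].
  by apply: eq_esum => x _.
move: sa sb; rewrite /summ /asum e.
have := esum_ge0 (fun x (_ : [set: V] x) => a0 x : (0%:E <= (a x)%:E)%E).
have := esum_ge0 (fun x (_ : [set: V] x) => b0 x : (0%:E <= (b x)%:E)%E).
case: (\esum_(x in _) (b x)%:E)%E => [q||] //; case: (\esum_(x in _) (a x)%:E)%E => [p||] // _ _ _ _.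
by rewrite -EFinD ltry.
Qed.

Lemma asumZ a (r : R) : (forall x, 0 <= a x) -> 0 <= r -> summ a ->
  summ (fun x => r * a x) /\ asum (fun x => r * a x) = r * asum a.
Proof.
move=> a0 r0 sa.
have aux b t : (forall x, 0 <= b x) -> 0 <= t -> summ b ->
    summ (fun x => t * b x) /\ asum (fun x => t * b x) <= t * asum b.
  move=> b0 t0 sb; apply: asum_ub => [x|s us]; first exact: mulr_ge0.
  by rewrite -mulr_sumr ler_wpM2l // asum_lb.
have [h1 h2] := aux a r a0 r0 sa; split=> //.
have [->|rn0] := eqVneq r 0.
  rewrite mul0r; apply/eqP; rewrite eq_le asum_ge0 ?andbT; last by move=> x; rewrite mul0r.
  have -> : (fun x => 0 * a x) = (fun x => r * a x * 0).
    by apply/funext => x; rewrite mulr0 mul0r.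
  apply: (proj2 (@asum_ub (fun x => r * a x * 0) 0 _ _)) => [x|s us]; first by rewrite mulr0.
  by rewrite big1 // => x _; rewrite mulr0.
have rp : 0 < r by rewrite lt_neqAle eq_sym rn0.
apply/eqP; rewrite eq_le h2 /=.
have ri : 0 <= r^-1 by rewrite invr_ge0.
have [_] := aux (fun x => r * a x) r^-1 (fun x => mulr_ge0 r0 (a0 x)) ri h1.
have -> : (fun x => r^-1 * (r * a x)) = a by apply/funext => x; rewrite mulKf.
by rewrite mulrC ler_pdivlMr // mulrC.
Qed.

Lemma summ_finite a s : (forall x, 0 <= a x) -> (forall x, x \notin s -> a x = 0) ->
  uniq s -> summ a /\ asum a = \sum_(x <- s) a x.
Proof.
move=> a0 az us.
have [h1 h2] : summ a /\ asum a <= \sum_(x <- s) a x.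
  apply: asum_ub => // t ut.
  rewrite (bigID (mem s)) /= addrC big1 ?add0r; last by move=> x /az.
  rewrite -big_filter; have -> : \sum_(x <- s) a x = \sum_(x <- s | x \in t) a x + \sum_(x <- s | x \notin t) a x.
    by rewrite [LHS](bigID (mem t)).
  rewrite -[X in X <= _]addr0; apply: lerD; last exact: sumr_ge0.
  rewrite -[X in _ <= X]big_filter le_eqVlt; apply/orP; left; apply/eqP/perm_big.
  apply: uniq_perm; rewrite ?filter_uniq // => x.
  by rewrite !mem_filter andbC.
by split=> //; apply/eqP; rewrite eq_le h2 asum_lb.
Qed.

Lemma asum_adherent a (e : R) : (forall x, 0 <= a x) -> summ a -> 0 < e ->
  exists2 s, uniq s & asum a - e < \sum_(x <- s) a x.
Proof.
move=> a0 sa e0; apply: contrapT => h.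
have [_] : summ a /\ asum a <= asum a - e.
  by apply: asum_ub => // s us; rewrite leNgt; apply/negP => h'; apply: h; exists s.
by apply/negP; rewrite -ltNge; lra.
Qed.

End NonnegativeSums.

Lemma sum_sqr_le (R : realType) (T : Type) (s : seq T) (a : T -> R) :
  (\sum_(y <- s) a y) ^+ 2 <= (size s)%:R * \sum_(y <- s) a y ^+ 2.
Proof.
elim: s => [|x s IH]; first by rewrite !big_nil expr0n /= mul0r.
rewrite !big_cons /= -natr1.
have h : 2 * a x * \sum_(y <- s) a y <= (size s)%:R * a x ^+ 2 + \sum_(y <- s) a y ^+ 2.
  elim: s {IH} => [|y s IH]; first by rewrite !big_nil mul0r mulr0 addr0.
  rewrite !big_cons /= -natr1; have := sqr_ge0 (a x - a y); nra.
have := sqr_ge0 (a x); nra.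
Qed.

(** * Square summable functions weighted by the degree, and the walk on them *)

Section SquareSummable.
Context {R : realType} {V : choiceType} (adj : rel V).
Local Notation Cx := (cplx R).
Local Notation normc := (@Normc.normc R).
Local Notation Re := (@complex.Re R).
Local Notation Im := (@complex.Im R).

Definition wt (x : V) : R := (degree adj x)%:R.
Definition dens (f : V -> Cx) (x : V) : R := wt x * normc (f x) ^+ 2.

Lemma dens_ge0 f x : 0 <= dens f x.
Proof. by rewrite mulr_ge0 ?sqr_ge0 // ler0n. Qed.

Definition sqn f : R := asum (dens f).

Lemma dens_ReIm f x : dens f x = wt x * (Re (f x) ^+ 2 + Im (f x) ^+ 2).
Proof. by rewrite /dens normc2. Qed.

Lemma ell2D (f g : V -> Cx) : ell2 adj f -> ell2 adj g -> ell2 adj (f + g).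
Proof.
move=> hf hg; have [h _] := asumD (dens_ge0 f) (dens_ge0 g) hf hg.
have h2 : (forall x, 0 <= dens f x + dens g x) by move=> x; rewrite addr_ge0 ?dens_ge0.
have [h3 _] := asumZ h2 (ler0n R 2) h.
apply: (proj1 (summ_le (dens_ge0 _) _ h3)) => x.
rewrite !dens_ReIm -mulrDr mulrCA ler_wpM2l ?ler0n //= cReD cImD.
have := sqr_ge0 (Re (f x) - Re (g x)); have := sqr_ge0 (Im (f x) - Im (g x)); nra.
Qed.

Lemma ell2Z (c : Cx) (f : V -> Cx) : ell2 adj f -> ell2 adj (c *: f).
Proof.
move=> hf; have [h3 _] := asumZ (dens_ge0 f) (sqr_ge0 (normc c)) hf.
apply: (proj1 (summ_le (dens_ge0 _) _ h3)) => x.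
rewrite /dens /= [(c *: f) x](_ : _ = c * f x) // normcM exprMn mulrCA //.
Qed.

Definition ell2_pred : {pred (V -> Cx)} := fun f => `[< ell2 adj f >].

Lemma ell2_submod : submod_closed ell2_pred.
Proof.
split.
  apply/asboolP; have [] := @summ_finite R V (dens 0) [::] (dens_ge0 0) _ isT => // x _.
  by rewrite /dens [normc _]Normc.normc0 expr0n mulr0.
by move=> c f g /asboolP hf /asboolP hg; apply/asboolP/ell2D => //; exact: ell2Z.
Qed.

HB.instance Definition _ :=
  GRing.isSubmodClosed.Build Cx (V -> Cx) ell2_pred ell2_submod.

Record l2 := L2 { l2fun :> V -> Cx; _ : l2fun \in ell2_pred }.
HB.instance Definition _ := [isSub for l2fun].
HB.instance Definition _ := [Choice of l2 by <:].
HB.instance Definition _ := [SubChoice_isSubLmodule of l2 by <:].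

Lemma l2P (f : l2) : ell2 adj f.
Proof. by case: f => f /= /asboolP. Qed.

Definition mkl2 (f : V -> Cx) (hf : ell2 adj f) : l2 := L2 (asboolT hf).

Lemma l2D (f g : l2) x : (f + g) x = f x + g x.
Proof. by []. Qed.
Lemma l2N (f : l2) x : (- f) x = - f x.
Proof. by []. Qed.
Lemma l2B (f g : l2) x : (f - g) x = f x - g x.
Proof. by []. Qed.
Lemma l2Z c (f : l2) x : (c *: f) x = c * f x.
Proof. by []. Qed.
Lemma l20 x : (0 : l2) x = 0.
Proof. by []. Qed.
Lemma l2_ext (f g : l2) : (forall x, f x = g x) -> f = g.
Proof. by move=> h; apply/val_inj/funext. Qed.

Lemma sqn_ge0 f : 0 <= sqn f.
Proof. exact: asum_ge0 (dens_ge0 f). Qed.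

(** Identities between squared norms follow from pointwise ones; both sides are kept as sums because
    nonnegative series only add. *)
Lemma sqn_eq2 (f1 f2 g1 g2 : l2) :
  (forall x, dens f1 x + dens f2 x = dens g1 x + dens g2 x) ->
  sqn f1 + sqn f2 = sqn g1 + sqn g2.
Proof.
move=> h; rewrite /sqn.
rewrite -(asumD (dens_ge0 f1) (dens_ge0 f2) (l2P f1) (l2P f2)).2.
rewrite -(asumD (dens_ge0 g1) (dens_ge0 g2) (l2P g1) (l2P g2)).2.
by congr asum; apply/funext.
Qed.

Lemma sqn_eq3 (f1 f2 f3 g1 g2 g3 : l2) :
  (forall x, dens f1 x + dens f2 x + dens f3 x = dens g1 x + dens g2 x + dens g3 x) ->
  sqn f1 + sqn f2 + sqn f3 = sqn g1 + sqn g2 + sqn g3.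
Proof.
move=> h; rewrite /sqn.
have ge0 (p q : l2) x : 0 <= dens p x + dens q x by rewrite addr_ge0 ?dens_ge0.
have [s1 e1] := asumD (dens_ge0 f1) (dens_ge0 f2) (l2P f1) (l2P f2).
have [s2 e2] := asumD (dens_ge0 g1) (dens_ge0 g2) (l2P g1) (l2P g2).
have [s3 e3] := asumD (ge0 f1 f2) (dens_ge0 f3) s1 (l2P f3).
have [s4 e4] := asumD (ge0 g1 g2) (dens_ge0 g3) s2 (l2P g3).
by rewrite -e1 -e2 -e3 -e4; congr asum; apply/funext.
Qed.

Lemma sqnZ c (f : l2) : sqn (c *: f) = normc c ^+ 2 * sqn f.
Proof.
rewrite /sqn -(asumZ (dens_ge0 f) (sqr_ge0 (normc c)) (l2P f)).2.
by congr asum; apply/funext => x; rewrite /dens /= normcM exprMn mulrCA.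
Qed.

Lemma sqnN (f : l2) : sqn (- f) = sqn f.
Proof.
by rewrite /sqn; congr asum; apply/funext => x; rewrite /dens l2N normcN.
Qed.

Lemma sqn_ub (f : V -> Cx) (M : R) :
  (forall s, uniq s -> \sum_(x <- s) dens f x <= M) -> ell2 adj f /\ sqn f <= M.
Proof. exact: asum_ub (dens_ge0 f). Qed.

Lemma sqn_lb (f : l2) s : uniq s -> \sum_(x <- s) dens f x <= sqn f.
Proof. exact: asum_lb (dens_ge0 f) (l2P f). Qed.

(** Polarization spares the summability of the products [f x * conjc (g x)]; the algebraic laws then
    come from pointwise identities between squares. *)
Definition ip (f g : l2) : R := (sqn (f + g) - sqn (f - g)) / 4.

Ltac sqn_lra := repeat match goal with |- context [sqn ?f] => generalize (sqn f); intro end; lra.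
Ltac dens_tac := rewrite ?dens_ReIm ?l2D ?l2N ?l2Z ?l20 ?(cReD, cImD, cReN, cImN, cReM, cImM, cReJ, cImJ, cRe_real, cIm_real); ring.

Context (lfin : forall x, finite_set [set y | adj x y]).
Context (adj_sym : symmetric adj).
Context (degp : forall x, (0 < degree adj x)%N).

Lemma wt_gt0 x : 0 < wt x.
Proof. by rewrite ltr0n. Qed.

Lemma wt_ge1 x : 1 <= wt x.
Proof. by rewrite ler1n. Qed.

Lemma densZ c (f : l2) x : dens (c *: f) x = normc c ^+ 2 * dens f x.
Proof. by rewrite /dens l2Z normcM exprMn mulrCA. Qed.

Lemma sqn0 : sqn (0 : l2) = 0.
Proof. by rewrite -(scale0r (0 : l2)) sqnZ (normc_nat 0) expr0n mul0r. Qed.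

Lemma ip_self (f : l2) : ip f f = sqn f.
Proof.
rewrite /ip subrr sqn0 subr0 -mulr2n -scaler_nat sqnZ (normc_nat 2).
by rewrite mulrAC -natrX mulfV ?mul1r // pnatr_eq0.
Qed.

Lemma ip_symm (u v : l2) : ip u v = ip v u.
Proof. by rewrite /ip [v + u]addrC -(sqnN (v - u)) opprB. Qed.

Lemma ip_opp (u v : l2) : ip (- u) v = - ip u v.
Proof.
rewrite /ip -[sqn (- u + v)]sqnN opprD opprK -[sqn (- u - v)]sqnN opprD !opprK.
by rewrite -mulNr opprB.
Qed.

Lemma ip_add (u v w : l2) : ip (u + v) w = ip u w + ip v w.
Proof.
have : sqn (u + v + w) + sqn (u - w) + sqn (v - w) =
       sqn (u + v - w) + sqn (u + w) + sqn (v + w).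
  by apply: sqn_eq3 => x; dens_tac.
by rewrite /ip; sqn_lra.
Qed.

Lemma ip_conj c (u v : l2) : ip (c *: u) v = ip u ((conjc c : Cx) *: v).
Proof.
have : sqn (c *: u + v) + sqn (u - (conjc c : Cx) *: v) =
       sqn (c *: u - v) + sqn (u + (conjc c : Cx) *: v).
  by apply: sqn_eq2 => x; dens_tac.
have aux (X Y Z W : R) : X + W = Y + Z -> (X - Y) / 4 = (Z - W) / 4 by lra.
exact: aux.
Qed.

Lemma ip_real r (u v : l2) : ip ((r%:C%C : Cx) *: u) v = r * ip u v.
Proof.
have pos (s : R) (u' v' : l2) : 0 <= s -> ip ((s%:C%C : Cx) *: u') v' = s * ip u' v'.
  (* [t] is a square root of [s], so that scaling by [t] produces the factor [s] as part of a
     squared norm. *)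
  move=> r0; pose t : Cx := (Num.sqrt s)%:C%C.
  have t2 : normc t ^+ 2 = s by rewrite normc_real real_normK ?num_real // sqr_sqrtr.
  have : sqn ((s%:C%C : Cx) *: u' + v') + sqn (t *: (u' - v')) =
         sqn ((s%:C%C : Cx) *: u' - v') + sqn (t *: (u' + v')).
    by apply: sqn_eq2 => x; rewrite !(densZ t) t2; dens_tac.
  rewrite !sqnZ t2.
  have aux (X Y Z W : R) : X + s * W = Y + s * Z -> (X - Y) / 4 = s * ((Z - W) / 4) by lra.
  exact: aux.
have [r0|r0] := lerP 0 r; first exact: pos.
have -> : (r%:C%C : Cx) *: u = - (((- r)%:C%C : Cx) *: u).
  by rewrite -scaleNr; congr (_ *: u); apply: cplx_eqP => /=; ring.
by rewrite ip_opp pos ?mulNr ?opprK // oppr_ge0 ltW.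
Qed.

Lemma ip_inner : inner_product ip.
Proof.
split; [exact: ip_symm|exact: ip_add|exact: ip_conj|exact: ip_real| |].
- by move=> u; rewrite ip_self sqn_ge0.
move=> u; rewrite ip_self => u0; apply: l2_ext => x.
have := sqn_lb u (isT : uniq [:: x]); rewrite u0 big_seq1 /dens.
rewrite pmulr_rle0 ?wt_gt0 // => h; apply/eqP; rewrite -normc_eq0 -sqrf_eq0.
by rewrite eq_le h sqr_ge0.
Qed.

Local Notation nm := (@nm R l2 ip).

Lemma hn_sqn f : nm f = Num.sqrt (sqn f).
Proof. by rewrite /nm ip_self. Qed.

Lemma hn2_sqn f : nm f ^+ 2 = sqn f.
Proof. by rewrite hn_sqn sqr_sqrtr // sqn_ge0. Qed.

Lemma point_le (f : l2) x : normc (f x) <= nm f.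
Proof.
rewrite -ler_sqr ?nnegrE ?normc_ge0 ?hn_ge0 // hn2_sqn.
have := sqn_lb f (isT : uniq [:: x]); rewrite big_seq1; apply: le_trans.
by rewrite /dens ler_peMl ?sqr_ge0 // wt_ge1.
Qed.

Lemma ell2_finite (f : V -> Cx) (s : seq V) : (forall x, x \notin s -> f x = 0) ->
  ell2 adj f.
Proof.
move=> fz; have [] := @summ_finite R V (dens f) (undup s) (dens_ge0 f) _ (undup_uniq s) => //.
by move=> x; rewrite mem_undup => /fz e; rewrite /dens e [normc _]Normc.normc0 expr0n mulr0.
Qed.

Lemma delta_subproof (x : V) (c : Cx) : ell2 adj (fun y => if y == x then c else 0).
Proof. by apply: (@ell2_finite _ [:: x]) => y; rewrite inE => /negPf ->. Qed.

Definition delta x c : l2 := mkl2 (delta_subproof x c).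

Lemma deltaE x c y : delta x c y = if y == x then c else 0.
Proof. by []. Qed.

Lemma sqn_finite (f : l2) s : uniq s -> (forall x, x \notin s -> f x = 0) ->
  sqn f = \sum_(x <- s) dens f x.
Proof.
move=> us fz; have [] := @summ_finite R V (dens f) s (dens_ge0 f) _ us => //.
by move=> x /fz e; rewrite /dens e [normc _]Normc.normc0 expr0n mulr0.
Qed.

Lemma sqn_delta x c : sqn (delta x c) = wt x * normc c ^+ 2.
Proof.
rewrite (@sqn_finite _ [:: x]) //; first by rewrite big_seq1 /dens deltaE eqxx.
by move=> y; rewrite inE deltaE => /negPf ->.
Qed.

Lemma ip_delta (f : l2) x c : ip f (delta x c) = wt x * Re (f x * conjc c).
Proof.
have : sqn (f + delta x c) + sqn (delta x (f x - c)) =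
       sqn (f - delta x c) + sqn (delta x (f x + c)).
  apply: sqn_eq2 => y; rewrite !dens_ReIm l2D l2B !deltaE.
  by case: eqP => [->|_]; rewrite ?(cReD, cImD, cReN, cImN) ?subr0 ?addr0 //=; ring.
rewrite !sqn_delta !normc2 !(cReD, cImD, cReN, cImN) /ip cReM cReJ cImJ.
by repeat match goal with |- context [sqn ?f] => generalize (sqn f); intro end; nra.
Qed.

Lemma approx_finite (f : l2) (e : R) : 0 < e -> exists (s : seq V) (g : l2),
  [/\ uniq s, forall x, g x = if x \in s then f x else 0 & nm (f - g) < e].
Proof.
move=> e0; have [s us hs] := asum_adherent (dens_ge0 f) (l2P f) (exprn_gt0 2 e0).
have gz : ell2 adj (fun x => if x \in s then f x else 0).
  by apply: (@ell2_finite _ s) => x /negPf ->.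
exists s, (mkl2 gz); split=> //.
rewrite -ltr_sqr ?nnegrE ?hn_ge0 ?(ltW e0) // hn2_sqn.
have e1 : sqn (f - mkl2 gz) + sqn (mkl2 gz) = sqn f + sqn (0 : l2).
  apply: sqn_eq2 => x; rewrite /dens l2B l20 /=; case: ifP => _.
    by rewrite subrr addrC.
  by rewrite subr0.
have e2 : sqn (mkl2 gz) = \sum_(x <- s) dens f x.
  rewrite (@sqn_finite _ s) //; last by move=> x /= /negPf ->.
  by apply: eq_big_seq => x xs; rewrite /dens /= xs.
have e3 : sqn (0 : l2) = 0 by rewrite (@sqn_finite _ [::]) ?big_nil.
by move: hs e1 e3; rewrite -e2 -/(sqn f); sqn_lra.
Qed.

Definition nb (x : V) : {fset V} := fset_set [set y | adj x y].

Lemma in_nb x y : (y \in nb x) = adj x y.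
Proof. by rewrite in_fset_set //; apply/idP/idP; rewrite inE. Qed.

Lemma degreeE x : degree adj x = #|` nb x|.
Proof. by rewrite /degree /degree_in /nb; congr (#|` fset_set _|); apply/seteqP; split=> y //= []. Qed.

Lemma P_opE (f : V -> Cx) x :
  P_op adj f x = (degree adj x)%:R^-1 * \sum_(y <- nb x) f y.
Proof.
rewrite /P_op fsbig_finite // mulr_sumr; apply: eq_big_seq => y.
by rewrite in_nb /step => ->.
Qed.

(** Double counting: as [adj] is symmetric, [y] occurs in at most [degree adj y] of the inner sums.
    This is why the degree is the weight for which [P] is a contraction. *)
Lemma sum_nb_exchange (g : V -> R) s : uniq s -> (forall y, 0 <= g y) ->
  exists2 t, uniq t & \sum_(x <- s) \sum_(y <- nb x) g y <= \sum_(y <- t) wt y * g y.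
Proof.
move=> us g0; pose t := undup (flatten [seq enum_fset (nb x) | x <- s]).
exists t; first exact: undup_uniq.
have -> : \sum_(x <- s) \sum_(y <- nb x) g y =
    \sum_(x <- s) \sum_(y <- t) (if adj x y then g y else 0).
  apply: eq_big_seq => x xs; rewrite -big_mkcond /= -[RHS]big_filter.
  apply/perm_big/uniq_perm; rewrite ?fset_uniq ?filter_uniq ?undup_uniq // => y.
  rewrite mem_filter -in_nb mem_undup; apply/idP/andP => [h|[] //]; split=> //.
  by apply/flattenP; exists (enum_fset (nb x)) => //; apply: map_f.
rewrite exchange_big /=; apply: ler_sum => y _.
rewrite -big_mkcond /= -big_filter big_const_seq count_predT iter_addr_0 -mulr_natl.
rewrite ler_wpM2r // ler_nat degreeE; apply: uniq_leq_size; first by rewrite filter_uniq.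
by move=> x; rewrite !mem_filter in_nb adj_sym => /andP[].
Qed.

Lemma P_op_sqn (f : l2) : ell2 adj (P_op adj f) /\ sqn (P_op adj f) <= sqn f.
Proof.
apply: sqn_ub => s us.
have [t ut ht] := sum_nb_exchange us (fun y => sqr_ge0 (normc (f y))).
apply: le_trans (sqn_lb f ut); apply: le_trans ht; apply: ler_sum => x _.
rewrite /dens P_opE normcM normcV normc_nat -/(wt x) exprMn.
have w0 := wt_gt0 x.
have h := sum_sqr_le (nb x) (fun y => normc (f y)).
rewrite -degreeE -/(wt x) in h.
have h2 : normc (\sum_(y <- nb x) f y) ^+ 2 <= (\sum_(y <- nb x) normc (f y)) ^+ 2.
  by rewrite ler_sqr ?nnegrE ?normc_ge0 ?sumr_ge0 ?normc_sum // => *; exact: normc_ge0.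
have -> : wt x * ((wt x)^-1 ^+ 2 * normc (\sum_(y <- nb x) f y) ^+ 2) =
    (wt x)^-1 * normc (\sum_(y <- nb x) f y) ^+ 2 by field; rewrite gt_eqF.
by rewrite mulrC ler_pdivrMr // mulrC; apply: le_trans h2 _.
Qed.

Definition Pl2 (f : l2) : l2 := mkl2 (P_op_sqn f).1.

Lemma Pl2E (f : l2) x : Pl2 f x = (degree adj x)%:R^-1 * \sum_(y <- nb x) f y.
Proof. exact: P_opE. Qed.

Lemma Pl2_linear c (u v : l2) : Pl2 (c *: u + v) = c *: Pl2 u + Pl2 v.
Proof.
apply: l2_ext => x; rewrite l2D l2Z !Pl2E mulrCA -mulrDr; congr (_ * _).
by rewrite mulr_sumr -big_split /=.
Qed.

Lemma Pl2_contr u : ip (Pl2 u) (Pl2 u) <= ip u u.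
Proof. by rewrite !ip_self (P_op_sqn u).2. Qed.

Lemma sum_delta_nb x (c : Cx) : Pl2 (delta x c) = \sum_(y <- nb x) delta y ((degree adj y)%:R^-1 * c).
Proof.
apply: l2_ext => z; rewrite Pl2E.
have sumE (s : seq V) (F : V -> l2) : (\sum_(y <- s) F y) z = \sum_(y <- s) F y z.
  by elim: s => [|y s IH]; rewrite ?big_nil // !big_cons l2D IH.
rewrite sumE; rewrite [RHS](eq_bigr (fun y => if z == y then (degree adj y)%:R^-1 * c else 0)) //.
rewrite (eq_bigr (fun y => if y == x then c else 0)) //.
rewrite -big_mkcond -big_filter -[RHS]big_mkcond -[RHS]big_filter.
have f1 (w y : V) : [seq i <- nb w | i == y] = if adj w y then [:: y] else [::].
  rewrite -in_nb; case: ifP => h; first by rewrite filter_pred1_uniq ?fset_uniq.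
  by apply/eqP; rewrite -(negbK (_ == _)) -has_filter has_pred1 h.
have f2 : [seq i <- nb x | z == i] = if adj x z then [:: z] else [::].
  by rewrite -f1; apply: eq_filter => i; rewrite eq_sym.
by rewrite f1 f2 adj_sym; case: ifP => _; rewrite ?big_seq1 ?big_nil ?mulr0.
Qed.

Lemma ip_suml (I : Type) (s : seq I) (F : I -> l2) g :
  ip (\sum_(i <- s) F i) g = \sum_(i <- s) ip (F i) g.
Proof.
elim: s => [|i s IH]; first by rewrite !big_nil (ip0l ip_inner).
by rewrite !big_cons (ipDl ip_inner) IH.
Qed.

Lemma l2_sumE (I : Type) (s : seq I) (F : I -> l2) z :
  (\sum_(y <- s) F y) z = \sum_(y <- s) F y z.
Proof. by elim: s => [|y s IH]; rewrite ?big_nil // !big_cons l2D IH. Qed.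

Lemma finite_l2E s (g : l2) : uniq s -> (forall x, x \notin s -> g x = 0) ->
  g = \sum_(x <- s) delta x (g x).
Proof.
move=> us gz; apply: l2_ext => z; rewrite l2_sumE.
under eq_bigr do rewrite deltaE.
rewrite -big_mkcond -big_filter; have [zs|zs] := boolP (z \in s).
  rewrite (_ : [seq x <- s | z == x] = [:: z]) ?big_seq1 //.
  by rewrite -(filter_pred1_uniq us zs); apply: eq_filter => i; rewrite /= eq_sym.
rewrite gz // (_ : [seq x <- s | z == x] = [::]) ?big_nil //; apply/eqP.
by rewrite -(negbK (_ == _)) -has_filter; apply: contra zs => /hasP [k ? /eqP ->].
Qed.

Lemma Pl2_sym_delta (f : l2) x c : ip (Pl2 f) (delta x c) = ip f (Pl2 (delta x c)).
Proof.
rewrite ip_delta sum_delta_nb (ip_sym ip_inner f) ip_suml.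
have -> : \sum_(y <- nb x) ip (delta y ((degree adj y)%:R^-1 * c)) f =
    \sum_(y <- nb x) Re (f y * conjc c).
  apply: eq_bigr => y _; rewrite (ip_sym ip_inner) ip_delta conjcM.
  have -> : conjc ((degree adj y)%:R^-1) = ((wt y)^-1)%:C%C :> Cx.
    by rewrite conjcV conjc_nat fmorphV /= rmorph_nat.
  by rewrite mulrCA cReRM mulrA mulfV ?mul1r // gt_eqF // wt_gt0.
have ReS (s : seq V) (F : V -> Cx) : \sum_(y <- s) Re (F y) = Re (\sum_(y <- s) F y).
  by elim: s => [|y s IH]; rewrite ?big_nil // !big_cons IH cReD.
rewrite ReS -mulr_suml Pl2E -mulrA.
have -> : (degree adj x)%:R^-1 = ((wt x)^-1)%:C%C :> Cx by rewrite fmorphV /= rmorph_nat.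
by rewrite cReRM mulrA mulfV ?mul1r // gt_eqF // wt_gt0.
Qed.

(** Symmetry is checked against deltas, extended to [h] of finite support, and then to all [g] by
    density and the contraction bound. *)
Lemma Pl2_sym f g : ip (Pl2 f) g = ip f (Pl2 g).
Proof.
have fin (h : l2) s : uniq s -> (forall x, x \notin s -> h x = 0) ->
    ip (Pl2 f) h = ip f (Pl2 h).
  move=> us hz; rewrite (finite_l2E us hz) (ip_sym ip_inner) ip_suml.
  have -> : Pl2 (\sum_(x <- s) delta x (h x)) = \sum_(x <- s) Pl2 (delta x (h x)).
    elim: (s) => [|y t IH]; first by rewrite !big_nil (op0 Pl2_linear).
    by rewrite !big_cons (opD Pl2_linear) IH.
  rewrite (ip_sym ip_inner f) ip_suml; apply: eq_bigr => x _.
  by rewrite (ip_sym ip_inner) Pl2_sym_delta (ip_sym ip_inner).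
apply/eqP; rewrite -subr_eq0 -normr_eq0 eq_le normr_ge0 andbT.
apply/ler_addgt0Pr => e e0; rewrite add0r.
have K0 : 0 < 2 * nm f + 1 by have := hn_ge0 (ip := ip) f; lra.
have [s [h [us hE hh]]] := approx_finite g (divr_gt0 e0 K0).
have eh := fin h s us (fun x xs => etrans (hE x) (ifN _ _ xs)).
have -> : ip (Pl2 f) g - ip f (Pl2 g) = ip (Pl2 f) (g - h) - ip f (Pl2 (g - h)).
  by rewrite (opB Pl2_linear) !(ipDr ip_inner) !(ipNr ip_inner) eh; ring.
have h1 := Cauchy_Schwarz ip_inner (Pl2 f) (g - h).
have h2 := Cauchy_Schwarz ip_inner f (Pl2 (g - h)).
have h3 := op_contr ip_inner Pl2_contr f.
have h4 := op_contr ip_inner Pl2_contr (g - h).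
have n0 := hn_ge0 (ip := ip) (g - h); have n1 := hn_ge0 (ip := ip) f.
rewrite ltr_pdivlMr // in hh.
have k := ler_normB (ip (Pl2 f) (g - h)) (ip f (Pl2 (g - h))).
apply: le_trans k _; apply: le_trans (lerD h1 h2) _; move: hh.
have : nm (Pl2 f) * nm (g - h) <= nm f * nm (g - h) by rewrite ler_wpM2r.
have : nm f * nm (Pl2 (g - h)) <= nm f * nm (g - h) by rewrite ler_wpM2l.
move: (nm (Pl2 f)) (nm (Pl2 (g - h))) (nm f) (nm (g - h)) n0 n1 => a b c d.
by move=> d0 c0 ? ? ?; lra.
Qed.

(** The intervals of radius [r n], the geometric tail, around [x n] are nested. *)
Lemma real_geometric_cvg (x : nat -> R) (q K : R) : 0 <= q -> q < 1 -> 0 <= K ->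
  (forall n, `|x n.+1 - x n| <= K * q ^+ n) ->
  exists l, forall n, `|l - x n| <= K * q ^+ n / (1 - q).
Proof.
move=> q0 q1 K0 hx; have q1' : 0 < 1 - q by rewrite subr_gt0.
pose r n := K * q ^+ n / (1 - q).
have rS n : r n = K * q ^+ n + r n.+1 by rewrite /r exprS; field; rewrite gt_eqF.
pose a n := x n - r n; pose b n := x n + r n.
have aS n : a n <= a n.+1 /\ b n.+1 <= b n.
  by have := hx n; rewrite ler_norml /a /b (rS n) => /andP[]; lra.
have am n m : (n <= m)%N -> a n <= a m /\ b m <= b n.
  elim: m => [|m IH]; first by rewrite leqn0 => /eqP ->.
  rewrite leq_eqVlt => /orP[/eqP -> //|]; rewrite ltnS => /IH [h1 h2].
  by have [h3 h4] := aS m; split; [exact: le_trans h3 | exact: le_trans h2].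
have r0 n : 0 <= r n by rewrite /r !mulr_ge0 ?exprn_ge0 // invr_ge0 ltW.
have ab n m : a n <= b m.
  have /am[h1 _] := leq_maxl n m; have /am[_ h2] := leq_maxr n m.
  apply: le_trans h1 _; apply: le_trans h2; rewrite /a /b.
  by have := r0 (maxn n m); lra.
have hs : has_sup (range a).
  by split; [exists (a 0%N), 0%N | exists (b 0%N) => _ [n _ <-]].
exists (sup (range a)) => n.
have h1 : a n <= sup (range a) by apply: (ub_le_sup hs.2); exists n.
have h2 : sup (range a) <= b n by apply: ge_sup => [|_ [m _ <-]]; [exact: hs.1 | exact: ab].
by rewrite ler_norml; move: h1 h2; rewrite /a /b -/(r n) => ? ?; apply/andP; split; lra.
Qed.

(** The limit is taken pointwise; the norm estimate is proved on each finite set [s], where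
    pointwise convergence suffices, and passes to the supremum over [s]. *)
Lemma ip_complete_l2 : ip_complete ip.
Proof.
move=> u q K q0 q1 K0 hu; have q1' : 0 < 1 - q by rewrite subr_gt0.
have hu' n : nm (u n.+1 - u n) <= K * q ^+ n by exact: hu.
have lim x : exists z : Cx, forall n, normc (z - u n x) <= 2 * (K * q ^+ n / (1 - q)).
  have hx n : normc (u n.+1 x - u n x) <= K * q ^+ n.
    by apply: le_trans (hu' n); rewrite -l2B point_le.
  have [|lr hr] := @real_geometric_cvg (fun n => Re (u n x)) q K q0 q1 K0.
    move=> n; rewrite -cReN -cReD; apply: le_trans (hx n); exact: ler_Re_normc.
  have [|li hi] := @real_geometric_cvg (fun n => Im (u n x)) q K q0 q1 K0.
    move=> n; rewrite -cImN -cImD; apply: le_trans (hx n); exact: ler_Im_normc.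
  exists (lr +i* li)%C => n; apply: le_trans (normc_le_ReIm _) _.
  rewrite !(cReD, cImD, cReN, cImN) /= mulr2n mulrDl mul1r; exact: lerD.
have [v hv] := choice lim.
pose B n := K * q ^+ n / (1 - q).
have B0 n : 0 <= B n by rewrite /B !mulr_ge0 ?exprn_ge0 // invr_ge0 ltW.
have BS n : B n = K * q ^+ n + B n.+1 by rewrite /B exprS; field; rewrite gt_eqF.
have unm n m : nm (u (m + n)%N - u n) <= B n.
  suff : nm (u (m + n)%N - u n) + B (m + n)%N <= B n by have := B0 (m + n)%N; lra.
  elim: m => [|m IH]; first by rewrite add0n subrr (hn0 ip_inner) add0r.
  have := hnD3 ip_inner (u (m.+1 + n)%N) (u (m + n)%N) (u n).
  have := hu' (m + n)%N; rewrite (BS (m + n)%N) in IH; rewrite -addSn in IH *.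
  by move: (nm _) (nm _) (nm _) IH => *; lra.
have key n s : uniq s -> \sum_(x <- s) dens (fun x => v x - u n x) x <= B n ^+ 2.
  move=> us; pose W := \sum_(x <- s) wt x.
  have W0 : 0 <= W by apply: sumr_ge0 => x _; exact: ltW (wt_gt0 x).
  have cutP (f : V -> Cx) : ell2 adj (fun x => if x \in s then f x else 0).
    by apply: (@ell2_finite _ s) => x /negPf ->.
  pose cut f : l2 := mkl2 (cutP f).
  have cutE f : sqn (cut f) = \sum_(x <- s) dens f x.
    rewrite (@sqn_finite _ s) //; last by move=> x /= /negPf ->.
    by apply: eq_big_seq => x xs; rewrite /dens /= xs.
  rewrite -cutE -hn2_sqn ler_sqr ?nnegrE ?hn_ge0 //.
  apply/ler_addgt0Pr => e e0.
  (* [W] is the total weight of [s], so [T] turns the pointwise error of [u (m + n)] into a norm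
     error on [s]; [m] then makes it at most [e]. *)
  pose T := Num.sqrt W * (2 * (K / (1 - q))) + 1.
  have T0 : 0 < T.
    rewrite ltr_wpDl // !mulr_ge0 ?sqrtr_ge0 // invr_ge0 ltW //.
  have [m hm] : exists m, q ^+ m < e / T.
    have q1'' : `|q| < 1 by rewrite ger0_norm.
    have /cvgrPdist_lt h := cvg_expr q1''.
    have [m _ /(_ m (leqnn m)) /= p] := h (e / T) (divr_gt0 e0 T0).
    by exists m; rewrite sub0r normrN ger0_norm ?exprn_ge0 in p.
  have -> : cut (fun x => v x - u n x) =
      cut (fun x => u (m + n)%N x - u n x) + cut (fun x => v x - u (m + n)%N x).
    by apply: l2_ext => x; rewrite l2D /=; case: ifP => _; rewrite ?addr0 //; ring.
  have h0 := hnD ip_inner (cut (fun x => u (m + n)%N x - u n x)) (cut (fun x => v x - u (m + n)%N x)).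
  apply: (le_trans h0); apply: lerD.
    apply: le_trans (unm n m); rewrite -ler_sqr ?nnegrE ?hn_ge0 // !hn2_sqn cutE.
    exact: (sqn_lb (u (m + n)%N - u n) us).
  rewrite -ler_sqr ?nnegrE ?hn_ge0 ?(ltW e0) // hn2_sqn cutE.
  apply: (@le_trans _ _ (\sum_(x <- s) wt x * (2 * B (m + n)%N) ^+ 2)).
    apply: ler_sum => x _; rewrite /dens ler_wpM2l ?(ltW (wt_gt0 x)) //.
    by apply: lerXn2r; [rewrite nnegrE normc_ge0 | rewrite nnegrE; apply: mulr_ge0 => //; exact: B0 | exact: hv].
  rewrite -mulr_suml -/W -[W]sqr_sqrtr // -exprMn.
  have nn : 0 <= Num.sqrt W * (2 * B (m + n)%N).
    by apply: mulr_ge0; [exact: sqrtr_ge0 | apply: mulr_ge0 => //; exact: B0].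
  rewrite ler_sqr ?nnegrE ?(ltW e0) //.
  rewrite ltr_pdivlMr // in hm.
  have h1 : B (m + n)%N <= q ^+ m * (K / (1 - q)).
    have -> : B (m + n)%N = q ^+ n * (q ^+ m * (K / (1 - q))) by rewrite /B exprD; ring.
    rewrite ler_piMl ?exprn_ile1 ?(ltW q1) // !mulr_ge0 ?exprn_ge0 // invr_ge0 ltW //.
  apply: (@le_trans _ _ (q ^+ m * T)); last exact: ltW.
  apply: (@le_trans _ _ (Num.sqrt W * (2 * (q ^+ m * (K / (1 - q)))))).
    by rewrite ler_wpM2l ?sqrtr_ge0 // ler_wpM2l //.
  rewrite /T mulrDr mulr1; have := exprn_ge0 m q0.
  have -> : Num.sqrt W * (2 * (q ^+ m * (K / (1 - q)))) =
     q ^+ m * (Num.sqrt W * (2 * (K / (1 - q)))) by ring.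
  by move=> ?; rewrite lerDl.
have vl2 : ell2 adj v.
  have [h _] := sqn_ub (key 0%N).
  have -> : v = (fun x => v x - u 0%N x) + (u 0%N : V -> Cx).
    by apply/funext => x; rewrite /= fctE subrK.
  exact: ell2D h (l2P _).
exists (mkl2 vl2) => n; rewrite -/(nm _) -/(B n).
rewrite -ler_sqr ?nnegrE ?hn_ge0 // hn2_sqn.
by have [_] := sqn_ub (key n).
Qed.

End SquareSummable.

(** * Cells and the elimination of their interior *)

Section GraphBasics.
Context {V : choiceType} (adj : rel V).
Context (hgraph : infinite_connected_graph adj).

Lemma adj_sym : symmetric adj.
Proof. by case: hgraph. Qed.
Lemma adj_irr x : adj x x = false.
Proof. by case: hgraph => _ + _ _ _; exact. Qed.
Lemma adj_conn x y : joined adj setT x y.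
Proof. by case: hgraph => _ _ + _ _; exact. Qed.
Lemma adj_lfin x : finite_set [set y | adj x y].
Proof. by case: hgraph => _ _ _ + _; exact. Qed.
Lemma adj_infinite : infinite_set [set: V].
Proof. by case: hgraph. Qed.

Lemma mem_nb x y : (y \in nb adj x) = adj x y.
Proof. exact: in_nb adj_lfin x y. Qed.

Lemma exists_other (x : V) : exists y, y != x.
Proof.
apply: contrapT => h; apply: adj_infinite.
have -> : [set: V] = [set x]; last exact: finite_set1.
apply/seteqP; split=> // y _; apply/eqP/negPn/negP => yx; apply: h; exists y; exact: yx.
Qed.

Lemma degree_gt0 x : (0 < degree adj x)%N.
Proof.
rewrite degreeE cardfs_gt0; apply/fset0Pn.
have [y yx] := exists_other x; have [[|z p] [hp hl _]] := adj_conn x y.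
  by move: yx; rewrite -hl eqxx.
by exists z; rewrite mem_nb; case/andP: hp.
Qed.

Lemma joined_refl (A : set V) x : A x -> joined adj A x x.
Proof. by move=> Ax; exists [::]; split=> // z; rewrite inE => /eqP ->. Qed.

Lemma joined_trans (A : set V) x y z :
  joined adj A x y -> joined adj A y z -> joined adj A x z.
Proof.
move=> [p [hp hl hA]] [q [hq hm hB]]; exists (p ++ q); split.
- by rewrite cat_path hp hl.
- by rewrite last_cat hl.
move=> t; rewrite inE mem_cat => /orP[/eqP ->|/orP[tp|tq]].
- by apply: hA; rewrite mem_head.
- by apply: hA; rewrite inE tp orbT.
- by apply: hB; rewrite inE tq orbT.
Qed.

Lemma joined_step (A : set V) x y : A x -> A y -> adj x y -> joined adj A x y.
Proof.
move=> Ax Ay xy; exists [:: y]; split=> //=; first by rewrite xy.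
by move=> z; rewrite !inE => /orP[]/eqP ->.
Qed.

Lemma joined_sym (A : set V) x y : joined adj A x y -> joined adj A y x.
Proof.
move=> [p]; elim: p x => [|z p IH] x [hp hl hA].
  by rewrite -hl; apply: joined_refl; apply: hA; rewrite mem_head.
case/andP: hp => xz hp; apply: (@joined_trans _ _ z).
  apply: IH; split=> // t tp; apply: hA; by rewrite inE tp orbT.
apply: joined_step; rewrite ?(adj_sym z) //; apply: hA; rewrite ?mem_head //.
by rewrite inE mem_head orbT.
Qed.

Lemma joined_sub (A : set V) x y : joined adj A x y -> A x /\ A y.
Proof.
move=> [p [hp hl hA]]; split; apply: hA; first exact: mem_head.
by rewrite -hl mem_last.
Qed.

End GraphBasics.

Section Cells.
Context {V : choiceType} (adj : rel V) (F : set V).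
Context (hgraph : infinite_connected_graph adj).
Context (hsim : symmetrically_self_similar adj F) (hgeom : bounded_geometry adj F).
Local Notation nb := (nb adj).
Local Notation bdry := (bdry adj).
Local Notation gclosure := (gclosure adj).
Implicit Types (C D : set V).

Definition cell_of (x : V) : set V := [set y | joined adj (~` F) x y].

Lemma cell_ofP x : ~ F x -> cells adj F (cell_of x) /\ cell_of x x.
Proof. by move=> Fx; split; [exists x | exact: joined_refl]. Qed.

Lemma cell_outside D y : cells adj F D -> D y -> ~ F y.
Proof. by move=> [x Fx ->] h; have [] := joined_sub h. Qed.

Lemma cell_eq D y : cells adj F D -> D y -> D = cell_of y.
Proof.
move=> [x Fx ->] /= xy; apply/seteqP; split=> z /= h.
  by apply: joined_trans h; exact: joined_sym.
exact: joined_trans h.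
Qed.

Lemma cell_step D y z : cells adj F D -> D y -> adj y z -> ~ F z -> D z.
Proof.
move=> cD Dy yz Fz; rewrite (cell_eq cD Dy); apply: joined_step => //.
exact: cell_outside Dy.
Qed.

Lemma bdry_sub D b : cells adj F D -> bdry D b -> F b.
Proof.
move=> cD [nD [x Dx xb]]; apply: contrapT => Fb; apply: nD.
exact: cell_step Dx xb Fb.
Qed.

Lemma cell_nb D y z : cells adj F D -> D y -> adj y z -> D z \/ bdry D z.
Proof.
move=> cD Dy yz; have [Dz|nDz] := pselect (D z); first by left.
by right; split=> //; exists y.
Qed.

Lemma cell_nb_closure D y z : cells adj F D -> D y -> adj y z -> gclosure D z.
Proof. by move=> cD Dy yz; have [] := cell_nb cD Dy yz; [left|right]. Qed.

Lemma F_indep x y : F x -> F y -> adj x y = false.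
Proof. by case: hsim => [[+ _ _] _ _ _] => h Fx Fy; apply/negbTE/h. Qed.

Lemma F_nb a y : F a -> adj a y -> ~ F y /\ bdry (cell_of y) a.
Proof.
move=> Fa ay; have Fy : ~ F y by move=> Fy; rewrite F_indep in ay.
have [cy yy] := cell_ofP Fy; split=> //; split; first by move/(cell_outside cy).
by exists y; rewrite ?(adj_sym hgraph y).
Qed.

Lemma cells_meet C D : cells adj F C -> cells adj F D -> C <> D ->
  is_subset1 (gclosure C `&` gclosure D).
Proof. by case: hsim => [[_ + _] _ _ _]; exact. Qed.

Lemma cell_finite D : cells adj F D -> finite_set D.
Proof. by case: hsim => _ + _ _; exact. Qed.

Lemma bdry_finite D : cells adj F D -> finite_set (bdry D).
Proof. by case: hgeom => _ _ [N h] /h []. Qed.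

Lemma cells_iso C D : cells adj F C -> cells adj F D -> exists f, cell_iso adj C D f.
Proof. by case: hsim => _ _ + _; exact. Qed.

Lemma degree_bounded : exists N, forall x, (degree adj x <= N)%N.
Proof. by case: hgeom. Qed.

Definition bd D : {fset V} := fset_set (bdry D).
Definition cl D : {fset V} := fset_set D.

Lemma mem_bd D b : cells adj F D -> (b \in bd D) <-> bdry D b.
Proof. by move=> cD; rewrite in_fset_set ?inE //; exact: bdry_finite. Qed.

Lemma mem_cl D b : cells adj F D -> (b \in cl D) <-> D b.
Proof. by move=> cD; rewrite in_fset_set ?inE //; exact: cell_finite. Qed.

Section Iso.
Context (D C : set V) (phi : V -> V).
Context (cD : cells adj F D) (cC : cells adj F C) (hphi : cell_iso adj D C phi).

Lemma iso_inj x y : gclosure D x -> gclosure D y -> phi x = phi y -> x = y.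
Proof.
case: hphi => [[_ h _] _ _] Dx Dy; apply: h; rewrite inE //.
Qed.

Lemma iso_adj x y : gclosure D x -> gclosure D y -> adj (phi x) (phi y) = adj x y.
Proof. by case: hphi => _ + _; exact. Qed.

Lemma iso_closure x : gclosure D x -> gclosure C (phi x).
Proof. by case: hphi => [[h _ _] _ _]; exact: h. Qed.

Lemma iso_surj z : gclosure C z -> exists2 x, gclosure D x & phi x = z.
Proof. by case: hphi => [[_ _ h] _ _] /h. Qed.

Lemma iso_bdry b : bdry D b -> bdry C (phi b).
Proof. by case: hphi => _ _ <- h; exists b. Qed.

Lemma iso_bdry_surj c : bdry C c -> exists2 b, bdry D b & phi b = c.
Proof. by case: hphi => _ _ <-. Qed.

Lemma iso_cell x : D x -> C (phi x).
Proof.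
move=> Dx; have [//|/iso_bdry_surj [b Db e]] := iso_closure (or_introl Dx).
have xb := iso_inj (or_intror Db) (or_introl Dx) e.
by case: Db => + _; rewrite xb.
Qed.

Lemma iso_cell_surj z : C z -> exists2 x, D x & phi x = z.
Proof.
move=> Cz; have [x [Dx|Db] e] := iso_surj (or_introl Cz); first by exists x.
by have [] := iso_bdry Db; rewrite e.
Qed.

(** All neighbours of a vertex of a cell lie in the closure of the cell, so an isomorphism of
    closures carries [P] along inside the cell. *)
Lemma iso_nb x : D x -> perm_eq (nb (phi x)) [seq phi y | y <- nb x].
Proof.
move=> Dx; apply: uniq_perm; first exact: fset_uniq.
  rewrite map_inj_in_uniq ?fset_uniq // => y z.
  rewrite !mem_nb // => xy xz; apply: iso_inj; exact: cell_nb_closure Dx _.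
move=> z; rewrite mem_nb //; apply/idP/mapP => [xz|[y]].
  have [y Dy e] := iso_surj (cell_nb_closure cC (iso_cell Dx) xz).
  exists y => //; rewrite mem_nb // -(iso_adj (or_introl Dx) Dy) e //.
rewrite mem_nb // => xy ->; rewrite iso_adj //; first by left.
exact: cell_nb_closure Dx xy.
Qed.

Lemma iso_flux a : bdry D a ->
  perm_eq [seq y <- nb (phi a) | `[< C y >]] [seq phi y | y <- nb a & `[< D y >]].
Proof.
move=> Da; apply: uniq_perm; first by rewrite filter_uniq ?fset_uniq.
  rewrite map_inj_in_uniq ?filter_uniq ?fset_uniq // => y z.
  rewrite !mem_filter => /andP[/asboolP Dy _] /andP[/asboolP Dz _].
  by apply: iso_inj; left.
move=> z; rewrite mem_filter mem_nb //; apply/andP/mapP => [[/asboolP Cz az]|[y]].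
  have [y Dy e] := iso_cell_surj Cz; exists y => //.
  rewrite mem_filter asboolT // mem_nb // -iso_adj ?e //; first by right.
  by left.
rewrite mem_filter mem_nb // => /andP[/asboolP Dy ay] ->.
split; first by apply/asboolP/iso_cell.
by rewrite iso_adj //; [right|left].
Qed.

Lemma iso_bd : perm_eq (bd C) [seq phi b | b <- bd D].
Proof.
apply: uniq_perm; first exact: fset_uniq.
  rewrite map_inj_in_uniq ?fset_uniq // => y z /(mem_bd _ cD) ? /(mem_bd _ cD) ?.
  by apply: iso_inj; right.
move=> z; apply/idP/mapP => [/(mem_bd _ cC)/iso_bdry_surj [b Db <-]|[b /(mem_bd _ cD) Db ->]].
  by exists b => //; apply/(mem_bd _ cD).
by apply/(mem_bd _ cC)/iso_bdry.
Qed.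

Lemma iso_cl : perm_eq (cl C) [seq phi x | x <- cl D].
Proof.
apply: uniq_perm; first exact: fset_uniq.
  rewrite map_inj_in_uniq ?fset_uniq // => y z /(mem_cl _ cD) ? /(mem_cl _ cD) ?.
  by apply: iso_inj; left.
move=> z; apply/idP/mapP => [/(mem_cl _ cC)/iso_cell_surj [b Db <-]|[b /(mem_cl _ cD) Db ->]].
  by exists b => //; apply/(mem_cl _ cD).
by apply/(mem_cl _ cC)/iso_cell.
Qed.

End Iso.

(** The part that the cell [D] contributes to the neighbour sum at a boundary vertex [a]. *)
Definition flux (K : nmodType) D a (f : V -> K) : K := \sum_(y <- nb a | `[< D y >]) f y.

Definition cells_at (a : V) : seq (set V) := undup [seq cell_of y | y <- nb a].

Lemma mem_cells_at a D : F a -> reflect (cells adj F D /\ bdry D a) (D \in cells_at a).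
Proof.
move=> Fa; rewrite mem_undup; apply: (iffP mapP) => [[y]|[cD [nD [y Dy ya]]]].
  by rewrite mem_nb // => ay ->; have [Fy] := F_nb Fa ay; split=> //; exact: (cell_ofP Fy).1.
by exists y; [rewrite mem_nb // (adj_sym hgraph) | exact: cell_eq].
Qed.

(** [F] is independent, so a neighbour of [a] is off [F] and lies in exactly one cell, which has [a]
    on its boundary. *)
Lemma sum_nb_cells (K : nmodType) a (f : V -> K) : F a ->
  \sum_(y <- nb a) f y = \sum_(D <- cells_at a) flux D a f.
Proof.
move=> Fa; rewrite /flux.
under [RHS]eq_bigr do rewrite big_mkcond.
rewrite exchange_big /=; apply: eq_big_seq => y; rewrite mem_nb // => ay.
have [Fy by_] := F_nb Fa ay; have [cy yy] := cell_ofP Fy.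
rewrite -big_mkcond -big_filter.
have -> : [seq D <- cells_at a | `[< D y >]] = [:: cell_of y]; last by rewrite big_seq1.
rewrite -(@filter_pred1_uniq _ (cells_at a) (cell_of y)) ?undup_uniq //; last first.
  by apply/(mem_cells_at _ Fa).
apply: eq_in_filter => D /(mem_cells_at _ Fa) [cD _] /=.
by apply/asboolP/eqP => [|->] //; exact: cell_eq.
Qed.

Section Psi.
Context (psi : V -> V).
Context (hpsi : set_bij setT F psi).
Context (hpsi_adj : forall x y, adj x y <-> reduced_adj adj F (psi x) (psi y)).

Lemma psi_F x : F (psi x).
Proof. by case: hpsi => h _ _; exact: h. Qed.
Lemma psi_inj : injective psi.
Proof. by case: hpsi => _ h _ x y; apply: h; rewrite inE. Qed.
Lemma psi_surj a : F a -> exists x, psi x = a.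
Proof. by case: hpsi => _ _ h /h [x _ <-]; exists x. Qed.

Lemma psi_adjP x y : adj x y ->
  exists2 D, D \in cells_at (psi x) & psi y \in bd D /\ psi y != psi x.
Proof.
move=> /hpsi_adj [_ _ /eqP ne [D cD [hx hy]]]; exists D.
  by apply/(mem_cells_at _ (psi_F x)).
by rewrite eq_sym ne; split=> //; apply/mem_bd.
Qed.

(** Through [psi] the neighbours of [y] are the other boundary vertices of the cells at [psi y];
    none is counted twice because distinct cells share at most one vertex of their closures. *)
Lemma sum_nb_psi (K : nmodType) y (f : V -> K) :
  \sum_(z <- nb y) f (psi z) =
  \sum_(D <- cells_at (psi y)) \sum_(b <- bd D | b != psi y) f b.
Proof.
have e D : D \in cells_at (psi y) -> \sum_(b <- bd D | b != psi y) f b =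
    \sum_(z <- nb y) (if psi z \in bd D then f (psi z) else 0).
  move=> /(mem_cells_at _ (psi_F y)) [cD bD].
  rewrite -big_mkcond -[LHS]big_filter -[RHS]big_filter.
  transitivity (\sum_(b <- [seq psi z | z <- [seq z <- nb y | psi z \in bd D]]) f b); last by rewrite big_map.
  apply/perm_big/uniq_perm.
  - by rewrite filter_uniq ?fset_uniq.
  - by rewrite map_inj_uniq ?filter_uniq ?fset_uniq //; exact: psi_inj.
  move=> b; rewrite mem_filter; apply/andP/mapP => [[ne /(mem_bd _ cD) Db]|[z]].
    have [z zb] := psi_surj (bdry_sub cD Db); exists z => //; rewrite mem_filter zb.
    apply/andP; split; first by apply/mem_bd.
    rewrite mem_nb //; apply/hpsi_adj; rewrite zb; split; [exact: psi_F|exact: bdry_sub Db| |].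
      by apply/eqP; rewrite eq_sym.
    by exists D.
  rewrite mem_filter mem_nb // => /andP[zD yz] ->; split=> //.
  by apply/eqP => /psi_inj zy; rewrite zy adj_irr in yz.
rewrite [RHS](eq_big_seq _ e) exchange_big /=; apply: eq_big_seq => z.
rewrite mem_nb // => yz; have [D Dy [zD ne]] := psi_adjP yz.
rewrite -big_mkcond -big_filter.
have -> : [seq D <- cells_at (psi y) | psi z \in bd D] = [:: D]; last by rewrite big_seq1.
rewrite -(@filter_pred1_uniq _ (cells_at (psi y)) D) ?undup_uniq //.
apply: eq_in_filter => D' Dy' /=; apply/idP/eqP => [zD'|-> //].
have [cD bD] := mem_cells_at _ (psi_F y) Dy.
have [cD' bD'] := mem_cells_at _ (psi_F y) Dy'.
apply: contrapT => nDD; move/eqP: ne; apply.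
apply: (cells_meet cD' cD nDD); split; right => //.
- by apply/mem_bd.
- by apply/mem_bd.
Qed.

End Psi.
End Cells.

Lemma conjc0c (R : realType) : conjc (0 : cplx R) = 0 :> cplx R.
Proof. by apply: cplx_eqP => /=; rewrite ?oppr0. Qed.

Lemma conjc_sum (R : realType) (I : Type) (r : seq I) (F : I -> cplx R) :
  conjc (\sum_(i <- r) F i) = \sum_(i <- r) (conjc (F i) : cplx R).
Proof.
elim: r => [|i r IH]; first by rewrite !big_nil conjc0c.
by rewrite !big_cons conjcD IH.
Qed.

Lemma conjc_sum_cond (R : realType) (I : Type) (r : seq I) (Q : pred I) (F : I -> cplx R) :
  conjc (\sum_(i <- r | Q i) F i) = \sum_(i <- r | Q i) (conjc (F i) : cplx R).
Proof. by rewrite -!(big_filter r Q) conjc_sum. Qed.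

(** * Cramer's rule for kernels on finite sets of vertices *)

Section FiniteKernel.
Context {R : realType} {V : choiceType} (x0 : V) (s : seq V) (K : V -> V -> cplx R).
Local Notation Cx := (cplx R).
Implicit Types (u h : V -> Cx) (lam : Cx).

Definition kernel_mx : 'M[Cx]_(size s) := \matrix_(i, j) K (nth x0 s i) (nth x0 s j).
Definition kernel_poly : {poly Cx} := char_poly kernel_mx.
(** The entry of the adjugate at the vertices [y] and [x], written as a sum over ordinals so that it
    is indexed by [V]; it is 0 outside [s]. *)
Definition kernel_adj (y x : V) : {poly Cx} :=
  \sum_(i < size s) \sum_(j < size s)
    (if (nth x0 s i == y) && (nth x0 s j == x) then (\adj (char_poly_mx kernel_mx)) i j else 0).

Lemma horner_char_mx lam :
  map_mx (fun p : {poly Cx} => p.[lam]) (char_poly_mx kernel_mx) = lam%:M - kernel_mx.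
Proof.
by apply/matrixP => i j; rewrite !mxE hornerD hornerN hornerC hornerMn hornerX.
Qed.

Lemma horner_kernel_poly lam : kernel_poly.[lam] = \det (lam%:M - kernel_mx).
Proof.
by rewrite -horner_char_mx (det_map_mx (horner_eval lam)).
Qed.

Lemma horner_kernel_adj lam y x : (kernel_adj y x).[lam] =
  \sum_(i < size s) \sum_(j < size s)
    (if (nth x0 s i == y) && (nth x0 s j == x) then (\adj (lam%:M - kernel_mx)) i j else 0).
Proof.
rewrite /kernel_adj horner_sum; apply: eq_bigr => i _; rewrite horner_sum.
apply: eq_bigr => j _; case: ifP => _; last by rewrite horner0.
by rewrite -horner_char_mx -[map_mx _ _]/(map_mx (horner_eval lam) _) -map_mx_adj [RHS]mxE.
Qed.

Context (us : uniq s).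

Lemma kernel_sum (f : V -> Cx) : \sum_(x <- s) f x = \sum_(i < size s) f (nth x0 s i).
Proof. by rewrite (big_nth x0) big_mkord. Qed.

Lemma nth_mem_index y : y \in s -> exists i : 'I_(size s), nth x0 s i = y.
Proof. by move=> ys; exists (Ordinal (etrans (index_mem y s) ys)) => /=; rewrite nth_index. Qed.

Lemma kernel_adj_nth lam i j :
  (kernel_adj (nth x0 s i) (nth x0 s j)).[lam] = 
  (if (i < size s)%N =P true is ReflectT hi then
   if (j < size s)%N =P true is ReflectT hj then
     (\adj (lam%:M - kernel_mx)) (Ordinal hi) (Ordinal hj) else 0 else 0) \/ ~~ ((i < size s)%N && (j < size s)%N).
Proof.
case: eqP => hi; last by right; move/negP: hi => /negPf ->.
case: eqP => hj; last by right; move/negP: hj => /negPf ->; rewrite andbF.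
left; rewrite horner_kernel_adj (bigD1 (Ordinal hi)) //= [X in _ + X]big1 ?addr0; last first.
  move=> k /eqP ki; rewrite big1 // => l _; rewrite nth_uniq //.
  by case: eqP => // e; case: ki; apply: val_inj.
rewrite (bigD1 (Ordinal hj)) //= !eqxx /= big1 ?addr0 // => k /eqP ki.
by rewrite nth_uniq //; case: eqP => // e; case: ki; apply: val_inj.
Qed.

Lemma kernel_adj_ord lam (i j : 'I_(size s)) :
  (kernel_adj (nth x0 s i) (nth x0 s j)).[lam] = (\adj (lam%:M - kernel_mx)) i j.
Proof.
case: (kernel_adj_nth lam i j) => [->|]; last by rewrite !ltn_ord.
case: eqP => hi; last by case: hi; exact: ltn_ord.
case: eqP => hj; last by case: hj; exact: ltn_ord.
by congr (_ _ _); apply: val_inj.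
Qed.

Definition kernel_lapl lam u x : Cx := lam * u x - \sum_(z <- s) K x z * u z.

Lemma kernel_lapl_mx lam u (i : 'I_(size s)) :
  kernel_lapl lam u (nth x0 s i) = ((lam%:M - kernel_mx) *m (\col_j u (nth x0 s j))) i 0.
Proof.
rewrite mulmxBl mul_scalar_mx !mxE /kernel_lapl kernel_sum; congr (_ - _).
by apply: eq_bigr => j _; rewrite !mxE.
Qed.

Lemma kernel_cramer lam u y : y \in s ->
  kernel_poly.[lam] * u y = \sum_(x <- s) (kernel_adj y x).[lam] * kernel_lapl lam u x.
Proof.
move=> /nth_mem_index [i <-]; rewrite kernel_sum.
have /matrixP/(_ i 0) := mulmxA (\adj (lam%:M - kernel_mx)) (lam%:M - kernel_mx) (\col_j u (nth x0 s j)).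
rewrite mul_adj_mx mul_scalar_mx [LHS]mxE [RHS]mxE -horner_kernel_poly [X in _ * X]mxE => <-.
by apply: eq_bigr => j _; rewrite kernel_adj_ord kernel_lapl_mx.
Qed.

Lemma kernel_solve lam h : kernel_poly.[lam] != 0 ->
  exists u, (forall y, y \notin s -> u y = 0) /\
    forall x, x \in s -> kernel_lapl lam u x = h x.
Proof.
rewrite horner_kernel_poly => d0.
pose M := lam%:M - kernel_mx; pose w := invmx M *m (\col_j h (nth x0 s j)).
exists (fun y => \sum_(i < size s) if nth x0 s i == y then w i 0 else 0); split.
  by move=> y ys; rewrite big1 // => i _; case: eqP => // e; rewrite -e mem_nth in ys.
have e (i : 'I_(size s)) : \sum_(k < size s) (if nth x0 s k == nth x0 s i then w k 0 else 0) = w i 0.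
  rewrite (bigD1 i) //= eqxx big1 ?addr0 // => k ki.
  by rewrite nth_uniq // (negPf ki : (k == i :> nat) = false).
move=> x /nth_mem_index [i <-]; rewrite kernel_lapl_mx.
rewrite (_ : \col_j _ = w); last by apply/matrixP => k l; rewrite mxE e ord1.
by rewrite /w mulmxA mulmxV ?unitmxE ?unitfE // mul1mx mxE.
Qed.

Lemma kernel_singular lam : kernel_poly.[lam] = 0 ->
  exists u, [/\ forall y, y \notin s -> u y = 0, exists y, u y != 0 &
    forall x, x \in s -> kernel_lapl lam u x = 0].
Proof.
rewrite horner_kernel_poly => /eqP; rewrite -det_tr => /det0P [w w0 hw].
pose u y := \sum_(i < size s) if nth x0 s i == y then w 0 i else 0.
have e (i : 'I_(size s)) : u (nth x0 s i) = w 0 i.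
  rewrite /u (bigD1 i) //= eqxx big1 ?addr0 // => k ki.
  by rewrite nth_uniq // (negPf ki : (k == i :> nat) = false).
exists u; split.
- by move=> y ys; rewrite /u big1 // => i _; case: eqP => // e'; rewrite -e' mem_nth in ys.
- apply: contrapT => h; move/eqP: w0; apply; apply/matrixP => a i; rewrite ord1 mxE -e.
  by apply/eqP/negPn/negP => h'; apply: h; eexists; exact: h'.
move=> x /nth_mem_index [i <-]; rewrite kernel_lapl_mx.
rewrite (_ : \col_j _ = w^T); last by apply/matrixP => k l; rewrite !mxE e ord1.
by rewrite -[_ *m _]trmxK trmx_mul trmxK hw !mxE.
Qed.

Lemma size_kernel_poly : size kernel_poly = (size s).+1.
Proof. exact: size_char_poly. Qed.

(** Cofactors are determinants of one order less with entries of degree at most 1. This degree bound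
    is what makes [A] dominate [B] at [lam = infinity]. *)
Lemma size_kernel_adj y x : (size (kernel_adj y x) <= size s)%N.
Proof.
have hdet m (M : 'M[{poly Cx}]_m) : (forall i j, (size (M i j) <= 2)%N) -> (size (\det M) <= m.+1)%N.
  move=> hM; apply: (leq_trans (size_sum _ _ _)); apply/bigmax_leqP => p _.
  rewrite -signr_odd; set T := (\prod_i _)%R; apply: (@leq_trans (size T)).
    by case: (odd _); rewrite ?expr0 ?mul1r // expr1 mulN1r size_polyN.
  have [->|nz] := eqVneq T 0%R; first by rewrite size_poly0.
  rewrite size_prod; last by move=> i _; move/prodf_neq0: nz; exact.
  rewrite card_ord leq_subLR addnS ltnS.
  apply: (@leq_trans (\sum_(i < m) 2)%N); first by apply: leq_sum.
  by rewrite sum_nat_const card_ord muln2 addnn.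
apply: (leq_trans (size_sum _ _ _)); apply/bigmax_leqP => i _.
apply: (leq_trans (size_sum _ _ _)); apply/bigmax_leqP => j _.
case: ifP => _; last by rewrite size_poly0.
rewrite mxE /cofactor -signr_odd; set d := \det _.
apply: (@leq_trans (size d)).
  by case: (odd _); rewrite ?expr0 ?mul1r // expr1 mulN1r size_polyN.
rewrite -[X in (_ <= X)%N]prednK ?(leq_ltn_trans _ (ltn_ord i)) //.
apply: hdet => k l; rewrite !mxE; apply: leq_trans (size_polyD _ _) _.
rewrite geq_max size_polyN (leq_trans (size_polyC_leq1 _)) // andbT.
by case: (_ == _); rewrite ?mulr1n ?size_polyX ?mulr0n ?size_poly0.
Qed.

Context (Kreal : forall x y, conjc (K x y) = K x y).

Lemma conj_char_mx lam :
  map_mx (fun z : Cx => conjc z : Cx) (lam%:M - kernel_mx) = (conjc lam : Cx)%:M - kernel_mx.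
Proof.
by apply/matrixP => i j; rewrite !mxE rmorphB rmorphMn /= Kreal.
Qed.

Lemma kernel_poly_conj lam : kernel_poly.[conjc lam] = conjc kernel_poly.[lam].
Proof.
rewrite !horner_kernel_poly -conj_char_mx.
exact: (det_map_mx (conjc : {rmorphism Cx -> Cx})).
Qed.

Lemma kernel_adj_conj lam y x : (kernel_adj y x).[conjc lam] = conjc (kernel_adj y x).[lam].
Proof.
rewrite !horner_kernel_adj -conj_char_mx conjc_sum; apply: eq_bigr => i _.
rewrite conjc_sum.
apply: eq_bigr => j _.
case: (_ && _); last first.
  rewrite conjc0c.
  by [].
by rewrite -[map_mx _ _]/(map_mx (conjc : {rmorphism Cx -> Cx}) _) -map_mx_adj mxE.
Qed.

End FiniteKernel.

Lemma poly_eq_off_zeros (R : realType) (p q c : {poly cplx R}) : c != 0 ->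
  (forall x, c.[x] != 0 -> p.[x] = q.[x]) -> p = q.
Proof.
move=> c0 h; apply/eqP; rewrite -subr_eq0; apply/negPn/negP => pq0.
have r0 : (p - q) * c != 0 by rewrite mulf_neq0.
pose rs := [seq (i%:R : cplx R) | i <- iota 0 (size ((p - q) * c))].
suff : (size rs < size (((p - q) * c)%R : seq _))%N by rewrite size_map size_iota ltnn.
apply: (max_poly_roots r0).
  apply/allP => _ /mapP [i _ ->]; rewrite rootE hornerM hornerD hornerN.
  by have [->|/h ->] := eqVneq c.[i%:R] 0; rewrite ?mulr0 // subrr mul0r.
by rewrite map_inj_uniq ?iota_uniq // => i j /eqP; rewrite eqr_nat => /eqP.
Qed.

Lemma finite_bound (R : realType) (T : choiceType) (s t : seq T) (f : T -> T -> cplx R) :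
  exists2 M : R, 0 <= M & forall x y, x \in s -> y \in t -> Normc.normc (f x y) <= M.
Proof.
exists (\sum_(x <- s) \sum_(y <- t) Normc.normc (f x y)).
  by apply: sumr_ge0 => x _; apply: sumr_ge0 => y _; exact: normc_ge0.
have le (r : seq T) (g : T -> R) x : (forall z, 0 <= g z) -> x \in r -> g x <= \sum_(z <- r) g z.
  move=> g0; elim: r => //= z r IH; rewrite inE big_cons => /orP[/eqP <-|/IH h].
    by rewrite lerDl sumr_ge0.
  by apply: le_trans h _; rewrite lerDr.
move=> x y xs yt; apply: le_trans (le s (fun x => \sum_(y <- t) Normc.normc (f x y)) x _ xs) => [|z].
  by apply: (le t (fun y => Normc.normc (f x y))) => // z; exact: normc_ge0.
by apply: sumr_ge0 => ? _; exact: normc_ge0.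
Qed.

(** * Elimination of the interior of the cells *)

Section CellAlgebra.
Context {R : realType} {V : choiceType} (adj : rel V) (F : set V).
Context (hgraph : infinite_connected_graph adj).
Context (hsim : symmetrically_self_similar adj F) (hgeom : bounded_geometry adj F).
Context (C : set V) (v w : V) (hC : cells adj F C).
Context (hv : bdry adj C v) (hw : bdry adj C w) (hvw : v <> w).
Local Notation Cx := (cplx R).
Local Notation normc := (@Normc.normc R).
Local Notation nb := (nb adj).
Local Notation bd := (bd adj).
Local Notation deg := (degree adj).
Implicit Types (D : set V) (u f : V -> Cx) (lam : Cx).

Definition lapl lam u x : Cx := lam * u x - P_op adj u x.

(** The characteristic polynomial of the walk killed on leaving [C]; its zeros are the Dirichlet
    eigenvalues of the cell. *)
Definition cell_poly : {poly Cx} := kernel_poly v (cl C) (step R adj).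
Definition cell_adj (y x : V) : {poly Cx} := kernel_adj v (cl C) (step R adj) y x.
(** Divided by [cell_poly], this is the Poisson kernel: the value at [y] of the solution with
    boundary value 1 at [b] and 0 at the other boundary vertices. *)
Definition cell_bdr (y b : V) : {poly Cx} :=
  \sum_(x <- cl C | adj x b) ((deg x)%:R^-1)%:P * cell_adj y x.
Definition flux_src (a x : V) : {poly Cx} := \sum_(y <- nb a | `[< C y >]) cell_adj y x.
(** An entry of the Dirichlet-to-Neumann map of the cell, multiplied by [cell_poly]. *)
Definition flux_bdr (a b : V) : {poly Cx} := \sum_(y <- nb a | `[< C y >]) cell_bdr y b.

Local Notation chi := cell_poly.
Local Notation lfin := (adj_lfin hgraph).

Lemma laplE lam u x : lapl lam u x = lam * u x - (deg x)%:R^-1 * \sum_(y <- nb x) u y.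
Proof. by rewrite /lapl (P_opE lfin). Qed.

Lemma sum_nb_cell (K : nmodType) D x (f : V -> K) : cells adj F D -> D x ->
  \sum_(y <- nb x) f y = \sum_(z <- cl D | adj x z) f z + \sum_(b <- bd D | adj x b) f b.
Proof.
move=> cD Dx; rewrite (bigID (fun y => `[< D y >])) /=; congr (_ + _).
  rewrite -[LHS]big_filter -[RHS]big_filter; apply/perm_big/uniq_perm.
  - by rewrite filter_uniq ?fset_uniq.
  - by rewrite filter_uniq ?fset_uniq.
  move=> y; rewrite !mem_filter (mem_nb hgraph); apply/andP/andP => [[/asboolP Dy xy]|[xy /(mem_cl hsim _ cD) Dy]].
    by split=> //; apply/(mem_cl hsim _ cD).
  by split=> //; apply/asboolP.
rewrite -[LHS]big_filter -[RHS]big_filter; apply/perm_big/uniq_perm.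
- by rewrite filter_uniq ?fset_uniq.
- by rewrite filter_uniq ?fset_uniq.
move=> y; rewrite !mem_filter (mem_nb hgraph); apply/andP/andP => [[/asboolP Dy xy]|[xy /(mem_bd hgeom _ cD) Dy]].
  split=> //; apply/(mem_bd hgeom _ cD).
  by have [] := cell_nb cD Dx xy.
by split=> //; apply/asboolP; case: Dy.
Qed.

Lemma lapl_kernel lam u x : C x ->
  kernel_lapl (cl C) (step R adj) lam u x = lapl lam u x + (deg x)%:R^-1 * \sum_(b <- bd C | adj x b) u b.
Proof.
move=> Cx_; rewrite /kernel_lapl laplE (sum_nb_cell _ hC Cx_) mulrDr opprD addrA subrK.
congr (_ - _); rewrite mulr_sumr [RHS]big_mkcond /=; apply: eq_bigr => z _.
by rewrite /step; case: (adj x z); rewrite ?mul0r.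
Qed.

(** Cramer's rule in [C], with the boundary values acting as a further right-hand side. *)
Lemma cell_value lam u y : C y -> chi.[lam] * u y =
  \sum_(x <- cl C) (cell_adj y x).[lam] * lapl lam u x +
  \sum_(b <- bd C) (cell_bdr y b).[lam] * u b.
Proof.
move=> Cy; rewrite (kernel_cramer _ _ (fset_uniq _)); last exact/(mem_cl hsim _ hC).
rewrite (eq_big_seq (fun x => (cell_adj y x).[lam] * lapl lam u x +
   \sum_(b <- bd C) if adj x b then ((deg x)%:R^-1 * (cell_adj y x).[lam]) * u b else 0)); last first.
  move=> x /(mem_cl hsim _ hC) Cx_; rewrite lapl_kernel // mulrDr; congr (_ + _).
  rewrite -big_mkcond /= mulrA mulr_sumr; apply: eq_bigr => b _.
  by rewrite [(deg x)%:R^-1 * _]mulrC.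
rewrite big_split /=; congr (_ + _); rewrite exchange_big /=; apply: eq_bigr => b _.
rewrite -big_mkcond /= /cell_bdr horner_sum mulr_suml; apply: eq_bigr => x _.
by rewrite hornerM hornerC.
Qed.

Lemma cell_flux lam u a : chi.[lam] * flux adj C a u =
  \sum_(x <- cl C) (flux_src a x).[lam] * lapl lam u x +
  \sum_(b <- bd C) (flux_bdr a b).[lam] * u b.
Proof.
rewrite /flux mulr_sumr (eq_bigr (fun y => \sum_(x <- cl C) (cell_adj y x).[lam] * lapl lam u x +
  \sum_(b <- bd C) (cell_bdr y b).[lam] * u b)); last first.
  by move=> y /asboolP /cell_value ->.
rewrite big_split /=; congr (_ + _); rewrite exchange_big /=; apply: eq_bigr => x _.
  by rewrite /flux_src horner_sum mulr_suml.
by rewrite /flux_bdr horner_sum mulr_suml.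
Qed.

Section Transport.
Context (D : set V) (phi : V -> V) (cD : cells adj F D) (hphi : cell_iso adj C D phi).

Lemma iso_deg x : C x -> deg (phi x) = deg x.
Proof.
move=> Cx_; rewrite !(degreeE _) !cardfE /= -!cardfE.
rewrite (perm_size (iso_nb hgraph hC cD hphi Cx_) : size (enum_fset _) = _).
by rewrite size_map.
Qed.

Lemma lapl_iso lam f x : C x -> lapl lam (f \o phi) x = lapl lam f (phi x).
Proof.
move=> Cx_; rewrite !laplE /= iso_deg //; congr (_ - _ * _).
by rewrite (perm_big _ (iso_nb hgraph hC cD hphi Cx_)) big_map.
Qed.

Lemma flux_iso (K : nmodType) (f : V -> K) a : bdry adj C a ->
  flux adj D (phi a) f = flux adj C a (f \o phi).
Proof.
move=> Ca; rewrite /flux -big_filter.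
rewrite (perm_big _ (iso_flux hgraph hphi Ca)) big_map big_filter //.
Qed.

Lemma sum_bd_iso (K : nmodType) (f : V -> K) :
  \sum_(b <- bd D) f b = \sum_(b <- bd C) f (phi b).
Proof. by rewrite (perm_big _ (iso_bd hgeom hC cD hphi)) big_map. Qed.

Lemma sum_cl_iso (K : nmodType) (f : V -> K) :
  \sum_(b <- cl D) f b = \sum_(b <- cl C) f (phi b).
Proof. by rewrite (perm_big _ (iso_cl hsim hC cD hphi)) big_map. Qed.

(** The Dirichlet problem is solved in the reference cell [C], where [chi] is the determinant, and
    carried to [D] by [phi]. *)
Lemma cell_solve lam f : chi.[lam] != 0 ->
  exists u, (forall x, ~ D x -> u x = f x) /\ forall x, D x -> lapl lam u x = 0.
Proof.
move=> c0.
have [k hk] : exists k, forall z, D z -> C (k z) /\ phi (k z) = z.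
  have /choice [k hk] : forall z, exists x, D z -> C x /\ phi x = z.
    move=> z; have [Dz|nD] := pselect (D z); last by exists z.
    by have [x Cx_ xz] := iso_cell_surj hphi Dz; exists x.
  by exists k.
have [u0 [u0z hu0]] := kernel_solve (x0 := v) (fset_uniq (cl C))
  (fun x => (deg x)%:R^-1 * \sum_(b <- bd C | adj x b) f (phi b)) c0.
pose u1 x := if `[< C x >] then u0 x else f (phi x).
pose u z := if `[< D z >] then u0 (k z) else f z.
have uphi x : gclosure adj C x -> u (phi x) = u1 x.
  move=> Cx_; rewrite /u /u1; case: asboolP => [Dx|nDx]; case: asboolP => [xC|nxC] //.
  - have [h1 h2] := hk _ Dx; congr u0; apply: (iso_inj hphi) => //; by left.
  - by case: Cx_ => // /(iso_bdry hphi) [].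
  - by have := iso_cell hphi xC.
exists u; split=> [x nD|x Dx]; first by rewrite /u asboolF.
have [Ck <-] := hk _ Dx; move: (k x) Ck => y Cy {x Dx}.
rewrite -lapl_iso //.
have -> : lapl lam (u \o phi) y = lapl lam u1 y.
  rewrite !laplE /= uphi; last by left.
  congr (_ - _ * _); apply: eq_big_seq => z; rewrite (mem_nb hgraph) => yz.
  by apply: uphi; exact: (cell_nb_closure hC Cy yz).
have e1 : kernel_lapl (cl C) (step R adj) lam u1 y = kernel_lapl (cl C) (step R adj) lam u0 y.
  rewrite /kernel_lapl /u1 asboolT //; congr (_ - _); apply: eq_big_seq => z /(mem_cl hsim _ hC) Cz.
  by rewrite asboolT.
have := lapl_kernel lam u1 Cy; rewrite e1 hu0; last exact/(mem_cl hsim _ hC).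
have -> : \sum_(b <- bd C | adj y b) u1 b = \sum_(b <- bd C | adj y b) f (phi b).
  rewrite big_seq_cond [RHS]big_seq_cond; apply: eq_bigr => b /andP[/(mem_bd hgeom _ hC) [nb_ _] _].
  by rewrite /u1 asboolF.
by move/eqP; rewrite -[X in X == _]add0r (inj_eq (addIr _)) => /eqP <-.
Qed.

End Transport.

Lemma cell_singular lam : chi.[lam] = 0 ->
  exists u, [/\ forall y, ~ C y -> u y = 0, exists y, u y != 0 & forall x, C x -> lapl lam u x = 0].
Proof.
move=> /(kernel_singular (fset_uniq (cl C))) [u [uz unz hu]]; exists u; split=> //.
  by move=> y nC; apply: uz; apply/negP => /(mem_cl hsim _ hC).
move=> x Cx_; have := lapl_kernel lam u Cx_; rewrite hu; last exact/(mem_cl hsim _ hC).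
rewrite big_seq_cond big1 ?mulr0 ?addr0 // => b /andP[/(mem_bd hgeom _ hC) [nC _] _].
by apply: uz; apply/negP => /(mem_cl hsim _ hC).
Qed.

Lemma cell_poly_neq0 : chi != 0.
Proof. by rewrite -size_poly_gt0 size_kernel_poly. Qed.

(** Let [u] be the solution with boundary value 1 at [g b] only; then [u \o g] is the one with value
    1 at [b], and the fluxes at [g a] and [a] coincide. This settles all [lam] with [chi.[lam] !=
    0], hence the polynomials. *)
Lemma flux_bdr_aut g a b : cell_iso adj C C g -> bdry adj C a -> bdry adj C b ->
  flux_bdr (g a) (g b) = flux_bdr a b.
Proof.
move=> hg Ca Cb; apply: (poly_eq_off_zeros cell_poly_neq0) => lam c0.
have [u [uf hu]] := cell_solve hC hg (fun z => if z == g b then 1 else 0) c0.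
have ub z : bdry adj C z -> u z = if z == g b then 1 else 0 by case=> nz _; rewrite uf.
have sumE a' (b' : V) (u' : V -> Cx) : bdry adj C b' -> 
    (forall z, bdry adj C z -> u' z = if z == b' then 1 else 0) ->
    \sum_(z <- bd C) (flux_bdr a' z).[lam] * u' z = (flux_bdr a' b').[lam].
  move=> Cb' hu'; rewrite (eq_big_seq (fun z => if z == b' then (flux_bdr a' z).[lam] else 0)); last first.
    by move=> z /(mem_bd hgeom _ hC) /hu' ->; case: eqP => _; rewrite ?mulr1 ?mulr0.
  rewrite -big_mkcond -big_filter filter_pred1_uniq ?fset_uniq ?big_seq1 //.
  exact/(mem_bd hgeom _ hC).
have h1 := cell_flux lam u (g a); have h2 := cell_flux lam (u \o g) a.
rewrite (flux_iso hg) // h2 in h1.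
rewrite (sumE (g a) (g b) u (iso_bdry hg Cb) ub) in h1.
rewrite (sumE a b) in h1; [|by []|]; last first.
  move=> z Cz /=; rewrite ub; last exact: iso_bdry hg _ Cz.
  case: eqP => [/(iso_inj hg) ->|]; rewrite ?eqxx //; try by right.
  by case: (z =P b) => // ->.
rewrite !big_seq [X in X + _ = _]big1 in h1; last first.
  by move=> x /(mem_cl hsim _ hC) Cx_; rewrite (lapl_iso hC hg) // hu ?mulr0 //; exact: iso_cell hg _ Cx_.
rewrite [X in _ = X + _]big1 ?add0r in h1; last first.
  by move=> x /(mem_cl hsim _ hC) Cx_; rewrite hu ?mulr0.
by [].
Qed.

Definition flux_diag := flux_bdr v v.
Definition flux_off := flux_bdr v w.

Lemma bdry_other a : exists2 b, bdry adj C b & a <> b.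
Proof.
by have [->|/eqP av] := eqVneq a v; [exists w | exists v].
Qed.

Lemma double_transitive a b : bdry adj C a -> bdry adj C b -> a <> b ->
  exists g, [/\ cell_iso adj C C g, g v = a & g w = b].
Proof. by case: hsim => _ _ _ h Ca Cb ab; exact: (h C hC). Qed.

(** Double transitivity leaves one diagonal and one off-diagonal entry, so a flux involves [u a] and
    the plain sum of the other boundary values: the walk on the reduced graph appears. *)
Lemma flux_bdrE a b : bdry adj C a -> bdry adj C b ->
  flux_bdr a b = if b == a then flux_diag else flux_off.
Proof.
move=> Ca Cb; case: eqP => [->|/nesym ab].
  have [c Cc ac] := bdry_other a.
  have [g [hg <- _]] := double_transitive Ca Cc ac.
  by rewrite (flux_bdr_aut hg).
by have [g [hg <- <-]] := double_transitive Ca Cb ab; rewrite (flux_bdr_aut hg).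
Qed.

(* The degree of a boundary vertex inside a cell; by double transitivity it depends
   neither on the vertex nor on the cell. *)
Definition cell_delta : nat := size [seq y <- nb v | `[< C y >]].
Definition cell_theta : nat := #|` bd C|.
Local Notation delta := cell_delta.
Local Notation theta := cell_theta.

Lemma theta_gt1 : (1 < theta)%N.
Proof.
have sub : {subset [:: v; w] <= enum_fset (bd C)}.
  by move=> z; rewrite !inE => /orP[]/eqP ->; exact/(mem_bd hgeom _ hC).
by apply: (uniq_leq_size _ sub) => /=; rewrite inE andbT; apply/eqP.
Qed.

Lemma delta_gt0 : (0 < delta)%N.
Proof.
case: hv => _ [x Cx_ xv]; rewrite /cell_delta -has_predT; apply/hasP; exists x => //.
by rewrite mem_filter (mem_nb hgraph) (adj_sym hgraph) xv asboolT.
Qed.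

Lemma card_bd D : cells adj F D -> #|` bd D| = theta.
Proof.
move=> cD; have [phi hphi] := cells_iso hsim hC cD.
by rewrite /cell_theta !cardfE /= -!cardfE (perm_size (iso_bd hgeom hC cD hphi) : size (enum_fset _) = _) size_map.
Qed.

Lemma card_cl D : cells adj F D -> #|` cl D| = #|` cl C|.
Proof.
move=> cD; have [phi hphi] := cells_iso hsim hC cD.
by rewrite !cardfE /= -!cardfE (perm_size (iso_cl hsim hC cD hphi) : size (enum_fset _) = _) size_map.
Qed.

Lemma flux_size D a : cells adj F D -> bdry adj D a ->
  size [seq y <- nb a | `[< D y >]] = delta.
Proof.
move=> cD Da; have [phi hphi] := cells_iso hsim hC cD.
have [a0 Ca <-] := iso_bdry_surj hphi Da.
rewrite (perm_size (iso_flux hgraph hphi Ca)) size_map.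
have [b Cb ab] := bdry_other a0.
have [g [hg <- _]] := double_transitive Ca Cb ab.
by rewrite (perm_size (iso_flux hgraph hg hv)) size_map.
Qed.

Lemma deg_cells a : F a -> deg a = (size (cells_at adj F a) * delta)%N.
Proof.
move=> Fa; rewrite (degreeE _) -sum1_size.
rewrite (sum_nb_cells hgraph hsim (fun=> 1%N) Fa) /flux.
rewrite (eq_big_seq (fun=> delta)); last first.
  by move=> D /(mem_cells_at hgraph hsim _ Fa) [cD Da]; rewrite -(flux_size cD Da) -sum1_size big_filter.
by rewrite big_const_seq count_predT iter_addn_0 mulnC.
Qed.

(** [err] collects the contribution of [(lam - P) u] inside the cell. [M] serves all cells at once
    because each is a copy of [C]. *)
Lemma cell_flux_err lam : exists2 M : R, 0 <= M &
  forall D a u, cells adj F D -> bdry adj D a -> exists2 err,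
    chi.[lam] * flux adj D a u = flux_diag.[lam] * u a + flux_off.[lam] * \sum_(b <- bd D | b != a) u b + err &
    normc err <= M * \sum_(x <- cl D) normc (lapl lam u x).
Proof.
have [M M0 hM] := finite_bound (bd C) (cl C) (fun a x => (flux_src a x).[lam]).
exists M => // D a u cD Da; have [phi hphi] := cells_iso hsim hC cD.
have [a0 Ca <-] := iso_bdry_surj hphi Da.
exists (\sum_(x <- cl C) (flux_src a0 x).[lam] * lapl lam u (phi x)).
  rewrite (flux_iso hphi) // cell_flux addrC; congr (_ + _); last first.
    by apply: eq_big_seq => x /(mem_cl hsim _ hC) Cx_; rewrite (lapl_iso cD hphi).
  have a0b : a0 \in enum_fset (bd C) by exact/(mem_bd hgeom _ hC).
  rewrite (bigD1_seq a0) ?fset_uniq //= flux_bdrE // eqxx; congr (_ + _).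
  rewrite [X in _ = _ * X]big_mkcond (sum_bd_iso cD hphi) /= mulr_sumr [LHS]big_mkcond /=.
  apply: eq_big_seq => b /(mem_bd hgeom _ hC) Cb.
  have -> : (phi b != phi a0) = (b != a0).
    by congr (~~ _); apply/eqP/eqP => [/(iso_inj hphi) ->|-> //] => //; right.
  by case: ifP => ba; rewrite ?mulr0 // flux_bdrE // (negPf ba).
rewrite (sum_cl_iso cD hphi) mulr_sumr; apply: le_trans (normc_sum _ _ _) _.
rewrite big_seq [X in _ <= X]big_seq; apply: ler_sum => x xC.
rewrite normcM ler_wpM2r ?normc_ge0 // hM //; exact/(mem_bd hgeom _ hC).
Qed.

Lemma cell_value_err lam : exists2 M : R, 0 <= M &
  forall D y u, cells adj F D -> D y ->
    normc (chi.[lam] * u y) <= M * (\sum_(x <- cl D) normc (lapl lam u x) + \sum_(b <- bd D) normc (u b)).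
Proof.
have [M M0 hM] := finite_bound (cl C) (cl C) (fun a x => (cell_adj a x).[lam]).
have [M' M'0 hM'] := finite_bound (cl C) (bd C) (fun a x => (cell_bdr a x).[lam]).
exists (M + M'); first exact: addr_ge0.
move=> D y u cD Dy; have [phi hphi] := cells_iso hsim hC cD.
have [y0 Cy <-] := iso_cell_surj hphi Dy.
have y0C : y0 \in cl C by exact/(mem_cl hsim _ hC).
rewrite -[u _]/((u \o phi) y0) cell_value //; apply: le_trans (normcD _ _) _.
rewrite (sum_cl_iso cD hphi) (sum_bd_iso cD hphi) mulrDr; apply: lerD.
  apply: le_trans (normc_sum _ _ _) _; rewrite mulr_sumr big_seq [X in _ <= X]big_seq.
  apply: ler_sum => x xC; rewrite normcM (lapl_iso cD hphi); last exact/(mem_cl hsim _ hC).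
  by rewrite ler_wpM2r ?normc_ge0 //; apply: le_trans (hM _ _ y0C xC) _; rewrite lerDl.
apply: le_trans (normc_sum _ _ _) _; rewrite mulr_sumr big_seq [X in _ <= X]big_seq.
apply: ler_sum => x xC; rewrite normcM.
by rewrite ler_wpM2r ?normc_ge0 //; apply: le_trans (hM' _ _ y0C xC) _; rewrite lerDr.
Qed.

Section Renormalization.
Context (psi : V -> V) (hpsi : set_bij setT F psi).
Context (hpsi_adj : forall x y, adj x y <-> reduced_adj adj F (psi x) (psi y)).

(* Multiples by [cell_poly] of the [A] and [B] with [A - B P] the Schur complement of
   [lam - P] on [F]. *)
Definition num_poly : {poly Cx} := chi * 'X - (delta%:R^-1)%:P * flux_diag.
Definition den_poly : {poly Cx} := (theta.-1%:R / delta%:R)%:P * flux_off.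

Lemma deg_psi_cells y : deg y = (size (cells_at adj F (psi y)) * theta.-1)%N.
Proof.
rewrite (degreeE _) -sum1_size (sum_nb_psi hgraph hsim hgeom hpsi hpsi_adj y (fun=> 1%N)).
rewrite (eq_big_seq (fun=> theta.-1)); last first.
  move=> D /(mem_cells_at hgraph hsim _ (psi_F hpsi y)) [cD Da].
  rewrite -(card_bd cD) -sum1_size [in RHS](bigD1_seq (psi y)) ?fset_uniq //=.
  exact/(mem_bd hgeom _ cD).
by rewrite big_const_seq count_predT iter_addn_0 mulnC.
Qed.

(** Each cell at [psi y] contributes [delta] neighbours of [psi y] and [theta - 1] neighbours of
    [y], so [psi] multiplies degrees by a constant. *)
Lemma deg_psi y : (deg (psi y) * theta.-1 = deg y * delta)%N.
Proof. by rewrite [deg y]deg_psi_cells (deg_cells (psi_F hpsi y)) mulnAC. Qed.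

(** Summing [cell_flux_err] over the cells at [psi y], the off-diagonal parts form the neighbour sum
    of [u \o psi] at [y]; the number of cells cancels because both degrees are proportional to
    it. *)
Lemma renorm_err lam : exists2 M : R, 0 <= M & forall u y, exists2 err,
  chi.[lam] * lapl lam u (psi y) =
    num_poly.[lam] * u (psi y) - den_poly.[lam] * P_op adj (u \o psi) y + err &
  normc err <= M * \sum_(D <- cells_at adj F (psi y)) \sum_(x <- cl D) normc (lapl lam u x).
Proof.
have [M M0 hM] := cell_flux_err lam; exists M => // u y.
set a := psi y; have Fa : F a by exact: (psi_F hpsi).
have /choice [err herr] : forall D, exists e, D \in cells_at adj F a ->
   chi.[lam] * flux adj D a u = flux_diag.[lam] * u a + flux_off.[lam] * \sum_(b <- bd D | b != a) u b + e /\
    normc e <= M * \sum_(x <- cl D) normc (lapl lam u x).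
  move=> D; have [h|h] := boolP (D \in cells_at adj F a); last by exists 0.
  have [cD Da] := mem_cells_at hgraph hsim _ Fa h.
  by have [e h1 h2] := hM D a u cD Da; exists e.
have d0 : (deg a)%:R != 0 :> Cx by rewrite pnatr_eq0 -lt0n (degree_gt0 hgraph).
have n0 : (size (cells_at adj F a))%:R != 0 :> Cx.
  by apply: contraNneq d0; rewrite deg_cells // natrM => ->; rewrite mul0r.
have de0 : (delta%:R : Cx) != 0 by rewrite pnatr_eq0 -lt0n delta_gt0.
exists (- (deg a)%:R^-1 * \sum_(D <- cells_at adj F a) err D).
  have e1 : chi.[lam] * \sum_(y <- nb a) u y = (flux_diag.[lam] * u a) *+ size (cells_at adj F a) +
      flux_off.[lam] * \sum_(z <- nb y) u (psi z) + \sum_(D <- cells_at adj F a) err D.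
    rewrite (sum_nb_cells hgraph hsim u Fa) mulr_sumr.
    rewrite (eq_big_seq _ (fun D hD => (herr D hD).1)) !big_split /=.
    rewrite (sum_nb_psi hgraph hsim hgeom hpsi hpsi_adj y u) -mulr_sumr.
    by rewrite -[\sum_(_ <- _) flux_off.[lam] * _]mulr_sumr big_const_seq count_predT iter_addr_0 mulrnAr.
  have -> : chi.[lam] * lapl lam u a = chi.[lam] * lam * u a -
     (deg a)%:R^-1 * (chi.[lam] * \sum_(y <- nb a) u y) by rewrite laplE; ring.
  rewrite e1 (P_opE lfin) /= [deg y]deg_psi_cells -/a deg_cells // /num_poly /den_poly.
  rewrite !(hornerD, hornerN, hornerM, hornerC, hornerX) !natrM -mulr_natl.
  have t0 : (theta.-1%:R : Cx) != 0 by rewrite pnatr_eq0 -lt0n -subn1 subn_gt0 theta_gt1.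
  by field; rewrite n0 t0 de0.
rewrite normcM normcN normcV normc_nat mulr_sumr.
apply: (@le_trans _ _ (normc (\sum_(D <- cells_at adj F a) err D))).
  rewrite ler_piMl ?normc_ge0 // invf_le1 ?ler1n ?ltr0n (degree_gt0 hgraph) //.
apply: le_trans (normc_sum _ _ _) _; rewrite big_seq [X in _ <= X]big_seq.
by apply: ler_sum => D hD; exact: (herr D hD).2.
Qed.

(** The Dirichlet problems of different cells are independent: the neighbours of a vertex off [F]
    lie in its own cell or in [F]. *)
Lemma harmonic_extension lam f : chi.[lam] != 0 -> exists u,
  (forall y, u (psi y) = f y) /\ forall x, ~ F x -> lapl lam u x = 0.
Proof.
move=> c0.
have /choice [k hk] : forall a, exists x, F a -> psi x = a.
  move=> a; have [Fa|nF] := pselect (F a); last by exists a.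
  by have [x <-] := psi_surj hpsi Fa; exists x.
have kK y : k (psi y) = y by apply: (psi_inj hpsi); rewrite hk //; exact: (psi_F hpsi).
pose f' := f \o k.
have /choice [U hU] : forall D : set V, exists u, cells adj F D -> 
    (forall x, ~ D x -> u x = f' x) /\ forall x, D x -> lapl lam u x = 0.
  move=> D; have [cD|nc] := pselect (cells adj F D); last by exists f.
  have [phi hphi] := cells_iso hsim hC cD.
  by have [u hu] := cell_solve cD hphi f' c0; exists u.
exists (fun x => if `[< F x >] then f' x else U (cell_of adj F x) x); split=> [y|x Fx].
  by rewrite asboolT /f' /= ?kK //; exact: (psi_F hpsi).
have [cx xx] := cell_ofP adj Fx; have [h1 h2] := hU _ cx.
rewrite -(h2 x xx) !laplE asboolF //; congr (_ - _ * _); apply: eq_big_seq => z.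
rewrite (mem_nb hgraph) => xz; case: asboolP => Fz.
  by rewrite h1 // => /(cell_outside cx).
by have -> : cell_of adj F z = cell_of adj F x by rewrite (cell_eq hgraph cx (cell_step hgraph cx xx xz Fz)).
Qed.

End Renormalization.
End CellAlgebra.

(** * Balls and a Schur test *)

Section Balls.
Context {R : realType} {V : choiceType} (adj : rel V).
Context (hgraph : infinite_connected_graph adj).
Local Notation Cx := (cplx R).
Local Notation normc := (@Normc.normc R).
Local Notation nb := (nb adj).

Fixpoint nears k (x : V) : seq V :=
  if k is k'.+1 then x :: flatten [seq nears k' y | y <- nb x] else [:: x].

Lemma nears_refl k x : x \in nears k x.
Proof. by case: k => [|k]; rewrite inE eqxx. Qed.

Lemma nearsS k x y : reflect (y = x \/ exists2 z, adj x z & y \in nears k z) (y \in nears k.+1 x).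
Proof.
rewrite inE; apply: (iffP orP) => [[/eqP|/flattenP [_ /mapP [z xz ->]]]|[/eqP|[z xz h]]]; [by left| |by left|].
  by move=> h; right; exists z => //; rewrite (mem_nb hgraph) in xz.
right; apply/flattenP; exists (nears k z) => //; apply: map_f.
by rewrite (mem_nb hgraph).
Qed.

Lemma nears_succ k x y : y \in nears k x -> y \in nears k.+1 x.
Proof.
elim: k x => [|k IH] x; first by rewrite inE => /eqP ->; exact: nears_refl.
move=> /nearsS [->|[z xz /IH h]]; first exact: nears_refl.
by apply/nearsS; right; exists z.
Qed.

Lemma nears_trans j k x y z : y \in nears j x -> z \in nears k y -> z \in nears (j + k) x.
Proof.
elim: j x => [|j IH] x; first by rewrite inE => /eqP ->.
move=> /nearsS [->|[t xt yt]] zy.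
  by elim: (j.+1) => [//|m h]; rewrite addSn; exact: nears_succ.
by rewrite addSn; apply/nearsS; right; exists t => //; exact: IH.
Qed.

Lemma nears_adj x y : adj x y -> y \in nears 1 x.
Proof. by move=> xy; apply/nearsS; right; exists y; rewrite ?nears_refl. Qed.

Lemma nears_le j k x y : (j <= k)%N -> y \in nears j x -> y \in nears k x.
Proof. by move=> jk yx; rewrite -(subnKC jk); apply: nears_trans yx _; exact: nears_refl. Qed.

Lemma nears_sym k x y : (y \in nears k x) = (x \in nears k y).
Proof.
have imp z t : t \in nears k z -> z \in nears k t; last by apply/idP/idP; exact: imp.
elim: k z => [|k IH] z; first by rewrite !inE eq_sym.
move=> /nearsS [->|[s zs /IH h]]; first exact: nears_refl.
by rewrite -addn1; apply: nears_trans h _; apply: nears_adj; rewrite (adj_sym hgraph).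
Qed.

Lemma nears_last k x y : y \in nears k.+1 x ->
  y \in nears k x \/ exists2 z, z \in nears k x & adj z y.
Proof.
rewrite nears_sym => /nearsS [->|[z yz h]]; first by left; exact: nears_refl.
by right; exists z; rewrite 1?nears_sym // (adj_sym hgraph).
Qed.

Lemma nears_path x p : path adj x p -> last x p \in nears (size p) x.
Proof.
elim: p x => [|y p IH] x /=; first by rewrite inE.
by case/andP => xy /IH h; apply/nearsS; right; exists y.
Qed.

Lemma nears_conn x y : exists k, y \in nears k x.
Proof.
have [p [hp <- _]] := adj_conn hgraph x y; exists (size p); exact: nears_path.
Qed.

Lemma nears_size N k : (forall x, (degree adj x <= N)%N) ->
  exists B, forall x, (size (nears k x) <= B)%N.
Proof.
move=> hN; elim: k => [|k [B hB]]; first by exists 1%N.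
exists (N * B).+1 => x /=; rewrite ltnS size_flatten /shape -map_comp.
apply: (@leq_trans (\sum_(y <- nb x) B)%N).
  by rewrite sumnE big_map; apply: leq_sum => y _; exact: hB.
by rewrite big_const_seq count_predT iter_addn_0 mulnC leq_mul2r -degreeE hN orbT.
Qed.

Definition nball k x := undup (nears k x).

Lemma mem_nball k x y : (y \in nball k x) = (y \in nears k x).
Proof. exact: mem_undup. Qed.

Lemma ball_sum_le k x (s : seq V) (g : V -> R) : uniq s -> {subset s <= nears k x} ->
  (forall y, 0 <= g y) -> \sum_(y <- s) g y <= \sum_(y <- nball k x) g y.
Proof.
move=> us sub g0; rewrite [leRHS](bigID (mem s)) /= -[leLHS]addr0; apply: lerD; last exact: sumr_ge0.
rewrite -[leRHS]big_filter le_eqVlt; apply/orP; left; apply/eqP/perm_big/uniq_perm => //.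
  by rewrite filter_uniq ?undup_uniq.
by move=> y; rewrite mem_filter mem_nball /=; case: (boolP (y \in s)) => // /sub ->.
Qed.

(** Schur test for finite range: a ball of radius [k] has at most [B] vertices and a vertex lies in
    at most [B] such balls, hence [B ^ 2]; [N] compares the degree weight with counting. *)
Lemma schur k (N : nat) : (forall x, (degree adj x <= N)%N) -> exists2 K : R, 0 <= K &
  forall (M : R) (f g : V -> Cx), ell2 adj g -> 0 <= M ->
    (forall x, normc (f x) <= M * \sum_(y <- nball k x) normc (g y)) ->
    ell2 adj f /\ sqn adj f <= K * M ^+ 2 * sqn adj g.
Proof.
move=> hN; have [B hB] := nears_size k hN.
exists (N%:R * B%:R ^+ 2); first by rewrite mulr_ge0 ?sqr_ge0.
move=> M f g hg M0 fg; apply: sqn_ub => s us.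
pose t := undup (flatten [seq nball k x | x <- s]).
have gt : \sum_(y <- t) normc (g y) ^+ 2 <= sqn adj g.
  apply: le_trans (sqn_lb (mkl2 hg) (undup_uniq _ : uniq t)); apply: ler_sum => y _.
  by rewrite /dens ler_peMl ?sqr_ge0 // ler1n (degree_gt0 hgraph).
have hx x : dens adj f x <= N%:R * (M ^+ 2 * (B%:R * \sum_(y <- nball k x) normc (g y) ^+ 2)).
  rewrite /dens; apply: ler_pM; rewrite ?ler0n ?sqr_ge0 ?ler_nat //.
  apply: (@le_trans _ _ ((M * \sum_(y <- nball k x) normc (g y)) ^+ 2)).
    rewrite ler_sqr ?nnegrE ?normc_ge0 // mulr_ge0 // sumr_ge0 // => y _; exact: normc_ge0.
  rewrite exprMn ler_wpM2l ?sqr_ge0 //; apply: le_trans (sum_sqr_le _ _) _.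
  rewrite ler_wpM2r ?sumr_ge0 // => [y _|]; first exact: sqr_ge0.
  by rewrite ler_nat (leq_trans (size_undup _)).
apply: le_trans (ler_sum _ (fun x _ => hx x)) _.
rewrite -!mulr_sumr.
have -> : \sum_(x <- s) \sum_(y <- nball k x) normc (g y) ^+ 2 =
    \sum_(x <- s) \sum_(y <- t) (if y \in nears k x then normc (g y) ^+ 2 else 0).
  apply: eq_big_seq => x xs; rewrite -big_mkcond /= -[RHS]big_filter.
  apply/perm_big/uniq_perm; rewrite ?undup_uniq ?filter_uniq ?undup_uniq // => y.
  rewrite mem_filter mem_undup -mem_nball; apply/idP/andP => [h|[] //]; split=> //.
  by rewrite mem_undup; apply/flattenP; exists (nball k x) => //; exact: map_f.
rewrite exchange_big /=.
have le2 : \sum_(y <- t) \sum_(x <- s) (if y \in nears k x then normc (g y) ^+ 2 else 0) <=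
    B%:R * \sum_(y <- t) normc (g y) ^+ 2.
  rewrite mulr_sumr; apply: ler_sum => y _.
  rewrite -big_mkcond /= -big_filter big_const_seq count_predT iter_addr_0 -[leLHS]mulr_natl.
  rewrite ler_wpM2r ?sqr_ge0 // ler_nat; apply: leq_trans (hB y).
  apply: uniq_leq_size; first by rewrite filter_uniq.
  by move=> x; rewrite mem_filter nears_sym => /andP[].
have b0 : 0 <= B%:R :> R by [].
have n0 : 0 <= N%:R :> R by [].
have m0 := sqr_ge0 M.
rewrite (_ : N%:R * B%:R ^+ 2 * M ^+ 2 * sqn adj g = N%:R * (M ^+ 2 * (B%:R * (B%:R * sqn adj g)))); last by ring.
apply: ler_wpM2l => //; apply: ler_wpM2l => //; apply: ler_wpM2l => //.
by apply: le_trans le2 _; apply: ler_wpM2l.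
Qed.

End Balls.

(** * Polynomials, the sphere and power series *)

Lemma frac_repr (T : idomainType) (f : {fraction T}) :
  f * FracField.tofrac (generic_quotient.repr f : {ratio T}).2 =
  FracField.tofrac (generic_quotient.repr f : {ratio T}).1.
Proof.
set x := generic_quotient.repr f.
have d0 : x.2 != 0 by exact: denom_ratioP.
rewrite -[f]generic_quotient.reprK -/x !generic_quotient.piE.
apply/eqP; rewrite generic_quotient.piE /= FracField.equivfE /FracField.mulf.
rewrite !numden_Ratio ?mulr1 ?oner_neq0 ?mulf_neq0 ?oner_neq0 //.
by rewrite mulrC.
Qed.

Lemma frac_numden (T : idomainType) (f : {fraction T}) :
  exists n d : T, d != 0 /\ f * FracField.tofrac d = FracField.tofrac n.
Proof.
exists (generic_quotient.repr f : {ratio T}).1, (generic_quotient.repr f : {ratio T}).2.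
by split; [exact: denom_ratioP | exact: frac_repr].
Qed.

Lemma poly_bound (R : realType) (p : {poly cplx R}) (rho : R) :
  exists2 M : R, 0 <= M & forall z, Normc.normc z <= rho -> Normc.normc p.[z] <= M.
Proof.
elim/poly_ind: p => [|p c [M M0 hM]].
  by exists 0 => // z _; rewrite horner0 Normc.normc0.
exists (M * `|rho| + Normc.normc c); first by rewrite addr_ge0 ?mulr_ge0 ?normc_ge0.
move=> z zr; rewrite hornerMXaddC; apply: le_trans (normcD _ _) _; rewrite lerD2r normcM.
apply: ler_pM; rewrite ?normc_ge0 ?hM //; exact: le_trans zr (ler_norm _).
Qed.

Lemma poly_eq0_inj (R : realType) (p : {poly cplx R}) (f : nat -> cplx R) :
  injective f -> (forall n, p.[f n] = 0) -> p = 0.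
Proof.
move=> fi h; apply/eqP/negPn/negP => p0.
pose rs := [seq f i | i <- iota 0 (size p)].
suff : (size rs < size p)%N by rewrite size_map size_iota ltnn.
apply: (max_poly_roots p0).
  by apply/allP => _ /mapP [i _ ->]; rewrite rootE h.
by rewrite map_inj_uniq ?iota_uniq.
Qed.

Section PolyKernel.
Context (T : idomainType).
Local Notation "x %:F" := (@FracField.tofrac T x).

(** A kernel vector over the fraction field exists by rank; clearing its denominators keeps it
    nonzero. *)
Lemma poly_left_kernel r n (M : 'M[T]_(r, n)) : (n < r)%N ->
  exists2 p : 'rV[T]_r, p != 0 & p *m M = 0.
Proof.
move=> nr; pose Mf := map_mx (@FracField.tofrac T) M.
have k0 : kermx Mf != 0.
  by rewrite kermx_eq0 /row_free neq_ltn (leq_ltn_trans (rank_leq_col _) nr).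
pose u := nz_row (kermx Mf).
have u0 : u != 0 by rewrite nz_row_eq0.
have uM : u *m Mf = 0 by apply/sub_kermxP; exact: nz_row_sub.
have /choice [nd hnd] : forall j, exists q : T * T, q.2 != 0 /\ u 0 j * q.2%:F = q.1%:F.
  by move=> j; have [a [b hb]] := frac_numden (u 0 j); exists (a, b).
pose D := \prod_j (nd j).2.
pose p : 'rV_r := \row_j ((nd j).1 * \prod_(i | i != j) (nd i).2).
have pE j : (p 0 j)%:F = D%:F * u 0 j.
  rewrite [p 0 j]mxE.
  have -> : D%:F = (nd j).2%:F * (\prod_(i | i != j) (nd i).2)%:F.
    by rewrite /D (bigD1 j) //=; exact: tofracM.
  apply: (etrans (tofracM _ _)); rewrite -(hnd j).2; ring.
have D0 : D%:F != 0.
  rewrite tofrac_eq0; apply/prodf_neq0 => j _; exact: (hnd j).1.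
exists p.
  apply: contra_neq u0 => p0; apply/matrixP => i j; rewrite ord1 mxE.
  by apply: (mulfI D0); rewrite -pE p0 mxE rmorph0 mulr0.
apply/matrixP => i j; rewrite ord1 !mxE; apply/eqP; rewrite -tofrac_eq0 rmorph_sum /=.
have /matrixP/(_ 0 j) := uM; rewrite !mxE => e.
rewrite (eq_bigr (fun k => D%:F * (u 0 k * Mf k j))); first by rewrite -mulr_sumr e mulr0.
by move=> k _; rewrite tofracM pE !mxE mulrA.
Qed.

End PolyKernel.

Lemma geometric_small (R : realType) (q K e : R) : 0 <= q -> q < 1 -> 0 <= K -> 0 < e ->
  exists M, forall m, (M <= m)%N -> K * q ^+ m <= e.
Proof.
move=> q0 q1 K0 e0; have K1 : 0 < K + 1 by rewrite ltr_wpDl.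
have q1' : `|q| < 1 by rewrite ger0_norm.
have /cvgrPdist_lt h := cvg_expr q1'.
have [M _ hM] := h (e / (K + 1)) (divr_gt0 e0 K1).
exists M => m /hM /=; rewrite sub0r normrN ger0_norm ?exprn_ge0 // => /ltW h1.
apply: (@le_trans _ _ ((K + 1) * q ^+ m)); first by rewrite ler_wpM2r ?exprn_ge0 // lerDl.
by rewrite mulrC -ler_pdivlMr.
Qed.

(** [z ^ k p (1 / z)]: passes between the coordinates [z] and [lam = 1 / z]. *)
Definition revp (R : realType) (k : nat) (p : {poly cplx R}) : {poly cplx R} :=
  \poly_(i < k.+1) p`_(k - i).

Lemma horner_revp (R : realType) k (p : {poly cplx R}) z : (size p <= k.+1)%N -> z != 0 ->
  (revp k p).[z] = z ^+ k * p.[z^-1].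
Proof.
move=> sp z0; rewrite horner_poly (horner_coef_wide _ sp) mulr_sumr.
rewrite (reindex_inj rev_ord_inj) /=; apply: eq_bigr => i _.
have ik : (i <= k)%N by rewrite -ltnS.
rewrite subSS subKn // mulrCA; congr (_ * _).
rewrite exprVn; move: (nat_of_ord i) ik => m mk.
by rewrite -[in RHS](subnK mk) exprD mulfK // expf_neq0.
Qed.

Lemma revp0 (R : realType) k (p : {poly cplx R}) : (revp k p).[0] = p`_k.
Proof. by rewrite horner_coef0 coef_poly subn0. Qed.

(** * Neighbourhoods in the plane and on the sphere *)

Section PlaneTopology.
Context {R : realType}.
Local Notation Cx := (cplx R).
Local Notation normc := (@Normc.normc R).

Lemma cnbhsP (z : Cx) (A : set Cx) :
  nbhs z A <-> exists2 r : R, 0 < r & forall y, normc (y - z) < r -> A y.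
Proof.
split=> [/nbhs_ballP [e e0 hA]|[r r0 hA]].
  case: e e0 hA => a b; rewrite /= ltcE /= => /andP[/eqP b0 a0] hA.
  exists a => // y yz; apply: hA; rewrite -ball_normE /= normc_normr ltcE /= b0 eqxx /=.
  by rewrite normcBC.
apply/nbhs_ballP; exists (r%:C%C); first by rewrite /= ltcE /= eqxx.
by move=> y; rewrite -ball_normE /= normc_normr ltcR normcBC; exact: hA.
Qed.

Lemma ccvgP (s : nat -> Cx) (l : Cx) : (s @ \oo --> l) <->
  forall e : R, 0 < e -> exists N, forall n, (N <= n)%N -> normc (s n - l) < e.
Proof.
split=> [h e e0|h A /cnbhsP [r r0 hA]].
  have /h [N _ hN] : nbhs l [set y | normc (y - l) < e] by apply/cnbhsP; exists e.
  by exists N.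
by have [N hN] := h r r0; exists N => // n /hN /hA.
Qed.

Lemma compact_normc (K : R) : compact [set z : Cx | normc z <= K].
Proof.
pose f (p : R * R) : Cx := (p.1 +i* p.2)%C.
have cf : continuous f.
  move=> [a b] A /cnbhsP [r r0 hA].
  have r2 : 0 < r / 2 by rewrite divr_gt0.
  exists (ball a (r / 2), ball b (r / 2)); first by split; exact: nbhsx_ballx.
  move=> [a' b'] [/= ha hb]; apply: hA.
  apply: le_lt_trans (normc_le_ReIm _) _; rewrite cReD cImD cReN cImN /=.
  move: ha hb; rewrite -!ball_normE /= !(distrC a) !(distrC b) => ha hb.
  by rewrite (splitr r) ltrD.
have cS : compact (`[- K, K]%classic `*` `[- K, K]%classic : set (R * R)).
  by apply: compact_setX; exact: segment_compact.
have cI : compact (f @` (`[- K, K]%classic `*` `[- K, K]%classic)).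
  by apply: continuous_compact => //; exact: continuous_subspaceT.
apply: (subclosed_compact _ cI).
  rewrite -openC openE => z /= /negP; rewrite -ltNge => zK; apply/cnbhsP.
  exists (normc z - K); first by rewrite subr_gt0.
  move=> y yz /=; apply/negP; rewrite -ltNge.
  have := normcB_ge z (y - z); rewrite subrKC; lra.
move=> z /= zK; exists (complex.Re z, complex.Im z); last by case: z {zK}.
have h1 := ler_Re_normc z; have h2 := ler_Im_normc z.
move: h1 h2; rewrite !ler_norml => /andP[h1 h2] /andP[h3 h4].
by split; rewrite /= in_itv /=; apply/andP; split; lra.
Qed.

(** At infinity, complements of compact sets are compared with discs [|h| < r] through
    [h |-> 1 / h]. *)
Lemma snbhsP (p : sphere R) (W : set (sphere R)) :
  nbhs p W <-> exists2 r : R, 0 < r & forall h, normc h < r -> W (chart p h).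
Proof.
case: p => [z|]; rewrite /nbhs /= /chart.
  split=> [/cnbhsP [r r0 h]|[r r0 h]].
    by exists r => // k kr; apply: h; rewrite addrAC subrr add0r.
  apply/cnbhsP; exists r => // y yr; have := h (y - z) yr; by rewrite subrKC.
split=> [[U [cU _] hU]|[r r0 h]].
  have [M [M0 hM]] : exists M : R, 0 < M /\ forall z, U z -> normc z < M.
    have [N _ hN] : \forall n \near \oo, U `<=` (fun z => normc z < n%:R).
      apply: ((compact_near_coveringP _).1 cU nat \oo (fun n z => normc z < n%:R)) => z Uz.
      pose n0 := (Num.truncn (normc z + 1)).+1.
      exists ([set y | normc (y - z) < 1], [set n | (n0 <= n)%N]).
        by split; [apply/cnbhsP; exists 1 | exists n0].
      move=> [y n] [/= yz n0n]; apply: (@lt_le_trans _ _ n0%:R); last by rewrite ler_nat.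
      apply: (@le_lt_trans _ _ (normc z + 1)).
        by rewrite -[y](subrKC z); apply: le_trans (normcD _ _) _; rewrite lerD2l ltW.
      by apply: truncnS_gt.
    exists N.+1%:R; split=> // z Uz; apply: lt_le_trans (hN N (leqnn N) z Uz) _.
    by rewrite ler_nat.
  exists M^-1; first by rewrite invr_gt0.
  move=> h hM'; apply: hU; rewrite /sphere_inv; have [h0|h0] := eqVneq h 0; first by right.
  left; exists h^-1 => // Uh; have := hM _ Uh; rewrite normcV ltNge => /negP; apply.
  by rewrite -[M]invrK lef_pV2 ?posrE ?invr_gt0 ?normc_gt0 // ltW.
exists [set z | normc z <= r^-1].
  split; first exact: compact_normc.
  rewrite -openC openE => z /= /negP; rewrite -ltNge => zK; apply/cnbhsP.
  exists (normc z - r^-1); first by rewrite subr_gt0.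
  move=> y yz /=; apply/negP; rewrite -ltNge.
  have := normcB_ge z (y - z); rewrite subrKC; lra.
move=> _ [[z /= /negP zr <-]|->]; last first.
  by have := h 0; rewrite Normc.normc0 /sphere_inv eqxx; exact.
rewrite -ltNge in zr; have z0 : z != 0.
  by rewrite -normc_gt0; apply: lt_trans zr; rewrite invr_gt0.
have := h z^-1; rewrite /sphere_inv invr_eq0 (negPf z0) invrK; apply.
by rewrite normcV -[r]invrK ltf_pV2 ?posrE ?invr_gt0 ?normc_gt0.
Qed.

Lemma chart0 p : chart p (0 : Cx) = p.
Proof. by case: p => [z|] /=; rewrite ?addr0 // /sphere_inv eqxx. Qed.

Lemma invc_near (a : Cx) (e : R) : a != 0 -> 0 < e -> exists2 d : R, 0 < d &
  forall b, normc (b - a) < d -> b != 0 /\ normc (b^-1 - a^-1) < e.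
Proof.
move=> a0 e0; have na : 0 < normc a by rewrite normc_gt0.
exists (Num.min (normc a / 2) (e * normc a ^+ 2 / 2)).
  by rewrite lt_min !divr_gt0 // mulr_gt0 // exprn_gt0.
move=> b; rewrite lt_min => /andP[h1 h2].
have nb : normc a / 2 < normc b.
  have := normcB_ge a (b - a); rewrite subrKC; lra.
have b0 : b != 0 by rewrite -normc_gt0; apply: lt_trans nb; rewrite divr_gt0.
split=> //; have nb0 : 0 < normc b by rewrite normc_gt0.
have -> : b^-1 - a^-1 = - (b - a) / (b * a) by field; rewrite a0 b0.
rewrite normcM normcV normcN normcM ltr_pdivrMr ?mulr_gt0 //.
apply: lt_le_trans h2 _; rewrite -mulrA ler_pM2l // expr2.
have -> : normc a * normc a / 2 = (normc a / 2) * normc a by ring.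
by rewrite ler_pM2r // ltW.
Qed.

Lemma chart_cont p (h0 : Cx) (W : set (sphere R)) : nbhs (chart p h0) W ->
  exists2 d : R, 0 < d & forall h, normc (h - h0) < d -> W (chart p h).
Proof.
case: p => [z|] /=.
  move/snbhsP => [r r0 h]; exists r => // k kr; have := h (k - h0) kr.
  by rewrite /= -addrA subrKC.
rewrite {1}/sphere_inv; have [->|h00] := eqVneq h0 0.
  by move/snbhsP => [r r0 h]; exists r => // k; rewrite subr0 => /h.
move/snbhsP => [r r0 h]; have [d d0 hd] := invc_near h00 r0.
exists d => // k /hd [k0 kr]; have := h _ kr; rewrite /= subrKC /sphere_inv (negPf k0).
by [].
Qed.

Lemma connected_clopen (Om E : set (sphere R)) : connected Om ->
  (forall q, Om q -> E q -> nbhs q E) -> (forall q, Om q -> ~ E q -> nbhs q (~` E)) ->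
  (exists2 q, Om q & E q) -> Om `<=` E.
Proof.
move=> cO h1 h2 [q0 Oq0 Eq0].
suff : Om `&` E = Om by move=> e q; rewrite -{1}e => -[].
apply: cO; first by exists q0.
  exists (E^°); first exact: open_interior.
  apply/seteqP; split=> q [Oq Eq]; split=> //; first exact: h1.
  exact: interior_subset Eq.
exists (~` (~` E)^°); first by rewrite closedC; exact: open_interior.
apply/seteqP; split=> q [Oq Eq]; split=> //.
  by move=> /interior_subset; apply.
by apply: contrapT => nE; apply: Eq; exact: h2.
Qed.

Definition convex_set (A : set Cx) : Prop := forall x y (t : R), A x -> A y -> 0 <= t -> t <= 1 ->
  A (x + t%:C%C * (y - x)).

Lemma chart_convex_connected p (A : set Cx) : convex_set A -> connected (chart p @` A).
Proof.
move=> cA; have [[x Ax]|nA] := pselect (exists x, A x); last first.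
  rewrite (_ : _ @` A = set0); first exact: connected0.
  by apply/seteqP; split=> // q [x Ax _]; apply: nA; exists x.
have -> : chart p @` A = \bigcup_(y in A) ((fun t : R => chart p (x + t%:C%C * (y - x))) @` `[0, 1]%classic).
  apply/seteqP; split=> [_ [y Ay <-]|_ [y Ay [t /= ht <-]]].
    exists y => //; exists 1; first by rewrite /= in_itv /= ler01 lexx.
    by rewrite mul1r subrKC.
  by move: ht; rewrite in_itv /= => /andP[t0 t1]; exists (x + t%:C%C * (y - x)) => //; exact: cA.
apply: bigcup_connected.
  exists (chart p x) => y Ay; exists 0; first by rewrite /= in_itv /= ler01 lexx.
  by rewrite mul0r addr0.
move=> y Ay; apply: connected_continuous_connected; first exact: segment_connected.
apply: continuous_subspaceT => t W /= /chart_cont [d d0 hd].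
pose K := normc (y - x) + 1; have K0 : 0 < K by rewrite ltr_wpDl ?normc_ge0.
apply/nbhs_ballP; exists (d / K); first by rewrite /= divr_gt0.
move=> s; rewrite -ball_normE /= => hs; apply: hd.
have -> : x + s%:C%C * (y - x) - (x + t%:C%C * (y - x)) = (s - t)%:C%C * (y - x).
  by rewrite rmorphB /=; ring.
rewrite normcM normc_real distrC; apply: (@le_lt_trans _ _ (`|t - s| * K)).
  by rewrite ler_wpM2l // lerDl.
by rewrite -ltr_pdivlMr.
Qed.

Lemma poly_increment (p : {poly Cx}) z0 : exists2 M : R, 0 <= M &
  forall z, normc (z - z0) <= 1 -> normc (p.[z] - p.[z0]) <= M * normc (z - z0).
Proof.
have : root (p - p.[z0]%:P) z0 by rewrite rootE !hornerE subrr.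
move=> /factor_theorem [q hq]; have [M M0 hM] := poly_bound q (normc z0 + 1).
exists M => // z zz; have := congr1 (fun r : {poly Cx} => r.[z]) hq.
rewrite !hornerE => ->; rewrite normcM ler_wpM2r ?normc_ge0 //; apply: hM.
by rewrite -[z](subrKC z0); apply: le_trans (normcD _ _) _; rewrite lerD2l.
Qed.

End PlaneTopology.

Section HomogeneousPoints.
Context {R : realType}.
Local Notation Cx := (cplx R).

(** The pair [(a, b)] stands for [z = b / a], that is [lam = a / b]; so [(lam, 1)] is
    [sphere_inv lam] and [(1, 0)] is [z = 0]. *)
Definition pt (s : Cx * Cx) : sphere R := if s.1 == 0 then None else Some (s.2 / s.1).

Lemma pt_eq s t : (s.1 != 0) || (s.2 != 0) -> (t.1 != 0) || (t.2 != 0) ->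
  s.1 * t.2 = s.2 * t.1 -> pt s = pt t.
Proof.
rewrite /pt => hs ht e; have [s0|s0] := eqVneq s.1 0.
  rewrite s0 eqxx /= in hs; move: e; rewrite s0 mul0r => /eqP.
  by rewrite eq_sym mulf_eq0 (negPf hs) /= => /eqP ->; rewrite eqxx.
have t0 : t.1 != 0.
  apply: contraTneq ht => t0; rewrite t0 eqxx /= negbK.
  by move/eqP: e; rewrite t0 mulr0 mulf_eq0 (negPf s0).
rewrite (negPf t0); congr Some; apply: (mulIf s0); apply: (mulIf t0).
by rewrite divfK // [RHS]mulrAC divfK // -e mulrC.
Qed.

Lemma pt_inv lam : pt (lam, 1) = sphere_inv lam.
Proof. by rewrite /pt /sphere_inv /= div1r. Qed.

End HomogeneousPoints.

(** * The chordal metric in homogeneous coordinates *)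

Section Chordal.
Context {R : realType}.
Local Notation Cx := (cplx R).
Local Notation normc := (@Normc.normc R).
Implicit Types (x y : Cx * Cx) (z : Cx) (p q : sphere R).

Definition hcoord (p : sphere R) : Cx * Cx := if p is Some z then (z, 1) else (1, 0).
Definition wedge x y : Cx := x.1 * y.2 - x.2 * y.1.
Definition hnorm2 x : R := normc x.1 ^+ 2 + normc x.2 ^+ 2.
Definition hnorm x : R := Num.sqrt (hnorm2 x).

Lemma hnorm2_pair a b : hnorm2 (a, b) = normc a ^+ 2 + normc b ^+ 2.
Proof. by []. Qed.

Lemma wedge_pair a b c d : wedge (a, b) (c, d) = a * d - b * c.
Proof. by []. Qed.

Lemma hnorm_inf : hnorm (1, 0) = 1.
Proof. by rewrite /hnorm hnorm2_pair Normc.normc1 Normc.normc0 expr1n expr0n /= addr0 sqrtr1. Qed.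

Lemma hnorm_zero : hnorm (0, 1) = 1.
Proof. by rewrite /hnorm hnorm2_pair Normc.normc1 Normc.normc0 expr1n expr0n /= add0r sqrtr1. Qed.

Lemma hnorm_fin z : hnorm (z, 1) = Num.sqrt (1 + normc z ^+ 2).
Proof. by rewrite /hnorm hnorm2_pair Normc.normc1 expr1n addrC. Qed.

Lemma hnorm_ge1 z : 1 <= hnorm (z, 1).
Proof. by rewrite hnorm_fin -(@sqrtr1 R) ler_wsqrtr // sqrtr1 lerDl sqr_ge0. Qed.

Lemma hnorm2_ge0 x : 0 <= hnorm2 x.
Proof. by rewrite addr_ge0 ?sqr_ge0. Qed.

Lemma hnorm_sq x : hnorm x ^+ 2 = hnorm2 x.
Proof. by rewrite sqr_sqrtr // hnorm2_ge0. Qed.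

Lemma hcoord_gt0 p : 0 < hnorm (hcoord p).
Proof.
case: p => [z|]; last by rewrite hnorm_inf.
exact: lt_le_trans ltr01 (hnorm_ge1 z).
Qed.

Lemma chordalE p q : chordal p q = 2 * normc (wedge (hcoord p) (hcoord q)) /
  (hnorm (hcoord p) * hnorm (hcoord q)).
Proof.
case: p q => [z|] [u|]; rewrite /hcoord ?hnorm_inf ?hnorm_fin wedge_pair /chordal.
- by rewrite mulr1 mul1r.
- by rewrite mulr0 mulr1 sub0r normcN Normc.normc1 !mulr1.
- by rewrite mul0r mulr1 subr0 Normc.normc1 mulr1 mul1r.
- by rewrite mul1r mul0r subrr Normc.normc0 mulr0 mul0r.
Qed.

Lemma chordal_scale p q x y (c d : Cx) : c != 0 -> d != 0 ->
  x.1 = c * (hcoord p).1 -> x.2 = c * (hcoord p).2 ->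
  y.1 = d * (hcoord q).1 -> y.2 = d * (hcoord q).2 ->
  chordal p q = 2 * normc (wedge x y) / (hnorm x * hnorm y).
Proof.
move=> c0 d0 x1 x2 y1 y2; rewrite chordalE.
have sc (s t : Cx * Cx) (a : Cx) : s.1 = a * t.1 -> s.2 = a * t.2 -> hnorm s = normc a * hnorm t.
  move=> e1 e2; rewrite /hnorm /hnorm2 e1 e2 !normcM !exprMn -mulrDr sqrtrM ?sqr_ge0 //.
  by rewrite sqrtr_sqr ger0_norm ?normc_ge0.
rewrite (sc x (hcoord p) c) // (sc y (hcoord q) d) //.
have -> : wedge x y = c * d * wedge (hcoord p) (hcoord q).
  by rewrite /wedge x1 x2 y1 y2; ring.
rewrite !normcM; have := hcoord_gt0 p; have := hcoord_gt0 q.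
have : 0 < normc c by rewrite normc_gt0.
have : 0 < normc d by rewrite normc_gt0.
move: (normc c) (normc d) (hnorm _) (hnorm _) (normc _) => a b e f g b0 a0 f0 e0.
by field; rewrite !gt_eqF.
Qed.

Lemma chordal_sym p q : chordal p q = chordal q p.
Proof.
rewrite !chordalE [hnorm _ * _]mulrC; congr (2 * _ / _).
by rewrite -normcN; congr normc; rewrite /wedge; ring.
Qed.

(** Lagrange's identity. *)
Lemma hdot_le x y : normc (x.1 * conjc y.1 + x.2 * conjc y.2) <= hnorm x * hnorm y.
Proof.
rewrite -ler_sqr ?nnegrE ?normc_ge0 ?mulr_ge0 ?sqrtr_ge0 // exprMn !hnorm_sq.
have -> : hnorm2 x * hnorm2 y = normc (x.1 * conjc y.1 + x.2 * conjc y.2) ^+ 2 + normc (wedge x y) ^+ 2.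
  rewrite /hnorm2 /wedge !normc2 !(cReD, cImD, cReN, cImN, cReM, cImM, cReJ, cImJ); ring.
by rewrite lerDl sqr_ge0.
Qed.

(** The homogeneous form rests on [wedge x z <y, y> = wedge x y <z, y> + wedge y z <x, y>], with
    [hdot_le] for the Hermitian products. *)
Lemma chordal_triangle p q (r : sphere R) : chordal p r <= chordal p q + chordal q r.
Proof.
rewrite !chordalE; have := hcoord_gt0 p; have := hcoord_gt0 q; have := hcoord_gt0 r.
move: (hcoord p) (hcoord q) (hcoord r) => x y z z0 y0 x0.
have key : normc (wedge x z) * hnorm y ^+ 2 <=
    normc (wedge x y) * (hnorm z * hnorm y) + normc (wedge y z) * (hnorm x * hnorm y).
  have -> : hnorm y ^+ 2 = normc (y.1 * conjc y.1 + y.2 * conjc y.2).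
    rewrite hnorm_sq /hnorm2.
    have e (a : Cx) : a * conjc a = (normc a ^+ 2)%:C%C.
      by apply: cplx_eqP; rewrite ?(cReM, cImM, cReJ, cImJ) /= ?normc2; ring.
    rewrite !e (_ : _ + _ = (normc y.1 ^+ 2 + normc y.2 ^+ 2)%:C%C); last by rewrite rmorphD.
    by rewrite normc_real ger0_norm ?addr_ge0 ?sqr_ge0.
  rewrite -normcM.
  have -> : wedge x z * (y.1 * conjc y.1 + y.2 * conjc y.2) =
      wedge x y * (z.1 * conjc y.1 + z.2 * conjc y.2) + wedge y z * (x.1 * conjc y.1 + x.2 * conjc y.2).
    by rewrite /wedge; ring.
  apply: le_trans (normcD _ _) _; rewrite !normcM.
  by apply: lerD; rewrite ler_wpM2l ?normc_ge0 // hdot_le.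
move: key z0 y0 x0; move: (normc _) (normc _) (normc _) (hnorm x) (hnorm y) (hnorm z) => c b a X Y Z key Z0 Y0 X0.
have -> : 2 * b / (X * Y) + 2 * c / (Y * Z) = 2 * (b * (Z * Y) + c * (X * Y)) / (X * Z * Y ^+ 2).
  by field; rewrite !gt_eqF.
have -> : 2 * a / (X * Z) = 2 * (a * Y ^+ 2) / (X * Z * Y ^+ 2).
  by field; rewrite !gt_eqF.
rewrite ler_pM2r ?invr_gt0 ?mulr_gt0 ?exprn_gt0 //.
by rewrite ler_pM2l.
Qed.

Lemma chordal_inv (a b : Cx) : chordal (sphere_inv a) (sphere_inv b) <= 2 * normc (a - b).
Proof.
have hc (t : Cx) : exists2 c : Cx, c != 0 &
    (1 : Cx) = c * (hcoord (sphere_inv t)).1 /\ t = c * (hcoord (sphere_inv t)).2.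
  rewrite /sphere_inv; have [->|t0] := eqVneq t 0.
    by exists 1; rewrite ?oner_neq0 //= !mul1r.
  by exists t => //=; rewrite mulfV // mulr1.
have [c c0 [x1 x2]] := hc a; have [d d0 [y1 y2]] := hc b.
rewrite (@chordal_scale _ _ (1, a) (1, b) c d) //.
have h1 (t : Cx) : 1 <= hnorm (1, t).
  by rewrite /hnorm hnorm2_pair Normc.normc1 expr1n -[X in X <= _](@sqrtr1 R) ler_wsqrtr // lerDl sqr_ge0.
rewrite ler_pdivrMr; last by rewrite mulr_gt0 // (lt_le_trans ltr01 (h1 _)).
rewrite -mulrA ler_pM2l // /wedge /= mul1r mulr1 normcBC ler_peMr ?normc_ge0 //.
by rewrite -[1]mulr1 ler_pM.
Qed.

Lemma chordal_pt0 (s : Cx * Cx) (e : R) : s.1 != 0 -> normc s.2 <= e * normc s.1 ->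
  chordal (Some 0) (pt s) <= 2 * e.
Proof.
move=> s0 hs; rewrite /pt (negPf s0) chordalE /hcoord wedge_pair mul0r sub0r mul1r normcN hnorm_zero mul1r.
have n1 := hnorm_ge1 (s.2 / s.1).
rewrite ler_pdivrMr; last exact: lt_le_trans ltr01 n1.
rewrite -mulrA ler_pM2l // normcM normcV.
have a0 : 0 < normc s.1 by rewrite normc_gt0.
have h : normc s.2 / normc s.1 <= e by rewrite ler_pdivrMr.
apply: (le_trans h); rewrite ler_peMr //; apply: le_trans h; rewrite divr_ge0 ?normc_ge0 //.
Qed.

Lemma chordal_0_inv (t : Cx) : normc t <= 1 -> 1 <= chordal (Some 0) (sphere_inv t).
Proof.
move=> t1; rewrite /sphere_inv; have [t0|t0] := eqVneq t 0.
  by rewrite chordalE /hcoord wedge_pair hnorm_zero hnorm_inf mul0r mul1r sub0r normcN Normc.normc1 !mulr1 divr1 ler1n.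
have nt : 0 < normc t by rewrite normc_gt0.
have np := hcoord_gt0 (Some t^-1).
rewrite chordalE; rewrite /hcoord in np *; rewrite wedge_pair hnorm_zero mul0r sub0r mul1r normcN normcV.
rewrite mul1r ler_pdivlMr // mul1r -ler_sqr ?nnegrE ?(ltW np) //; last first.
  by rewrite mulr_ge0 // invr_ge0 normc_ge0.
rewrite hnorm_sq hnorm2_pair Normc.normc1 expr1n normcV exprMn.
have : 1 <= (normc t)^-1 ^+ 2 by rewrite exprn_ege1 // invr_ge1 ?unitfE ?gt_eqF.
lra.
Qed.

End Chordal.

Lemma poly_isolated (R : realType) (p : {poly cplx R}) (q : cplx R) : p != 0 ->
  exists2 d : R, 0 < d & forall z, z != q -> Normc.normc (z - q) < d -> p.[z] != 0.
Proof.
move=> p0; have [r hr] := closed_field_poly_normal p.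
have [d d0 hd] : exists2 d : R, 0 < d & forall z, z \in r -> z != q -> d <= Normc.normc (z - q).
  elim: (r) => [|a s [d d0 hd]]; first by exists 1.
  have [aq|aq] := eqVneq a q.
    by exists d => // z; rewrite inE => /orP[/eqP ->|/hd //]; rewrite aq eqxx.
  exists (Num.min d (Normc.normc (a - q))); first by rewrite lt_min d0 normc_gt0 subr_eq0.
  move=> z; rewrite inE ge_min => /orP[/eqP -> _|/hd h /h ->//]; by rewrite lexx orbT.
exists d => // z zq zd; rewrite hr hornerZ mulf_neq0 ?lead_coef_eq0 // horner_prod.
rewrite prodf_seq_neq0; apply/allP => a ar; rewrite /= !hornerE subr_eq0.
by apply/negP => /eqP za; have := hd a ar; rewrite -za => /(_ zq); rewrite leNgt zd.
Qed.

(** If all roots were at distance at least [e] from [q], the factorization into linear terms would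
    give the opposite inequality. This is the source of the openness of rational maps. *)
Lemma poly_root_near (R : realType) (p : {poly cplx R}) (q : cplx R) (e : R) : 0 < e -> p != 0 ->
  Normc.normc p.[q] < Normc.normc (lead_coef p) * e ^+ (size p).-1 ->
  exists2 z, Normc.normc (z - q) < e & p.[z] = 0.
Proof.
move=> e0 p0 hp; have [r hr] := closed_field_poly_normal p.
apply: contrapT => nz; move: hp; apply/negP; rewrite -leNgt.
have l0 : lead_coef p != 0 by rewrite lead_coef_eq0.
have sr : size r = (size p).-1.
  by rewrite hr size_scale // size_prod_XsubC.
rewrite -sr [in X in _ <= X]hr hornerZ normcM ler_wpM2l ?normc_ge0 //.
have far z : z \in r -> e <= Normc.normc (q - z).
  move=> zr; rewrite leNgt; apply/negP => h; apply: nz; exists z; first by rewrite normcBC.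
  by apply/eqP; rewrite -rootE hr rootZ // root_prod_XsubC.
rewrite horner_prod; elim: (r) far => [|z s IH] far.
  by rewrite big_nil expr0 Normc.normc1.
rewrite big_cons normcM exprS; apply: ler_pM; rewrite ?exprn_ge0 ?(ltW e0) //.
  by rewrite !hornerE; apply: far; rewrite mem_head.
by apply: IH => t ts; apply: far; rewrite inE ts orbT.
Qed.

Lemma sphere_inv_neq0 (R : realType) (t : cplx R) : sphere_inv t <> Some 0.
Proof.
by rewrite /sphere_inv; case: eqP => // /eqP t0 [] /eqP; rewrite invr_eq0 (negPf t0).
Qed.

Lemma sphere_inv_surj (R : realType) (p : sphere R) : p <> Some 0 -> exists t, p = sphere_inv t.
Proof.
case: p => [z z0|_]; last by exists 0; rewrite /sphere_inv eqxx.
have zn : z != 0 by apply/eqP => e; apply: z0; rewrite e.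
by exists z^-1; rewrite /sphere_inv invr_eq0 (negPf zn) invrK.
Qed.

Lemma sphere_inv_inj (R : realType) : injective (@sphere_inv R).
Proof.
move=> a b; rewrite /sphere_inv; case: eqP => [->|_]; case: eqP => // [_ [] /invr_inj //].
Qed.

(** * Power series and the identity theorem *)

Section PowerSeries.
Context {R : realType}.
Local Notation Cx := (cplx R).
Local Notation normc := (@Normc.normc R).

Definition power_series (a : nat -> Cx) (r : R) (g : Cx -> Cx) : Prop :=
  forall h, normc h < r -> series (fun n => a n * h ^+ n) @ \oo --> g h.

Lemma power_series0 a (r : R) g : 0 < r -> power_series a r g -> g 0 = a 0%N.
Proof.
move=> r0 hg; have h0 : normc (0 : Cx) < r by rewrite Normc.normc0.
apply/eqP; rewrite -subr_eq0 -normc_eq0; apply/eqP/le_anti; rewrite normc_ge0 andbT.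
apply/ler_addgt0Pl => e e0; rewrite addr0; have /ccvgP/(_ e e0)[N hN] := hg _ h0.
have := hN N.+1 (leqnSn N); rewrite normcBC /series /= big_nat_recl // big1 => [|i _]; last first.
  by rewrite exprS mul0r mulr0.
by rewrite expr0 mulr1 addr0 => /ltW.
Qed.

Lemma power_series_shift a (r : R) g : 0 < r -> power_series a r g -> a 0%N = 0 ->
  exists2 g1, power_series (fun n => a n.+1) r g1 & forall h, normc h < r -> g h = h * g1 h.
Proof.
move=> r0 hg a0; exists (fun h => if h == 0 then a 1%N else g h / h) => h hr; last first.
  case: eqVneq => [->|h0]; last by rewrite mulrC divfK.
  by rewrite mul0r (power_series0 r0 hg).
have sE N : h * series (fun n => a n.+1 * h ^+ n) N = series (fun n => a n * h ^+ n) N.+1.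
  rewrite /series /= [RHS]big_nat_recl // a0 mul0r add0r mulr_sumr.
  by apply: eq_bigr => i _; rewrite exprS; ring.
apply/ccvgP => e e0; case: (eqVneq h 0) => [h0|h0].
  exists 1%N => -[//|n _]; rewrite /series /= big_nat_recl // big1 => [|i _]; last first.
    by rewrite h0 exprS mul0r mulr0.
  by rewrite expr0 mulr1 addr0 subrr Normc.normc0.
have nh : 0 < normc h by rewrite normc_gt0.
have /ccvgP/(_ _ (mulr_gt0 e0 nh))[N hN] := hg _ hr; exists N => n Nn.
have := hN n.+1 (leqW Nn); rewrite -sE.
rewrite (_ : _ - g h = h * (series (fun n => a n.+1 * h ^+ n) n - g h / h)).
  by rewrite normcM mulrC ltr_pM2r.
by rewrite mulrBr; congr (_ - _); rewrite mulrC divfK.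
Qed.

Lemma power_series_coef a (r : R) g : 0 < r -> power_series a r g ->
  exists M rho : R, [/\ 0 <= M, 0 < rho & forall n, normc (a n) * rho ^+ n <= M].
Proof.
move=> r0 hg; have r2 : 0 < r / 2 by rewrite divr_gt0.
have [|N hN] := (ccvgP _ _).1 (hg (r / 2)%:C%C _) 1 ltr01.
  by rewrite normc_real gtr0_norm //; lra.
pose t n := normc (a n * ((r / 2)%:C%C : Cx) ^+ n).
have tE n : t n = normc (a n) * (r / 2) ^+ n by rewrite /t normcM normcX normc_real gtr0_norm.
exists (2 + \sum_(i < N) t i), (r / 2); split=> // [|n].
  by rewrite addr_ge0 // sumr_ge0 // => i _; exact: normc_ge0.
rewrite -tE; have [nN|nN] := ltnP n N.
  rewrite (bigD1 (Ordinal nN)) //= addrCA ler_wpDr // addr_ge0 // sumr_ge0 // => i _; exact: normc_ge0.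
have h1 := hN _ nN; have h2 := hN _ (leqW nN).
apply: (@le_trans _ _ 2); last by rewrite lerDl sumr_ge0 // => i _; exact: normc_ge0.
set s := series _ in h1 h2; set l := g _ in h1 h2.
have -> : t n = normc ((s n.+1 - l) - (s n - l)).
  by rewrite /t; congr normc; rewrite /s /series /= big_nat_recr //=; ring.
have := normcD (s n.+1 - l) (- (s n - l)); rewrite normcN; lra.
Qed.

Lemma expr_lip (x y : Cx) (t : R) n : normc x <= t -> normc y <= t ->
  normc (x ^+ n.+1 - y ^+ n.+1) <= n.+1%:R * t ^+ n * normc (x - y).
Proof.
move=> hx hy; have t0 : 0 <= t := le_trans (normc_ge0 _) hx.
elim: n => [|n IH]; first by rewrite !expr1 expr0 !mul1r.
rewrite (_ : _ - _ = x * (x ^+ n.+1 - y ^+ n.+1) + (x - y) * y ^+ n.+1); last first.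
  by rewrite [x ^+ n.+2]exprS [y ^+ n.+2]exprS; ring.
apply: le_trans (normcD _ _) _; rewrite !normcM normcX.
have h1 : normc y ^+ n.+1 <= t ^+ n.+1 by rewrite lerXn2r ?nnegrE ?normc_ge0.
have h2 : normc x * normc (x ^+ n.+1 - y ^+ n.+1) <= t * (n.+1%:R * t ^+ n * normc (x - y)).
  by apply: ler_pM => //; exact: normc_ge0.
apply: le_trans (lerD h2 (ler_wpM2l (normc_ge0 _) h1)) _.
by rewrite -[n.+2%:R]natr1 exprS le_eqVlt; apply/orP; left; apply/eqP; ring.
Qed.

Lemma power_series_lip a (r : R) g : 0 < r -> power_series a r g ->
  exists M d : R, [/\ 0 <= M, 0 < d & forall h h', normc h < d -> normc h' < d ->
    normc (g h - g h') <= M * normc (h - h')].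
Proof.
move=> r0 hg; have [M [rho [M0 rho0 hM]]] := power_series_coef r0 hg.
(* For arguments below [rho / 4] the [n]-th term has Lipschitz constant at most
   [M rho^-n n (rho / 4)^(n - 1)]; with [n <= 2 ^ n] this is at most [4 (M / rho) 2^-n], and the sum
   over [n >= 1] is at most [4 (M / rho)]. *)
exists (4 * (M / rho)), (Num.min r (rho / 4)); split.
- by rewrite mulr_ge0 // divr_ge0 // ltW.
- by rewrite lt_min r0 divr_gt0.
move=> h h'; rewrite !lt_min => /andP[hr hp] /andP[hr' hp'].
have D0 := normc_ge0 (h - h').
have Q0 : 0 <= M / rho by rewrite divr_ge0 // ltW.
have sb N : normc (series (fun n => a n * h ^+ n) N.+1 - series (fun n => a n * h' ^+ n) N.+1) <=
    (4 - 8 * 2^-1 ^+ N.+1) * (M / rho) * normc (h - h').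
  elim: N => [|N IH].
    rewrite /series /= !big_nat1 !expr0 subrr Normc.normc0 expr1.
    by rewrite (_ : 4 - 8 * 2^-1 = 0 :> R) ?mul0r //; lra.
  move: IH; rewrite /series /= => IH; rewrite [X in normc (X - _)]big_nat_recr // [X in normc (_ - X)]big_nat_recr //=.
  move: IH; set s := \sum_(0 <= i < N.+1) _; set s' := \sum_(0 <= i < N.+1) _ => IH.
  rewrite (_ : _ - _ = (s - s') + a N.+1 * (h ^+ N.+1 - h' ^+ N.+1)); last by ring.
  have h1 := expr_lip N (ltW hp) (ltW hp').
  have h2 : normc (a N.+1 * (h ^+ N.+1 - h' ^+ N.+1)) <= 4 * 2^-1 ^+ N.+1 * (M / rho) * normc (h - h').
    rewrite normcM; apply: le_trans (ler_wpM2l (normc_ge0 _) h1) _.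
    rewrite [X in X <= _]mulrA; apply: ler_wpM2r => //.
    have h3 : N.+1%:R <= 2 ^+ N.+1 :> R by rewrite -natrX ler_nat ltnW // ltn_expl.
    have rN : rho ^+ N.+1 != 0 by rewrite expf_neq0 // gt_eqF.
    have h4 : normc (a N.+1) <= M / rho ^+ N.+1 by rewrite ler_pdivlMr ?exprn_gt0.
    apply: le_trans (ler_pM (normc_ge0 _) _ h4 (ler_wpM2r _ h3)) _.
    + by rewrite mulr_ge0 // exprn_ge0 // divr_ge0 // ltW.
    + by rewrite exprn_ge0 // divr_ge0 // ltW.
    have -> : M / rho ^+ N.+1 * (2 ^+ N.+1 * (rho / 4) ^+ N) = 4 * 2^-1 ^+ N.+1 * (M / rho) * (2 ^+ N.+1 * 2 ^+ N.+1 / 4 ^+ N.+1).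
      rewrite expr_div_n [rho ^+ N.+1]exprS [4 ^+ N.+1]exprS exprVn; field.
      by rewrite !expf_neq0 //= gt_eqF.
    by rewrite -exprMn (_ : 2 * 2 = 4 :> R) ?divff ?expf_neq0 ?mulr1 //; ring.
  apply: le_trans (normcD _ _) (le_trans (lerD IH h2) _).
  rewrite [2^-1 ^+ N.+2]exprS le_eqVlt; apply/orP; left; apply/eqP.
  by generalize (2^-1 ^+ N.+1 : R) (M / rho) (normc (h - h')) => k Q D; field.
apply/ler_addgt0Pr => e e0; have e2 : 0 < e / 2 by rewrite divr_gt0.
have /ccvgP/(_ _ e2)[N hN] := hg _ hr; have /ccvgP/(_ _ e2)[N' hN'] := hg _ hr'.
pose n := (N + N').+1; have h1 := hN n (leqW (leq_addr _ _)); have h2 := hN' n (leqW (leq_addl _ _)).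
have h3 := sb (N + N')%N; rewrite -/n in h3.
have h4 : 0 <= 2^-1 ^+ n :> R by rewrite exprn_ge0.
set s := series _ n in h1 h3; set s' := series _ n in h2 h3.
rewrite (_ : g h - g h' = ((s - s') - (s - g h)) + (s' - g h')); last by ring.
have h5 := normcD ((s - s') - (s - g h)) (s' - g h'); have h6 := normcD (s - s') (- (s - g h)).
rewrite normcN in h6; apply: le_trans h5 _; move: h1 h2 h3 h4 h6.
generalize (2^-1 ^+ n : R) (M / rho) (normc (h - h')) D0 Q0 => k Q D {}D0 {}Q0.
set A := normc (s - g h); set B := normc (s' - g h'); set S := normc (s - s').
set G := normc (s - s' - _).
have aux : A < e / 2 -> B < e / 2 -> S <= (4 - 8 * k) * Q * D -> 0 <= k -> G <= S + A ->
   G + B <= 4 * Q * D + e.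
  move=> x1 x2 x3 x4 x5; have : 0 <= k * (Q * D) by rewrite !mulr_ge0.
  nra.
exact: aux.
Qed.

(** Divide by [h] until the constant term is nonzero; the induction is on the index of the first
    nonzero coefficient. *)
Lemma power_series_isolated a (r : R) g : 0 < r -> power_series a r g ->
  (exists2 d : R, 0 < d & forall h, h != 0 -> normc h < d -> g h != 0) \/
  (forall h, normc h < r -> g h = 0).
Proof.
move=> r0 hg; have [[k hk]|ha] := pselect (exists n, a n != 0); last first.
  right=> h hr; have a0 n : a n = 0 by apply/eqP/contraT => an; case: ha; exists n.
  have := hg _ hr; rewrite (_ : series _ = fun _ => 0); last first.
    by apply/funext => n; rewrite /series /= big1 // => i _; rewrite a0 mul0r.
  move=> /ccvgP hc; apply/eqP; rewrite -normc_eq0; apply/eqP/le_anti; rewrite normc_ge0 andbT.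
  apply/ler_addgt0Pl => e e0; rewrite addr0; have [N /(_ _ (leqnn N))] := hc e e0.
  by rewrite sub0r normcN => /ltW.
left; have : exists n, a n != 0 by exists k.
move=> /ex_minnP[n]; clear k hk; elim: n a g hg => [|n IH] a g hg an hmin.
  have [M [d [M0 d0 hM]]] := power_series_lip r0 hg.
  have n0 : 0 < normc (a 0%N) by rewrite normc_gt0.
  exists (Num.min d (normc (a 0%N) / (M + 1))).
    by rewrite lt_min d0 divr_gt0 //; lra.
  move=> h _; rewrite lt_min ltr_pdivlMr; last by lra.
  move=> /andP[hd h1]; apply: contraTneq h1 => gh; rewrite -leNgt.
  have := hM h 0 hd; rewrite Normc.normc0 => /(_ d0).
  rewrite gh (power_series0 r0 hg) sub0r normcN subr0 => h2.
  by apply: le_trans h2 _; rewrite mulrC ler_wpM2l ?normc_ge0 //; lra.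
have a0 : a 0%N = 0 by apply/eqP; apply: contraT => /hmin.
have [g1 hg1 gE] := power_series_shift r0 hg a0.
have [d d0 hd] := IH _ _ hg1 an (fun m hm => hmin m.+1 hm).
exists (Num.min d r); first by rewrite lt_min d0.
move=> h h0; rewrite lt_min => /andP[h1 h2]; rewrite gE // mulf_neq0 //; exact: hd.
Qed.

Lemma analytic_isolated (f g : sphere R -> Cx) p : analytic_at f p -> analytic_at g p ->
  (exists2 r : R, 0 < r & forall h, normc h < r -> f (chart p h) = g (chart p h)) \/
  (exists2 r : R, 0 < r & forall h, h != 0 -> normc h < r -> f (chart p h) <> g (chart p h)).
Proof.
move=> [a [r r0 ha]] [b [s s0 hb]].
have m0 : 0 < Num.min r s by rewrite lt_min r0.
have hd : power_series (fun n => a n - b n) (Num.min r s) (fun h => f (chart p h) - g (chart p h)).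
  move=> h; rewrite lt_min => /andP[h1 h2].
  rewrite (_ : (fun n => (a n - b n) * h ^+ n) = (fun n => a n * h ^+ n) - (fun n => b n * h ^+ n)); last first.
    by apply/funext => n; rewrite mulrBl.
  rewrite (_ : series _ = series (fun n => a n * h ^+ n) - series (fun n => b n * h ^+ n)); last first.
    by apply/funext => n; rewrite /series /= sumrB.
  exact: cvgB (ha _ h1) (hb _ h2).
have [[d d0 hz]|h0] := power_series_isolated m0 hd; [right|left]; last first.
  by exists (Num.min r s) => // h /h0 /eqP; rewrite subr_eq0 => /eqP.
by exists d => // h n0 /(hz _ n0); rewrite subr_eq0 => /eqP.
Qed.

End PowerSeries.

(** If [Q K] failed, the sets whose complement in [K] has [Q] would form a proper filter, and its
    cluster point in [K] would contradict the local hypothesis. *)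
Lemma compact_ideal (R : realType) (K : set (cplx R)) (Q : set (cplx R) -> Prop) : compact K ->
  Q set0 -> (forall A B, Q A -> Q B -> Q (A `|` B)) -> (forall A B, A `<=` B -> Q B -> Q A) ->
  (forall p, K p -> exists2 U, nbhs p U & Q U) -> Q K.
Proof.
move=> Kc Q0 QU Qm Qloc; apply: contrapT => nQ.
pose G : set_system (cplx R) := fun A => Q (K `\` A).
have GF : ProperFilter G.
  split; first by rewrite /G setD0.
  split; first by rewrite /G setDT.
    move=> A B hA hB; apply: Qm (QU _ _ hA hB) => x [Kx]; rewrite not_andE.
    by case=> ?; [left|right].
  by move=> A B AB hA; apply: Qm hA => x [Kx nB]; split=> // /AB.
have [|p [Kp cp]] := Kc G GF; first by rewrite /G setDv.
have [U Up QUU] := Qloc p Kp.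
have GU : G (~` U) by apply: Qm QUU => x [_]; rewrite /setC /mkset; exact: contrapT.
by have [x []] := cp _ _ GU Up.
Qed.

(** The supremum of the points of [A] between [a] and [b] belongs to [A] by closedness, and openness
    lets it move on unless it is [b]. *)
Lemma real_clopen_up (R : realType) (A : set R) (a b : R) : a <= b -> A a ->
  (forall t, a <= t -> t <= b -> (forall e, 0 < e -> exists2 s, A s & `|s - t| < e) -> A t) ->
  (forall t, a <= t -> t <= b -> A t -> exists2 e, 0 < e &
     forall s, a <= s -> s <= b -> `|s - t| < e -> A s) -> A b.
Proof.
move=> ab Aa hcl hop; pose S := [set t | [/\ a <= t, t <= b & A t]].
have Sa : S a by split.
have hs : has_sup S by split; [exists a|exists b => t []].
have s1 : a <= sup S by apply: ub_le_sup => //; case: hs.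
have s2 : sup S <= b by apply: ge_sup => [|t []//]; exists a.
have As : A (sup S).
  apply: hcl => // e e0; have [t [t1 t2 At] lt] := sup_adherent e0 hs.
  exists t => //; rewrite distrC ger0_norm ?subr_ge0; first by lra.
  by apply: ub_le_sup; [case: hs|split].
have [e e0 he] := hop _ s1 s2 As.
have [<-//|ne] := eqVneq (sup S) b.
have lt : sup S < b by rewrite lt_neqAle ne.
pose t := Num.min b (sup S + e / 2).
have [t1 t2] : t <= b /\ t <= sup S + e / 2 by rewrite !ge_min !lexx orbT.
have t3 : sup S < t by rewrite lt_min lt; lra.
have St : S t.
  by split=> //; [lra|apply: he => //; [lra|rewrite ger0_norm; lra]].
have : t <= sup S by apply: ub_le_sup => //; case: hs.
by rewrite leNgt t3.
Qed.

Lemma poly_lower (R : realType) (p : {poly cplx R}) (q : cplx R) : p != 0 ->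
  exists (k : nat) (c d : R), [/\ 0 < c, 0 < d & forall z, Normc.normc (z - q) < d ->
    c * Normc.normc (z - q) ^+ k <= Normc.normc p.[z]].
Proof.
move=> p0; have [k [g gq pE]] := multiplicity_XsubC p q; rewrite p0 /= /root in gq.
have [M M0 hM] := poly_increment g q.
have n0 : 0 < Normc.normc g.[q] by rewrite normc_gt0.
exists k, (Normc.normc g.[q] / 2), (Num.min 1 (Normc.normc g.[q] / (2 * (M + 1)))).
split; [by rewrite divr_gt0|by rewrite lt_min ltr01 divr_gt0 // mulr_gt0 //; lra|].
move=> z; rewrite lt_min ltr_pdivlMr; last by rewrite mulr_gt0 //; lra.
move=> /andP[/ltW z1 z2]; rewrite pE hornerM horner_exp hornerXsubC normcM normcX.
apply: ler_wpM2r; first by rewrite exprn_ge0 // normc_ge0.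
have := hM _ z1; have := normcB_ge g.[q] (g.[z] - g.[q]); rewrite subrKC.
have := normc_ge0 (z - q); move: z2.
have aux (n Q G D : R) : n * (2 * (M + 1)) < Q -> 0 <= n -> Q - D <= G -> D <= M * n -> Q / 2 <= G by nra.
exact: aux.
Qed.

Section PlanePolynomials.
Context {R : realType}.
Local Notation Cx := (cplx R).
Local Notation normc := (@Normc.normc R).
Implicit Types lam : Cx.

Lemma nonreal_near lam (d : R) : 0 < d -> exists2 lam', complex.Im lam' != 0 & normc (lam' - lam) < d.
Proof.
move=> d0; have d2 : 0 < d / 2 by rewrite divr_gt0.
have [i0|i0] := eqVneq (complex.Im lam) 0.
  exists (lam + (0 +i* (d / 2))%C); first by rewrite cImD i0 add0r gt_eqF.
  rewrite addrAC subrr add0r; apply: le_lt_trans (normc_le_ReIm _) _ => /=.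
  by rewrite normr0 add0r gtr0_norm // ltr_pdivrMr // ltr_pMr // ltr1n.
by exists lam => //; rewrite subrr Normc.normc0.
Qed.

Lemma horner_eqM (a b c d : {poly Cx}) z : a * b = c * d -> a.[z] * b.[z] = c.[z] * d.[z].
Proof. by move/(congr1 (fun p : {poly Cx} => p.[z])); rewrite !hornerM. Qed.

Lemma poly_lt_near_root (nh dh : {poly Cx}) q : nh.[q] = 0 -> dh.[q] != 0 -> exists2 d : R, 0 < d &
  forall q', normc (q' - q) < d -> normc nh.[q'] < normc dh.[q'].
Proof.
move=> nq dq.
have [M1 M10 hM1] := poly_increment nh q; have [M2 M20 hM2] := poly_increment dh q.
pose d := Num.min 1 (normc dh.[q] / (2 * (M1 + M2 + 1))).
have dq0 : 0 < normc dh.[q] by rewrite normc_gt0.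
have M0 : 0 < 2 * (M1 + M2 + 1) by lra.
have d0 : 0 < d by rewrite /d lt_min ltr01 /= divr_gt0.
exists d => // q'; rewrite lt_min ltr_pdivlMr // => /andP[/ltW l1 l2].
have := hM1 _ l1; have := hM2 _ l1; rewrite nq subr0 => i2 i1.
have := normcB_ge dh.[q] (dh.[q'] - dh.[q]); rewrite subrKC.
have := normc_ge0 (q' - q); move: i1 i2 l2.
have aux (n D D' e m1 m2 x : R) : n <= m1 * e -> x <= m2 * e -> e * (2 * (m1 + m2 + 1)) < D ->
  0 <= e -> 0 <= m1 -> 0 <= m2 -> D - x <= D' -> n < D' by nra.
move=> i1 i2 l2 e0 i3; exact: (aux _ _ _ _ _ _ _ i1 i2 l2 e0 M10 M20 i3).
Qed.

Lemma real_segment_convex (a b : R) : convex_set [set z : Cx | complex.Im z = 0 /\ a <= complex.Re z <= b].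
Proof.
move=> x y t [ix /andP[x1 x2]] [iy /andP[y1 y2]] t0 t1.
case: x y ix iy x1 x2 y1 y2 => [x x'] [y y'] /= -> -> x1 x2 y1 y2; split; first by lra.
by apply/andP; split; nra.
Qed.

End PlanePolynomials.

(** * The resolvent kernel as a function on the sphere *)

Section Resolvent.
Context {R : realType} {V : choiceType} (adj : rel V).
Context (hgraph : infinite_connected_graph adj).
Local Notation Cx := (cplx R).
Local Notation normc := (@Normc.normc R).
Local Notation H := (@l2 R V adj).
Local Notation degp := (degree_gt0 hgraph).
Local Notation P := (Pl2 (R := R) (adj_lfin hgraph) (adj_sym hgraph) degp).
Local Notation L := (res_op P).
Local Notation nm := (@nm R H (@ip R V adj)).
Local Notation hH := (ip_inner (R := R) degp).
Local Notation hC2 := (ip_complete_l2 (R := R) degp).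
Local Notation Plin := (Pl2_linear (R := R) (adj_lfin hgraph) (adj_sym hgraph) degp).
Local Notation Psym := (Pl2_sym (R := R) (adj_lfin hgraph) (adj_sym hgraph) degp).
Local Notation Pcontr := (Pl2_contr (R := R) (adj_lfin hgraph) (adj_sym hgraph) degp).
Implicit Types (lam : Cx) (x y : V).
Local Notation reg := (@regular R H (@ip R V adj) P).
Local Notation ip := (@ip R V adj).

Definition resolvent lam (f : H) : H := xget 0 [set u | L lam u = f].

Lemma resolventP lam f : reg lam -> L lam (resolvent lam f) = f.
Proof.
by move=> [_ /(_ f) [u hu]]; rewrite /resolvent; case: xgetP => [u' -> //|/(_ u)].
Qed.

Lemma resolvent_eq lam u f : reg lam -> L lam u = f -> resolvent lam f = u.
Proof. by move=> hl hu; apply: (regular_unique hH Plin hl); rewrite resolventP. Qed.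

Lemma resolvent_linear lam : reg lam -> forall c u v,
  resolvent lam (c *: u + v) = c *: resolvent lam u + resolvent lam v.
Proof.
move=> hl c u v; apply: resolvent_eq => //.
by rewrite (res_opD Plin) (res_opZ Plin) !resolventP.
Qed.

Lemma resolvent_bound lam : reg lam -> exists2 K : R, 0 < K & forall f, nm (resolvent lam f) <= K * nm f.
Proof.
move=> hl; case: (hl) => [[c c0 hc] _]; exists c^-1; first by rewrite invr_gt0.
move=> f; rewrite mulrC ler_pdivlMr // mulrC -{2}(resolventP f hl); exact: hc.
Qed.

Lemma resolvent_setP lam : resolvent_set adj lam <-> reg lam.
Proof.
split=> [[T [Tl Tlin [M hM]] hT]|hl].
  have invT (u : H) : T (L lam u) = u.
    have [_ e] := hT u (l2P u); rewrite -[RHS]e; congr T; apply/funext => x.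
    by rewrite res_opE.
  split.
    exists (`|M| + 1)^-1; first by rewrite invr_gt0 ltr_wpDl.
    move=> u; rewrite mulrC ler_pdivrMr ?ltr_wpDl //.
    have := hM (L lam u) (l2P _); rewrite invT /ell2_norm -/(sqn adj u) -!(hn_sqn) => h.
    apply: (le_trans h); rewrite mulrC ler_wpM2l ?hn_ge0 //.
    by apply: le_trans (ler_norm M) _; rewrite lerDl.
  move=> f; exists (mkl2 (Tl f (l2P f))); apply: l2_ext => x; rewrite res_opE.
  have [e _] := hT f (l2P f); exact: (congr1 (fun g => g x) e).
(* Operators act on all functions, so a value off [ell2] has to be chosen; the identity is taken. *)
pose T (f : V -> Cx) : V -> Cx :=
  if pselect (ell2 adj f) is left hf then resolvent lam (mkl2 hf) else f.
have TE (f : H) : T f = resolvent lam f.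
  rewrite /T; case: pselect => [hf|]; last by case; exact: l2P.
  by congr (l2fun (resolvent lam _)); apply: l2_ext.
exists T.
  split=> [f hf|a f g hf hg|].
  - by rewrite -[f]/(l2fun (mkl2 hf)) TE; exact: l2P.
  - have e : (fun x => a * f x + g x) = (a *: mkl2 hf + mkl2 hg : H) by [].
    rewrite e TE resolvent_linear //; rewrite -[f]/(l2fun (mkl2 hf)) -[g]/(l2fun (mkl2 hg)).
    by rewrite !TE.
  have [K K0 hK] := resolvent_bound hl.
  exists K => f hf; rewrite -[f]/(l2fun (mkl2 hf)) TE /ell2_norm.
  rewrite -/(sqn adj (resolvent lam (mkl2 hf))) -/(sqn adj (mkl2 hf)) -!hn_sqn; exact: hK.
move=> f hf; rewrite -[f]/(l2fun (mkl2 hf)); split.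
  rewrite TE; apply/funext => x; have := congr1 (fun g : H => g x) (resolventP (mkl2 hf) hl).
  by rewrite res_opE.
have -> : (fun x => lam * mkl2 hf x - P_op adj (mkl2 hf) x) = L lam (mkl2 hf).
  by apply/funext => x; rewrite res_opE.
by rewrite TE; congr l2fun; exact: resolvent_eq.
Qed.

Lemma regular_open lam : reg lam -> exists2 d : R, 0 < d & forall lam', normc (lam' - lam) < d -> reg lam'.
Proof.
move=> [[c c0 hc] hs]; exists c => // lam'; exact: (regular_near hH hC2 Plin hc hs).
Qed.

Lemma nonreal_regular lam : complex.Im lam != 0 -> reg lam.
Proof. by move=> h; apply: (coercive_regular hH hC2 Plin Pcontr); exact: (nonreal_coercive hH Plin Psym h). Qed.

Lemma large_regular lam : 1 < normc lam -> reg lam.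
Proof. by move=> h; apply: (coercive_regular hH hC2 Plin Pcontr); exact: (large_coercive hH Plin Psym Pcontr h). Qed.

(** For [z <> 0] this is regularity of [lam = 1 / z]; [z = 0] is always good, and infinity stands
    for [lam = 0]. *)
Definition good (p : sphere R) : Prop := ~ spec_inv R adj p.

Lemma good_inv lam : good (sphere_inv lam) <-> reg lam.
Proof.
rewrite /good /spec_inv /spec; split=> [h|h [l nl /sphere_inv_inj e]].
  by apply/resolvent_setP; apply: contrapT => nl; apply: h; exists lam.
by apply: nl; rewrite e; apply/resolvent_setP.
Qed.

Lemma good_zero : good (Some 0).
Proof. by move=> [l _] /sphere_inv_neq0. Qed.

Lemma good_some z : z != 0 -> good (Some z) <-> reg z^-1.
Proof.
by move=> z0; rewrite -good_inv /sphere_inv invr_eq0 (negPf z0) invrK.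
Qed.

Lemma good_open p : good p -> exists2 r : R, 0 < r & forall h, normc h < r -> good (chart p h).
Proof.
have [->|pz] := pselect (p = Some 0).
  exists 1 => // h h1 /=; rewrite add0r; have [->|h0] := eqVneq h 0; first exact: good_zero.
  apply/good_some => //; apply: large_regular.
  by rewrite normcV -[X in X < _]invr1 ltf_pV2 ?posrE ?normc_gt0.
have [t ->] := sphere_inv_surj pz; move=> /good_inv /regular_open [d d0 hd].
rewrite /sphere_inv; have [t0|t0] := eqVneq t 0.
  exists d => // h hh; apply/good_inv/hd; by rewrite t0 subr0.
have ti : t^-1 != 0 by rewrite invr_eq0.
have [r r0 hr] := invc_near ti d0; exists r => // h hh /=.
have [|z0 zd] := hr (t^-1 + h); first by rewrite addrAC subrr add0r.
by apply/(good_some z0)/hd; rewrite invrK in zd.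
Qed.

(** The remainder after [n] terms is exactly [h ^+ n *: iter n B u]. *)
Lemma neumann_series (B : H -> H) (g u : H) (K : R) (h : Cx) x :
  (forall c u v, B (c *: u + v) = c *: B u + B v) -> (forall u, nm (B u) <= K * nm u) -> 0 <= K ->
  u = g + h *: B u -> normc h * K < 1 ->
  series (fun n => iter n B g x * h ^+ n) @ \oo --> u x.
Proof.
move=> Blin hB K0 hu hK.
have part n : u - \sum_(k < n) h ^+ k *: iter k B g = h ^+ n *: iter n B u.
  elim: n => [|n IH]; first by rewrite big_ord0 subr0 expr0 scale1r.
  rewrite big_ord_recr /= opprD addrA IH -scalerBr exprSr -scalerA; congr (_ *: _).
  have iB k (a : H) (c : Cx) (b : H) : iter k B (a + c *: b) = iter k B a + c *: iter k B b.
    by elim: k => [//|k IHk]; rewrite !iterS IHk addrC Blin addrC.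
  by rewrite {1}hu iB addrAC subrr add0r -iterSr.
have bd n : nm (iter n B u) <= K ^+ n * nm u.
  elim: n => [|n IH]; first by rewrite expr0 mul1r.
  rewrite iterS exprS -mulrA; apply: le_trans (hB _) _; exact: ler_wpM2l.
apply/ccvgP => e e0.
have [N hN] := geometric_small (mulr_ge0 (normc_ge0 h) K0) hK (hn_ge0 (ip := ip) u) (divr_gt0 e0 (ltr0Sn R 1)).
exists N => n /hN hn; rewrite normcBC.
have -> : u x - series (fun n => iter n B g x * h ^+ n) n = (h ^+ n *: iter n B u) x.
  rewrite -part l2B l2_sumE /series /= big_mkord; congr (_ - _).
  by apply: eq_bigr => k _; exact: mulrC.
apply: le_lt_trans (point_le degp _ _) _; rewrite (hnZ hH) normcX.
apply: (@le_lt_trans _ _ (e / 2)); last by rewrite ltr_pdivrMr // ltr_pMr // ltr1n.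
rewrite exprMn mulrC -mulrA in hn; apply: le_trans hn.
by rewrite ler_wpM2l ?exprn_ge0 ?normc_ge0.
Qed.

(** The kernel of [(1 - z P)^-1], completed by its limits at [z = 0] and, when [lam = 0] is regular,
    at infinity. *)
Definition gkernel x y (p : sphere R) : Cx :=
  if p is Some z then (if z == 0 then (x == y)%:R else z^-1 * resolvent z^-1 (delta adj y 1) x) else 0.

Lemma gkernel_solution z y : good (Some z) -> exists u : H,
  u - z *: P u = delta adj y 1 /\ forall x, gkernel x y (Some z) = u x.
Proof.
have [-> _|z0] := eqVneq z 0.
  exists (delta adj y 1); split; first by rewrite scale0r subr0.
  by move=> x; rewrite /gkernel eqxx deltaE; case: eqP.
move=> /(good_some z0) hr; exists (z^-1 *: resolvent z^-1 (delta adj y 1)); split.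
  rewrite (opZ Plin) scalerA mulfV // scale1r -[RHS](resolventP (delta adj y 1) hr).
  by rewrite [RHS]res_opE.
by move=> x; rewrite /gkernel (negPf z0) l2Z.
Qed.

Lemma solve_operator z : good (Some z) -> exists (S : H -> H) (K : R),
  [/\ forall c u v, S (c *: u + v) = c *: S u + S v, forall u, nm (S u) <= K * nm u, 0 <= K &
      forall u f, u - z *: P u = f -> u = S f].
Proof.
have [-> _|z0] := eqVneq z 0.
  exists id, 1; split=> // [u|u f <-]; first by rewrite mul1r.
  by rewrite scale0r subr0.
move=> /(good_some z0) hr; have [K K0 hK] := resolvent_bound hr.
exists (fun f => z^-1 *: resolvent z^-1 f), (normc z^-1 * K); split.
- by move=> c u v; rewrite resolvent_linear // scalerDr !scalerA [z^-1 * c]mulrC.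
- by move=> u; rewrite (hnZ hH) -mulrA ler_wpM2l ?normc_ge0.
- by rewrite mulr_ge0 ?normc_ge0 // ltW.
move=> u f <-; rewrite (_ : u - z *: P u = z *: L z^-1 u); last first.
  by rewrite res_opE scalerBr scalerA mulfV // scale1r.
rewrite (@resolvent_eq _ (z *: u)) ?scalerA ?mulVf ?scale1r //.
by rewrite (res_opZ Plin).
Qed.

(** With [S] the inverse of [1 - z P], the equation at [z + h] reads [u = S delta + h S P u]. *)
Lemma gkernel_series z x y : good (Some z) -> exists (a : nat -> Cx) (r : R), 0 < r /\
  forall h, normc h < r -> series (fun n => a n * h ^+ n) @ \oo --> gkernel x y (Some (z + h)).
Proof.
move=> gz; have [S [K [Slin hS K0 hsol]]] := solve_operator gz.
have [r r0 hr] := good_open gz.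
exists (fun n => iter n (S \o P) (S (delta adj y 1)) x), (Num.min r (K + 1)^-1).
have K1 : 0 < K + 1 by rewrite ltr_wpDl.
split; first by rewrite lt_min r0 invr_gt0.
move=> h; rewrite lt_min => /andP[/hr gh hK].
have [u [hu ->]] := gkernel_solution y gh.
apply: (@neumann_series (S \o P) _ u K).
- by move=> c f g /=; rewrite Plin Slin.
- by move=> f /=; apply: le_trans (hS _) _; rewrite ler_wpM2l // (op_contr hH Pcontr).
- exact: K0.
- have -> : S (delta adj y 1) + h *: (S \o P) u = S (h *: P u + delta adj y 1).
    by rewrite Slin addrC.
  apply: hsol; rewrite -hu scalerDl opprD !addrA addrC addrA; congr (_ + _).
  by rewrite addKr.
rewrite -(ltr_pM2r K1) mulVf ?gt_eqF // in hK; apply: le_lt_trans hK.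
by rewrite ler_wpM2l ?normc_ge0 // lerDl.
Qed.

(** At infinity the coordinate is [h = lam] and the kernel is [h R(h)], so the Neumann series of
    [R(h)] around [R(0)] is shifted by one. *)
Lemma gkernel_analytic p x y : good p -> analytic_at (gkernel x y) p.
Proof.
case: p => [z gz|g0].
  by have [a [r [r0 ha]]] := gkernel_series x y gz; exists a, r.
have r0 : reg 0 by apply/good_inv; rewrite /sphere_inv eqxx.
have [K K0 hK] := resolvent_bound r0.
have [r rr hr] := good_open g0.
pose b n := iter n (fun f => - resolvent 0 f) (resolvent 0 (delta adj y 1)) x.
have K1 : 0 < K + 1 by rewrite ltr_wpDl // ltW.
exists (fun n => if n is m.+1 then b m else 0), (Num.min r (K + 1)^-1); first by rewrite lt_min rr invr_gt0.
move=> h; rewrite lt_min => /andP[/hr gh hh].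
have ser n : series (fun n => (if n is m.+1 then b m else 0) * h ^+ n) n.+1 = h * series (fun n => b n * h ^+ n) n.
  rewrite /series /= big_nat_recl //= mul0r add0r mulr_sumr; apply: eq_bigr => k _.
  by rewrite exprS mulrCA.
have lim (l : Cx) : series (fun n => b n * h ^+ n) @ \oo --> l ->
    series (fun n => (if n is m.+1 then b m else 0) * h ^+ n) @ \oo --> h * l.
  move=> /ccvgP hl; apply/ccvgP => e e0.
  have h1 : 0 < normc h + 1 by rewrite ltr_wpDl ?normc_ge0.
  have [N hN] := hl (e / (normc h + 1)) (divr_gt0 e0 h1).
  exists N.+1 => -[//|n] /hN; rewrite ser -mulrBr normcM ltr_pdivlMr // => hn.
  by apply: le_lt_trans hn; rewrite mulrC ler_wpM2l ?normc_ge0 // lerDl.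
rewrite /chart /sphere_inv; have [h0|h0] := eqVneq h 0.
  rewrite [gkernel _ _ _](_ : _ = h * b 0%N); last by rewrite h0 mul0r.
  apply: lim; apply/ccvgP => e e0; exists 1%N => -[//|n] _; rewrite /series /= big_nat_recl // h0.
  by rewrite expr0 mulr1 big1 ?addr0 ?subrr ?Normc.normc0 // => k _; rewrite expr0n /= mulr0.
have rh : reg h by apply/good_inv; move: gh; rewrite /chart.
rewrite /gkernel invr_eq0 (negPf h0) invrK; apply: lim.
apply: (@neumann_series (fun f => - resolvent 0 f) _ _ K).
- by move=> c u v; rewrite resolvent_linear // opprD scalerN.
- by move=> u; rewrite (hnN hH).
- exact: ltW.
- set u := resolvent h _; have hu := resolventP (delta adj y 1) rh; rewrite -/u in hu.
  rewrite scalerN -scaleNr -[RHS]addrC -resolvent_linear //; apply/esym/resolvent_eq => //.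
  by rewrite -hu !res_opE scale0r sub0r scaleNr addrA addNr add0r.
rewrite -(ltr_pM2r K1) mulVf ?gt_eqF // in hh; apply: le_lt_trans hh.
by rewrite ler_wpM2l ?normc_ge0 // lerDl.
Qed.

Lemma stepn_iter n x y : stepn R adj n x y = iter n P (delta adj y 1) x.
Proof.
elim: n x => [|n IH] x; first by rewrite /= ; case: eqP.
rewrite iterS /= /P_op; apply: eq_fsbigr => z _; by rewrite IH.
Qed.

Lemma gkernel_green x y z : normc z < 1 -> gkernel x y (Some z) = green adj x y z.
Proof.
move=> z1; have gz : good (Some z).
  have [->|z0] := eqVneq z 0; first exact: good_zero.
  apply/good_some => //; apply: large_regular.
  by rewrite normcV -[X in X < _]invr1 ltf_pV2 ?posrE ?normc_gt0.
have [u [hu ->]] := gkernel_solution y gz.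
have := @neumann_series P (delta adj y 1) u 1 z x Plin.
rewrite mulr1 => /(_ _ ler01 _ z1) h; rewrite /green; apply/esym/cvg_lim; first exact: norm_hausdorff.
have -> : (fun n => stepn R adj n x y * z ^+ n) = (fun n => iter n P (delta adj y 1) x * z ^+ n).
  by apply/funext => n; rewrite stepn_iter.
apply: h; first by move=> f; rewrite mul1r; exact: (op_contr hH Pcontr f).
by rewrite -hu subrK.
Qed.

Lemma chart_ball_open p (r : R) (h0 : Cx) : normc h0 < r ->
  nbhs (chart p h0) (chart p @` [set h | normc h < r]).
Proof.
case: p => [z|] hr /=.
  apply/snbhsP; exists (r - normc h0); first by rewrite subr_gt0.
  move=> h hh; exists (h0 + h) => /=; last by rewrite addrA.
  by apply: le_lt_trans (normcD _ _) _; rewrite -ltrBrDl.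
apply/snbhsP; rewrite /sphere_inv; have [e|h00] := eqVneq h0 0.
  exists r; first by apply: le_lt_trans hr; exact: normc_ge0.
  by move=> h hh; exists h.
have hi : h0^-1 != 0 by rewrite invr_eq0.
have rr : 0 < r - normc h0 by rewrite subr_gt0.
have [d d0 hd] := invc_near hi rr; exists d => // k kd.
have [|b0 bd] := hd (h0^-1 + k); first by rewrite addrAC subrr add0r.
exists (h0^-1 + k)^-1; last by rewrite /chart /sphere_inv invr_eq0 (negPf b0) invrK.
rewrite /=.
rewrite invrK in bd; have := normcD h0 ((h0^-1 + k)^-1 - h0); rewrite subrKC.
move: bd; lra.
Qed.

Lemma half_nonreal (z : Cx) : complex.Im z != 0 -> exists s : bool, 0 < (if s then complex.Im z else - complex.Im z).
Proof.
move=> h; have [p|p] := ltP 0 (complex.Im z); first by exists true.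
by exists false; rewrite oppr_gt0 lt_neqAle h.
Qed.

(** [gkernel] is the continuation, on the union of the unit disc, both open half planes and a chart
    disc at [p] consisting of good points. Each piece is convex in a chart, and both the unit disc
    and the chart disc contain nonreal points, which makes the union connected. *)
Lemma green_regular_good p x y : good p -> green_regular_at adj x y p.
Proof.
move=> gp; have [r r0 hr] := good_open gp.
pose Hp (s : bool) : set Cx := [set z | 0 < (if s then complex.Im z else - complex.Im z)].
pose D : set Cx := [set z | normc z < 1].
pose Bl : set Cx := [set h | normc h < r].
have cH s : convex_set (Hp s).
  move=> a b t; rewrite /Hp /= => ha hb t0 t1.
  have -> : complex.Im (a + t%:C%C * (b - a)) = (1 - t) * complex.Im a + t * complex.Im b.
    by rewrite cImD cImM /= cImD cImN; ring.
  by case: s ha hb => ha hb; nra.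
have cB (e : R) : convex_set [set h : Cx | normc h < e].
  move=> a b t /= ha hb t0 t1.
  have -> : a + t%:C%C * (b - a) = (1 - t)%:C%C * a + t%:C%C * b by rewrite rmorphB rmorph1 /=; ring.
  apply: le_lt_trans (normcD _ _) _; rewrite !normcM !normc_real ger0_norm ?subr_ge0 // ger0_norm //.
  apply: (@le_lt_trans _ _ (Num.max (normc a) (normc b))); last by rewrite gt_max ha hb.
  have : normc a <= Num.max (normc a) (normc b) by rewrite le_max lexx.
  have : normc b <= Num.max (normc a) (normc b) by rewrite le_max lexx orbT.
  have aux (p1 p2 M : R) : p2 <= M -> p1 <= M -> (1 - t) * p1 + t * p2 <= M by nra.
  exact: aux.
pose O0 := chart (Some 0) @` D; pose O1 s := chart (Some 0) @` Hp s; pose O2 := chart p @` Bl.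
pose Om := O0 `|` O1 true `|` O1 false `|` O2.
have mO1 z : complex.Im z != 0 -> Om (Some z).
  move=> /half_nonreal [s hs]; left.
  by case: s hs => hs; [left; right|right]; exists z; rewrite //= add0r.
exists Om, (gkernel x y); split.
- rewrite openE => q [[[[z /= zD <-]|[z /= zH <-]]|[z /= zH <-]]|[h /= hB <-]].
  + rewrite add0r; apply/snbhsP; exists (1 - normc z); first by rewrite subr_gt0.
    move=> h hh; do 3 left; exists (z + h) => /=; last by rewrite add0r.
    by apply: le_lt_trans (normcD _ _) _; rewrite -ltrBrDl.
  + rewrite add0r; apply/snbhsP; exists (complex.Im z) => // h hh; apply: mO1.
    by rewrite cImD; have := ler_Im_normc h; rewrite ler_norml => /andP[]; move: hh zH; rewrite /Hp /=; lra.
  + rewrite add0r; apply/snbhsP; exists (- complex.Im z) => // h hh; apply: mO1.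
    by rewrite cImD; have := ler_Im_normc h; rewrite ler_norml => /andP[]; move: hh zH; rewrite /Hp /=; lra.
  + by apply: filterS (chart_ball_open p hB) => q' hq; right.
- have i2 s : D (0 +i* (if s then 2^-1 else - 2^-1))%C /\ Hp s (0 +i* (if s then 2^-1 else - 2^-1))%C.
    split; rewrite /D /Hp /=; last by case: s => /=; lra.
    rewrite expr0n /= add0r sqrtr_sqr; case: s; rewrite ?normrN ger0_norm ?invr_ge0 // invf_lt1 ?ltr1n //.
  have c1 : connected (O0 `|` O1 true).
    refine (connectedU _ (chart_convex_connected (cB 1)) (chart_convex_connected (cH true))).
    have [h1 h2] := i2 true; exists (chart (Some 0) (0 +i* 2^-1)%C); split; by eexists; [|reflexivity].
  have c2 : connected (O0 `|` O1 true `|` O1 false).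
    refine (connectedU _ c1 (chart_convex_connected (cH false))).
    have [h1 h2] := i2 false; exists (chart (Some 0) (0 +i* - 2^-1)%C); split; last by eexists; [|reflexivity].
    by left; eexists; [|reflexivity].
  refine (connectedU _ c2 (chart_convex_connected (cB r))).
  have [q iq [h hB hq]] : exists2 z : Cx, complex.Im z != 0 & exists2 h, Bl h & chart p h = Some z.
    case: (p) => [z|].
      have [z' iz hz] := nonreal_near z r0; exists z' => //; exists (z' - z) => //=.
      by rewrite subrKC.
    have [h ih hh] := nonreal_near 0 r0; rewrite subr0 in hh.
    have h0 : h != 0 by apply: contraNneq ih => ->.
    exists h^-1; last by exists h => //=; rewrite /sphere_inv (negPf h0).
    by rewrite cImV // mulf_neq0 ?oppr_eq0 // invr_eq0 sqrf_eq0 normc_eq0.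
  exists (Some q); split; last by exists h.
  have [s hs] := half_nonreal iq.
  by case: s hs => hs; [left; right|right]; exists q; rewrite //= add0r.
- move=> z z1; split; last exact: gkernel_green.
  by do 3 left; exists z; rewrite //= add0r.
- have gnr z : complex.Im z != 0 -> good (Some z).
    move=> iz; have z0 : z != 0 by apply: contraNneq iz => ->.
    apply/(good_some z0)/nonreal_regular.
    by rewrite cImV // mulf_neq0 ?oppr_eq0 // invr_eq0 sqrf_eq0 normc_eq0.
  move=> q Oq; apply: gkernel_analytic; move: Oq => [[[[z /= zD <-]|[z /= zH <-]]|[z /= zH <-]]|[h /= hB <-]].
  + rewrite add0r; have [->|z0] := eqVneq z 0; first exact: good_zero.
    apply/good_some => //; apply: large_regular.
    by rewrite normcV -[X in X < _]invr1 ltf_pV2 ?posrE ?normc_gt0.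
  + by rewrite add0r; apply: gnr; move: zH; rewrite /Hp /= => /gt_eqF ->.
  + by rewrite add0r; apply: gnr; move: zH; rewrite /Hp /= oppr_gt0 => /lt_eqF ->.
  + exact: hr.
split; last by [].
by right; exists 0; [rewrite /Bl /mkset Normc.normc0|exact: chart0].
Qed.

Lemma real_conj lam : complex.Im lam = 0 -> conjc lam = lam.
Proof. by case: lam => a b /= ->; rewrite oppr0. Qed.

Lemma imV lam : complex.Im lam != 0 -> complex.Im (lam^-1) != 0.
Proof.
move=> il; have l0 : lam != 0 by apply: contraNneq il => ->.
by rewrite cImV // mulf_neq0 ?oppr_eq0 // invr_eq0 sqrf_eq0 normc_eq0.
Qed.

Lemma imV0 lam : complex.Im lam = 0 -> complex.Im lam^-1 = 0.
Proof.
by have [->|l0] := eqVneq lam 0; [rewrite invr0|rewrite cImV // => ->; rewrite oppr0 mul0r].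
Qed.

Lemma real_chart_nonreal lam h : complex.Im lam = 0 -> complex.Im h != 0 -> good (chart (sphere_inv lam) h).
Proof.
move=> il ih; have gnr z : complex.Im z != 0 -> good (Some z).
  move=> iz; have z0 : z != 0 by apply: contraNneq iz => ->.
  exact/(good_some z0)/nonreal_regular/imV.
rewrite [sphere_inv lam]/sphere_inv; case: eqVneq => [_|l0].
  exact/good_inv/nonreal_regular.
by apply: gnr; rewrite cImD imV0 // add0r.
Qed.

Lemma real_chart_real lam t h : complex.Im lam = 0 -> complex.Im t = 0 ->
  chart (sphere_inv lam) h = sphere_inv t -> complex.Im h = 0.
Proof.
move=> il it; rewrite [sphere_inv lam]/sphere_inv; case: eqVneq => [_|l0].
  by move/sphere_inv_inj => ->.
rewrite /sphere_inv; case: eqVneq => // t0 [] /(canRL (addKr _)) ->.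
rewrite cImD imV0 // addr0; case: (lam) il => a b /= e.
by rewrite e mul0r !oppr0.
Qed.

Lemma spectral_real lam : ~ good (sphere_inv lam) -> complex.Im lam = 0.
Proof. by move=> hg; apply/eqP; apply: contra_notT hg => il; apply/good_inv/nonreal_regular. Qed.

(** * Uniqueness of continuations of the Green functions *)

Section Continuation.
Context (hgap : forall a b : R, a < b -> exists r : R, [/\ a < r, r < b & reg r%:C%C]).

Lemma gap_chart lam (r : R) : complex.Im lam = 0 -> 0 < r -> exists h2 : Cx,
  [/\ complex.Im h2 = 0, normc h2 < r & good (chart (sphere_inv lam) h2)].
Proof.
move=> il r0; have n0 : normc (0 : Cx) < r by rewrite Normc.normc0.
have hW := chart_ball_open (sphere_inv lam) n0; rewrite chart0 in hW.
have [d d0 hd] := chart_cont (p := None) (h0 := lam) hW.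
have [t [t1 t2 ht]] : exists r0 : R, [/\ complex.Re lam < r0, r0 < complex.Re lam + d & reg r0%:C%C].
  by apply: hgap; lra.
have [|h2 hr e] := hd t%:C%C.
  rewrite (_ : _ - _ = (t - complex.Re lam)%:C%C).
    by rewrite normc_real gtr0_norm; lra.
  by case: (lam) il => a b /= ->; apply/eqP; rewrite eq_complex /= subrr !eqxx.
exists h2; split=> //; last by rewrite e; exact/good_inv.
exact: real_chart_real il (_ : complex.Im t%:C%C = 0) e.
Qed.

(** For [s = 1] and [s = -1] the two open half-discs, each with the real point [h2] added, through
    which they get joined. *)
Definition half (s : R) (r : R) (h2 : Cx) : set Cx :=
  [set h | normc h < r /\ (h = h2 \/ 0 < s * complex.Im h)].

Lemma half_convex s r h2 : complex.Im h2 = 0 -> convex_set (half s r h2).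
Proof.
move=> i2 x y t [xr hx] [yr hy] t0 t1; split.
  have -> : x + t%:C%C * (y - x) = (1 - t)%:C%C * x + t%:C%C * y by rewrite rmorphB rmorph1; ring.
  apply: le_lt_trans (normcD _ _) _; rewrite !normcM !normc_real !ger0_norm //; last by lra.
  have := normc_ge0 x; have := normc_ge0 y; have [->|t0'] := eqVneq t 0; first by rewrite subr0 mul0r addr0 mul1r.
  have {}t0 : 0 < t by rewrite lt_neqAle eq_sym t0'.
  by nra.
have iE : complex.Im (x + t%:C%C * (y - x)) = (1 - t) * complex.Im x + t * complex.Im y.
  by case: (x) (y) => [a b] [c d] /=; ring.
case: (eqVneq t 0) => [->|tn0]; first by rewrite mul0r addr0.
case: (eqVneq t 1) => [->|tn1]; first by rewrite mul1r subrKC.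
have {}t0 : 0 < t by rewrite lt_neqAle eq_sym tn0.
have {}t1 : t < 1 by rewrite lt_neqAle tn1.
case: hx => hx; case: hy => hy.
- by left; rewrite hx hy subrr mulr0 addr0.
- by right; rewrite iE hx i2; nra.
- by right; rewrite iE hy i2; nra.
- by right; rewrite iE; nra.
Qed.

Context (x y : V) (Om : set (sphere R)) (f : sphere R -> Cx).
Context (Omo : open Om) (Omc : connected Om).
Context (Om1 : forall z : Cx, normc z < 1 -> Om (Some z) /\ f (Some z) = green adj x y z).
Context (fan : forall q, Om q -> analytic_at f q).

(** Spectral points belong to [W] vacuously, so that [W] can be a neighbourhood of them. *)
Let W : set (sphere R) := [set q | good q -> f q = gkernel x y q].

(** Two analytic functions agree near [q] or differ on a punctured disc; interior points of [W]
    accumulating at [q] leave only the first case. *)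
Lemma identity_good q : Om q -> good q -> closure W° q -> nbhs q W.
Proof.
move=> Oq gq cq; have [r r0 hr] := good_open gq.
have := analytic_isolated (fan Oq) (gkernel_analytic x y gq).
case=> [[d d0 hd]|[d d0 hd]].
  by apply/snbhsP; exists d => // h /hd e _.
exfalso; pose e := Num.min r d; have e0 : 0 < e by rewrite lt_min r0.
have n0 : normc (0 : Cx) < e by rewrite Normc.normc0.
have hB := chart_ball_open q n0; rewrite chart0 in hB.
have [q1 [/nbhs_interior Wq' [h0 he eq]]] := cq _ hB; rewrite -eq in Wq'.
have [d1 d10 hd1] := chart_cont Wq'.
have he' : 0 < Num.min d1 (e - normc h0) by rewrite lt_min d10 subr_gt0.
have [h1 ih1] := nonreal_near h0 he'; rewrite lt_min => /andP[l1 l2].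
have h1e : normc h1 < e.
  by have := normcD h0 (h1 - h0); rewrite subrKC; lra.
move: h1e; rewrite lt_min => /andP[l3 l4].
apply: (hd h1 _ l4); first by apply: contraNneq ih1 => ->.
by apply: (nbhs_singleton (hd1 _ l1)); exact: hr.
Qed.

Lemma identity_connected G : connected G -> G `<=` Om -> G `<=` good -> (exists2 q, G q & nbhs q W) ->
  G `<=` W°.
Proof.
move=> Gc GO Gg hG; apply: (connected_clopen Gc) => // q Gq Wq.
  by apply: nbhs_interior.
apply: contrapT => hn; apply: Wq; apply: identity_good; [exact: GO|exact: Gg|].
move=> B hB; apply: contrapT => hE; apply: hn; apply: filterS hB => q' Bq' Wq'.
by apply: hE; exists q'.
Qed.

(* Both half-discs at [q] belong to the resolvent set, and they communicate through a real
   point of it. *)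
Lemma identity_spectral q : Om q -> ~ good q -> closure W° q -> nbhs q W.
Proof.
have [->|/sphere_inv_surj[lam ->] Oq] := pselect (q = Some 0).
  by move=> _ ng; case: ng; exact: good_zero.
move=> ng cq; have il := spectral_real ng; set p := sphere_inv lam in Oq ng cq *.
have /snbhsP[r r0 hr] := open_nbhs_nbhs (conj Omo Oq).
have [h2 [i2 h2r g2]] := gap_chart il r0.
pose G := chart p @` half 1 r h2 `|` chart p @` half (-1) r h2.
have hG h : normc h < r -> complex.Im h != 0 -> G (chart p h).
  move=> hh; case/lt_total/orP => ih; [right|left]; exists h => //; split=> //; right.
    by rewrite mulN1r oppr_gt0.
  by rewrite mul1r.
have hGi q' : G q' -> exists h, [/\ q' = chart p h, normc h < r & h = h2 \/ complex.Im h != 0].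
  case=> -[h [hh hd] <-]; exists h; split=> //; case: hd => hd; [by left|right|by left|right].
    by move: hd; rewrite mul1r => /gt_eqF ->.
  by move: hd; rewrite mulN1r oppr_gt0 => /lt_eqF ->.
have near_nonreal h (d : R) : normc h < r -> 0 < d -> exists h1 : Cx,
    [/\ complex.Im h1 != 0, normc h1 < r & normc (h1 - h) < d].
  move=> hh d0; have m0 : 0 < Num.min d (r - normc h) by rewrite lt_min d0 subr_gt0.
  have [h1 ih1] := nonreal_near h m0; rewrite lt_min => /andP[l1 l2]; exists h1; split=> //.
  by have := normcD h (h1 - h); rewrite subrKC; lra.
have GW : G `<=` W°.
  apply: identity_connected.
  - apply: connectedU; [|exact: chart_convex_connected (half_convex i2)..].
    by exists (chart p h2); split; exists h2 => //; split=> //; left.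
  - by move=> _ /hGi[h [-> hh _]]; apply: hr.
  - by move=> _ /hGi[h [-> _ [->//|ih]]]; exact: real_chart_nonreal.
  have n0 : normc (0 : Cx) < r by rewrite Normc.normc0.
  have hB := chart_ball_open p n0; rewrite chart0 in hB.
  have [q1 [/nbhs_interior Wq' [h0 he eq]]] := cq _ hB; rewrite -eq in Wq'.
  have [d1 d10 hd1] := chart_cont Wq'.
  have [h1 [ih1 h1r h1d]] := near_nonreal _ _ he d10.
  by exists (chart p h1); [exact: hG|exact: hd1].
apply/snbhsP; exists r => // h hh; have [ih|ih] := eqVneq (complex.Im h) 0; last first.
  exact: nbhs_singleton (GW _ (hG _ hh ih)).
move=> gh; apply: (nbhs_singleton (identity_good (hr _ hh) gh _)) => //.
move=> B /chart_cont[d d0 hd]; have [h1 [ih1 h1r h1d]] := near_nonreal _ _ hh d0.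
by exists (chart p h1); split; [apply: GW; exact: hG|exact: hd].
Qed.

(** The interior of [W] is relatively clopen in the connected set [Om], closedness being
    [identity_good] and [identity_spectral], and it contains [z = 0]. *)
Lemma identity_green q : Om q -> exists2 r : R, 0 < r &
  forall h, normc h < r -> good (chart q h) -> f (chart q h) = gkernel x y (chart q h).
Proof.
move=> Oq; suff /snbhsP : nbhs q W by [].
suff : Om `<=` W° by exact.
apply: (connected_clopen Omc) => [q' _ Wq'|q' Oq' nW|]; first exact: nbhs_interior.
  apply: contrapT => hn; apply: nW.
  have cq : closure W° q'.
    move=> B hB; apply: contrapT => hE; apply: hn; apply: filterS hB => q1 Bq1 Wq1.
    by apply: hE; exists q1.
  by have [gq|ngq] := pselect (good q'); [exact: identity_good|exact: identity_spectral].
exists (Some 0); first by apply: (Om1 _).1; rewrite Normc.normc0.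
apply/snbhsP; exists 1 => // h h1 _; rewrite /chart add0r (Om1 h1).2.
by rewrite gkernel_green.
Qed.

End Continuation.

Lemma res_op_adj lam (u v : H) : ip (L lam u) v = ip u (L (conjc lam) v).
Proof.
by rewrite !res_opE (ipDl hH) (ipDr hH) (ipNl hH) (ipNr hH) (ipZ hH) Psym.
Qed.

Lemma ip_delta_i (u : H) x : ip u (delta adj x ('i%C : Cx)) = wt adj x * complex.Im (u x).
Proof. by rewrite ip_delta; case: (u x) => a b /=; congr (_ * _); ring. Qed.

Lemma delta_scale x (c : Cx) : c *: delta adj x 1 = delta adj x c :> H.
Proof. by apply: l2_ext => y; rewrite l2Z !deltaE; case: ifP; rewrite ?mulr1 ?mulr0. Qed.

(** Test the adjoint relation between [lam - P] and [conj lam - P] with [i v]. *)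
Lemma resolvent_conj_im lam (u v : H) x : L lam u = delta adj x 1 -> L (conjc lam) v = delta adj x 1 ->
  complex.Im (v x) = - complex.Im (u x).
Proof.
move=> hu hv; have := res_op_adj lam u (('i%C : Cx) *: v).
rewrite hu (res_opZ Plin) hv delta_scale ip_delta_i.
rewrite ip_symm ip_delta l2Z.
have w0 : wt adj x != 0 :> R by rewrite gt_eqF // (wt_gt0 degp).
by move=> /(mulfI w0); case: (u x) (v x) => a b [c d] /= e; lra.
Qed.

Lemma resolvent_norm lam (u : H) x : L lam u = delta adj x 1 ->
  `|complex.Im lam| * nm u ^+ 2 = wt adj x * `|complex.Im (u x)|.
Proof.
move=> hu; have := ip_res_self hH Plin Psym ('i%C : Cx) lam u.
rewrite hu delta_scale ip_symm ip_delta_i -(hn2 hH) => e.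
have e2 : wt adj x * complex.Im (u x) = - complex.Im lam * nm u ^+ 2.
  by rewrite e; case: (lam) => a b /=; ring.
rewrite -[nm u ^+ 2]ger0_norm ?sqr_ge0 // -normrM -normrN -mulNr -e2 normrM.
by rewrite (ger0_norm (x := wt adj x)) // ltW // wt_gt0.
Qed.

Lemma resolvent_norm_le lam (u v : H) x (M : R) : complex.Im lam != 0 ->
  L lam u = delta adj x 1 -> L (conjc lam) v = delta adj x 1 ->
  normc (u x - v x) <= M * `|complex.Im lam| -> nm u ^+ 2 <= wt adj x * M.
Proof.
move=> il hu hv hM; have i0 : 0 < `|complex.Im lam| by rewrite normr_gt0.
rewrite -(ler_pM2l i0) (resolvent_norm hu) mulrCA ler_wpM2l ?(ltW (wt_gt0 degp _)) //.
rewrite mulrC; apply: le_trans hM; have := resolvent_conj_im hu hv.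
have := ler_Im_normc (u x - v x); move=> h1 h2; apply: le_trans h1; move: h2; case: (u x) (v x) => a b [c d] /= ->.
rewrite opprK -mulr2n -mulr_natl normrM ger0_norm //.
by have := normr_ge0 b; lra.
Qed.

(* The diagonal kernel [K] satisfies [K (conj lam) = conj (K lam)], so its continuation being
   Lipschitz yields [|Im K| <= M |Im lam|], and [|Im lam| |R delta_x| ^ 2] is [deg x |Im K|]. *)
Lemma resolvent_local_bound lam0 x (f : sphere R -> Cx) (r : R) : complex.Im lam0 = 0 -> 0 < r ->
  analytic_at f (sphere_inv lam0) -> (sphere_inv lam0 = infty -> f infty = 0) ->
  (forall h, normc h < r -> good (chart (sphere_inv lam0) h) ->
     f (chart (sphere_inv lam0) h) = gkernel x x (chart (sphere_inv lam0) h)) ->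
  exists M d : R, 0 < d /\ forall lam u, complex.Im lam != 0 -> normc (lam - lam0) < d ->
    L lam u = delta adj x 1 -> nm u <= M.
Proof.
move=> il r0 [a [s s0 ha]] fi hf.
suff [M [d [d0 hM]]] : exists M d : R, 0 < d /\ forall lam u v, complex.Im lam != 0 ->
    normc (lam - lam0) < d -> L lam u = delta adj x 1 -> L (conjc lam) v = delta adj x 1 ->
    normc (u x - v x) <= M * `|complex.Im lam|.
  exists (wt adj x * M + 1), d; split=> // lam u ilam hl hu.
  have il' : complex.Im (conjc lam) != 0 by case: (lam) ilam => p q /=; rewrite oppr_eq0.
  have hv := resolventP (delta adj x 1) (nonreal_regular il').
  have := resolvent_norm_le ilam hu hv (hM _ _ _ ilam hl hu hv).
  have := hn_ge0 (ip := ip) u; set n := nm u; nra.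
have kE lam u : complex.Im lam != 0 -> L lam u = delta adj x 1 ->
    gkernel x x (sphere_inv lam) = lam * u x.
  move=> ilam hu; have l0 : lam != 0 by apply: contraNneq ilam => ->.
  rewrite /sphere_inv (negPf l0) /= invr_eq0 (negPf l0) invrK.
  by rewrite (resolvent_eq (nonreal_regular ilam) hu).
have gE lam : complex.Im lam != 0 -> good (sphere_inv lam).
  by move=> ilam; apply/good_inv/nonreal_regular.
have ic lam : complex.Im lam != 0 -> complex.Im (conjc lam) != 0.
  by case: lam => p q /=; rewrite oppr_eq0.
have dc lam : normc (lam - conjc lam) = 2 * `|complex.Im lam|.
  case: lam => p q /=; rewrite subrr opprK expr0n /= add0r sqrtr_sqr.
  have -> : q + q = 2 * q by ring.
  by rewrite normrM (ger0_norm (x := 2)).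
(* At [lam0 = 0] the diagonal kernel is [f / lam], which is still a power series because the
   continuation vanishes at infinity. *)
have [l0|l0] := eqVneq lam0 0.
  have pE : sphere_inv lam0 = infty by rewrite /sphere_inv l0 eqxx.
  rewrite pE in ha fi hf.
  have ha' : power_series a s (fun h => f (sphere_inv h)) by move=> h /ha.
  have g0 : f (sphere_inv 0) = 0 by rewrite /sphere_inv eqxx fi.
  have a0 : a 0%N = 0 by rewrite -(power_series0 s0 ha').
  have [g1 hg1 gg] := power_series_shift s0 ha' a0.
  have [M [d [M0 d0 hM]]] := power_series_lip s0 hg1.
  exists (2 * M), (Num.min d (Num.min r s)); split; first by rewrite !lt_min d0 r0.
  move=> lam u v ilam; rewrite l0 subr0 !lt_min => /and3P[h1 h2 h3] hu hv.
  have g1E mu (u' : H) : complex.Im mu != 0 -> normc mu < r -> normc mu < s ->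
      L mu u' = delta adj x 1 -> u' x = g1 mu.
    move=> imu h4 h5 hu'; have mu0 : mu != 0 by apply: contraNneq imu => ->.
    apply: (mulfI mu0); rewrite -(kE _ _ imu hu') -gg // -[sphere_inv mu]/(chart None mu) hf //.
    exact: gE.
  have nc : normc (conjc lam) = normc lam by exact: normcJ.
  rewrite (g1E _ _ ilam h2 h3 hu) (g1E _ _ (ic _ ilam) _ _ hv) ?nc //.
  by have := hM lam (conjc lam) h1; rewrite nc dc => /(_ h1); lra.
have pE : sphere_inv lam0 = Some lam0^-1 by rewrite /sphere_inv (negPf l0).
rewrite pE in ha hf; have ha' : power_series a s (fun h => f (Some (lam0^-1 + h))) by move=> h /ha.
have [M [d [M0 d0 hM]]] := power_series_lip s0 ha'.
set g := fun h => f _ in ha' hM.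
pose e := Num.min 1 (Num.min d r); have e0 : 0 < e by rewrite !lt_min ltr01 d0.
have [d1 d10 hd1] := invc_near l0 e0.
(* Near [lam0], [A] bounds [|1 / lam|], [B] bounds [|g|] and [m] bounds [|lam|] from below: the
   constants of the product rule for [lam^-1 g (lam^-1 - lam0^-1)]. *)
pose B := normc (g 0) + M; pose A := normc lam0^-1 + 1.
pose m := normc lam0 / 2; have n0 : 0 < normc lam0 by rewrite normc_gt0.
exists ((A * M + B) * (2 / m ^+ 2)), (Num.min d1 m); split; first by rewrite lt_min d10 divr_gt0.
have uE lam (u : H) : complex.Im lam != 0 -> normc (lam - lam0) < Num.min d1 m ->
    L lam u = delta adj x 1 ->
    u x = lam^-1 * g (lam^-1 - lam0^-1) /\ normc (lam^-1 - lam0^-1) < e /\ m <= normc lam.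
  move=> ilam; rewrite lt_min => /andP[/hd1[ln0 h1] h2] hu.
  split; last by split=> //; have := normcB_ge lam0 (lam - lam0); rewrite subrKC /m; rewrite /m in h2; lra.
  move: h1; rewrite !lt_min => /and3P[_ _ hr].
  apply: (mulfI ln0); rewrite -(kE _ _ ilam hu) mulrA divff // mul1r /g.
  have := hf _ hr; rewrite /chart subrKC => ->; first by rewrite /sphere_inv (negPf ln0).
  by have := gE _ ilam; rewrite /sphere_inv (negPf ln0).
move=> lam u v ilam hl hu hv.
have hl' : normc (conjc lam - lam0) < Num.min d1 m.
  by rewrite -{1}(real_conj il) -rmorphB; move: hl; rewrite -normcJ.
have [-> [h1 h2]] := uE _ _ ilam hl hu.
have [-> [h3 h4]] := uE _ _ (ic _ ilam) hl' hv.
set z := lam^-1; set z' := (conjc lam)^-1.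
have zz : normc (z - z') <= 2 / m ^+ 2 * `|complex.Im lam|.
  have l1 : lam != 0 by apply: contraNneq ilam => ->.
  have l2 : conjc lam != 0 by apply: contraNneq (ic _ ilam) => ->.
  have m0 : 0 < m by rewrite /m divr_gt0.
  rewrite (_ : z - z' = - (lam - conjc lam) / (lam * conjc lam)); last by rewrite /z /z'; field; rewrite l2.
  rewrite normcM normcN normcV normcM dc mulrAC ler_wpM2r //.
  rewrite ler_pM2l // lef_pV2 ?posrE ?mulr_gt0 ?normc_gt0 ?exprn_gt0 //.
  by rewrite expr2; apply: ler_pM => //; exact: ltW.
move: h1 h3; rewrite !lt_min => /and3P[h11 h12 _] /and3P[h31 h32 _].
rewrite (_ : _ - _ = z * (g (z - lam0^-1) - g (z' - lam0^-1)) + (z - z') * g (z' - lam0^-1)); last by ring.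
apply: le_trans (normcD _ _) _; rewrite !normcM.
have h5 : normc (g (z - lam0^-1) - g (z' - lam0^-1)) <= M * normc (z - z').
  by apply: le_trans (hM _ _ h12 h32) _; rewrite opprB addrA subrK.
have h6 : normc (g (z' - lam0^-1)) <= B.
  have := hM (z' - lam0^-1) 0 h32; rewrite Normc.normc0 subr0 => /(_ d0) h6.
  have := normcD (g 0) (g (z' - lam0^-1) - g 0); rewrite subrKC /B; nra.
have h7 : normc z <= A.
  by have := normcD (lam0^-1) (z - lam0^-1); rewrite subrKC /A; lra.
have h8 := normc_ge0 (z - z').
apply: (@le_trans _ _ ((A * M + B) * normc (z - z'))).
  have A0 : 0 <= A by rewrite /A; have := normc_ge0 lam0^-1; lra.
  rewrite mulrDl -mulrA; apply: lerD; last by rewrite mulrC; exact: ler_wpM2r.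
  by apply: ler_pM => //; exact: normc_ge0.
rewrite -mulrA; apply: ler_wpM2l => //.
by rewrite addr_ge0 ?mulr_ge0 ?addr_ge0 ?normc_ge0.
Qed.

(* The resolvent of [f] has at most a pole of order [k] at [t]. *)
Definition polar_order k (f : H) t : Prop := exists M d : R, 0 < d /\
  forall lam u, complex.Im lam != 0 -> normc (lam - t) < d -> L lam u = f ->
    normc (lam - t) ^+ k * nm u <= M.

Definition polar (f : H) t : Prop := exists k, polar_order k f t.

(** A bound is asked only for [|lam| <= 2]; farther out [|R(lam) f| <= |f|] anyway. *)
Definition tame (f : H) (A : set Cx) : Prop := exists M : R, forall lam u,
  A lam -> normc lam <= 2 -> complex.Im lam != 0 -> L lam u = f -> nm u <= M.

Lemma res_op_comm t lam (u : H) : L t (L lam u) = L lam (L t u).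
Proof.
rewrite (res_op_shift _ lam t) (res_op_shift _ lam t u).
by rewrite (res_opD Plin) (res_opZ Plin).
Qed.

Lemma resolvent_res_op t lam (u u' f : H) : complex.Im lam != 0 -> L lam u = f -> L lam u' = L t f ->
  u' = f + (t - lam) *: u.
Proof.
move=> il hu hu'; apply: (regular_unique hH Plin (nonreal_regular il)).
by rewrite hu' -hu res_op_comm (res_op_shift _ lam t u).
Qed.

(** [R(lam) (t - P) f = f + (t - lam) R(lam) f]: a factor [t - P] lowers the pole order at [t] by
    one. *)
Lemma polar_res_op k f t : polar_order k.+1 f t -> polar_order k (L t f) t.
Proof.
move=> [M [d [d0 hM]]]; exists (nm f + M), (Num.min 1 d); split; first by rewrite lt_min ltr01.
move=> lam u il; rewrite lt_min => /andP[l1 l2] hu.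
have [_ /(_ f)[u0 hu0]] := nonreal_regular il.
have h1 := hM _ _ il l2 hu0; rewrite (resolvent_res_op il hu0 hu).
apply: le_trans (ler_wpM2l _ (hnD hH _ _)) _; first by rewrite exprn_ge0 // normc_ge0.
rewrite (hnZ hH) [normc (t - lam)]normcBC mulrDr mulrA -exprSr; apply: lerD => //.
have f0 := hn_ge0 (ip := ip) f; rewrite -[X in _ <= X]mul1r; apply: ler_wpM2r => //.
by rewrite exprn_ile1 ?normc_ge0 // ltW.
Qed.

Lemma polar_iter k f t : polar_order k f t -> polar_order 0 (iter k (L t) f) t.
Proof. by elim: k f => [|k IH] f // /polar_res_op /IH; rewrite iterSr. Qed.

Lemma tame_res_op f t A : tame f A -> tame (L t f) A.
Proof.
move=> [M hM]; exists (nm f + (normc t + 2) * `|M|) => lam u Al l2 il hu.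
have [_ /(_ f)[u0 hu0]] := nonreal_regular il.
have h1 := hM _ _ Al l2 il hu0; rewrite (resolvent_res_op il hu0 hu).
apply: le_trans (hnD hH _ _) _; rewrite lerD2l (hnZ hH).
apply: ler_pM; [exact: normc_ge0|exact: hn_ge0| |exact: le_trans h1 (ler_norm _)].
by apply: le_trans (normcD _ _) _; rewrite normcN lerD2l.
Qed.

Definition res_prod (s : seq Cx) (f : H) : H := foldr (fun t h => L t h) f s.

Lemma res_prod_comm s t f : res_prod s (L t f) = L t (res_prod s f).
Proof. by elim: s => //= t' s ->; rewrite res_op_comm. Qed.

Lemma res_prodC s s' f : res_prod s (res_prod s' f) = res_prod s' (res_prod s f).
Proof. by elim: s' => //= t s' IH; rewrite res_prod_comm IH. Qed.

Lemma tame_res_prod s f A : tame f A -> tame (res_prod s f) A.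
Proof. by elim: s => //= t s IH /IH; exact: tame_res_op. Qed.

(** Locally a power of [t - P] removes the poles; by compactness a finite product does so on
    [|lam| <= 2], and [resolvent_Liouville] applies to the result. *)
Lemma polar_vanish f : (forall t, polar f t) -> exists s, res_prod s f = 0.
Proof.
move=> hp; have [s [M hM]] : exists s, tame (res_prod s f) [set z : Cx | normc z <= 2].
  pose Q A := exists s, tame (res_prod s f) A; apply: (compact_ideal (Q := Q)).
  - exact: compact_normc.
  - by exists [::], 0.
  - move=> A B [s hs] [s' hs']; exists (s ++ s').
    have [M hM] : tame (res_prod (s ++ s') f) A.
      by rewrite /res_prod foldr_cat -/(res_prod _ _) -/(res_prod _ _) res_prodC; exact: tame_res_prod.
    have [M' hM'] : tame (res_prod (s ++ s') f) B.
      by rewrite /res_prod foldr_cat; exact: tame_res_prod.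
    exists (Num.max M M') => lam u [Al|Bl] l2 il hu; rewrite le_max.
      by rewrite (hM _ _ Al l2 il hu).
    by rewrite (hM' _ _ Bl l2 il hu) orbT.
  - move=> A B AB [s [M hM]]; exists s, M => lam u /AB; exact: hM.
  move=> t _; have [k /polar_iter[M [d [d0 hM]]]] := hp t.
  exists [set z | normc (z - t) < d]; first by apply/cnbhsP; exists d.
  exists (nseq k t), M => lam u lt _ il hu.
  rewrite -[nm u]mul1r -[1 in X in X <= _](expr0 (normc (lam - t))).
  apply: (hM _ _ il lt); rewrite hu /res_prod; clear; elim: k => //= k ->; by [].
exists s; apply: (resolvent_Liouville hH hC2 Plin Psym Pcontr (K := Num.max M (nm (res_prod s f)))).
move=> lam u il hu; rewrite le_max; have [l2|l2] := leP (normc lam) 2.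
  by rewrite (hM _ _ l2 l2 il hu).
apply/orP; right; rewrite -hu res_opE.
have := hnB_ge hH (lam *: u) (- P u); rewrite (hnN hH) (hnZ hH).
have := op_contr hH Pcontr u; have := hn_ge0 (ip := ip) u.
set a' := nm u; set b' := nm (P u); set c' := nm (_ : H); move: l2.
have aux (n a b c : R) : 2 < n -> 0 <= a -> b <= a -> n * a - b <= c -> a <= c by nra.
exact: aux.
Qed.

(** Otherwise the ball of radius [n] would be closed under adjacency, hence the whole infinite
    graph. *)
Lemma sphere_nonempty x n : exists y, y \in nears adj n.+1 x /\ y \notin nears adj n x.
Proof.
apply: contrapT => hn.
have sub k y : y \in nears adj (k + n)%N x -> y \in nears adj n x.
  elim: k y => // k IH y; rewrite addSn => /(nears_last hgraph)[/IH //|[z zn zy]].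
  have zn' := IH _ zn.
  apply: contrapT => /negP ny; apply: hn; exists y; split=> //.
  have -> : n.+1 = (n + 1)%N by rewrite addn1.
  exact: (nears_trans hgraph zn') (nears_adj hgraph zy).
have [_ _ _ _ hinf] := hgraph; apply: hinf.
apply: (sub_finite_set (B := [set` nears adj n x])); last exact: finite_seq.
move=> y _ /=; have [k hk] := nears_conn hgraph x y.
by apply: (sub k); exact: (nears_le hgraph (leq_addr n k) hk).
Qed.

Lemma res_op_far t (g : H) z : g z = 0 -> L t g z = - (degree adj z)%:R^-1 * \sum_(y <- nb adj z) g y.
Proof. by move=> g0; rewrite res_opE l2B l2Z g0 mulr0 sub0r Pl2E mulNr. Qed.

Lemma res_prod_far s x z : z \notin nears adj (size s) x -> res_prod s (delta adj x 1) z = 0.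
Proof.
elim: s z => [|t s IH] z hz.
  by move: hz; rewrite deltaE /=; case: eqVneq => // ->; rewrite inE eqxx.
rewrite [size _]/= in hz; rewrite [res_prod _ _]/= res_op_far; last first.
  by apply: IH; apply: contra hz => hz; exact: nears_succ.
rewrite big_seq big1 ?mulr0 // => y; rewrite in_nb; last exact: (adj_lfin hgraph).
move=> zy; apply: IH; apply: contra hz => hy; rewrite -addn1.
by apply: (nears_trans hgraph hy); rewrite (nears_sym hgraph); exact: nears_adj.
Qed.

(* On the sphere of radius [size s] only the [- P] of each factor [t - P] counts. *)
Lemma res_prod_sphere s x z : z \in nears adj (size s) x ->
  (forall m, (m < size s)%N -> z \notin nears adj m x) ->
  0 < (-1) ^+ size s * res_prod s (delta adj x 1) z :> Cx.
Proof.
elim: s z => [|t s IH] z.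
  by rewrite /= inE => /eqP -> _; rewrite eqxx expr0 mulr1 ltr01.
rewrite [size _]/= => hz hm; rewrite [res_prod _ _]/= res_op_far; last first.
  by apply: res_prod_far; exact: hm.
set g := res_prod _ _; set S := \sum_(_ <- _) _.
have -> : (-1) ^+ (size s).+1 * (- (degree adj z)%:R^-1 * S) = (degree adj z)%:R^-1 * ((-1) ^+ size s * S).
  by rewrite exprS; ring.
have lf := adj_lfin hgraph.
have pos y : adj z y -> y \in nears adj (size s) x -> 0 < (-1) ^+ size s * g y.
  move=> zy hy; apply: IH => // m ms; apply: contra (hm m.+1 ms) => hy'; rewrite -addn1.
  by apply: (nears_trans hgraph hy'); rewrite (nears_sym hgraph); exact: nears_adj.
have nn y : adj z y -> 0 <= (-1) ^+ size s * g y.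
  have [hy zy|hy _] := boolP (y \in nears adj (size s) x); first exact/ltW/pos.
  by rewrite /g res_prod_far // mulr0.
have [zs|[y ys yz]] := nears_last hgraph hz; first by have := hm _ (ltnSn _); rewrite zs.
have zy : adj z y by rewrite (adj_sym hgraph).
have hy : y \in nb adj z by rewrite in_nb.
rewrite mulr_gt0 ?invr_gt0 ?ltr0n ?degp //.
rewrite /S mulr_sumr (big_rem y) //= ltr_wpDr ?pos // big_seq sumr_ge0 // => y' /mem_rem.
by rewrite in_nb //; exact: nn.
Qed.

Lemma res_prod_neq0 s x : res_prod s (delta adj x 1) <> 0.
Proof.
have [z [hz hm]] : exists z, z \in nears adj (size s) x /\ forall m, (m < size s)%N -> z \notin nears adj m x.
  case: (size s) => [|n]; first by exists x; split=> //; exact: nears_refl.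
  have [z [h1 h2]] := sphere_nonempty x n; exists z; split=> // m mn.
  by apply: contra h2; exact: nears_le.
by move=> h; have := res_prod_sphere hz hm; rewrite h l20 mulr0 ltxx.
Qed.

Lemma not_all_polar x : ~ forall t, polar (delta adj x 1) t.
Proof. by move=> /polar_vanish[s]; exact: res_prod_neq0. Qed.

Lemma polar_regular f t : reg t -> polar f t.
Proof.
move=> [[c c0 hc] _]; exists 0%N, (2 * nm f / c), (c / 2); split; first by rewrite divr_gt0.
move=> lam u il hl hu; rewrite expr0 mul1r ler_pdivlMr // -hu.
have h1 := hc u; rewrite (res_op_shift _ lam t) in h1.
have := hnD hH (L lam u) ((t - lam) *: u); rewrite (hnZ hH) normcBC.
have := hn_ge0 (ip := ip) u; move: hl h1.
set a' := nm u; set b' := nm (L lam u); set c' := nm (_ : H); set n' := Normc.normc _.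
have aux (k n a b e : R) : n < k / 2 -> k * a <= e -> 0 <= a -> e <= b + n * a -> a * k <= 2 * b by nra.
exact: aux.
Qed.

End Resolvent.

(** * Renormalization of resolvents *)

Section SelfSimilarWalk.
Context {R : realType} {V : choiceType} (adj : rel V) (F : set V).
Context (hgraph : infinite_connected_graph adj).
Context (hsim : symmetrically_self_similar adj F) (hgeom : bounded_geometry adj F).
Context (C : set V) (v w : V) (hC : cells adj F C).
Context (hv : bdry adj C v) (hw : bdry adj C w) (hvw : v <> w).
Context (psi : V -> V) (hpsi : set_bij setT F psi).
Context (hpsi_adj : forall x y, adj x y <-> reduced_adj adj F (psi x) (psi y)).
Local Notation Cx := (cplx R).
Local Notation normc := (@Normc.normc R).
Local Notation deg := (degree adj).
Local Notation chi := (cell_poly (R := R) adj C v).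
Local Notation Ap := (num_poly (R := R) adj C v).
Local Notation Bp := (den_poly (R := R) adj C v w).
Local Notation H := (@l2 R V adj).
Local Notation degp := (degree_gt0 hgraph).
Local Notation P := (Pl2 (R := R) (adj_lfin hgraph) (adj_sym hgraph) degp).
Local Notation L := (res_op P).
Local Notation coerc := (@coercive R H (@ip R V adj) P).
Local Notation bbelow := (@bounded_below R H (@ip R V adj) P).
Local Notation nm := (@nm R H (@ip R V adj)).
Implicit Types (lam : Cx).
Local Notation hH := (ip_inner (R := R) degp).
Local Notation hC2 := (ip_complete_l2 (R := R) degp).
Local Notation Plin := (Pl2_linear (R := R) (adj_lfin hgraph) (adj_sym hgraph) degp).
Local Notation Psym := (Pl2_sym (R := R) (adj_lfin hgraph) (adj_sym hgraph) degp).
Local Notation Pcontr := (Pl2_contr (R := R) (adj_lfin hgraph) (adj_sym hgraph) degp).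
Local Notation reg := (@regular R H (@ip R V adj) P).
Local Notation ip := (@ip R V adj).
Local Notation T := (ratfun_map (transition_function R adj C v w)).
Local Notation polar := (polar hgraph).

Lemma res_lapl lam (u : H) x : L lam u x = lapl adj lam u x.
Proof. by rewrite res_opE. Qed.

(** The factor by which [psi] multiplies degrees, see [wt_psi]. *)
Definition kappa : R := (cell_delta adj C v)%:R / (cell_theta adj C).-1%:R.

Lemma theta1_gt0 : 0 < (cell_theta adj C).-1%:R :> R.
Proof. by rewrite ltr0n -subn1 subn_gt0 (theta_gt1 hgeom hC hv hw hvw). Qed.

Lemma kappa_gt0 : 0 < kappa.
Proof. by rewrite divr_gt0 ?theta1_gt0 // ltr0n (delta_gt0 hgraph hv). Qed.

Lemma wt_psi y : wt (R := R) adj (psi y) = kappa * wt adj y.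
Proof.
have t0 := theta1_gt0; apply: (mulIf (lt0r_neq0 t0)).
rewrite /wt -natrM (deg_psi hgraph hsim hgeom hC hv hw hvw hpsi hpsi_adj) natrM /kappa.
by field; rewrite lt0r_neq0.
Qed.

Lemma dens_eq0 (f : V -> Cx) x : f x = 0 -> dens adj f x = 0.
Proof. by rewrite /dens => ->; rewrite Normc.normc0 expr0n mulr0. Qed.

Lemma dens_eq (f g : V -> Cx) x : f x = g x -> dens adj f x = dens adj g x.
Proof. by rewrite /dens => ->. Qed.

Lemma dens_psi (f : V -> Cx) y : dens adj f (psi y) = kappa * dens adj (f \o psi) y.
Proof. by rewrite /dens wt_psi /= mulrA. Qed.

Lemma pull_ell2 (f : H) : ell2 adj (f \o psi) /\ kappa * sqn adj (f \o psi) <= sqn adj f.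
Proof.
have k0 := kappa_gt0; rewrite mulrC -ler_pdivlMr //.
apply: sqn_ub => s us; rewrite ler_pdivlMr // mulrC mulr_sumr.
under eq_bigr do rewrite -dens_psi.
rewrite -(big_map psi predT (fun x => dens adj f x)); apply: sqn_lb.
by rewrite map_inj_uniq //; exact: psi_inj hpsi.
Qed.

Definition pull (f : H) : H := mkl2 (pull_ell2 f).1.

Lemma pullE f y : pull f y = f (psi y).
Proof. by []. Qed.

Lemma F_ell2 (f : V -> Cx) : (forall x, ~ F x -> f x = 0) -> ell2 adj (f \o psi) ->
  ell2 adj f /\ sqn adj f = kappa * sqn adj (f \o psi).
Proof.
move=> fz hf; have k0 := kappa_gt0.
have [h1 h2] : ell2 adj f /\ sqn adj f <= kappa * sqn adj (f \o psi).
  apply: sqn_ub => s us.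
  have /choice [k hk] : forall a, exists x, F a -> psi x = a.
    move=> a; have [Fa|nF] := pselect (F a); last by exists a.
    by have [x <-] := psi_surj hpsi Fa; exists x.
  pose t := [seq k a | a <- s & `[< F a >]].
  have ut : uniq t.
    rewrite map_inj_in_uniq ?filter_uniq // => a b; rewrite !mem_filter.
    by move=> /andP[/asboolP Fa _] /andP[/asboolP Fb _] e; rewrite -(hk _ Fa) e hk.
  have := sqn_lb (mkl2 hf) ut; rewrite -(ler_pM2l k0); apply: le_trans.
  rewrite mulr_sumr; under [leRHS]eq_bigr do rewrite -dens_psi.
  rewrite big_map big_filter (bigID (fun a => `[< F a >])) /= [X in _ + X]big1 ?addr0; last first.
    by move=> a /asboolP /fz e; rewrite /dens e [normc _]Normc.normc0 expr0n mulr0.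
  rewrite le_eqVlt; apply/orP; left; apply/eqP; apply: eq_bigr => a /asboolP /hk e.
  by rewrite e.
split=> //; apply/eqP; rewrite eq_le h2 /=; exact: (pull_ell2 (mkl2 h1)).2.
Qed.

(** Only the values of [h] on [F] count; [h'] is [h] cut off outside [F], and the two products are
    compared through polarization. *)
Lemma ip_pull (g h : H) : (forall x, ~ F x -> g x = 0) -> ip g h = kappa * ip (pull g) (pull h).
Proof.
move=> gz.
have hP : ell2 adj (fun x => if `[< F x >] then h x else 0).
  apply: (proj1 (summ_le (dens_ge0 adj _) _ (l2P h))) => x; rewrite /dens; case: ifP => // _.
  by rewrite [normc 0]Normc.normc0 expr0n mulr0 mulr_ge0 ?sqr_ge0.
pose h' : H := mkl2 hP.
have e1 : sqn adj (g + h) + sqn adj (g - h') = sqn adj (g - h) + sqn adj (g + h').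
  apply: sqn_eq2 => x; rewrite /dens !l2D !l2N /=; case: asboolP => [_|/gz ->]; first exact: addrC.
  by rewrite subr0 !add0r normcN.
have eF (k : H) : (forall x, ~ F x -> k x = 0) -> sqn adj k = kappa * sqn adj (pull k).
  by move=> kz; have [_ ->] := F_ell2 kz (pull_ell2 k).1.
have h'z x : ~ F x -> h' x = 0 by move=> nF; rewrite /= asboolF.
have ph : pull h' = pull h by apply: l2_ext => y; rewrite /= asboolT //; exact: psi_F hpsi _.
have e2 : sqn adj (g + h') = kappa * sqn adj (pull g + pull h).
  rewrite eF; last by move=> x nF; rewrite l2D gz // h'z // addr0.
  by rewrite -ph.
have e3 : sqn adj (g - h') = kappa * sqn adj (pull g - pull h).
  rewrite eF; last by move=> x nF; rewrite l2B gz // h'z // subr0.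
  by rewrite -ph.
rewrite /ip mulrA mulrBr -e2 -e3; congr (_ / 4).
have aux (X Y Z W : R) : X + W = Y + Z -> X - Y = Z - W by lra.
exact: aux.
Qed.

Lemma cell_diameter : exists k, forall D x y, cells adj F D -> gclosure adj D x ->
  gclosure adj D y -> y \in nears adj k x.
Proof.
(* A path without repetition inside a cell has fewer edges than the cell has vertices; each end may
   need one more edge to leave the boundary. *)
exists (1 + #|` cl C| + 1)%N => D x y cD Dx Dy.
have inner z : gclosure adj D z -> exists2 z', D z' & z' \in nears adj 1 z.
  case=> [Dz|[_ [z' Dz' zz]]]; first by exists z; rewrite ?nears_refl.
  by exists z' => //; apply: nears_adj; rewrite // (adj_sym hgraph).
have [x' Dx' xx] := inner x Dx; have [y' Dy' yy] := inner y Dy.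
rewrite (nears_sym hgraph) in yy; apply: (nears_trans hgraph _ yy); apply: (nears_trans hgraph xx).
move: (Dy'); rewrite {1}(cell_eq hgraph cD Dx') => -[p [hp hl hF]].
have hD z : z \in x' :: p -> D z.
  move=> zp; rewrite (cell_eq hgraph cD Dx').
  case/splitPl: zp hp hl hF => p1 p2 lz; rewrite cat_path => /andP[hp1 _] _ hF.
  exists p1; split=> // t tp; apply: hF; move: tp; rewrite !inE mem_cat => /orP[->//|->].
  by rewrite orbT.
case/shortenP: hp hl => p' hp' up' sub' hl.
apply: (nears_le hgraph (_ : (size p' <= _)%N)); last by rewrite -hl; exact: nears_path.
rewrite -(card_cl hsim hC cD); apply: ltnW.
apply: (uniq_leq_size up') => z zp; apply/(mem_cl hsim _ cD)/hD.
by move: zp; rewrite !inE => /orP[->//|/sub' ->]; rewrite orbT.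
Qed.

(** Off the zeros of [chi], the values on [F] and [(lam - P) u] inside the cells determine [u] cell
    by cell with uniform constants; the Schur test on balls that contain a cell adds up these local
    bounds. *)
Lemma value_bound lam : chi.[lam] != 0 -> exists2 K : R, 0 <= K & forall (u h : V -> Cx),
  (forall x, h x = if `[< F x >] then u x else lapl adj lam u x) -> ell2 adj h ->
  ell2 adj u /\ sqn adj u <= K * sqn adj h.
Proof.
move=> c0; have [k hk] := cell_diameter; have [N hN] := degree_bounded hgeom.
have [K K0 hK] := schur (R := R) hgraph k hN.
have [M M0 hM] := cell_value_err hgraph hsim hgeom v hC lam.
pose M' := M / normc chi.[lam] + 1; have c0' : 0 < normc chi.[lam] by rewrite normc_gt0.
have Mc : 0 <= M / normc chi.[lam] by rewrite divr_ge0 // ltW.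
have M'0 : 0 <= M' by rewrite addr_ge0.
exists (K * M' ^+ 2); first by rewrite mulr_ge0 ?sqr_ge0.
move=> u h hE hh; apply: hK => // x.
have s0 : 0 <= \sum_(y <- nball adj k x) normc (h y) by apply: sumr_ge0 => ? _; exact: normc_ge0.
have [Fx|nF] := pselect (F x).
  have -> : u x = h x by rewrite hE asboolT.
  apply: (@le_trans _ _ (\sum_(y <- nball adj k x) normc (h y))); last first.
    by rewrite ler_peMl // lerDr.
  rewrite -[leLHS](big_seq1 +%R x (fun y => normc (h y))).
  apply: ball_sum_le => // [y|y]; last exact: normc_ge0.
  by rewrite inE => /eqP ->; exact: nears_refl.
have [cD Dx] := cell_ofP adj nF; set D := cell_of adj F x in cD Dx.
apply: (@le_trans _ _ (M / normc chi.[lam] * \sum_(y <- nball adj k x) normc (h y))); last first.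
  by rewrite ler_wpM2r // lerDl.
rewrite mulrAC ler_pdivlMr // mulrC -normcM; apply: (le_trans (hM D x u cD Dx)).
rewrite ler_wpM2l //.
rewrite (eq_big_seq (fun x => normc (h x))); last first.
  by move=> y /(mem_cl hsim _ cD) Dy; rewrite hE asboolF //; exact: cell_outside cD _.
rewrite [X in _ + X](eq_big_seq (fun x => normc (h x))); last first.
  by move=> y /(mem_bd hgeom _ cD) Dy; rewrite hE asboolT //; exact: bdry_sub Dy.
rewrite -big_cat; apply: ball_sum_le => [||y]; last exact: normc_ge0.
  rewrite cat_uniq !fset_uniq andbT /=; apply/hasPn => y /(mem_bd hgeom _ cD) [nD _].
  by apply/negP => /(mem_cl hsim _ cD).
move=> y; rewrite mem_cat => /orP[/(mem_cl hsim _ cD)|/(mem_bd hgeom _ cD)] h1.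
  by apply: (hk D) => //; left.
by apply: (hk D) => //; [left|right].
Qed.

(** The error of [renorm_err] at [y] involves only the cells touching [psi y], which lie in one
    ball, so the Schur test applies. *)
Lemma renorm_bound lam : exists2 K : R, 0 <= K & forall u : H,
  nm (Ap.[lam] *: pull u - Bp.[lam] *: P (pull u)) <= K * nm (L lam u).
Proof.
have [k hk] := cell_diameter; have [N hN] := degree_bounded hgeom.
have [K K0 hK] := schur (R := R) hgraph k hN.
have [M M0 hM] := renorm_err hgraph hsim hgeom hC hv hw hvw hpsi hpsi_adj lam.
pose M' := normc chi.[lam] + M; have M'0 : 0 <= M' by rewrite addr_ge0 ?normc_ge0.
have k0 := kappa_gt0.
have K2 : 0 <= K * M' ^+ 2 / kappa by rewrite divr_ge0 ?(ltW k0) // mulr_ge0 ?sqr_ge0.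
exists (Num.sqrt (K * M' ^+ 2 / kappa)); first exact: sqrtr_ge0.
move=> u; set W := (X in nm X).
have /choice [j hj] : forall a, exists x, F a -> psi x = a.
  move=> a; have [Fa|nF] := pselect (F a); last by exists a.
  by have [x <-] := psi_surj hpsi Fa; exists x.
pose f x := if `[< F x >] then W (j x) else 0.
have fpsi y : f (psi y) = W y.
  have Fy := psi_F hpsi y.
  by rewrite /f asboolT //; congr (W _); apply: (psi_inj hpsi); rewrite hj.
have [|hf1 hf2] := hK M' f (L lam u) (l2P _) M'0.
  move=> x; have s0 : 0 <= \sum_(y <- nball adj k x) normc (L lam u y) by apply: sumr_ge0 => ? _; exact: normc_ge0.
  have [Fx|nF] := pselect (F x); last by rewrite /f asboolF // [normc _]Normc.normc0 mulr_ge0.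
  have [y yx] := psi_surj hpsi Fx; rewrite -yx fpsi.
  have [err e1 e2] := hM u y.
  have -> : W y = chi.[lam] * L lam u (psi y) - err.
    by rewrite res_lapl e1 addrK /W l2D l2N !l2Z !pullE.
  rewrite -yx in Fx s0.
  apply: le_trans (normcD _ _) _; rewrite normcN normcM mulrDl; apply: lerD.
    rewrite ler_wpM2l ?normc_ge0 //.
    rewrite -[leLHS](big_seq1 +%R (psi y) (fun y => normc (L lam u y))).
    apply: ball_sum_le => // [z|z]; last exact: normc_ge0.
    by rewrite inE => /eqP ->; exact: nears_refl.
  apply: (le_trans e2); rewrite ler_wpM2l //.
  under eq_bigr do under eq_bigr do rewrite -res_lapl.
  (* Distinct cells are disjoint, so the double sum runs over distinct vertices of one ball. *)
  rewrite -(@big_allpairs_dep _ _ _ _ _ _ (fun (D : set V) x => x) (cells_at adj F (psi y)) (fun D => enum_fset (cl D)) (fun x => normc (L lam u x))).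
  apply: ball_sum_le => [|z|z]; last exact: normc_ge0.
    apply: allpairs_uniq_dep; [exact: undup_uniq|by move=> D _; exact: fset_uniq|].
    move=> [D z] [D' z'] /allpairsPdep [D1 [z1 [h1 h2 [eD ez]]]] /allpairsPdep [D2 [z2 [h3 h4 [eD' ez']]]] /= zz.
    subst D z D' z'; have [cD1 _] := mem_cells_at hgraph hsim _ Fx h1.
    have [cD2 _] := mem_cells_at hgraph hsim _ Fx h3.
    subst z2; congr existT.
    move/(mem_cl hsim _ cD1)/(cell_eq hgraph cD1): h2 => ->.
    by move/(mem_cl hsim _ cD2)/(cell_eq hgraph cD2): h4 => ->.
  move=> /allpairsPdep [D [t [h1 h2 ->]]].
  have [cD Da] := mem_cells_at hgraph hsim _ Fx h1.
  by apply: (hk D) => //; [right|left; apply/(mem_cl hsim _ cD)].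
apply: (hn_le (ip_inner (R := R) degp)); first by rewrite mulr_ge0 ?sqrtr_ge0 ?hn_ge0.
rewrite ip_self exprMn sqr_sqrtr // hn2_sqn.
have := (pull_ell2 (mkl2 hf1)).2; rewrite /= (_ : f \o psi = W); last exact/funext.
move/le_trans => /(_ _ hf2); rewrite mulrC -ler_pdivlMr // => /le_trans; apply.
by rewrite -!mulrA [sqn _ _ * _]mulrC.
Qed.

Lemma renorm_exact lam (u : H) : (forall x, ~ F x -> L lam u x = 0) ->
  Ap.[lam] *: pull u - Bp.[lam] *: P (pull u) = chi.[lam] *: pull (L lam u).
Proof.
move=> hu; apply: l2_ext => y; rewrite l2B !l2Z !pullE res_lapl.
have [M M0 hM] := renorm_err hgraph hsim hgeom hC hv hw hvw hpsi hpsi_adj lam.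
have [err -> e2] := hM u y.
suff -> : err = 0 by rewrite addr0.
apply/eqP; rewrite -normc_eq0 eq_le normc_ge0 andbT; apply: (le_trans e2).
rewrite big_seq big1 ?mulr0 // => D /(mem_cells_at hgraph hsim _ (psi_F hpsi y)) [cD _].
rewrite big_seq big1 // => x /(mem_cl hsim _ cD) /(cell_outside cD) nF.
by rewrite -res_lapl hu // [normc _]Normc.normc0.
Qed.

Lemma res_ratio (a b : Cx) (f : H) : b != 0 -> a *: f - b *: P f = b *: L (a / b) f.
Proof. by move=> b0; rewrite res_opE scalerBr scalerA mulrC divfK. Qed.

(** Passing to a Schur complement preserves coercivity, here with the same [del] and with [c]
    divided by [chi]. *)
Lemma coercive_renorm lam : coerc lam ->
  [/\ chi.[lam] != 0, (Ap.[lam] != 0) || (Bp.[lam] != 0)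
    & Bp.[lam] != 0 -> coerc (Ap.[lam] / Bp.[lam])].
Proof.
move=> [c [del del0 hc]].
have hH := ip_inner (R := R) degp; have k0 := kappa_gt0.
(* At a zero of [chi], a Dirichlet eigenfunction [u] extended by 0 and [(lam - P) u] have disjoint
   supports, so the form vanishes at [u]. *)
have c0 : chi.[lam] != 0.
  apply/eqP => /(cell_singular hgraph hsim hgeom hC) [u [uz [y uy] hu]].
  have fu : ell2 adj u.
    apply: (@ell2_finite R V adj u (enum_fset (cl C))) => x xC; apply: uz.
    by move=> Cx_; move/negP: xC; apply; apply/(mem_cl hsim _ hC).
  have := hc (mkl2 fu).
  have -> : ip (c *: L lam (mkl2 fu)) (mkl2 fu) = 0.
    rewrite (finite_l2E (s := enum_fset (cl C)) (g := mkl2 fu)) ?fset_uniq //; last first.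
      move=> x xC; apply: uz; move=> Cx_; move/negP: xC; apply; exact/(mem_cl hsim _ hC).
    rewrite -{1}(finite_l2E (s := enum_fset (cl C)) (g := mkl2 fu)) ?fset_uniq //; last first.
      move=> x xC; apply: uz; move=> Cx_; move/negP: xC; apply; exact/(mem_cl hsim _ hC).
    rewrite (ip_sym hH) (ip_suml degp) big_seq big1 // => x /(mem_cl hsim _ hC) Cx_.
    by rewrite (ip_sym hH) (ip_delta) // l2Z res_lapl hu // mulr0 mul0r mulr0.
  rewrite ip_self -(pmulr_rle0 _ del0) => h0.
  have := point_le degp (mkl2 fu) y; rewrite hn_sqn.
  have -> : sqn adj (mkl2 fu) = 0.
    apply/eqP; rewrite eq_le sqn_ge0 andbT -(pmulr_rle0 _ del0); move: h0.
    by rewrite !pmulr_rle0.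
  by rewrite sqrtr0 => h; move: uy; rewrite -normc_gt0 ltNge h.
(* Coercivity is tested on the extension [U] of [f] that is harmonic in the cells: [(lam - P) U]
   lives on [F], where it is [(A - B P) f / chi]. *)
have key (f : H) : del * ip f f <= ip ((c / chi.[lam]) *: (Ap.[lam] *: f - Bp.[lam] *: P f)) f.
  have [u [uf hu]] := harmonic_extension hgraph hsim hgeom hC hpsi (f : V -> Cx) c0.
  have [K K0 hK] := value_bound c0.
  have [||hu1 _] := hK u (fun x => if `[< F x >] then u x else 0).
  - by move=> x; case: asboolP => // /hu ->.
  - apply: (F_ell2 _ _).1 => [x nF|]; first by rewrite asboolF.
    rewrite (_ : _ \o _ = f); first exact: l2P.
    by apply/funext => y /=; rewrite asboolT ?uf //; exact: psi_F hpsi _.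
  pose U := mkl2 hu1.
  have pU : pull U = f by apply: l2_ext => y; rewrite /= uf.
  have LU x : ~ F x -> L lam U x = 0 by move=> /hu e; rewrite res_lapl.
  have h1 := hc U.
  rewrite (ip_pull (g := c *: L lam U)) in h1; last by move=> x nF; rewrite l2Z LU // mulr0.
  have e1 : pull (c *: L lam U) = (c / chi.[lam]) *: (Ap.[lam] *: f - Bp.[lam] *: P f).
    rewrite -pU renorm_exact // scalerA divfK //; apply: l2_ext => y; by rewrite !l2Z.
  rewrite e1 pU in h1.
  rewrite -(ler_pM2l k0); apply: le_trans h1; rewrite mulrCA ler_wpM2l ?(ltW del0) //.
  by rewrite !ip_self -pU; exact: (pull_ell2 U).2.
split=> //.
  apply: contrapT => /negP; rewrite negb_or !negbK => /andP[/eqP a0 /eqP b0].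
  have := key (delta adj v 1); rewrite a0 b0 !scale0r subrr scaler0 (ip0l hH) ip_self.
  rewrite sqn_delta Normc.normc1 expr1n mulr1 leNgt mulr_gt0 // ltr0n; exact: degp.
move=> b0; exists (c / chi.[lam] * Bp.[lam]), del; first exact: del0.
move=> f; rewrite -scalerA -res_ratio; [exact: key|exact: b0].
Qed.

(** The renormalized operator bounds [u] on [F], and [value_bound] then bounds it in the cells. For
    [B = 0] the renormalized operator is the nonzero scalar [A]. *)
Lemma below_renorm lam : chi.[lam] != 0 -> (Ap.[lam] != 0) || (Bp.[lam] != 0) ->
  (Bp.[lam] != 0 -> bbelow (Ap.[lam] / Bp.[lam])) ->
  bbelow lam.
Proof.
move=> c0 ab hb; have hH := ip_inner (R := R) degp; have k0 := kappa_gt0.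
have [M M0 hM] : exists2 M : R, 0 <= M & forall u : H, nm (pull u) <= M * nm (L lam u).
  have [K K0 hK] := renorm_bound lam.
  have [b0|b0] := eqVneq Bp.[lam] 0.
    have a0 : Ap.[lam] != 0 by rewrite b0 eqxx orbF in ab.
    exists (K / normc Ap.[lam]); first by rewrite divr_ge0 ?normc_ge0.
    move=> u; have := hK u; rewrite b0 scale0r subr0 (hnZ hH) => h.
    by rewrite mulrAC ler_pdivlMr ?normc_gt0 // mulrC.
  have [d d0 hd] := hb b0.
  have nb0 : 0 < normc Bp.[lam] by rewrite normc_gt0.
  exists (K / (normc Bp.[lam] * d)); first by rewrite divr_ge0 // mulr_ge0 // ltW.
  move=> u; have := hK u; rewrite (res_ratio _ _ b0) (hnZ hH) => h.
  rewrite mulrAC ler_pdivlMr ?mulr_gt0 //; apply: le_trans h.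
  by rewrite mulrC -mulrA ler_pM2l // hd.
have [K K0 hK] := value_bound c0.
pose T := Num.sqrt (K * (1 + kappa * M ^+ 2)).
have T1 : 0 < T + 1 by rewrite ltr_wpDl // sqrtr_ge0.
exists (T + 1)^-1; first by rewrite invr_gt0.
move=> u; rewrite mulrC ler_pdivrMr // mulrC.
have n0 : 0 <= nm (L lam u) by exact: hn_ge0.
apply: (@le_trans _ _ (T * nm (L lam u))); last by rewrite ler_wpM2r // lerDl.
have hF : ell2 adj (fun x => if `[< F x >] then u x else 0).
  apply: (F_ell2 _ _).1 => [x nF|]; first by rewrite asboolF.
  rewrite (_ : _ \o _ = pull u); first exact: l2P.
  by apply/funext => y /=; rewrite asboolT //; exact: psi_F hpsi _.
have hG : ell2 adj (fun x => if `[< F x >] then 0 else L lam u x).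
  apply: (proj1 (summ_le (dens_ge0 adj _) _ (l2P (L lam u)))) => x; rewrite /dens; case: ifP => // _.
  by rewrite [normc 0]Normc.normc0 expr0n mulr0 mulr_ge0 ?sqr_ge0.
have sG : sqn adj (mkl2 hG) <= sqn adj (L lam u).
  apply: (summ_le (dens_ge0 adj _) _ (l2P (L lam u))).2 => x; rewrite /dens /=; case: ifP => // _.
  by rewrite [normc 0]Normc.normc0 expr0n mulr0 mulr_ge0 ?sqr_ge0.
have sF : sqn adj (mkl2 hF) = kappa * sqn adj (pull u).
  rewrite (F_ell2 _ _).2 /=; last first.
  - rewrite (_ : _ \o _ = pull u); first exact: l2P.
    by apply/funext => y /=; rewrite asboolT //; exact: psi_F hpsi _.
  - by move=> x nF; rewrite asboolF.
  congr (_ * sqn _ _); by apply/funext => y /=; rewrite asboolT //; exact: psi_F hpsi _.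
have hFE x : mkl2 hF x = if `[< F x >] then u x else 0 by [].
have hGE x : mkl2 hG x = if `[< F x >] then 0 else L lam u x by [].
pose h := mkl2 hF + mkl2 hG.
have hE x : h x = if `[< F x >] then u x else L lam u x.
  by rewrite /h l2D hFE hGE; case: ifP => _; rewrite ?addr0 ?add0r.
have sh : sqn adj h <= (1 + kappa * M ^+ 2) * sqn adj (L lam u).
  have -> : sqn adj h = sqn adj (mkl2 hF) + sqn adj (mkl2 hG).
    have := @sqn_eq2 R V adj h 0 (mkl2 hF) (mkl2 hG); rewrite sqn0 addr0; apply=> x.
    rewrite (dens_eq0 (l20 adj x)) addr0.
    have [Fx|nF] := pselect (F x).
      rewrite [X in _ = _ + X]dens_eq0 ?hGE ?asboolT // addr0.
      by apply: dens_eq; rewrite hE hFE asboolT.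
    rewrite [X in _ = X + _]dens_eq0 ?hFE ?asboolF // add0r.
    by apply: dens_eq; rewrite hE hGE asboolF.
  rewrite sF mulrDl mul1r addrC; apply: lerD => //; rewrite -mulrA ler_wpM2l ?(ltW k0) //.
  rewrite -!hn2_sqn -exprMn ler_sqr ?nnegrE ?hn_ge0 // mulr_ge0 //.
have [|_ hu] := hK u h _ (l2P h).
  by move=> x; rewrite hE -res_lapl.
have T0 : 0 <= K * (1 + kappa * M ^+ 2).
  by rewrite mulr_ge0 // addr_ge0 // mulr_ge0 ?sqr_ge0 // ltW.
apply: (hn_le (ip_inner (R := R) degp)); first by rewrite mulr_ge0 ?sqrtr_ge0.
rewrite ip_self exprMn sqr_sqrtr // hn2_sqn //; apply: (le_trans hu).
by rewrite -mulrA ler_wpM2l.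
Qed.

(** The relation that gets iterated: restricted to [F], a point source at [psi y] becomes a point
    source at [y]. *)
Lemma resolvent_pull lam (u : H) y c : L lam u = delta adj (psi y) c ->
  Ap.[lam] *: pull u - Bp.[lam] *: P (pull u) = delta adj y (chi.[lam] * c).
Proof.
move=> hu; rewrite renorm_exact hu; last first.
  by move=> x nF; rewrite deltaE; case: eqP => // xy; case: nF; rewrite xy; exact: psi_F hpsi _.
apply: l2_ext => z; rewrite l2Z pullE !deltaE (inj_eq (psi_inj hpsi)).
by case: eqP; rewrite ?mulr0.
Qed.

(** ** Finite rank modulo polynomials *)

(** A substitute for the inverse of [psi] off [F]: the preimages of all boundary vertices of the
    cell of [x], any two of which are equal or adjacent. *)
Definition parent (x y : V) : Prop :=
  (F x /\ psi y = x) \/ (~ F x /\ bdry adj (cell_of adj F x) (psi y)).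

Lemma parent_exists x : exists y, parent x y.
Proof.
have [Fx|nF] := pselect (F x).
  by have [y yx] := psi_surj hpsi Fx; exists y; left.
have [cD Dx] := cell_ofP adj nF; have [phi hphi] := cells_iso hsim hC cD.
have Db := iso_bdry hphi hv; have [y yx] := psi_surj hpsi (bdry_sub hgraph cD Db).
by exists y; right; rewrite yx.
Qed.

Lemma bdry_near D y y' : cells adj F D -> bdry adj D (psi y) -> bdry adj D (psi y') ->
  y' \in nears adj 1 y.
Proof.
move=> cD Dy Dy'; have [->|/eqP yy] := eqVneq y y'; first exact: nears_refl.
apply: (nears_adj hgraph); apply/hpsi_adj; split; try exact: psi_F hpsi _.
  by move/(psi_inj hpsi).
by exists D.
Qed.

Lemma parent_near x y y' : parent x y -> parent x y' -> y' \in nears adj 1 y.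
Proof.
move=> [[Fx yx]|[nF yb]] [[Fx' yx']|[nF' yb']] //.
  by move: yx'; rewrite -yx => /(psi_inj hpsi) ->; exact: nears_refl.
exact: bdry_near (cell_ofP adj nF).1 yb yb'.
Qed.

(** Parents move by an edge only when the path enters a cell from [F]; before doing so again it must
    return to [F], which costs a second edge. [s] pays for a start off [F], the last summand for an
    end off [F]. *)
Lemma parent_dist s c c' : parent c c' -> (~ F c -> (0 < s)%N) ->
  forall k x, x \in nears adj k c -> forall y, parent x y ->
  exists2 j, y \in nears adj j c' & (2 * j <= k + s + ~~ `[< F x >])%N.
Proof.
move=> pc s0; elim=> [|k IH] x.
  rewrite inE => /eqP -> y py; have [Fc|nF] := pselect (F c).
    case: pc py => [[_ e]|[] //] [[_ e']|[] //].
    exists 0%N; last by [].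
    by rewrite inE; apply/eqP/(psi_inj hpsi); rewrite e e'.
  exists 1%N; first exact: parent_near pc py.
  by rewrite asboolF //=; have := s0 nF; lia.
move=> /(nears_last hgraph) [/IH h|[z /IH h zx]] y py.
  by have [j hj le] := h y py; exists j => //; lia.
have [Fx|nFx] := pselect (F x).
  have Fz : ~ F z by move=> Fz; rewrite (F_indep hsim Fz Fx) in zx.
  have [|j hj le] := h y.
    right; split=> //; case: py => [[_ ->]|[] //].
    by have [cz zz] := cell_ofP adj Fz; have [/(cell_outside cz)|] := cell_nb cz zz zx.
  exists j => //; move: le; rewrite asboolF // asboolT //=; lia.
have [Fz|nFz] := pselect (F z).
  have [y0 p0] := parent_exists z; have [j hj le] := h y0 p0.
  exists (j + 1)%N; last by move: le; rewrite asboolT // asboolF //=; lia.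
  apply: (nears_trans hgraph hj); case: py => [[] //|[_ yb]]; case: p0 => [[_ e]|[] //].
  have [_ zb] := F_nb hgraph hsim Fz zx.
  by apply: bdry_near (cell_ofP adj nFx).1 _ yb; rewrite e.
have [|j hj le] := h y.
  right; split=> //; case: py => [[] //|[_]].
  have [cz zz] := cell_ofP adj nFz.
  by rewrite -(cell_eq hgraph cz (cell_step hgraph cz zz zx nFx)).
by exists j => //; move: le; rewrite !asboolF //=; lia.
Qed.

Lemma psi_nears k x y : psi y \in nears adj k (psi x) ->
  exists2 j, y \in nears adj j x & (2 * j <= k)%N.
Proof.
have par z : parent (psi z) z by left; split=> //; exact: psi_F hpsi _.
move=> h; have [|j hj le] := @parent_dist 0 _ _ (par x) _ k _ h y (par y).
  by move=> nF; case: nF; exact: psi_F hpsi _.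
exists j => //; move: le; rewrite asboolT; last exact: psi_F hpsi _.
by rewrite /= !addn0.
Qed.

(** By [psi_nears], [psi] at least doubles distances, so distinct vertices end up at distance at
    least [2 ^ m]. *)
Lemma iter_psi_far m x y : y <> x -> iter m psi y \notin nears adj (2 ^ m).-1 (iter m psi x).
Proof.
move=> yx; elim: m => [|m IH]; first by rewrite /= inE; apply/eqP.
rewrite !iterS; apply/negP => /psi_nears [j hj le]; move/negP: IH; apply.
apply: (nears_le hgraph _ hj); move: le; rewrite expnS; have := expn_gt0 2 m; lia.
Qed.

Definition lift (A : V -> Prop) (x : V) : Prop := forall y, parent x y -> A y.

(** Off [F], the parents of a neighbour of [x] are among those of [x], so an inner boundary vertex
    lies on [F]. Hence lifting does not increase the size of the inner boundary. *)
Lemma lift_inner (A : V -> Prop) x z : lift A x -> adj x z -> ~ lift A z ->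
  exists y, [/\ x = psi y, A y & exists2 y1, adj y y1 & ~ A y1].
Proof.
move=> Ax xz nAz; have [Fx|nFx] := pselect (F x).
  have [nFz zb] := F_nb hgraph hsim Fx xz.
  have [y py] := parent_exists x; have yx : psi y = x by case: py => [[]|[]].
  exists y; split=> //; first exact: Ax.
  apply: contrapT => h; apply: nAz => y1 [[] //|[_ y1b]].
  apply: contrapT => nA1; apply: h; exists y1 => //; apply/hpsi_adj; split; try exact: psi_F hpsi _.
    by move/(psi_inj hpsi) => e; apply: nA1; rewrite -e; exact: Ax.
  exists (cell_of adj F z); first exact: (cell_ofP adj nFz).1.
  by rewrite yx.
case: nAz => y py; apply: Ax; right; split=> //.
have [cx xx] := cell_ofP adj nFx; case: py => [[Fz ->]|[nFz]].
  by have [/(cell_outside cx)|] := cell_nb cx xx xz.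
by rewrite -(cell_eq hgraph cx (cell_step hgraph cx xx xz nFz)).
Qed.

Lemma lift_near : exists k, forall x y, parent x y -> x \in nears adj k (psi y).
Proof.
have [k hk] := cell_diameter; exists k => x y [[_ ->]|[nF yb]].
  exact: nears_refl.
have [cx xx] := cell_ofP adj nF.
by apply: (hk _ _ _ cx); [right|left].
Qed.

(* Contracting by the inverse of [psi] halves distances, up to a constant; so a ball of
   radius 2 can be lifted back to a set containing any given ball, each lift keeping
   the size of the inner boundary. *)
Lemma exhaustion : exists l, forall n c, exists (A t : seq V),
  [/\ uniq A, {subset nears adj n c <= A}, (size t <= l)%N &
    forall x z, x \in A -> adj x z -> z \notin A -> x \in t].
Proof.
have [N hN] := degree_bounded hgeom.
have [l hl] := nears_size 2 hN; have [k hk] := lift_near.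
exists l; elim/ltn_ind => n IH c; have [n2|n2] := leqP n 2.
  exists (undup (nears adj 2 c)), (undup (nears adj 2 c)); split=> //.
  - exact: undup_uniq.
  - by move=> x h; rewrite mem_undup; exact: nears_le h.
  - exact: leq_trans (size_undup _) (hl c).
have [c' pc] := parent_exists c.
(* Vertices of the ball of radius [n] have parents at distance [j] from [c'] with [2 j <= n + 2],
   one unit each for a start and an end off [F]; the radius drops since [n > 2]. *)
have [|A [t [uA sA st hA]]] := IH ((n + 2)./2)%N _ c'; first by lia.
pose B := [seq x <- undup (flatten [seq nears adj k (psi y) | y <- A]) | `[< lift (fun y => y \in A) x >]].
have BP x : x \in B <-> lift (fun y => y \in A) x.
  rewrite mem_filter; split=> [/andP[/asboolP //]|h]; apply/andP; split; first exact/asboolP.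
  have [y py] := parent_exists x; rewrite mem_undup; apply/flattenP.
  by exists (nears adj k (psi y)); [apply: map_f; exact: h|exact: hk].
exists B, (map psi t); split.
- by rewrite filter_uniq ?undup_uniq.
- move=> x xc; apply/BP => y py; apply: sA.
  have [j hj le] := @parent_dist 1 _ _ pc (fun _ => isT) n x xc y py.
  apply: (nears_le hgraph _ hj); move: le; case: (~~ _) => /=; lia.
- by rewrite size_map.
move=> x z /BP xB xz zB; have nz : ~ lift (fun y => y \in A) z by move/BP; exact/negP.
have [y [-> yA [y1 yy1 /negP ny1]]] := lift_inner xB xz nz.
by apply: map_f; exact: hA ny1.
Qed.

Lemma Pl2_delta y a : P (delta adj y 1) a = step R adj a y.
Proof.
rewrite Pl2E /step -(mem_nb hgraph); case: ifP => ya; last first.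
  rewrite big_seq big1 ?mulr0 // => z za; rewrite deltaE; case: eqP => // zy.
  by rewrite -zy za in ya.
rewrite (bigD1_seq y) ?fset_uniq //= eqxx big1 ?addr0 ?mulr1 // => z zy.
by rewrite (negPf zy).
Qed.

(* The deltas at [s] are dependent modulo [lam - P] over the polynomials in [lam]. *)
Definition dependent (s : seq V) : Prop := exists c : V -> {poly Cx},
  (exists2 x, x \in s & c x != 0) /\
  forall rho : R, exists M : R, forall lam, normc lam <= rho -> exists b : H,
    nm b <= M /\ \sum_(x <- s) (c x).[lam] *: delta adj x 1 = L lam b.

Lemma res_sum lam (I : Type) (s : seq I) (f : I -> H) :
  L lam (\sum_(i <- s) f i) = \sum_(i <- s) L lam (f i).
Proof.
elim: s => [|i s IH]; first by rewrite !big_nil (res_op0 Plin).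
by rewrite !big_cons (res_opD Plin) IH.
Qed.

Lemma nm_sum (I : Type) (s : seq I) (f : I -> H) : nm (\sum_(i <- s) f i) <= \sum_(i <- s) nm (f i).
Proof.
elim: s => [|i s IH]; first by rewrite !big_nil (hn0 hH).
by rewrite !big_cons; apply: le_trans (hnD hH _ _) _; rewrite lerD2l.
Qed.

(* In a finite set with at most [l] inner boundary vertices, [l + 1] given deltas together
   with the [(lam - P) delta_y], [y] off the inner boundary, outnumber the vertices. *)
Lemma dependent_large : exists l, forall s, uniq s -> size s = l.+1 -> dependent s.
Proof.
have [l hl] := exhaustion.
exists l => s us ss.
have [n hn] : exists n, {subset s <= nears adj n v}.
  elim: (s) => [|x r [n hn]]; first by exists 0%N.
  have [k hk] := nears_conn hgraph v x; exists (maxn n k) => y; rewrite inE => /orP[/eqP ->|/hn h].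
    exact: nears_le (leq_maxr _ _) hk.
  exact: nears_le (leq_maxl _ _) h.
have [A [t [uA sA st hA]]] := hl n v.
pose I := [seq y <- A | y \notin t].
have uI : uniq I by rewrite filter_uniq.
have sI : (size A <= size I + l)%N.
  rewrite /I -(count_predC (fun y => y \notin t) A) -size_filter leq_add2l; apply: leq_trans st.
  rewrite -size_filter; apply: uniq_leq_size; first by rewrite filter_uniq.
  by move=> y; rewrite mem_filter /= negbK => /andP[].
pose rr : seq (bool * V) := [seq (true, x) | x <- s] ++ [seq (false, y) | y <- I].
have urr : uniq rr.
  rewrite cat_uniq !map_inj_uniq ?us ?uI ?andbT /=; try by move=> ? ? [].
  by apply/hasPn => _ /mapP [y _ ->]; apply/negP => /mapP [].
pose q y a : {poly Cx} := (if y == a then 'X else 0) - (step R adj a y)%:P.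
pose E (r : bool * V) a : {poly Cx} := if r.1 then (r.2 == a)%:R else q r.2 a.
pose Mx : 'M[{poly Cx}]_(size rr, size A) := \matrix_(i, j) E (nth (true, v) rr i) (nth v A j).
have [|p p0 pM] := poly_left_kernel Mx.
  by rewrite size_cat !size_map ss; lia.
pose cc r : {poly Cx} := \sum_(i < size rr) if nth (true, v) rr i == r then p 0 i else 0.
have ccE (i : 'I_(size rr)) : cc (nth (true, v) rr i) = p 0 i.
  rewrite /cc (bigD1 i) //= eqxx big1 ?addr0 // => k ki.
  by rewrite nth_uniq // (negPf ki : (k == i :> nat) = false).
have rel a : a \in A -> \sum_(x <- s) cc (true, x) * (x == a)%:R + \sum_(y <- I) cc (false, y) * q y a = 0.
  move=> aA; have ja : (index a A < size A)%N by rewrite index_mem.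
  have /matrixP/(_ 0 (Ordinal ja)) := pM; rewrite !mxE => e0.
  have e1 : \sum_(r <- rr) cc r * E r a = 0.
    rewrite (big_nth (true, v)) big_mkord -[RHS]e0; apply: eq_bigr => i _.
    by rewrite ccE mxE /= nth_index.
  by rewrite -[RHS]e1 /rr big_cat !big_map.
have LE lam y a : L lam (delta adj y 1) a = (q y a).[lam].
  rewrite res_opE l2B l2Z Pl2_delta deltaE /q hornerD hornerN hornerC eq_sym.
  by case: eqP => _; rewrite ?hornerX ?horner0 ?mulr1 ?mulr0.
pose b lam : H := - \sum_(y <- I) (cc (false, y)).[lam] *: delta adj y 1.
have key lam : \sum_(x <- s) (cc (true, x)).[lam] *: delta adj x 1 = L lam (b lam).
  apply: l2_ext => a; rewrite (res_opN Plin) l2N res_sum !l2_sumE.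
  apply/eqP; rewrite -addr_eq0; apply/eqP.
  rewrite (eq_bigr (fun x => (cc (true, x)).[lam] * (x == a)%:R)); last first.
    by move=> x _; rewrite l2Z deltaE eq_sym; case: eqP.
  rewrite [X in _ + X](eq_bigr (fun y => (cc (false, y) * q y a).[lam])); last first.
    by move=> y _; rewrite (res_opZ Plin) l2Z LE hornerM.
  have [aA|aA] := boolP (a \in A).
    have := congr1 (fun p : {poly Cx} => p.[lam]) (rel a aA).
    rewrite horner0 hornerD !horner_sum => e; rewrite -[RHS]e; congr (_ + _); apply: eq_bigr => x _.
    by rewrite hornerM; case: eqP; rewrite ?hornerC ?horner0.
  rewrite !big_seq !big1 ?addr0 // => y.
    rewrite mem_filter => /andP[yt yA]; rewrite /q.
    have -> : (y == a) = false by apply/eqP => e; rewrite -e yA in aA.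
    rewrite /step; case: ifP => ay; last by rewrite subr0 mulr0 horner0.
    by rewrite (hA y a yA _ aA) // (adj_sym hgraph) in yt.
  move=> ys; have -> : (y == a) = false by apply/eqP => e; rewrite -e (sA _ (hn _ ys)) in aA.
  by rewrite mulr0.
exists (fun x => cc (true, x)); split; last first.
  move=> rho.
  have [M [M0 hM]] : exists M : R, 0 <= M /\ forall y lam, y \in I -> normc lam <= rho -> normc (cc (false, y)).[lam] <= M.
    elim: (I) => [|y r [M [M0 hM]]]; first by exists 0.
    have [M' M'0 hM'] := poly_bound (cc (false, y)) rho.
    exists (M + M'); split; first exact: addr_ge0.
    move=> z lam; rewrite inE => /orP[/eqP ->|zr] lr.
      by apply: le_trans (hM' _ lr) _; rewrite lerDr.
    by apply: le_trans (hM _ _ zr lr) _; rewrite lerDl.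
  exists (\sum_(y <- I) M * nm (delta adj y 1)) => lam lr; exists (b lam); split; last exact: key.
  rewrite /b (hnN hH); apply: le_trans (nm_sum _ _) _; rewrite big_seq [leRHS]big_seq.
  by apply: ler_sum => y yI; rewrite (hnZ hH) ler_wpM2r ?hn_ge0 // hM.
apply: contrapT => hc; move/eqP: p0; apply.
have c0 x : x \in s -> cc (true, x) = 0.
  by move=> xs; apply/eqP/negPn/negP => h; apply: hc; exists x.
(* If all coefficients at [s] vanish, then [(lam - P) b = 0]; at the infinitely many nonreal points
   [k + i] this forces [b = 0], so the other coefficients vanish as well, against [p != 0]. *)
have bz (k : nat) : b (k%:R +i* 1)%C = 0.
  have nr : coerc (k%:R +i* 1)%C.
    apply: nonreal_coercive; [exact: hH|exact: Plin|exact: Pl2_sym|by rewrite /= oner_neq0].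
  apply: (regular_unique hH Plin (coercive_regular hH (ip_complete_l2 degp) Plin (Pl2_contr _ _ degp) nr)).
  by rewrite -key (res_op0 Plin) big_seq big1 // => x /c0 ->; rewrite horner0 scale0r.
have cf y : y \in I -> cc (false, y) = 0.
  move=> yI; apply: (@poly_eq0_inj _ _ (fun k : nat => (k%:R +i* 1)%C)).
    by move=> i j [] /eqP; rewrite eqr_nat => /eqP.
  move=> k; have := congr1 (fun f : H => f y) (bz k); rewrite l20 l2N l2_sumE.
  rewrite (bigD1_seq y yI uI) l2Z deltaE eqxx mulr1 big1 ?addr0; last first.
    by move=> z /negPf zy; rewrite l2Z deltaE eq_sym zy mulr0.
  by rewrite [Algebra.Algebra_add__canonical__SemiGroup_ComLaw _ _ _]addr0 => /eqP; rewrite oppr_eq0 => /eqP.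
apply/matrixP => i j; rewrite ord1 mxE -ccE.
have : nth (true, v) rr j \in rr by rewrite mem_nth.
by rewrite mem_cat => /orP[/mapP [x /c0 e ->]|/mapP [y /cf e ->]].
Qed.

Lemma dependent_cat s t : uniq (s ++ t) -> dependent s -> dependent (s ++ t).
Proof.
move=> u [c [[x xs cx] hb]]; exists (fun z => if z \in s then c z else 0); split.
  by exists x; rewrite ?mem_cat xs.
move=> rho; have [M hM] := hb rho; exists M => lam /hM [b [b1 b2]]; exists b; split=> //.
rewrite big_cat /= -b2 [X in _ + X]big_seq [X in _ + X]big1 ?addr0; last first.
  move=> y yt; case: ifP => [ys|_]; last by rewrite horner0 scale0r.
  by move: u; rewrite cat_uniq => /and3P[_ /hasPn /(_ y yt)]; rewrite /= ys.
by apply: eq_big_seq => y ->.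
Qed.

(** [O] is an independent set of maximal size, sizes being bounded by [dependent_large]; in a
    relation on [x :: O] the coefficient at [x] cannot vanish. *)
Lemma finite_rank : exists O : seq V, forall x, exists2 c : {poly Cx}, c != 0 &
  forall rho : R, exists M : R, forall lam, normc lam <= rho -> exists (b : H) (co : V -> Cx),
    [/\ nm b <= M, forall o, o \in O -> normc (co o) <= M &
      c.[lam] *: delta adj x 1 = L lam b + \sum_(o <- O) co o *: delta adj o 1].
Proof.
have [l hl] := dependent_large.
pose Q n := `[< exists s, [/\ uniq s, size s = n & ~ dependent s] >].
have Q0 : exists n, Q n.
  exists 0%N; apply/asboolP; exists [::]; split=> // -[c [[x]]]; by rewrite in_nil.
have Ql n : Q n -> (n <= l)%N.
  move=> /asboolP [s [us ss nd]]; rewrite leqNgt; apply/negP => ln; apply: nd.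
  rewrite -(cat_take_drop l.+1 s); apply: dependent_cat; first by rewrite cat_take_drop.
  by apply: hl; rewrite ?take_uniq // size_takel // ss.
case: (ex_maxnP Q0 Ql) => n /asboolP [ O [uO sO nO]] hmax.
exists O => x; have [xO|xO] := boolP (x \in O).
  exists 1; first exact: oner_neq0.
  move=> rho; exists 1 => lam _; exists 0, (fun o => (o == x)%:R); split.
  - by rewrite (hn0 hH).
  - by move=> o _; rewrite normc_nat; case: (o == x).
  rewrite (res_op0 Plin) add0r hornerC scale1r (bigD1_seq x) //= eqxx scale1r big1 ?addr0 //.
  by move=> o /negPf ->; rewrite scale0r.
have [c [[z zs cz] hb]] : dependent (x :: O).
  apply: contrapT => nd; have : Q n.+1.
    by apply/asboolP; exists (x :: O); split; rewrite /= ?xO ?sO.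
  by move/hmax; rewrite ltnn.
exists (c x).
  apply/negP => /eqP cx; apply: nO; exists c; split.
    by exists z => //; move: zs; rewrite inE => /orP[/eqP e|//]; rewrite e cx eqxx in cz.
  move=> rho; have [M hM] := hb rho; exists M => lam /hM [b [b1 b2]]; exists b; split=> //.
  by rewrite -b2 big_cons cx horner0 scale0r add0r.
move=> rho; have [M hM] := hb rho.
have [M' [M'0 hM']] : exists M : R, 0 <= M /\ forall y lam, y \in O -> normc lam <= rho -> normc (c y).[lam] <= M.
  elim: (O) => [|y r [M1 [M10 hM1]]]; first by exists 0.
  have [M2 M20 hM2] := poly_bound (c y) rho.
  exists (M1 + M2); split; first exact: addr_ge0.
  move=> t lam; rewrite inE => /orP[/eqP ->|zr] lr.
    by apply: le_trans (hM2 _ lr) _; rewrite lerDr.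
  by apply: le_trans (hM1 _ _ zr lr) _; rewrite lerDl.
exists (Num.max M M') => lam lr; have [b [b1 b2]] := hM lam lr.
exists b, (fun o => - (c o).[lam]); split.
- by rewrite le_max b1.
- by move=> o oO; rewrite normcN le_max hM' ?orbT.
rewrite -b2 big_cons -addrA -big_split /= big1 ?addr0 // => o _.
by rewrite scaleNr subrr.
Qed.

(** ** Attraction outside the numerical range *)

(** [k] steps of the contraction [g |-> g - t (lam - P) g + t delta_x] from 0 stay supported in the
    ball of radius [k] and miss [u] by at most [q ^+ k |u|]. *)
Lemma resolvent_decay lam : coerc lam -> exists (K q : R), [/\ 0 <= K, 0 <= q, q < 1 &
  forall x u, L lam u = delta adj x 1 -> forall k y, y \notin nears adj k x -> normc (u y) <= K * q ^+ k].
Proof.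
move=> hl; have [t [q [q0 q1 hq]]] := coercive_contraction hH Pcontr hl.
have [c c0 hc] := coercive_below hH hl.
have [N hN] := degree_bounded hgeom.
exists (Num.sqrt N%:R / c), q; split=> //; first by rewrite divr_ge0 ?sqrtr_ge0 // ltW.
move=> x u hu.
have nu : nm u <= Num.sqrt N%:R / c.
  rewrite ler_pdivlMr // mulrC; apply: le_trans (hc u) _.
  by rewrite hu hn_sqn sqn_delta Normc.normc1 expr1n mulr1 ler_wsqrtr // ler_nat.
have approx k : exists g : H, (forall y, y \notin nears adj k x -> g y = 0) /\ nm (u - g) <= q ^+ k * nm u.
  elim: k => [|k [g [gz hg]]].
    by exists 0; split=> //; rewrite subr0 expr0 mul1r.
  exists (g - t *: L lam g + t *: delta adj x 1); split.
    move=> y ny; have ny' : y \notin nears adj k x by apply: contra ny => h; exact: nears_le h.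
    have yx : (y == x) = false by apply/eqP => e; rewrite e nears_refl in ny.
    rewrite l2D l2B !l2Z deltaE yx mulr0 addr0 gz // sub0r res_opE l2B l2Z gz // mulr0 sub0r.
    rewrite Pl2E big_seq big1 ?mulr0 ?oppr0 ?mulr0 ?oppr0 // => z; rewrite (mem_nb hgraph) => yz.
    apply: gz; apply: contra ny => zk; rewrite (nears_sym hgraph); apply/(nearsS hgraph); right.
    by exists z; rewrite // (nears_sym hgraph).
  have -> : u - (g - t *: L lam g + t *: delta adj x 1) = (u - g) - t *: L lam (u - g).
    by rewrite (res_opB Plin) hu scalerBr !opprD !opprK !addrA addrAC.
  apply: le_trans (hq _) _; rewrite exprS -mulrA ler_wpM2l //.
move=> k y ny; have [g [gz hg]] := approx k.
have -> : u y = (u - g) y by rewrite l2B gz // subr0.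
apply: le_trans (point_le degp _ _) _; apply: le_trans hg _.
by rewrite mulrC ler_wpM2r ?exprn_ge0.
Qed.

(** [|delta_x| <= (|lam| + 1) |u|] bounds [|u|] from below, and coercivity bounds [|u|^2] by a
    multiple of [|u x|], since [ip (c delta_x) u] sees only [u x]. *)
Lemma resolvent_diagonal lam : coerc lam -> exists2 c0 : R, 0 < c0 &
  forall x u, L lam u = delta adj x 1 -> c0 <= normc (u x).
Proof.
move=> [c [del del0 hc]].
have l1 : 0 < normc lam + 1 by rewrite ltr_wpDl ?normc_ge0.
have nd x : 0 < sqn adj (delta adj x 1 : H).
  by rewrite sqn_delta Normc.normc1 expr1n mulr1; exact: wt_gt0 degp x.
have c0 : c != 0.
  apply/eqP => c0; have := hc (delta adj v 1).
  rewrite c0 scale0r (ip0l hH) ip_self => h.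
  by have := mulr_gt0 del0 (nd v); rewrite ltNge h.
have nc : 0 < normc c by rewrite normc_gt0.
exists (del / (normc c * (normc lam + 1) ^+ 2)).
  by rewrite divr_gt0 // mulr_gt0 // exprn_gt0.
move=> x u hu; have w0 := wt_gt0 (R := R) degp x.
have h1 : wt adj x <= (normc lam + 1) ^+ 2 * ip u u.
  have := res_op_bound hH Pcontr lam u; rewrite hu => h.
  have := ler_pM (hn_ge0 _) (hn_ge0 _) h h.
  by rewrite -!expr2 exprMn !hn2_sqn sqn_delta Normc.normc1 expr1n mulr1 ip_self.
have h2 := hc u; rewrite hu in h2.
have h3 : ip (c *: delta adj x 1) u <= wt adj x * (normc c * normc (u x)).
  have -> : c *: delta adj x 1 = delta adj x c.
    by apply: l2_ext => y; rewrite l2Z !deltaE; case: eqP; rewrite ?mulr1 ?mulr0.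
  rewrite (ip_sym hH) ip_delta // ler_pM2l //.
  apply: le_trans (ler_norm _) _; apply: le_trans (ler_Re_normc _) _.
  by rewrite normcM normcJ mulrC.
rewrite ler_pdivrMr; last by rewrite mulr_gt0 // exprn_gt0.
rewrite -(ler_pM2l w0).
apply: (@le_trans _ _ ((normc lam + 1) ^+ 2 * (del * ip u u))).
  by rewrite mulrC mulrCA ler_pM2l.
have -> : wt adj x * (normc (u x) * (normc c * (normc lam + 1) ^+ 2)) =
    (normc lam + 1) ^+ 2 * (wt adj x * (normc c * normc (u x))) by ring.
by rewrite ler_pM2l ?exprn_gt0 //; exact: le_trans h2 h3.
Qed.

(** The renormalization in homogeneous coordinates: [(a, b)] is [lam = a / b], and [(1, 0)], which
    is [z = 0], is fixed. *)
Definition renorm_step (s : Cx * Cx) : Cx * Cx :=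
  if s.2 == 0 then (1, 0) else (Ap.[s.1 / s.2], Bp.[s.1 / s.2]).

Lemma iter_pullE m (u : H) y : iter m pull u y = u (iter m psi y).
Proof. by elim: m y => [//|m IH] y; rewrite iterS pullE IH -iterSr. Qed.

(** The induction that combines [coercive_renorm] and [resolvent_pull]. Once [(1, 0)] is reached,
    the equation says that the restricted solution is a point mass, a property that further
    restriction preserves. *)
Lemma renorm_state lam m : coerc lam -> let s := iter m renorm_step (lam, 1) in
  [/\ (s.1 != 0) || (s.2 != 0), s.2 != 0 -> coerc (s.1 / s.2) &
    forall y u c, L lam u = delta adj (iter m psi y) c ->
      exists c', s.1 *: iter m pull u - s.2 *: P (iter m pull u) = delta adj y c'].
Proof.
move=> hl; elim: m => [|m [IH1 IH2 IH3]] /=.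
  split=> [||y u c hu]; first by rewrite oner_neq0 orbT.
    by rewrite divr1.
  by exists c; rewrite scale1r -hu res_opE.
move: IH1 IH2 IH3; set s := iter m _ _ => IH1 IH2 IH3; rewrite /renorm_step.
have [b0|b0] := eqVneq s.2 0.
  split; [by rewrite /= oner_neq0|by move=> /eqP []|move=> y u c hu].
  have a0 : s.1 != 0 by rewrite b0 eqxx orbF in IH1.
  have [c' hc'] := IH3 (psi y) u c (etrans hu (congr1 (fun z => delta adj z c) (iterSr m psi y))).
  exists (s.1^-1 * c'); rewrite scale1r scale0r subr0.
  rewrite b0 scale0r subr0 in hc'; apply: l2_ext => z.
  have := congr1 (fun f : H => s.1^-1 * f (psi z)) hc'.
  rewrite l2Z mulKf // deltaE (inj_eq (psi_inj hpsi)) deltaE pullE => ->.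
  by case: eqP; rewrite ?mulr0.
have hb := IH2 b0.
have [c0 ab cb] := coercive_renorm hb.
split=> // y u c hu.
have [c' hc'] := IH3 (psi y) u c (etrans hu (congr1 (fun z => delta adj z c) (iterSr m psi y))).
exists (chi.[s.1 / s.2] * (s.2^-1 * c')).
apply: resolvent_pull; rewrite // (res_ratio _ _ b0) in hc' *.
have -> : L (s.1 / s.2) (iter m pull u) = s.2^-1 *: delta adj (psi y) c'.
  by rewrite -hc' scalerA mulVf ?scale1r.
by apply: l2_ext => z; rewrite l2Z !deltaE; case: eqP; rewrite ?mulr0.
Qed.

(* The renormalized pair [(a, b)] satisfies [a v - b P v = c' delta_y] with
   [v = u o psi^m], and [v] is nearly concentrated at [y] as [psi^m] spreads vertices
   out; so [b] is small against [a]. *)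
Lemma renorm_attracted lam (eta : R) : coerc lam -> 0 < eta -> exists m0, forall m, (m0 <= m)%N ->
  let s := iter m renorm_step (lam, 1) in s.1 != 0 /\ normc s.2 <= eta * normc s.1.
Proof.
move=> hl e0; have [K [q [K0 q0 q1 hK]]] := resolvent_decay hl.
have [c0 c00 hc0] := resolvent_diagonal hl.
have [N hN] := degree_bounded hgeom.
have N0 : 0 < N%:R :> R by rewrite ltr0n (leq_trans (degree_gt0 hgraph v)).
(* The first bound keeps [P vv] away from 0 at a neighbour of [v], the second yields the factor
   [eta]. *)
pose e := Num.min (c0 / (2 * N%:R)) (eta * (c0 / (2 * N%:R))).
have d0 : 0 < c0 / (2 * N%:R) by rewrite divr_gt0 // mulr_gt0.
have ee : 0 < e by rewrite lt_min d0 mulr_gt0.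
have [M hM] := geometric_small q0 q1 K0 ee.
exists M => m Mm; case: (renorm_state m hl); set s := iter m _ _ => h1 _ h3.
have [_ sol] := coercive_regular hH hC2 Plin Pcontr hl.
have [u hu] := sol (delta adj (iter m psi v) 1).
have [c' hc'] := h3 v u 1 hu.
set vv := iter m pull u in hc'.
have vz z : z <> v -> normc (vv z) <= e.
  move=> zv; rewrite iter_pullE.
  have far := iter_psi_far m zv.
  apply: le_trans (hK _ _ hu _ _ far) _; apply: hM; apply: leq_trans Mm _.
  by rewrite -ltnS prednK ?expn_gt0 // ltn_expl.
have vx : c0 <= normc (vv v) by rewrite iter_pullE; exact: hc0 hu.
have [z vz'] : exists z, adj v z.
  have := degree_gt0 hgraph v; rewrite degreeE cardfs_gt0 => /fset0Pn [z zb].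
  by exists z; rewrite -(mem_nb hgraph).
have zv : z <> v by move=> e'; rewrite e' (adj_irr hgraph) in vz'.
(* The neighbour [z] of [v] carries no source: [vv z] is small, while the mean [P vv z] sees the
   large value at [v]. *)
have eqz : s.1 * vv z = s.2 * P vv z.
  have := congr1 (fun f : H => f z) hc'; rewrite l2B !l2Z deltaE; case: eqP => // _.
  by move/eqP; rewrite subr_eq0 => /eqP.
have Pz : c0 / N%:R - e <= normc (P vv z).
  have vn : v \in nb adj z by rewrite (mem_nb hgraph) (adj_sym hgraph).
  have dz : 0 < (deg z)%:R :> R by rewrite ltr0n (degree_gt0 hgraph).
  rewrite Pl2E normcM normcV normc_nat (bigD1_seq v) ?fset_uniq //=.
  have s1 : normc (\sum_(i <- nb adj z | i != v) vv i) <= (deg z)%:R * e.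
    apply: le_trans (normc_sum _ _ _) _.
    apply: (@le_trans _ _ (\sum_(i <- nb adj z | i != v) e)).
      by apply: ler_sum => i /eqP; exact: vz.
    apply: (@le_trans _ _ (\sum_(i <- nb adj z) e)).
      rewrite big_mkcond /=; apply: ler_sum => i _; case: ifP => // _; exact: ltW.
    by rewrite big_const_seq count_predT iter_addr_0 degreeE mulr_natl.
  have s2 := normcB_ge (vv v) (\sum_(i <- nb adj z | i != v) vv i).
  rewrite [leRHS]mulrC ler_pdivlMr //; apply: le_trans s2.
  have : c0 / N%:R * (deg z)%:R <= c0.
    by rewrite mulrAC ler_pdivrMr // ler_pM2l // ler_nat.
  move: s1 vx; rewrite mulrBl mulrC; lra.
have b_le : normc s.2 * (c0 / (2 * N%:R)) <= normc s.1 * e.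
  have := congr1 (fun z : Cx => normc z) eqz; rewrite /= !normcM => e1.
  apply: (@le_trans _ _ (normc s.2 * normc (P vv z))); last first.
    by rewrite -e1 ler_wpM2l ?normc_ge0 // vz.
  rewrite ler_wpM2l ?normc_ge0 //; apply: le_trans Pz.
  have : e <= c0 / (2 * N%:R) by rewrite ge_min lexx.
  have -> : c0 / N%:R = c0 / (2 * N%:R) + c0 / (2 * N%:R) by field; rewrite gt_eqF.
  lra.
split.
  apply: contraTneq h1 => a0; rewrite a0 eqxx /= negbK -normc_eq0.
  move: b_le; rewrite a0 Normc.normc0 mul0r pmulr_lle0 // => h.
  by rewrite eq_le h normc_ge0.
rewrite -(ler_pM2r d0); apply: le_trans b_le _; rewrite [eta * _]mulrC -mulrA ler_wpM2l ?normc_ge0 //.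
by rewrite ge_min lexx orbT.
Qed.

(** ** The transition function *)

Section Transition.
Let G := fset_set (gclosure adj C).
Let I : finType := fset_sub_type G.

Lemma closure_finite : finite_set (gclosure adj C).
Proof. by rewrite finite_setU; split; [exact: cell_finite hsim _ hC|exact: bdry_finite hgeom _ hC]. Qed.

Lemma mem_closure y : (y \in G) <-> gclosure adj C y.
Proof. by rewrite in_fset_set ?inE //; exact: closure_finite. Qed.

Lemma sum_closure (K : nmodType) (f : V -> K) :
  \sum_(k < #|I|) f (val (enum_val k)) = \sum_(y <- G) f y.
Proof.
rewrite big_seq_fsetE /= [RHS](reindex_onto (@enum_val I (mem I)) (@enum_rank I)) /=; last first.
  by move=> i _; rewrite enum_rankK.
by apply: eq_bigl => k; rewrite enum_valK eqxx.
Qed.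

Lemma sum_closure_nb (K : nmodType) x (f : V -> K) : (forall y, adj x y -> gclosure adj C y) ->
  \sum_(y <- G | adj x y) f y = \sum_(y <- nb adj x) f y.
Proof.
move=> hx; rewrite -big_filter; apply/perm_big/uniq_perm; rewrite ?filter_uniq ?fset_uniq // => y.
rewrite mem_filter (mem_nb hgraph); apply/andP/idP => [[]//|xy].
by split=> //; apply/mem_closure/hx.
Qed.

Lemma degree_in_cell x : C x -> degree_in adj (gclosure adj C) x = deg x.
Proof.
move=> Cx_; rewrite /degree /degree_in; congr (#|` fset_set _|).
apply/seteqP; split=> y /= [h xy]; split=> //.
exact: cell_nb_closure hC Cx_ xy.
Qed.

Lemma sum_closure_flux (K : nmodType) (f : V -> K) :
  \sum_(y <- G | adj v y) f y = flux adj C v f.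
Proof.
rewrite /flux -big_filter -[RHS]big_filter; apply/perm_big/uniq_perm; rewrite ?filter_uniq ?fset_uniq // => y.
rewrite !mem_filter (mem_nb hgraph); apply/andP/andP => [[vy /mem_closure [Cy|by_]]|[/asboolP Cy vy]].
- by split=> //; exact/asboolP.
- have Fv := bdry_sub hgraph hC hv; have Fy := bdry_sub hgraph hC by_.
  by rewrite (F_indep hsim Fv Fy) in vy.
- by split=> //; apply/mem_closure; left.
Qed.

Lemma degree_in_bdry : degree_in adj (gclosure adj C) v = cell_delta adj C v.
Proof.
rewrite /cell_delta -sum1_size big_filter -[RHS]/(flux adj C v (fun=> 1%N)) -sum_closure_flux.
rewrite -big_filter sum1_size /degree_in.
rewrite cardfE -cardfE; apply/perm_size/uniq_perm; rewrite ?filter_uniq ?fset_uniq // => y.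
rewrite mem_filter in_fset_set; last first.
  by apply: sub_finite_set (adj_lfin hgraph v) => z [].
apply/idP/andP => [|[vy /mem_closure h]]; last by rewrite inE.
by rewrite inE => -[h vy]; split=> //; exact/mem_closure.
Qed.

Definition walk_mx (z : Cx) : 'M[Cx]_#|I| :=
  1%:M - z *: \matrix_(i, j) cellQ R adj C v (val (enum_val i)) (val (enum_val j)).

Lemma walk_mxM z (B : 'M[Cx]_#|I|) a b : (walk_mx z *m B) a b =
  B a b - z * \sum_k cellQ R adj C v (val (enum_val a)) (val (enum_val k)) * B k b.
Proof.
rewrite /walk_mx mulmxBl mul1mx -scalemxAl !mxE; congr (_ - _ * _).
by apply: eq_bigr => k _; rewrite mxE.
Qed.

(** [g] is a column of [(I - z Q)^-1] up to the factor [c]: harmonic in [C] for [lam = 1 / z], equal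
    to [c] at [w] and to 0 at the other boundary vertices except [v]. The equation at [v] is then a
    flux balance, which brings in [A] and [B]. *)
Lemma walk_flux z (g : V -> Cx) (c : Cx) : z != 0 ->
  (forall x, gclosure adj C x -> g x - z * (\sum_(y <- G) cellQ R adj C v x y * g y) = c * (x == w)%:R) ->
  Ap.[z^-1] * ((cell_theta adj C).-1%:R * g v) = Bp.[z^-1] * c.
Proof.
move=> z0 hg.
have Qsum x : ~ (bdry adj C x /\ x <> v) -> \sum_(y <- G) cellQ R adj C v x y * g y =
    (degree_in adj (gclosure adj C) x)%:R^-1 * \sum_(y <- G | adj x y) g y.
  move=> hx; rewrite mulr_sumr [RHS]big_mkcond /=; apply: eq_bigr => y _.
  by rewrite /cellQ asboolF //= andbT; case: ifP; rewrite ?mul0r.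
have gb b : bdry adj C b -> b <> v -> g b = c * (b == w)%:R.
  move=> Cb bv; rewrite -hg; last by right.
  rewrite big1 ?mulr0 ?subr0 // => y _; rewrite /cellQ asboolT ?andbF ?mul0r //.
have gC x : C x -> lapl adj z^-1 g x = 0.
  move=> Cx_; have := hg x (or_introl Cx_).
  rewrite Qsum; last by case=> [[]].
  have -> : (x == w) = false by apply/eqP => e; case: hw; rewrite -e.
  rewrite mulr0 degree_in_cell // sum_closure_nb; last by move=> y; exact: cell_nb_closure hC Cx_.
  move=> e; rewrite (laplE hgraph); apply: (mulfI z0).
  by rewrite mulr0 mulrBr mulrA mulfV // mul1r.
have gv : g v = z * ((cell_delta adj C v)%:R^-1 * flux adj C v g).
  have := hg v (or_intror hv); rewrite Qsum; last by case.
  rewrite degree_in_bdry sum_closure_flux.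
  have -> : (v == w) = false by apply/eqP.
  by rewrite mulr0 => /eqP; rewrite subr_eq0 => /eqP.
have de0 : ((cell_delta adj C v)%:R : Cx) != 0 by rewrite pnatr_eq0 -lt0n (delta_gt0 hgraph hv).
have fl := cell_flux hgraph hsim hgeom v hC z^-1 g v.
rewrite [X in X + _]big_seq [X in X + _]big1 ?add0r in fl; last first.
  by move=> x /(mem_cl hsim _ hC) /gC ->; rewrite mulr0.
have vb : v \in enum_fset (bd adj C) by exact/(mem_bd hgeom _ hC).
have wb : w \in enum_fset (bd adj C) by exact/(mem_bd hgeom _ hC).
have wv : w != v by apply/eqP => e; apply: hvw.
rewrite (bigD1_seq v) ?fset_uniq //= -big_filter (bigD1_seq w) ?filter_uniq ?fset_uniq //= in fl; last first.
  by rewrite mem_filter wv.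
rewrite [X in _ + (_ + X)]big1_seq ?addr0 in fl; last first.
  move=> b /andP[bw]; rewrite mem_filter => /andP[/eqP bv /(mem_bd hgeom _ hC) Cb].
  by rewrite gb // (negPf bw) !mulr0.
rewrite (gb w) // in fl; last by apply/eqP.
rewrite eqxx mulr1 in fl.
have flE : flux adj C v g = (cell_delta adj C v)%:R * (z^-1 * g v).
  by rewrite gv; field; rewrite z0 de0.
rewrite flE in fl; rewrite /num_poly /den_poly !(hornerM, hornerD, hornerN, hornerC, hornerX).
rewrite -/(flux_diag adj C v) -/(flux_off adj C v w) in fl.
apply: (mulfI de0).
have -> : (cell_delta adj C v)%:R * ((chi.[z^-1] * z^-1 - (cell_delta adj C v)%:R^-1 * (flux_diag adj C v).[z^-1]) *
    ((cell_theta adj C).-1%:R * g v)) =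
  (cell_theta adj C).-1%:R * (chi.[z^-1] * ((cell_delta adj C v)%:R * (z^-1 * g v)) - (flux_diag adj C v).[z^-1] * g v).
  by field; rewrite z0 de0.
by rewrite fl; field; rewrite de0.
Qed.

(** Cramer's rule: [D] is the determinant of [I - z Q] and [N] is [theta - 1] times an entry of its
    adjugate; [walk_flux] for a column of the adjugate identifies [N / D] with [B / A]. *)
Lemma transition_relation : exists N D : {poly Cx}, [/\ D.[0] = 1, N.[0] = 0,
  transition_function R adj C v w = FracField.tofrac N / FracField.tofrac D &
  forall z, z != 0 -> Ap.[z^-1] * N.[z] = Bp.[z^-1] * D.[z]].
Proof.
pose Mp : 'M[{poly Cx}]_#|I| := 1%:M - 'X *: \matrix_(i, j) (cellQ R adj C v (val (enum_val i)) (val (enum_val j)))%:P.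
have vG : v \in G by apply/mem_closure; right.
have wG : w \in G by apply/mem_closure; right.
pose i : I := Sub v vG; pose j : I := Sub w wG.
have ev z : map_mx (horner_eval z) Mp = walk_mx z.
  apply/matrixP => a b; rewrite !mxE /= /horner_eval !hornerE.
  by rewrite hornerMn hornerC.
pose t : {poly Cx} := ((cell_theta adj C).-1%:R)%:P.
exists (t * (\adj Mp) (enum_rank i) (enum_rank j)), (\det Mp).
have detE z : (\det Mp).[z] = \det (walk_mx z) by rewrite -ev (det_map_mx (horner_eval z)).
have adjE z a b : ((\adj Mp) a b).[z] = (\adj (walk_mx z)) a b.
  by rewrite -ev -map_mx_adj [RHS]mxE.
have W0 : walk_mx 0 = 1%:M by rewrite /walk_mx scale0r subr0.
have D0 : (\det Mp).[0] = 1 by rewrite detE W0 det1.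
have Dn : FracField.tofrac (\det Mp) != 0.
  by rewrite tofrac_eq0; apply: contraNneq (oner_neq0 Cx) => e; rewrite -D0 e horner0.
split=> //.
- rewrite hornerM adjE W0 adj1 mxE (inj_eq enum_rank_inj) -val_eqE /=.
  by move/eqP/negPf: hvw => ->; rewrite mulr0.
- rewrite /transition_function !insubT /=.
  have -> : 1%:M - FracField.tofrac 'X *: cellQmx R adj C v = map_mx (@FracField.tofrac {poly Cx}) Mp.
    apply/matrixP => a b; rewrite !mxE rmorphB rmorphM /=; congr (_ - _).
    by case: (a == b); rewrite ?rmorph1 ?rmorph0.
  have hdet : \det (map_mx (@FracField.tofrac {poly Cx}) Mp) = FracField.tofrac (\det Mp) by rewrite det_map_mx.
  rewrite /invmx unitmxE unitfE hdet Dn mxE -map_mx_adj [map_mx _ _ _ _]mxE.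
  rewrite /t rmorphM /= polyC_natr rmorph_nat -mulrA; congr (_ * _).
  by rewrite mulrC.
move=> z z0; rewrite hornerM /t hornerC detE.
pose g x := if insub x is Some k then (\adj (walk_mx z)) (enum_rank (k : I)) (enum_rank j) else 0.
have gE (k : 'I_#|I|) : g (val (enum_val k)) = (\adj (walk_mx z)) k (enum_rank j).
  by rewrite /g valK enum_valK.
have -> : ((\adj Mp) (enum_rank i) (enum_rank j)).[z] = g v.
  by rewrite adjE /g insubT.
apply: walk_flux => // x /mem_closure xG.
have /matrixP/(_ (enum_rank (Sub x xG : I)) (enum_rank j)) := mul_mx_adj (walk_mx z).
rewrite walk_mxM [in RHS]mxE (inj_eq enum_rank_inj) -val_eqE /= => e.
rewrite mulr_natr -e /g insubT; congr (_ - _ * _); rewrite -sum_closure.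
by apply: eq_bigr => k _; rewrite enum_rankK -[X in _ * X]/(g (val (enum_val k))) gE.
Qed.

End Transition.

(** [nh] and [dh] are the reversed numerator and denominator in lowest terms; having no common zero,
    they evaluate [T] even where [A] and [B] both vanish. *)
Lemma ratfun_renorm : exists nh dh : {poly Cx},
  [/\ forall lam, (dh.[lam] != 0) || (nh.[lam] != 0), nh * Ap = dh * Bp,
      forall lam, T (sphere_inv lam) = pt (dh.[lam], nh.[lam])
    & T (Some 0) = Some 0].
Proof.
have [N [D [D0 N0 trE rel]]] := transition_relation.
set f := transition_function _ _ _ _ _ in trE *.
pose n0 := (generic_quotient.repr f : {ratio {poly Cx}}).1.
pose d0 := (generic_quotient.repr f : {ratio {poly Cx}}).2.
pose n := n0 %/ gcdp n0 d0; pose d := d0 %/ gcdp n0 d0.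
have d00 : d0 != 0 by exact: denom_ratioP.
have g0 : gcdp n0 d0 != 0 by rewrite gcdp_eq0 negb_and d00 orbT.
have cop : coprimep n d by apply: coprimep_div_gcd; rewrite d00 orbT.
have nE : n * gcdp n0 d0 = n0 by rewrite divpK // dvdp_gcdl.
have dE : d * gcdp n0 d0 = d0 by rewrite divpK // dvdp_gcdr.
have dn0 : d != 0 by apply: contraNneq d00 => e; rewrite -dE e mul0r.
have nD : n * D = d * N.
  have Dn : FracField.tofrac D != 0.
    by rewrite tofrac_eq0; apply: contraNneq (oner_neq0 Cx) => e; rewrite -D0 e horner0.
  apply: (mulIf g0); rewrite mulrAC nE [RHS]mulrAC dE.
  apply/eqP; rewrite -tofrac_eq !tofracM -(frac_repr f) -/d0.
  by apply/eqP; move: (FracField.tofrac d0) => fd; rewrite trE mulrAC divfK // mulrC.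
(* Both polynomials are reversed with the same [k], the larger of the two degrees, so that the value
   at infinity comes out right. *)
pose k := (maxn (size n) (size d)).-1.
have k1 : k.+1 = maxn (size n) (size d).
  by rewrite /k prednK // leq_max [X in _ || X]lt0n size_poly_eq0 dn0 orbT.
have sn : (size n <= k.+1)%N by rewrite k1 leq_maxl.
have sd : (size d <= k.+1)%N by rewrite k1 leq_maxr.
pose nh := revp k n; pose dh := revp k d.
have nc z : (d.[z] != 0) || (n.[z] != 0).
  have [dz|] := eqVneq d.[z] 0 => //=.
  by apply: (@coprimep_root _ d n); rewrite ?rootE ?dz // coprimep_sym.
have lead (p : {poly Cx}) : (size p <= k.+1)%N -> p`_k = if size p == k.+1 then lead_coef p else 0.
  move=> sp; case: eqP => [e|/eqP e]; first by rewrite lead_coefE e.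
  by rewrite nth_default // -ltnS ltn_neqAle e.
have ncinf : (d`_k != 0) || (n`_k != 0).
  rewrite !lead //; have [dn|nd] := leqP (size n) (size d).
    by have -> : size d = k.+1; rewrite ?eqxx ?lead_coef_eq0 ?dn0 // k1 (maxn_idPr dn).
  have sk : size n = k.+1 by rewrite k1 (maxn_idPl (ltnW nd)).
  have nn : n != 0 by rewrite -size_poly_gt0 sk.
  by rewrite sk eqxx lead_coef_eq0 nn orbT.
have nhd lam : (dh.[lam] != 0) || (nh.[lam] != 0).
  have [->|l0] := eqVneq lam 0; first by rewrite !revp0.
  by rewrite !horner_revp // !mulf_eq0 !expf_eq0 (negPf l0) !andbF /=; exact: nc.
exists nh, dh; split=> //.
- apply: (@poly_eq_off_zeros _ _ _ ('X * revp (size D) D)).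
    rewrite mulf_neq0 ?polyX_eq0 //; apply: contraNneq (oner_neq0 Cx) => e.
    have := congr1 (fun p : {poly Cx} => p`_(size D)) e.
    by rewrite /revp coef_poly ltnSn subnn coef0 -horner_coef0 D0 => ->.
  move=> lam; rewrite hornerM hornerX mulf_eq0 negb_or => /andP[l0].
  rewrite horner_revp ?leqnSn // mulf_eq0 negb_or => /andP[_ Dz].
  rewrite [LHS]hornerM [RHS]hornerM !horner_revp // -![_ ^+ _ * _ * _]mulrA; congr (_ * _).
  have r1 := rel lam^-1; rewrite invr_eq0 invrK in r1; have {}r1 := r1 l0.
  have r2 : n.[lam^-1] * D.[lam^-1] = d.[lam^-1] * N.[lam^-1].
    by rewrite -!hornerM nD.
  apply: (mulIf Dz); move: r1 r2; clear.
  move: (Ap.[lam]) (Bp.[lam]) (N.[lam^-1]) (D.[lam^-1]) (n.[lam^-1]) (d.[lam^-1]) => a b c e p q r1 r2.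
  by rewrite mulrAC r2 -mulrA [c * a]mulrC r1 mulrA.
- move=> lam; rewrite /sphere_inv; have [->|l0] := eqVneq lam 0.
    rewrite /ratfun_map -/n0 -/d0 -/n -/d /pt /= !revp0 !lead //.
    case: ltnP => nd.
      have sk : size n = k.+1 by rewrite k1 (maxn_idPl (ltnW nd)).
      by rewrite -sk (ltn_eqF nd) eqxx.
    have sk : size d = k.+1 by rewrite k1 (maxn_idPr nd).
    by rewrite sk eqxx lead_coef_eq0 (negPf dn0) /= -lead.
  rewrite /ratfun_map -/n0 -/d0 -/n -/d /pt /= !horner_revp // mulf_eq0 expf_eq0 (negPf l0) andbF /=.
  case: ifP => dz //; congr Some.
  by rewrite -mulf_div divff ?mul1r // expf_neq0.
rewrite /ratfun_map -/n0 -/d0 -/n -/d.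
have := congr1 (fun p : {poly Cx} => p.[0]) nD; rewrite /= !hornerM D0 N0 mulr1 mulr0 => nz.
by have := nc 0; rewrite nz eqxx orbF => /negPf ->; rewrite mul0r.
Qed.

Lemma conjcN a : conjc (- a) = - conjc a :> Cx.
Proof. by case: a. Qed.

Lemma step_conj x y : conjc (step R adj x y) = step R adj x y.
Proof.
rewrite /step; case: ifP => _; last exact: conjc0c.
by rewrite conjcV conjc_nat.
Qed.

Lemma flux_bdr_conj a b lam : (flux_bdr adj C v a b).[conjc lam] = conjc (flux_bdr adj C v a b).[lam].
Proof.
rewrite /flux_bdr !horner_sum conjc_sum_cond; apply: eq_bigr => y _.
rewrite /cell_bdr !horner_sum conjc_sum_cond; apply: eq_bigr => x _.
rewrite !hornerM !hornerC conjcM conjcV conjc_nat; congr (_ * _).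
by rewrite /cell_adj; apply: kernel_adj_conj; exact: step_conj.
Qed.

Lemma num_poly_conj lam : Ap.[conjc lam] = conjc Ap.[lam].
Proof.
rewrite /num_poly !(hornerM, hornerD, hornerN, hornerC, hornerX) conjcD conjcN !conjcM conjcV conjc_nat.
by rewrite flux_bdr_conj (kernel_poly_conj v (cl C) step_conj).
Qed.

Lemma den_poly_conj lam : Bp.[conjc lam] = conjc Bp.[lam].
Proof.
rewrite /den_poly !(hornerM, hornerC) !conjcM conjcV !conjc_nat.
by rewrite flux_bdr_conj.
Qed.

Lemma size_flux_bdr a b : (size (flux_bdr (R := R) adj C v a b) <= #|` cl C|)%N.
Proof.
have h (J : Type) (s : seq J) (Q : pred J) (f : J -> {poly Cx}) : (forall j, (size (f j) <= #|` cl C|)%N) ->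
    (size (\sum_(j <- s | Q j) f j)%R <= #|` cl C|)%N.
  move=> hf; elim/big_ind: _ => [|p q hp hq|j _]; rewrite ?size_poly0 //.
  by apply: leq_trans (size_polyD _ _) _; rewrite geq_max hp.
apply: (h) => y; apply: (h) => x.
apply: (@leq_trans (size (cell_adj (R := R) adj C v y x))); last exact: size_kernel_adj.
by rewrite mul_polyC; exact: size_scale_leq.
Qed.

(** [chi * 'X] has degree one more than the number of vertices of a cell, while the fluxes have
    degree below that number. *)
Lemma size_den_num : (size Bp < size Ap)%N.
Proof.
have sA : size Ap = (#|` cl C|).+2.
  have c0 : chi != 0 by exact: cell_poly_neq0.
  rewrite /num_poly size_polyDl ?size_mulX ?size_kernel_poly //.
  rewrite size_polyN ltnS mul_polyC; apply: leq_trans (size_scale_leq _ _) _.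
  by apply: leq_trans (size_flux_bdr _ _) _.
rewrite sA /den_poly mul_polyC; apply: leq_ltn_trans (size_scale_leq _ _) _.
by apply: leq_ltn_trans (size_flux_bdr _ _) _.
Qed.

(** Outside the numerical range [A] and [B] do not vanish together, so the pair [(A, B)] and the
    reduced fraction give the same point. *)
Lemma ratfun_iter lam m : coerc lam -> iter m T (sphere_inv lam) = pt (iter m (renorm_step) (lam, 1)).
Proof.
move=> hl; have [nh [dh [nhd rel hT T0]]] := ratfun_renorm.
elim: m => [|m IH]; first by rewrite pt_inv.
have [h1 h2 _] := renorm_state m hl.
rewrite !iterS IH; move: h1 h2; set s := iter m _ _ => h1 h2.
rewrite /renorm_step; have [b0|b0] := eqVneq s.2 0.
  have a0 : s.1 != 0 by rewrite b0 eqxx orbF in h1.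
  by rewrite /pt (negPf a0) b0 mul0r T0 /= oner_eq0 mul0r.
have -> : pt s = sphere_inv (s.1 / s.2).
  rewrite /pt /sphere_inv mulf_eq0 invr_eq0 (negPf b0) orbF; case: eqP => // _.
  by rewrite invf_div.
have [_ ab _] := coercive_renorm (h2 b0).
rewrite hT; apply: pt_eq => //=.
have := congr1 (fun p : {poly Cx} => p.[s.1 / s.2]) rel; rewrite /= !hornerM => <-.
by [].
Qed.

Lemma ratfun_zero : T (Some 0) = Some 0.
Proof. by have [nh [dh []]] := ratfun_renorm. Qed.

(** In the coordinate [lam] the preimages of [t] are the roots of [dh - t nh]; as [nh] is shorter,
    degree and leading coefficient do not depend on [t]. *)
Lemma ratfun_plane : exists nh dh : {poly Cx},
  [/\ forall lam, (dh.[lam] != 0) || (nh.[lam] != 0), nh * Ap = dh * Bp, (size nh < size dh)%N &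
     forall q t, T (sphere_inv q) = sphere_inv t <-> dh.[q] = t * nh.[q]].
Proof.
have [nh [dh [nc rel hT T0]]] := ratfun_renorm.
exists nh, dh; split=> //.
  have sAB := size_den_num.
  have A0 : Ap != 0 by rewrite -size_poly_gt0; apply: leq_ltn_trans sAB.
  have [n0|n0] := eqVneq nh 0.
    rewrite n0 size_poly0 size_poly_gt0; apply: contraTneq (nc 0) => d0.
    by rewrite n0 d0 horner0 eqxx.
  have d0 : dh != 0.
    apply: contraNneq n0 => d0; move/eqP: rel; rewrite d0 mul0r mulf_eq0 (negPf A0) orbF.
    by move/eqP ->.
  have B0 : Bp != 0.
    apply: contraNneq n0 => b0; move/eqP: rel; rewrite b0 mulr0 mulf_eq0 (negPf A0) orbF.
    by move/eqP ->.
  have := congr1 (fun p : {poly Cx} => size p) rel; rewrite (size_mul n0 A0) (size_mul d0 B0).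
  have : (0 < size nh)%N by rewrite size_poly_gt0.
  have : (0 < size dh)%N by rewrite size_poly_gt0.
  move: (size nh) (size dh) (size Ap) (size Bp) sAB; lia.
move=> q t; rewrite hT; split.
  rewrite /pt /sphere_inv /=; case: eqP => [d0|/eqP d0]; case: eqP => [t0|/eqP t0] //.
    by rewrite d0 t0 mul0r.
  move=> [] e; have n0 : nh.[q] != 0.
    by apply: contraNneq t0 => n0; move/eqP: e; rewrite n0 mul0r eq_sym invr_eq0.
  by apply: (mulIf (invr_neq0 d0)); rewrite mulfV // -mulrA e mulfV.
move=> e; rewrite -pt_inv; apply: pt_eq => //=; first by rewrite oner_neq0 orbT.
by rewrite mulr1 e mulrC.
Qed.

Lemma step_lip q t : T (sphere_inv q) = sphere_inv t -> exists K d : R, [/\ 0 <= K, 0 < d &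
  forall q', normc (q' - q) < d -> exists2 t', T (sphere_inv q') = sphere_inv t' &
     normc (t' - t) <= K * normc (q' - q)].
Proof.
have [nh [dh [nc rel sz hT]]] := ratfun_plane.
move=> /hT e; have n0 : nh.[q] != 0.
  have := nc q; rewrite e; apply: contraTneq => ->; by rewrite mulr0 eqxx.
have nn : 0 < normc nh.[q] by rewrite normc_gt0.
have [M1 M10 h1] := poly_increment nh q.
have [M2 M20 h2] := poly_increment (dh - t *: nh) q.
exists (M2 * 2 / normc nh.[q]), (Num.min 1 (normc nh.[q] / 2 / (M1 + 1))).
have M1' : 0 < M1 + 1 by rewrite ltr_wpDl.
split; first by rewrite divr_ge0 ?mulr_ge0 // ltW.
  by rewrite lt_min ltr01 !divr_gt0.
move=> q'; rewrite lt_min => /andP[q1 q2].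
have a1 : normc nh.[q] / 2 <= normc nh.[q'].
  have := normcB_ge nh.[q] (nh.[q'] - nh.[q]); rewrite subrKC.
  have := h1 q' (ltW q1); rewrite ltr_pdivlMr // in q2.
  have := normc_ge0 (q' - q); move: (normc (q' - q)) q2 => x q2 x0; nra.
have n0' : nh.[q'] != 0 by rewrite -normc_gt0; apply: lt_le_trans a1; rewrite divr_gt0.
exists (dh.[q'] / nh.[q']); first by apply/hT; rewrite divfK.
have -> : dh.[q'] / nh.[q'] - t = ((dh - t *: nh).[q'] - (dh - t *: nh).[q]) / nh.[q'].
  by rewrite !hornerE e subrr subr0 mulrBl mulfK.
rewrite normcM normcV ler_pdivrMr ?normc_gt0 //.
apply: le_trans (h2 _ (ltW q1)) _.
have -> : M2 * 2 / normc nh.[q] * normc (q' - q) * normc nh.[q'] =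
   (M2 * normc (q' - q)) * (normc nh.[q'] / (normc nh.[q] / 2)).
  by field; rewrite gt_eqF.
rewrite ler_peMr ?mulr_ge0 ?normc_ge0 // ler_pdivlMr ?mul1r // divr_gt0 //.
Qed.

(** Continuity of roots: [dh - t' nh] is small at [q] and has the leading coefficient of [dh], so
    [poly_root_near] provides a root. *)
Lemma step_open q t (e : R) : T (sphere_inv q) = sphere_inv t -> 0 < e -> exists2 d : R, 0 < d &
  forall t', normc (t' - t) < d -> exists2 q', normc (q' - q) < e & T (sphere_inv q') = sphere_inv t'.
Proof.
have [nh [dh [nc rel sz hT]]] := ratfun_plane.
move=> /hT et e0; have n0 : nh.[q] != 0.
  have := nc q; rewrite et; apply: contraTneq => ->; by rewrite mulr0 eqxx.
have nn : 0 < normc nh.[q] by rewrite normc_gt0.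
have d0 : dh != 0 by rewrite -size_poly_gt0; apply: leq_ltn_trans sz.
have ld : 0 < normc (lead_coef dh) by rewrite normc_gt0 lead_coef_eq0.
exists (normc (lead_coef dh) * e ^+ (size dh).-1 / normc nh.[q]).
  by rewrite divr_gt0 // mulr_gt0 // exprn_gt0.
move=> t' tt; rewrite ltr_pdivlMr // in tt.
have st : (size (- (t' *: nh)) < size dh)%N.
  by rewrite size_polyN; apply: leq_ltn_trans sz; exact: size_scale_leq.
have sp : size (dh - t' *: nh) = size dh by rewrite size_polyDl.
have p0 : dh - t' *: nh != 0 by rewrite -size_poly_eq0 sp size_poly_eq0.
have [|z zq] := @poly_root_near _ (dh - t' *: nh) q e e0 p0.
  rewrite sp lead_coefDl // !hornerE et -mulrBl normcM normcBC //.
rewrite !hornerE => /eqP; rewrite subr_eq0 => /eqP hz; exists z => //.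
by apply/hT.
Qed.

Lemma step_isolated q t : exists2 d : R, 0 < d &
  forall q', q' != q -> normc (q' - q) < d -> T (sphere_inv q') <> sphere_inv t.
Proof.
have [nh [dh [nc rel sz hT]]] := ratfun_plane.
have p0 : dh - t *: nh != 0.
  rewrite -size_poly_gt0 size_polyDl; first by apply: leq_ltn_trans sz.
  by rewrite size_polyN; apply: leq_ltn_trans sz; exact: size_scale_leq.
have [d d0 hd] := poly_isolated q p0; exists d => // q' qq qd /hT e.
by have := hd q' qq qd; rewrite !hornerE e subrr eqxx.
Qed.

Lemma iter_finite m p t : iter m.+1 T p = sphere_inv t -> exists s, iter m T p = sphere_inv s.
Proof.
move=> h; apply: sphere_inv_surj => e; move: h; rewrite iterS e ratfun_zero => /esym.
exact: sphere_inv_neq0.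
Qed.

Lemma iter_cont m q t (e : R) : iter m T (sphere_inv q) = sphere_inv t -> 0 < e ->
  exists2 d : R, 0 < d & forall q', normc (q' - q) < d ->
    exists2 t', iter m T (sphere_inv q') = sphere_inv t' & normc (t' - t) < e.
Proof.
elim: m t e => [|m IH] t e.
  by move=> /sphere_inv_inj <- e0; exists e => // q' h; exists q'.
move=> h e0; have [s hs] := iter_finite h; rewrite iterS hs in h.
have [K [d [K0 d0 hK]]] := step_lip h.
have K1 : 0 < K + 1 by rewrite ltr_wpDl.
have [|d1 d10 hd1] := IH s (Num.min d (e / (K + 1))) hs; first by rewrite lt_min d0 divr_gt0.
exists d1 => // q' /hd1 [s' hs']; rewrite lt_min => /andP[sd se].
have [t' ht' le] := hK s' sd; exists t'; first by rewrite iterS hs'.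
apply: le_lt_trans le _; rewrite ltr_pdivlMr // in se; apply: le_lt_trans se.
by rewrite mulrC ler_wpM2l ?normc_ge0 // lerDl.
Qed.

(** ** Orbits in the numerical range *)

Definition persistent lam : Prop :=
  forall m, exists2 t, ~ coerc t & iter m T (sphere_inv lam) = sphere_inv t.

Lemma noncoercive_real t : ~ coerc t -> complex.Im t = 0 /\ normc t <= 1.
Proof.
move=> nt; split.
  apply/eqP/negPn/negP => h; apply: nt; exact: (nonreal_coercive hH Plin Psym h).
rewrite leNgt; apply/negP => h; apply: nt; exact: (large_coercive hH Plin Psym Pcontr h).
Qed.

(* Nonreal points next to [lam] are attracted by [0], while the orbit of [lam] keeps away
   from it; so no subsequence of iterates can converge uniformly around [lam]. *)
Lemma persistent_julia lam : persistent lam -> julia_set T (sphere_inv lam).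
Proof.
move=> hp [U [_ Ulam /(_ id) [k [hk [g /(_ _ Ulam) [W hW hg]]]]]].
(* The orbit of [lam] keeps chordal distance at least 1 from 0, and the attracted orbit of [lam']
   comes within 1/8; two closeness estimates to [g] and one by continuity cost 1/8 each. The total
   of 1/2 is a contradiction. *)
have e0 : 0 < 8^-1 :> R by rewrite invr_gt0.
have [j0 _ hj] := hg _ e0.
have kj j : (j <= k j)%N by elim: j => [//|j IH]; apply: leq_ltn_trans IH (hk j j.+1 (ltnSn j)).
have [t nt ht] := hp (k j0).
have hW' : nbhs (chart None lam) W by [].
have [d1 d10 hd1] := chart_cont hW'.
have e1 : 0 < 16^-1 :> R by rewrite invr_gt0.
have [d2 d20 hd2] := iter_cont ht e1.
have [|lam' il hl] := @nonreal_near R lam (Num.min d1 d2); first by rewrite lt_min d10.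
move: hl; rewrite lt_min => /andP[/hd1 Wl /hd2 [t' ht' tt]].
have cl' := nonreal_coercive hH Plin Psym il.
have [m0 hm0] := renorm_attracted cl' e1.
pose j := maxn j0 m0.
have [s0 ss] := hm0 (k j) (leq_trans (leq_maxr j0 m0) (kj j)).
have h1 := hj j (leq_maxl j0 m0) _ Wl; have h0 := hj j0 (leqnn j0) _ Wl.
rewrite /= ht' in h0.
have := ratfun_iter (k j) cl'.
rewrite -[sphere_inv lam']/(chart None lam') => e2; rewrite /= e2 in h1.
have h2 := chordal_pt0 s0 ss.
have h3 := chordal_inv t' t.
have h4 := chordal_0_inv (noncoercive_real nt).2.
have t1 := chordal_triangle (Some 0) (g (sphere_inv lam')) (sphere_inv t).
have t2 := chordal_triangle (Some 0) (pt (iter (k j) (renorm_step) (lam', 1))) (g (sphere_inv lam')).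
have t3 := chordal_triangle (g (sphere_inv lam')) (sphere_inv t') (sphere_inv t).
rewrite [chordal (g _) (sphere_inv t')]chordal_sym in t3.
move: h0 h1 h2 h3 h4 t1 t2 t3 tt.
have aux (a b c d e f h n : R) : a < 8^-1 -> b < 8^-1 -> c <= 2 * 16^-1 -> d <= 2 * n ->
    1 <= e -> e <= f + h -> f <= c + b -> h <= a + d -> n < 16^-1 -> False by lra.
exact: aux.
Qed.

Lemma ratfun_plane_zero (nh dh : {poly Cx}) q : (dh.[q] != 0) || (nh.[q] != 0) ->
  (forall t, T (sphere_inv q) = sphere_inv t <-> dh.[q] = t * nh.[q]) ->
  T (sphere_inv q) = Some 0 -> nh.[q] = 0 /\ dh.[q] != 0.
Proof.
move=> h0 hT hq; suff nq : nh.[q] = 0 by rewrite nq eqxx orbF in h0.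
apply: contrapT => /eqP nq; case: (@sphere_inv_neq0 R (dh.[q] / nh.[q])).
by rewrite -hq; apply/esym/hT; rewrite divfK.
Qed.

Lemma step_relation q t : T (sphere_inv q) = sphere_inv t -> Ap.[q] = t * Bp.[q].
Proof.
have [nh [dh [h0 hE _ hT]]] := ratfun_plane.
move=> /hT hd; have hn : nh.[q] != 0.
  by apply: contraTneq (h0 q) => hn; rewrite hd hn mulr0 eqxx.
by apply: (mulfI hn); rewrite (horner_eqM q hE) hd mulrCA mulrA.
Qed.

Lemma step_value q t : T (sphere_inv q) = sphere_inv t -> Bp.[q] != 0 -> Ap.[q] / Bp.[q] = t.
Proof.
by move=> /step_relation -> hB; rewrite mulfK.
Qed.

Lemma step_large q : T (sphere_inv q) = Some 0 -> exists2 d : R, 0 < d &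
  forall q', normc (q' - q) < d -> Bp.[q'] != 0 -> 1 < normc (Ap.[q'] / Bp.[q']).
Proof.
have [nh [dh [h0 hE _ hT]]] := ratfun_plane.
move=> hq; have [nq dq] := ratfun_plane_zero (h0 q) (hT q) hq.
have [d d0 hd] := poly_lt_near_root nq dq; exists d => // q' /hd lt hB.
have dn : dh.[q'] != 0 by rewrite -normc_gt0; apply: le_lt_trans (normc_ge0 _) lt.
have {}hE := horner_eqM q' hE.
have nn : nh.[q'] != 0.
  by apply: contraNneq (mulf_neq0 dn hB) => nn; rewrite -hE nn mul0r.
suff -> : Ap.[q'] / Bp.[q'] = dh.[q'] / nh.[q'].
  by rewrite normcM normcV ltr_pdivlMr ?normc_gt0 // mul1r.
by apply/eqP; rewrite eqr_div // [X in X == _]mulrC hE.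
Qed.

(** Induction on the time at which the orbit leaves the numerical range. Each step pulls lower
    bounds back by [below_renorm], which may fail at zeros of [chi] or [A]; these are isolated, but
    [q] can be one of them. *)
Lemma nonpersistent_below q : ~ persistent q -> exists2 d : R, 0 < d &
  forall q', q' != q -> normc (q' - q) < d -> bbelow q'.
Proof.
move=> hq; have [m hm] : exists m, forall t, ~ coerc t -> iter m T (sphere_inv q) <> sphere_inv t.
  apply: contrapT => hn; apply: hq => m; apply: contrapT => ht; apply: hn; exists m => t nt e.
  by apply: ht; exists t.
elim: m q hm {hq} => [|m IH] q hm.
  have cq : coerc q by apply: contrapT => /hm; apply.
  have [d d0 hd] := regular_open (coercive_regular hH hC2 Plin Pcontr cq).
  by exists d => // q' _ /hd [].
have chi0 : chi != 0 by exact: cell_poly_neq0.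
have A0 : Ap != 0.
  by have := size_den_num; apply: contraTneq => ->; rewrite size_poly0.
have [d1 d10 hd1] := poly_isolated q chi0; have [d2 d20 hd2] := poly_isolated q A0.
suff [d d0 hd] : exists2 d : R, 0 < d & forall q', q' != q -> normc (q' - q) < d ->
    Bp.[q'] != 0 -> bbelow (Ap.[q'] / Bp.[q']).
  exists (Num.min d (Num.min d1 d2)); first by rewrite !lt_min d0 d10.
  move=> q' nq; rewrite !lt_min => /and3P[l0 l1 l2].
  apply: below_renorm; first exact: hd1.
    by apply/orP; left; exact: hd2.
  exact: hd.
have [h0|/sphere_inv_surj [q1 hq1]] := pselect (T (sphere_inv q) = Some 0).
  have [d d0 hd] := step_large h0; exists d => // q' _ /hd h /h /(large_coercive hH Plin Psym Pcontr).
  exact: (coercive_below hH).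
have [t nt|d d0 hd] := IH q1; first by have := hm t nt; rewrite iterSr hq1.
have [K [d3 [K0 d30 hd3]]] := step_lip hq1.
have [d4 d40 hd4] := step_isolated q q1.
exists (Num.min (d / (K + 1)) (Num.min d3 d4)).
  by rewrite !lt_min d30 d40 divr_gt0 //; lra.
move=> q' nq; rewrite !lt_min ltr_pdivlMr; last by lra.
move=> /and3P[l0 /hd3 [t' ht' tt] l4] hB; rewrite (step_value ht' hB).
apply: hd; first by apply: contra_not_neq (hd4 _ nq l4) => <-.
apply: le_lt_trans tt (le_lt_trans _ l0); rewrite mulrC ler_wpM2l ?normc_ge0 //; lra.
Qed.

Lemma persistent_gap (hJ : totally_disconnected (julia_set T)) (a b : R) : a < b ->
  exists r : R, [/\ a < r, r < b & ~ persistent r%:C%C].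
Proof.
move=> ab; apply: contrapT => hn.
have hp r : a < r -> r < b -> persistent r%:C%C.
  by move=> ar rb; apply: contrapT => np; apply: hn; exists r.
have [a' h1 ab'] : exists2 a', a < a' & a' < b by exists ((a + b) / 2); rewrite ?midf_lt.
have [b' h2 h3] : exists2 b', a' < b' & b' < b by exists ((a' + b) / 2); rewrite ?midf_lt.
pose A := [set z : Cx | complex.Im z = 0 /\ a' <= complex.Re z <= b'].
have hA : chart None @` A `<=` julia_set T.
  move=> _ [[z z'] [/= -> /andP[az zb]] <-].
  have hz : persistent z%:C%C by apply: hp; lra.
  exact: (persistent_julia hz).
have cA := chart_convex_connected (p := None) (real_segment_convex (a := a') (b := b')).
have Aa : A a'%:C%C by split=> //=; apply/andP; split; lra.
have Ab : A b'%:C%C by split=> //=; apply/andP; split; lra.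
have ja : julia_set T (chart None (a'%:C%C : Cx)) by apply: hA; exists a'%:C%C.
have : connected_component (julia_set T) (chart None (a'%:C%C : Cx)) (chart None (b'%:C%C : Cx)).
  exists (chart None @` A); [split; [by exists a'%:C%C| |]|by exists b'%:C%C]; by [].
rewrite hJ //= => /sphere_inv_inj [] e; move: h2; rewrite e ltxx //.
Qed.

Lemma regular_gap (hJ : totally_disconnected (julia_set T)) (a b : R) : a < b ->
  exists r : R, [/\ a < r, r < b & reg r%:C%C].
Proof.
move=> ab; have [r [ar rb /nonpersistent_below [d d0 hd]]] := persistent_gap hJ ab.
pose e := Num.min (b - r) d / 2.
have m0 : 0 < Num.min (b - r) d by rewrite lt_min d0 andbT subr_gt0.
have e0 : 0 < e by rewrite /e divr_gt0.
have [m1 m2] : Num.min (b - r) d <= b - r /\ Num.min (b - r) d <= d.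
  by rewrite !ge_min !lexx orbT.
exists (r + e); split; [lra|rewrite /e; lra|].
apply: (real_below_regular hH hC2 Plin Psym Pcontr); apply: hd.
  by rewrite eq_complex /= eqxx andbT; apply/eqP; lra.
rewrite (_ : _ - _ = e%:C%C); last by apply/eqP; rewrite eq_complex /= subrr eqxx andbT; apply/eqP; lra.
by rewrite normc_real gtr0_norm // /e; lra.
Qed.

Lemma coercive_open lam : coerc lam -> exists2 d : R, 0 < d &
  forall lam', normc (lam' - lam) < d -> coerc lam'.
Proof.
move=> [c [del del0 hc]]; exists (del / (2 * (normc c + 1))).
  by rewrite divr_gt0 // mulr_gt0 // ltr_wpDl ?normc_ge0.
move=> lam' hl; exists c, (del / 2); first by rewrite divr_gt0.
move=> u; have h1 := hc u; rewrite (res_op_shift _ lam) scalerDr (ipDl hH).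
rewrite scalerA (ip_scale_self hH).
have h2 := ler_Re_normc (c * (lam' - lam)); rewrite normcM in h2.
have u0 : 0 <= ip u u by rewrite -(hn2 hH) sqr_ge0.
move: hl; rewrite ltr_pdivlMr; last by rewrite mulr_gt0 // ltr_wpDl ?normc_ge0.
have := normc_ge0 c; have := normc_ge0 (lam' - lam); move: h2; rewrite ler_norml => /andP[h2 _].
move: h1 h2 u0; set U := ip u u; set X := ip (c *: _) u; set Y := complex.Re _.
generalize (normc c) (normc (lam' - lam)) => k n h1 h2 u0 n0 k0 h3.
have : - (del / 2) <= Y by nra.
by nra.
Qed.

(** Covers [z = 0] as well, which is no [sphere_inv t]. *)
Definition escaped (p : sphere R) : Prop := forall t, ~ coerc t -> p <> sphere_inv t.

Lemma escaped_zero : escaped (Some 0).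
Proof. by move=> t _ /esym; exact: sphere_inv_neq0. Qed.

Lemma escaped_inv lam : escaped (sphere_inv lam) <-> coerc lam.
Proof.
split=> [h|h t nt /sphere_inv_inj e]; last by apply: nt; rewrite -e.
by apply: contrapT => /h; apply.
Qed.

Lemma escaped_step p : escaped p -> escaped (T p).
Proof.
have [->|/sphere_inv_surj[lam ->]] := pselect (p = Some 0).
  by rewrite ratfun_zero.
move=> /escaped_inv cl t nt /step_relation e.
have [_ h0 h1] := coercive_renorm cl.
have B0 : Bp.[lam] != 0.
  by apply: contraTneq h0 => B0; rewrite e B0 mulr0 eqxx.
by apply: nt; have := h1 B0; rewrite e mulfK.
Qed.

Lemma escaped_iter m p : escaped p -> escaped (iter m T p).
Proof. by elim: m => //= m IH /IH /escaped_step. Qed.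

Lemma escaped_near_zero q : T (sphere_inv q) = Some 0 -> exists2 d : R, 0 < d &
  forall q', normc (q' - q) < d -> escaped (T (sphere_inv q')).
Proof.
have [nh [dh [h0 hE _ hT]]] := ratfun_plane.
move=> hq; have [nq dq] := ratfun_plane_zero (h0 q) (hT q) hq.
have [d d0 hd'] := poly_lt_near_root nq dq; exists d => // q' /hd' + t nt /hT hd.
have [_ t1] := noncoercive_real nt.
rewrite hd normcM ltNge => /negP; apply; rewrite -[X in _ <= X]mul1r.
by apply: ler_wpM2r => //; exact: normc_ge0.
Qed.

Lemma escaped_open m q : escaped (iter m T (sphere_inv q)) -> exists2 d : R, 0 < d &
  forall q', normc (q' - q) < d -> escaped (iter m T (sphere_inv q')).
Proof.
elim: m q => [|m IH] q.
  move=> /escaped_inv /coercive_open[d d0 hd]; exists d => // q' /hd h.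
  exact/escaped_inv.
rewrite iterSr; have [h0 _|/sphere_inv_surj [q1 hq1]] := pselect (T (sphere_inv q) = Some 0).
  have [d d0 hd] := escaped_near_zero h0; exists d => // q' /hd h; rewrite iterSr.
  exact: escaped_iter.
rewrite hq1 => /IH[d d0 hd].
have [K [d3 [K0 d30 hd3]]] := step_lip hq1.
exists (Num.min (d / (K + 1)) d3).
  by rewrite !lt_min d30 divr_gt0 //; lra.
move=> q'; rewrite !lt_min ltr_pdivlMr; last by lra.
move=> /andP[l0 /hd3 [t' ht' tt]]; rewrite iterSr ht'.
apply: hd; apply: le_lt_trans tt (le_lt_trans _ l0); rewrite mulrC ler_wpM2l ?normc_ge0 //; lra.
Qed.

(** For real [s] a coercivity witness [c] sees only [Re c] times the form of [s - P], which is
    monotone in [s]: coercivity at [t] spreads to the right or to the left according to the sign of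
    [Re c]. *)
Lemma noncoercive_convex (a t b : R) : a <= t -> t <= b ->
  ~ coerc a%:C%C -> ~ coerc b%:C%C -> ~ coerc t%:C%C.
Proof.
move=> at_ tb na nb [c [del del0 hc]].
have scal (s : R) u : ip (c *: L s%:C%C u) u = complex.Re c * (s * ip u u - ip (P u) u).
  rewrite (ip_res_self hH Plin Psym); move: (ip u u) (ip (P u) u) => U X.
  by case: (c) => p q /=; ring.
have u0 (u : H) : 0 <= ip u u by rewrite -(hn2 hH) sqr_ge0.
have aux (k s s' U X D : R) : 0 <= k * (s' - s) -> 0 <= U -> D <= k * (s * U - X) -> D <= k * (s' * U - X).
  by move=> k0 U0 hD; have := mulr_ge0 k0 U0; lra.
have [c0|c0] := leP 0 (complex.Re c).
  apply: nb; exists c, del => [//|u]; have := hc u; rewrite !scal; apply: aux => //.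
  by rewrite mulr_ge0 // subr_ge0.
apply: na; exists c, del => [//|u]; have := hc u; rewrite !scal; apply: aux => //.
by rewrite mulr_le0 ?subr_le0 // ltW.
Qed.

Lemma nonpersistent_regular lam0 : complex.Im lam0 = 0 -> ~ persistent lam0 ->
  (forall x, exists M d : R, 0 < d /\ forall lam u, complex.Im lam != 0 -> normc (lam - lam0) < d ->
     L lam u = delta adj x 1 -> nm u <= M) -> reg lam0.
Proof.
move=> il np hb; pose r := complex.Re lam0.
have lE : lam0 = r%:C%C by rewrite /r; case: (lam0) il => a b /= ->.
have [del del0 hdel] := nonpersistent_below np.
rewrite lE; apply: (real_below_regular hH hC2 Plin Psym Pcontr).
apply: (isolated_dense_below hH hC2 Plin Psym Pcontr (r := r) (del := del)) => //.
  move=> t t0 td; apply: hdel.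
    by rewrite lE -subr_eq0 -normc_gt0 -rmorphB addrAC subrr add0r normc_real.
  by rewrite lE -rmorphB addrAC subrr add0r normc_real.
rewrite -lE; pose dense f := forall e : R, 0 < e -> exists u, nm (f - L lam0 u) < e.
have dense0 : dense 0 by move=> e e0; exists 0; rewrite (res_op0 Plin) subrr (hn0 hH).
have denseZ c f : dense f -> dense (c *: f).
  move=> hf e e0; have c0 : 0 < normc c + 1 by rewrite ltr_wpDl ?normc_ge0.
  have [u hu] := hf _ (divr_gt0 e0 c0); exists (c *: u).
  rewrite (res_opZ Plin) -scalerBr (hnZ hH); move: hu; rewrite ltr_pdivlMr //.
  have := hn_ge0 (ip := ip) (f - L lam0 u); have := normc_ge0 c; nra.
have denseD f g : dense f -> dense g -> dense (f + g).
  move=> hf hg e e0; have e2 : 0 < e / 2 by rewrite divr_gt0.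
  have [u hu] := hf _ e2; have [u' hu'] := hg _ e2; exists (u + u').
  rewrite (res_opD Plin) opprD addrACA; apply: le_lt_trans (hnD hH _ _) _.
  by rewrite [X in _ < X]splitr; exact: ltrD.
have dense_delta x : dense (delta adj x 1).
  move=> e e0; have [M [d [d0 hM]]] := hb x.
  have M0 : 0 < `|M| + 1 by rewrite ltr_wpDl.
  have m0 : 0 < Num.min d (e / (`|M| + 1)) by rewrite lt_min d0 divr_gt0.
  have [lam ilam] := nonreal_near lam0 m0; rewrite lt_min => /andP[hl].
  rewrite ltr_pdivlMr // => hle.
  have [_ /(_ (delta adj x 1))[u hu]] := nonreal_regular hgraph ilam.
  (* [delta_x - (lam0 - P) u = (lam - lam0) u], which is small because [u] stays bounded as [lam]
     tends to [lam0]. *)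
  exists u; rewrite (res_op_shift _ lam) hu opprD addNKr (hnN hH) (hnZ hH) normcBC.
  apply: le_lt_trans hle; apply: ler_wpM2l; first exact: normc_ge0.
  by apply: le_trans (hM _ _ ilam hl hu) _; have := ler_norm M; lra.
move=> f e e0; have e2 : 0 < e / 2 by rewrite divr_gt0.
have [s [g [us hg hfg]]] := approx_finite f e2.
have dg : dense g.
  have -> : g = \sum_(x <- s) delta adj x (g x).
    by apply: finite_l2E => // x xs; rewrite hg (negPf xs).
  elim: {+}s => [|x l IH]; first by rewrite big_nil.
  rewrite big_cons -[X in dense (X + _)]delta_scale.
  by apply: denseD IH; apply: denseZ; exact: dense_delta.
have [u hu] := dg _ e2; exists u; apply: le_lt_trans (hnD3 hH f g _) _.
by rewrite [X in _ < X]splitr; exact: ltrD.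
Qed.

Lemma pull_norm : exists2 K : R, 0 <= K & forall u : H, nm (pull u) <= K * nm u.
Proof.
have k0 := kappa_gt0.
set k := kappa in k0.
exists (Num.sqrt k^-1); first exact: sqrtr_ge0.
move=> u; apply: (hn_le hH); first by rewrite mulr_ge0 ?sqrtr_ge0 ?hn_ge0.
rewrite exprMn sqr_sqrtr ?invr_ge0 ?(ltW k0) // (hn2 hH) !ip_self mulrC ler_pdivlMr // mulrC.
by have [] := pull_ell2 u.
Qed.

(** When [lam] is carried to [tau], [R(tau) delta_y] is [B / chi] at [lam] times the restriction of
    [R(lam) delta_(psi y)]. A zero of [chi] at [q] of order [j] raises the pole order by at most
    [j], and [|tau - t| <= K |lam - q|] converts the distances. *)
Lemma polar_pull y q t : complex.Im t = 0 -> T (sphere_inv q) = sphere_inv t ->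
  polar (delta adj (psi y) 1) q -> polar (delta adj y 1) t.
Proof.
move=> it hq [k [M [d [d0 hM]]]].
have chi0 : chi != 0 by exact: cell_poly_neq0.
have A0 : Ap != 0.
  by have := size_den_num; apply: contraTneq => ->; rewrite size_poly0.
have [j [c [d1 [c0 d10 hc]]]] := poly_lower q chi0.
have [d2 d20 hA] := poly_isolated q A0; have [d3 d30 hchi] := poly_isolated q chi0.
have [K [d4 [K0 d40 hK]]] := step_lip hq.
have [N N0 hN] := pull_norm.
have [B B0 hB] := poly_bound Bp (normc q + d).
pose e := Num.min d (Num.min d1 (Num.min d2 (Num.min d3 d4))).
have e0 : 0 < e by rewrite !lt_min d0 d10 d20 d30.
have [d' d'0 hd'] := step_open hq e0.
exists (k + j)%N, (K ^+ (k + j)%N * (B * N * M / c)), d'; split=> // tau u it' /hd'[lam].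
rewrite !lt_min => /and5P[l0 l1 l2 l3 l4] hl hu.
have nq : lam != q.
  apply: contraNneq it' => lq; move: hl; rewrite lq hq => /sphere_inv_inj <-; exact/eqP.
have rel := step_relation hl.
have B1 : Bp.[lam] != 0.
  by apply: contraTneq (hA _ nq l2) => b0; rewrite rel b0 mulr0 eqxx.
(* [A] and [B] have real coefficients, so a real [lam] would have a real image [tau]. *)
have il : complex.Im lam != 0.
  apply: contraNneq it' => il; have lc := real_conj il.
  have e2 : conjc tau = tau.
    apply: (mulIf B1); rewrite -rel; have := den_poly_conj lam.
    have := num_poly_conj lam; rewrite lc => cA cB.
    by rewrite [X in _ * X]cB [X in _ = X]cA rel rmorphM.
  by move: e2; case: (tau) => a b [] /= /eqP; rewrite -subr_eq0 -opprD oppr_eq0 -mulr2n mulrn_eq0.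
have [_ /(_ (delta adj (psi y) 1))[u1 hu1]] := nonreal_regular hgraph il.
have := resolvent_pull hu1.
rewrite (res_ratio _ _ B1) mulr1 rel mulfK // => hp.
have x1 := hchi _ nq l3.
have uE : u = (Bp.[lam] / chi.[lam]) *: pull u1.
  apply: (regular_unique hH Plin (nonreal_regular hgraph it')).
  rewrite hu (res_opZ Plin) mulrC -scalerA hp -[X in _ = _ *: X]delta_scale scalerA mulVf //.
  by rewrite scale1r.
have [t' ht' tt] := hK _ l4.
have tE : t' = tau by apply: (@sphere_inv_inj R); rewrite -ht' -hl.
rewrite tE in tt; rewrite uE (hnZ hH) normcM normcV.
have h1 := hM _ _ il l0 hu1; have h2 := hN u1; have h3 := hc _ l1.
have h4 : normc Bp.[lam] <= B.
  apply: hB; have := normcD q (lam - q); rewrite subrKC => h; apply: le_trans h _.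
  by rewrite lerD2l ltW.
have nx : 0 < normc chi.[lam] by rewrite normc_gt0.
have n0 : 0 <= normc (lam - q) by exact: normc_ge0.
have u0 : 0 <= nm (pull u1) by exact: hn_ge0.
have b0 : 0 <= normc Bp.[lam] by exact: normc_ge0.
have lk : 0 <= normc (lam - q) ^+ k by rewrite exprn_ge0.
have h5 : normc (tau - t) ^+ (k + j)%N <= K ^+ (k + j)%N * normc (lam - q) ^+ (k + j)%N.
  by rewrite -exprMn lerXn2r ?nnegrE ?normc_ge0 // mulr_ge0.
apply: le_trans (ler_wpM2r _ h5) _.
  by rewrite mulr_ge0 // divr_ge0 // ltW.
rewrite -[X in X <= _]mulrA; apply: ler_wpM2l; first by rewrite exprn_ge0.
rewrite exprD ler_pdivlMr //.
have h6 : normc (lam - q) ^+ j * c / normc chi.[lam] <= 1 by rewrite ler_pdivrMr // mul1r mulrC.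
have -> : normc (lam - q) ^+ k * normc (lam - q) ^+ j * (normc Bp.[lam] / normc chi.[lam] * nm (pull u1)) * c =
   (normc (lam - q) ^+ j * c / normc chi.[lam]) * (normc Bp.[lam] * (normc (lam - q) ^+ k * nm (pull u1))) by ring.
apply: le_trans (ler_wpM2r _ h6) _; first by rewrite !mulr_ge0.
rewrite mul1r -mulrA; apply: ler_pM => //; first by rewrite mulr_ge0.
apply: le_trans (ler_wpM2l lk h2) _; rewrite mulrCA; exact: ler_wpM2l.
Qed.

(** The finitely many vertices of [O] share one neighbourhood of [lam0]; [finite_rank] expresses
    every delta through them, and division by the coefficient [c] costs a pole at its zeros. *)
Lemma polar_near lam0 :
  (forall x, exists M d : R, 0 < d /\ forall lam u, complex.Im lam != 0 -> normc (lam - lam0) < d ->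
     L lam u = delta adj x 1 -> nm u <= M) ->
  exists2 del : R, 0 < del & forall x t, normc (t - lam0) < del -> polar (delta adj x 1) t.
Proof.
move=> hb; have [ O hO] := finite_rank.
have [M [del [del0 hM]]] : exists M d : R, 0 < d /\ forall o lam u, o \in O ->
    complex.Im lam != 0 -> normc (lam - lam0) < d -> L lam u = delta adj o 1 -> nm u <= M.
  elim: O {hO} => [|o O [M [d [d0 IH]]]]; first by exists 0, 1.
  have [M' [d' [d'0 h]]] := hb o; exists (Num.max M M'), (Num.min d d'); split.
    by rewrite lt_min d0.
  move=> o' lam u; rewrite inE lt_min => /orP[/eqP -> |oO] il /andP[l1 l2] hu; rewrite le_max.
    by rewrite (h _ _ il l2 hu) orbT.
  by rewrite (IH _ _ _ oO il l1 hu).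
exists del => // x t ht; have [c c0 hc] := hO x.
have [M' hM'] := hc (normc lam0 + del).
have [k [e [d [e0 d0 hk]]]] := poly_lower t c0.
exists k, ((M' + \sum_(o <- O) M' * M) / e), (Num.min d (del - normc (t - lam0))).
split; first by rewrite lt_min d0 subr_gt0.
move=> lam u il; rewrite lt_min => /andP[l1 l2] hu.
have l3 : normc (lam - lam0) < del.
  have := normcD (lam - t) (t - lam0); rewrite addrA subrK => h.
  by apply: le_lt_trans h _; rewrite -ltrBrDr.
have [|b [co [hb1 hco hE]]] := hM' lam.
  have := normcD lam0 (lam - lam0); rewrite subrKC => h; apply: le_trans h _.
  by rewrite lerD2l ltW.
pose r o := resolvent hgraph lam (delta adj o 1).
have hr o : L lam (r o) = delta adj o 1 by exact: resolventP (nonreal_regular hgraph il).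
have uE : c.[lam] *: u = b + \sum_(o <- O) co o *: r o.
  apply: (regular_unique hH Plin (nonreal_regular hgraph il)).
  rewrite (res_opZ Plin) hu hE (res_opD Plin) res_sum; congr (_ + _).
  by apply: eq_bigr => o _; rewrite (res_opZ Plin) hr.
rewrite ler_pdivlMr // mulrC mulrA.
apply: (@le_trans _ _ (nm (c.[lam] *: u))).
  by rewrite (hnZ hH); apply: ler_wpM2r; [exact: hn_ge0|exact: hk].
rewrite uE; apply: le_trans (hnD hH _ _) (lerD hb1 _).
apply: le_trans (nm_sum _ _) _.
rewrite big_seq [X in _ <= X]big_seq; apply: ler_sum => o oO; rewrite (hnZ hH).
apply: ler_pM; [exact: normc_ge0|exact: hn_ge0|exact: hco|exact: hM oO il l3 (hr o)].
Qed.

Lemma iter_open m q t (e : R) : iter m T (sphere_inv q) = sphere_inv t -> 0 < e ->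
  exists2 d : R, 0 < d & forall t', normc (t' - t) < d -> exists2 q', normc (q' - q) < e &
    iter m T (sphere_inv q') = sphere_inv t'.
Proof.
elim: m t e => [|m IH] t e.
  by move=> /sphere_inv_inj -> e0; exists e => // t' h; exists t'.
move=> h e0; have [s hs] := iter_finite h.
have [d d0 hd] := IH _ _ hs e0; move: h; rewrite iterS hs => h.
have [d' d'0 hd'] := step_open h d0.
exists d' => // t' /hd'[s' /hd[q' h1 h2] h3]; exists q' => //.
by rewrite iterS h2.
Qed.

Lemma noncoercive_back m q t : iter m T (sphere_inv q) = sphere_inv t -> ~ coerc t -> ~ coerc q.
Proof.
move=> h nt cq; have := escaped_iter (m := m) ((escaped_inv q).2 cq).
by rewrite h => /(_ t nt).
Qed.

Lemma polar_iter_pull m q t y : ~ coerc t -> iter m T (sphere_inv q) = sphere_inv t ->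
  (forall x, polar (delta adj x 1) q) -> polar (delta adj y 1) t.
Proof.
move=> nt; elim: m q => [|m IH] q; first by move=> /sphere_inv_inj <-.
move=> h hq; have [q1 hq1] : exists q1, T (sphere_inv q) = sphere_inv q1.
  apply: contrapT => hn; suff h0 : T (sphere_inv q) = Some 0.
    have := escaped_iter (m := m) escaped_zero.
    by move: h; rewrite iterSr h0 => -> /(_ t nt).
  by apply: contrapT => /sphere_inv_surj[q1 h1]; apply: hn; exists q1.
move: h; rewrite iterSr hq1 => h; apply: (IH _ h) => x.
have [iq1 _] := noncoercive_real (noncoercive_back h nt).
exact: polar_pull iq1 hq1 (hq _).
Qed.

Section TotallyDisconnected.
Context (hJ : totally_disconnected (julia_set T)).

Lemma nonpersistent_escaped lam : ~ persistent lam -> exists m, escaped (iter m T (sphere_inv lam)).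
Proof.
move=> np; apply: contrapT => hn; apply: np => m; apply: contrapT => ht; apply: hn; exists m => t nt e.
by apply: ht; exists t.
Qed.

(* Let [T^m] send both ends of an interval around [x0] outside the numerical range.  The
   part of its image in the numerical range, a real interval, is open because [T] is
   open and real values there have real preimages, and closed by compactness. *)
Lemma persistent_onto (x0 del : R) : persistent x0%:C%C -> 0 < del ->
  exists m, forall t, ~ coerc t -> exists2 q, normc (q - x0%:C%C) < del & iter m T (sphere_inv q) = sphere_inv t.
Proof.
move=> hp del0.
have esc_iter m p : escaped p -> escaped (iter m T p).
  exact: escaped_iter.
have gap := persistent_gap hJ.
have [|r [r1 r2 /nonpersistent_escaped[m1 e1]]] := gap (x0 - del) x0; first by lra.
have [|r' [r'1 r'2 /nonpersistent_escaped[m2 e2]]] := gap x0 (x0 + del); first by lra.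
(* Escaped points stay escaped, so after [m1 + m2] steps both ends are. *)
pose m := (m1 + m2)%N; exists m.
have {}e1 : escaped (iter m T (sphere_inv r%:C%C)) by rewrite /m addnC iterD; exact: esc_iter.
have {}e2 : escaped (iter m T (sphere_inv r'%:C%C)) by rewrite /m iterD; exact: esc_iter.
pose c := (r + r') / 2; pose rho := (r' - r) / 2.
pose A (s : R) := ~ coerc s%:C%C /\ exists2 q, normc (q - c%:C%C) <= rho &
  iter m T (sphere_inv q) = sphere_inv s%:C%C.
have realE t : ~ coerc t -> t = (complex.Re t)%:C%C.
  by move=> /noncoercive_real[]; case: (t) => a b /= ->.
have Anc s : A s -> ~ coerc s%:C%C by case.
have Aop t : A t -> exists2 e, 0 < e & forall s, ~ coerc s%:C%C -> `|s - t| < e -> A s.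
  move=> [nt [q qr hq]].
  have qE := realE _ (noncoercive_back hq nt).
  have ne (z : R) : escaped (iter m T (sphere_inv z%:C%C)) -> q <> z%:C%C.
    by move=> ez qz; move: hq; rewrite qz => /(ez _ nt).
  (* [q] is real and differs from both ends, as their images are escaped; so it is an interior
     point. *)
  have lt : normc (q - c%:C%C) < rho.
    have := ne _ e1; have := ne _ e2; move: qr; rewrite qE -rmorphB !normc_real.
    rewrite /c /rho; move: (complex.Re q) => z; rewrite le_eqVlt => /orP[/eqP h|//] n1 n2.
    exfalso; have [z0|z0] := leP 0 (z - (r + r') / 2).
      by rewrite ger0_norm // in h; apply: n1; congr (_%:C%C); lra.
    by rewrite ltr0_norm // in h; apply: n2; congr (_%:C%C); lra.
  have lt0 : 0 < rho - normc (q - c%:C%C) by rewrite subr_gt0.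
  have [d d0 hd] := iter_open hq lt0.
  exists d => // s ns st; split=> //.
  have [|q' h1 h2] := hd s%:C%C; first by rewrite -rmorphB normc_real.
  exists q' => //; have := normcD (q' - q) (q - c%:C%C); rewrite addrA subrK; lra.
have Acl t : ~ coerc t%:C%C -> (forall e, 0 < e -> exists2 s, A s & `|s - t| < e) -> A t.
  move=> nt hcl; apply: contrapT => nA.
  (* [Q B]: the noncoercive values taken on [B] keep a fixed distance from [t]. If [t] is not a
     value this holds near every point, hence by compactness on the unit disc, which contains all
     preimages of noncoercive points. *)
  pose Q (B : set Cx) := exists2 e : R, 0 < e & forall q s, B q -> normc (q - c%:C%C) <= rho ->
    ~ coerc s -> normc (s - t%:C%C) < e -> iter m T (sphere_inv q) <> sphere_inv s.
  have [e e0 he] : Q [set z | normc z <= 1].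
    apply: (compact_ideal (Q := Q)); first exact: compact_normc.
    - by exists 1.
    - move=> B B' [e e0 he] [e' e'0 he']; exists (Num.min e e'); first by rewrite lt_min e0.
      by move=> q s [Bq|Bq] qr ns; rewrite lt_min => /andP[l1 l2]; [exact: he|exact: he'].
    - by move=> B B' BB [e e0 he]; exists e => // q s /BB; exact: he.
    move=> p _; have [pr|pr] := leP (normc (p - c%:C%C)) rho; last first.
      exists [set z | normc (z - p) < normc (p - c%:C%C) - rho].
        by apply/cnbhsP; exists (normc (p - c%:C%C) - rho); rewrite ?subr_gt0.
      exists 1 => // q s qp qr; exfalso; have := normcD (p - q) (q - c%:C%C).
      rewrite addrA subrK [normc (p - q)]normcBC.
      by move: qp qr; rewrite /mkset; lra.
    have [h0|/sphere_inv_surj[s hs]] := pselect (iter m T (sphere_inv p) = Some 0).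
      have ep : escaped (iter m T (sphere_inv p)) by rewrite h0; exact: escaped_zero.
      have [d d0 hd] := escaped_open ep.
      exists [set z | normc (z - p) < d]; first by apply/cnbhsP; exists d.
      by exists 1 => // q s qp _ ns _; exact: (hd _ qp).
    have st : 0 < normc (s - t%:C%C) / 2.
      rewrite divr_gt0 // normc_gt0 subr_eq0; apply/eqP => st; apply: nA; split=> //.
      by exists p => //; rewrite hs st.
    have [d d0 hd] := iter_cont hs st.
    exists [set z | normc (z - p) < d]; first by apply/cnbhsP; exists d.
    exists (normc (s - t%:C%C) / 2) => // q s' qp _ _ ss h.
    have [t' ht' tt] := hd _ qp; move: ht'; rewrite h => /sphere_inv_inj e; rewrite -e in tt.
    have := normcD (s - s') (s' - t%:C%C); rewrite addrA subrK [normc (s - s')]normcBC; lra.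
  have [s [ns [q qr hq]] st] := hcl e e0.
  have [_ q1] := noncoercive_real (noncoercive_back hq ns).
  by apply: (he q s%:C%C q1 qr ns _ hq); rewrite -rmorphB normc_real.
have conv := noncoercive_convex.
have A0 : exists t0, A t0.
  have [t nt ht] := hp m; exists (complex.Re t); rewrite /A -(realE _ nt); split=> //.
  exists x0%:C%C => //; rewrite -rmorphB normc_real ler_norml /c /rho; apply/andP; split; lra.
have [t0 At0] := A0.
suff Aall t : ~ coerc t%:C%C -> A t.
  move=> t nt; have := Aall (complex.Re t); rewrite -(realE _ nt) => /(_ nt)[_ [q qr hq]].
  exists q; last by rewrite hq -(realE _ nt).
  have cx : normc (c%:C%C - x0%:C%C : Cx) < del - rho.
    by rewrite -rmorphB normc_real ltr_norml /c /rho; apply/andP; split; lra.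
  have := normcD (q - c%:C%C) (c%:C%C - x0%:C%C); rewrite addrA subrK => h.
  by apply: le_lt_trans h _; rewrite -[del](subrKC rho); exact: ler_ltD.
move=> nt; have [tt|tt] := leP t0 t.
  apply: (real_clopen_up tt At0) => s s1 s2.
    by apply: Acl; exact: (conv t0 s t s1 s2 (Anc _ At0) nt).
  move=> /Aop[e e0 he]; exists e; first exact: e0.
  move=> s' s'1 s'2; apply: he; exact: (conv t0 s' t s'1 s'2 (Anc _ At0) nt).
(* The case [t < t0] is reduced to the upward one by reflection. *)
have tN : - t0 <= - t by rewrite lerN2 ltW.
have flip s : - t0 <= s -> s <= - t -> ~ coerc (- s)%:C%C.
  by move=> s1 s2; apply: (conv t (- s) t0 _ _ nt (Anc _ At0)); lra.
have AN : A (- - t0) by rewrite opprK; exact: At0.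
rewrite -[t]opprK; apply: (real_clopen_up (A := fun s => A (- s)) tN AN) => s s1 s2.
  move=> h; apply: (Acl _ (flip s s1 s2)) => e /h[s' As' ss]; exists (- s'); first exact: As'.
  by rewrite -opprD normrN.
move=> /Aop[e e0 he]; exists e; first exact: e0.
move=> s' s'1 s'2 ss; apply: (he _ (flip s' s'1 s'2)).
by rewrite -opprD normrN.
Qed.

Lemma all_green_regular lam : (forall x y, green_regular_at adj x y (sphere_inv lam)) -> reg lam.
Proof.
move=> hreg; apply: contrapT => nreg.
have il : complex.Im lam = 0.
  by apply: (spectral_real hgraph) => /(good_inv hgraph).
have gap := regular_gap hJ.
have hb x : exists M d : R, 0 < d /\ forall lam' u, complex.Im lam' != 0 -> normc (lam' - lam) < d ->
     L lam' u = delta adj x 1 -> nm u <= M.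
  have [Om [f [Oo Oc O1 Oan [Op fi]]]] := hreg x x.
  have [r r0 hr] := identity_green (hgraph := hgraph) gap Oo Oc O1 Oan Op.
  exact: (resolvent_local_bound (hgraph := hgraph) il r0 (Oan _ Op) fi hr).
have [hp|np] := pselect (persistent lam); last first.
  exact: nreg (nonpersistent_regular il np hb).
have [del del0 hdel] := polar_near hb.
have lE : lam = (complex.Re lam)%:C%C by case: (lam) il => a b /= ->.
rewrite lE in hp hdel.
have [m hm] := persistent_onto hp del0.
(* Every [t] is coercive or the image of some [q] near [lam], so [R(lam) delta_v] would have poles
   only. *)
apply: (@not_all_polar R V adj hgraph v) => t.
have [ct|nt] := pselect (coerc t).
  exact: polar_regular (coercive_regular hH hC2 Plin Pcontr ct).
have [q hq hqt] := hm t nt.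
have hx x := hdel x q hq.
exact: (polar_iter_pull _ nt hqt hx).
Qed.

End TotallyDisconnected.

End SelfSimilarWalk.

Theorem theorem9p3 (R : realType) (V : choiceType) (adj : rel V) (F : set V)
    (C : set V) (v w : V)
    (hgraph : infinite_connected_graph adj)
    (hsim : symmetrically_self_similar adj F)
    (hgeom : bounded_geometry adj F)
    (hC : cells adj F C)
    (hv : bdry adj C v) (hw : bdry adj C w) (hvw : v <> w)
    (hJ : cantor_set (julia_set (ratfun_map (transition_function R adj C v w)))) :
  spec_inv R adj = green_singularities R adj.
Proof.
have [[_ _ [psi [hpsi hpsi_adj]]] _ _ _] := hsim.
have [_ _ _ hJt] := hJ.
apply/seteqP; split=> p; last first.
  move=> [x [y hn]]; apply: contrapT => hg; apply: hn.
  exact: (green_regular_good hgraph x y hg).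
move=> [lam /= hs <-]; apply: contrapT => hn; apply: hs.
apply/(resolvent_setP hgraph)/(all_green_regular (R := R) hgraph hsim hgeom hC hv hw hvw hpsi hpsi_adj hJt).
by move=> x y; apply: contrapT => hxy; apply: hn; exists x, y.
Qed.
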